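(* Let $M$ be a connected $C^\infty$ closed manifold, let $m$ be a volume form on $M$, and let $f: M\to M$ be a $C^{1+\alpha}$ ($\alpha>0$) conservative Anosov endomorphism, i.e. $f$ preserves the measure $m$. Then $(f,m)$ is ergodic.
   Context: An $f$-orbit is a sequence $(x_n)_{n\in\mathbb{Z}}$ in $M$ with $f(x_n)=x_{n+1}$ for all $n\in\mathbb{Z}$. A $C^1$ local diffeomorphism $f: M\to M$ is an Anosov endomorphism if there are constants $C>0$ and $\lambda>1$ such that for every $f$-orbit $(x_n)_{n\in\mathbb{Z}}$ there is a splitting $T_{x_i}M = E^s_{x_i}\oplus E^u_{x_i}$, $i\in\mathbb{Z}$, preserved by $Df$, such that for all $n>0$ and all $i\in\mathbb{Z}$: $\|Df^n(x_i)v\|\ge C^{-1}\lambda^n\|v\|$ for every $v\in E^u_{x_i}$, and $\|Df^n(x_i)v\|\le C\lambda^{-n}\|v\|$ for every $v\in E^s_{x_i}$. (The subspace $E^u_{x_i}$ may depend on the whole orbit.) The map $f$ is $C^{1+\alpha}$ if it is $C^1$ with $\alpha$-Hölder derivative. The volume form $m$ is identified with the (normalized) measure it induces, and $f$ preserves $m$ if $m(f^{-1}(B))=m(B)$ for every Borel set $B$. *)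

(* Defs.v *)
From HB Require Import structures.
From mathcomp Require Import all_boot all_order all_algebra.
From mathcomp Require Import all_classical all_reals all_analysis.

Set Implicit Arguments.
Unset Strict Implicit.
Unset Printing Implicit Defensive.

Import Order.TTheory GRing.Theory Num.Theory.
Import numFieldNormedType.Exports.

Local Open Scope classical_set_scope.
Local Open Scope ring_scope.

(* [U] is meant to be open, so that only the values of [g] on [U] matter. *)
Fixpoint Ck_on (R : realType) (V W : normedModType R) (k : nat)
    (U : set V) (g : V -> W) : Prop :=
  if k is k'.+1 then
    (forall x, U x -> differentiable g x) /\
    (forall v, Ck_on k' U (fun x => 'd g x v))
  else forall x, U x -> {for x, continuous g}.

Definition smooth_on (R : realType) (V W : normedModType R)
  (U : set V) (g : V -> W) : Prop := forall k, Ck_on k U g.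

(* [cmap] and [cinv] are total; they are mutually inverse homeomorphisms
   between [cdom] and [cmap @` cdom], and arbitrary elsewhere. *)
Record chart (R : realType) (d : nat) (M : topologicalType) := Chart {
  cdom : set M ;
  cmap : M -> 'rV[R]_d ;
  cinv : 'rV[R]_d -> M ;
  cdom_open : open cdom ;
  cimg_open : open (cmap @` cdom) ;
  cmapK : forall p, cdom p -> cinv (cmap p) = p ;
  cmap_continuous : forall p, cdom p -> {for p, continuous cmap} ;
  cinv_continuous :
    forall y, (cmap @` cdom) y -> {for y, continuous cinv} }.

(* A smooth atlas (not necessarily maximal).  [chart_at p] is a preferred
   chart around [p], used below only to identify T_pM with R^d. *)
Record manifold (R : realType) (d : nat) (M : topologicalType) := Manifold {
  atlas : set (chart R d M) ;
  chart_at : M -> chart R d M ;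
  chart_at_atlas : forall p, atlas (chart_at p) ;
  mem_chart_at : forall p, cdom (chart_at p) p ;
  atlas_smooth : forall c c', atlas c -> atlas c' ->
    smooth_on (cmap c @` (cdom c `&` cdom c')) (cmap c' \o cinv c) }.

(* T_pM is 'rV[R]_d, a vector being represented by its coordinates in the
   chart [chart_at X p].  [tangent_map X f p] is Df(p) : T_pM -> T_{f p}M. *)
Definition tangent_map (R : realType) (d : nat) (M : topologicalType)
    (X : manifold R d M) (f : M -> M) (p : M) : 'Hom('rV[R]_d, 'rV[R]_d) :=
  linfun ('d (cmap (chart_at X (f p)) \o f \o cinv (chart_at X p))
             (cmap (chart_at X p) p)).

(* For p = cinv c y: the image in T_pM of the vector whose coordinates in the
   chart [c] are [v]. *)
Definition of_chart (R : realType) (d : nat) (M : topologicalType)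
    (X : manifold R d M) (c : chart R d M) (y v : 'rV[R]_d) : 'rV[R]_d :=
  'd (cmap (chart_at X (cinv c y)) \o cinv c) y v.

Record riemannian_metric (R : realType) (d : nat) (M : topologicalType)
    (X : manifold R d M) := RiemannianMetric {
  metric : M -> 'rV[R]_d -> 'rV[R]_d -> R ;
  metric_linear : forall p a u v w,
    metric p (a *: u + v) w = a * metric p u w + metric p v w ;
  metric_sym : forall p u v, metric p u v = metric p v u ;
  metric_pos : forall p v, v != 0 -> 0 < metric p v v ;
  metric_smooth : forall c, atlas X c -> forall u v : 'rV[R]_d,
    smooth_on (cmap c @` cdom c)
      (fun y => metric (cinv c y) (of_chart X c y u) (of_chart X c y v) : R^o)
}.

Definition tnorm (R : realType) (d : nat) (M : topologicalType)
    (X : manifold R d M) (g : riemannian_metric X) (p : M) (v : 'rV[R]_d) : R :=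
  Num.sqrt (metric g p v v).

(* A d-form evaluated on d tangent vectors, given as the rows of a matrix;
   [chart_frame X c y] is the coordinate frame of [c] at cinv c y. *)
Definition chart_frame (R : realType) (d : nat) (M : topologicalType)
    (X : manifold R d M) (c : chart R d M) (y : 'rV[R]_d) : 'M[R]_d :=
  \matrix_(i < d) of_chart X c y (delta_mx 0 i).

Record volume_form (R : realType) (d : nat) (M : topologicalType)
    (X : manifold R d M) := VolumeForm {
  vform : M -> 'M[R]_d -> R ;
  vform_multilinear : forall p (A B C : 'M[R]_d) (i : 'I_d) (b c : R),
    row i A = b *: row i B + c *: row i C ->
    row' i B = row' i A -> row' i C = row' i A ->
    vform p A = b * vform p B + c * vform p C ;
  vform_alternating : forall p (A : 'M[R]_d) (i j : 'I_d),
    i != j -> row i A = row j A -> vform p A = 0 ;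
  vform_nonvanishing : forall p, exists A, vform p A != 0 ;
  vform_smooth : forall c, atlas X c ->
    smooth_on (cmap c @` cdom c)
      (fun y => vform (cinv c y) (chart_frame X c y) : R^o)
}.

Definition borel (T : ptopologicalType) := g_sigma_algebraType (@open T).

(* The values on closed boxes characterize d-dimensional Lebesgue measure. *)
Definition is_lebesgue (R : realType) (d : nat)
    (leb : {measure set (borel 'rV[R]_d) -> \bar R}) : Prop :=
  forall a b : 'rV[R]_d, (forall i, a 0 i <= b 0 i) ->
    leb [set x : 'rV[R]_d | forall i, a 0 i <= x 0 i <= b 0 i] =
    (\prod_(i < d) (b 0 i - a 0 i))%:E.

Definition is_volume_measure (R : realType) (d : nat) (M : ptopologicalType)
    (X : manifold R d M) (omega : volume_form X)
    (mu : {measure set (borel M) -> \bar R}) : Prop :=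
  exists leb : {measure set (borel 'rV[R]_d) -> \bar R}, is_lebesgue leb /\
    forall (c : chart R d M) (B : set (borel M)),
      atlas X c -> measurable B -> B `<=` cdom c ->
      mu B = (\int[leb]_(y in cmap c @` B)
                `|vform omega (cinv c y) (chart_frame X c y)|%:E)%E.

Definition is_normalized_volume_measure (R : realType) (d : nat)
    (M : ptopologicalType) (X : manifold R d M) (omega : volume_form X)
    (m : probability (borel M) R) : Prop :=
  exists mu : {measure set (borel M) -> \bar R}, is_volume_measure omega mu /\
    forall B : set (borel M), measurable B ->
      m B = (mu B * ((fine (mu setT))^-1)%:E)%E.

Definition chart_overlap (R : realType) (d : nat) (M : topologicalType)
    (U : set M) (f : M -> M) (c c' : chart R d M) : set 'rV[R]_d :=
  cmap c @` (U `&` cdom c `&` f @^-1` cdom c').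

(* [U] is meant to be open. *)
Definition C1_on (R : realType) (d : nat) (M : topologicalType)
    (X : manifold R d M) (U : set M) (f : M -> M) : Prop :=
  (forall p, U p -> {for p, continuous f}) /\
  forall c c', atlas X c -> atlas X c' ->
    Ck_on 1 (chart_overlap U f c c') (cmap c' \o f \o cinv c).

(* On a compact manifold, being Hoelder is the same as being locally Hoelder
   in charts. *)
Definition holder_derivative (R : realType) (d : nat) (M : topologicalType)
    (X : manifold R d M) (alpha : R) (f : M -> M) : Prop :=
  forall c c', atlas X c -> atlas X c' ->
  forall y0, chart_overlap setT f c c' y0 ->
  exists (V : set 'rV[R]_d) (K : R),
    [/\ nbhs y0 V, V `<=` chart_overlap setT f c c' &
      forall y z, V y -> V z -> forall v : 'rV[R]_d,
        `| 'd (cmap c' \o f \o cinv c) y v - 'd (cmap c' \o f \o cinv c) z v |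
        <= K * `|y - z| `^ alpha * `|v| ].

Definition C1alpha (R : realType) (d : nat) (M : topologicalType)
    (X : manifold R d M) (alpha : R) (f : M -> M) : Prop :=
  C1_on X setT f /\ holder_derivative X alpha f.

Definition C1_local_diffeo (R : realType) (d : nat) (M : topologicalType)
    (X : manifold R d M) (f : M -> M) : Prop :=
  forall p, exists (U : set M) (g : M -> M),
    [/\ open U, U p, open (f @` U), forall q, U q -> g (f q) = q &
        C1_on X U f /\ C1_on X (f @` U) g].

Definition is_orbit (T : Type) (f : T -> T) (x : int -> T) : Prop :=
  forall i, f (x i) = x (i + 1).

Definition anosov_endomorphism (R : realType) (d : nat) (M : topologicalType)
    (X : manifold R d M) (g : riemannian_metric X) (f : M -> M) : Prop :=
  C1_local_diffeo X f /\
  exists C lambda : R, [/\ 0 < C, 1 < lambda &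
    forall x : int -> M, is_orbit f x ->
    exists Es Eu : int -> {vspace 'rV[R]_d},
    [/\ forall i, (Es i + Eu i = fullv)%VS /\ (Es i :&: Eu i = 0)%VS,
        forall i, (tangent_map X f (x i) @: Es i)%VS = Es (i + 1) /\
                  (tangent_map X f (x i) @: Eu i)%VS = Eu (i + 1),
        forall (n : nat) i v, (0 < n)%N -> v \in Eu i ->
          C^-1 * lambda ^+ n * tnorm g (x i) v <=
          tnorm g (iter n f (x i)) (tangent_map X (iter n f) (x i) v) &
        forall (n : nat) i v, (0 < n)%N -> v \in Es i ->
          tnorm g (iter n f (x i)) (tangent_map X (iter n f) (x i) v) <=
          C * lambda ^- n * tnorm g (x i) v]].

Definition preserves (d : measure_display) (T : measurableType d)
    (R : realType) (m : probability T R) (f : T -> T) : Prop :=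
  forall B : set T, measurable B -> m (f @^-1` B) = m B.

Definition ergodic (d : measure_display) (T : measurableType d)
    (R : realType) (m : probability T R) (f : T -> T) : Prop :=
  forall B : set T, measurable B -> f @^-1` B = B -> m B = 0%E \/ m B = 1%E.

(* Main.v *)
(* Hopf's argument, run on finite orbit segments instead of invariant
   manifolds, so that neither the dependence of E^u on the backward orbit nor
   the non-invertibility of [f] matters.

   The stable subspace E^s of a point depends only on the point, and it depends
   continuously on it.  In coordinates adapted to E^s, an iterate g = f^N is
   uniformly close to hyperbolic block matrices.  Let S(p,n,a,b) be the strip
   of the points whose orbit stays close to that of p up to time n, with stable
   offset at most a at time 0 and unstable offset at most b at time n.  As Dg is
   Hoelder, the unstable Jacobian of g^n varies on a strip by a bounded factor
   only, so that m(S(p,n,a,b)) is comparable to a^s b^(d-s) divided by this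
   Jacobian.  Hence strips have a Vitali covering property, and if g^n p is close
   to q, then the orbits that follow p until time n and then q satisfy
     m(S(p,n,e,D) \cap g^-n S(q,n,D,e)) >= c m(S(p,n,e,D)) m(S(q,n,D,e)),
   where c depends on D but not on n and e.

   Let A be invariant with complement B, both of positive measure in a small
   neighbourhood U of a point.  Choose compact K_A, K_B and open O_A, O_B such
   that K_A \subset A \subset O_A and K_B \subset B \subset O_B.  For small e and
   large n the strips S(q,n,D,e) centred in U \cap g^-n K_A lie in g^-n O_A, and
   the strips S(p,n,e,D) centred in K_B \cap g^-n U lie in O_B.  Finite disjoint
   families of both kinds fill a fixed proportion of B \cap U and of A \cap U, so
   the measure of O_B \cap g^-2n O_A is bounded below independently of the
   approximation, although it is at most m(O_A \ K_A) + m(O_B \ K_B) by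
   invariance.  Thus each point has a neighbourhood in which A or B is null, and
   connectedness finishes the proof. *)

(* The tie between hyperbolicity and measure is a boundary value problem: an orbit segment is
   determined by its stable part at time 0 and its unstable part at time n. Two invariant cones show
   that passing to these data expands distances, Perron's method solves for an orbit with given
   data, and in these data a strip is a box. [Jm] is the differential of the data. Only bounds up to
   constant factors are needed, so volumes are compared through fine grids of boxes.

   Constants must not depend on n. Two orbits in one strip are 2^-k close counted from one end or
   2^-(n-k) close counted from the other; the Hoelder exponent turns this into a summable bound,
   hence bounded distortion.

   Passing to an iterate makes a single step hyperbolic with definite rates. The sole block that is
   not small leads from unstable to stable coordinates and is tamed by rescaling. At each point one
   unstable space is chosen from an arbitrary past; it serves as a uniformly transverse complement
   of the stable space in which all vectors expand. *)
From HB Require Import structures.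
Require Import Defs.
From mathcomp Require Import all_boot all_order all_algebra.
From mathcomp Require Import all_classical all_reals all_analysis.
From mathcomp Require Import perm ring lra zify.
Set Implicit Arguments.
Unset Strict Implicit.
Unset Printing Implicit Defensive.
Import Order.TTheory GRing.Theory Num.Theory.
Import numFieldNormedType.Exports.
Local Open Scope classical_set_scope.
Local Open Scope ring_scope.

(** * Norms and operator bounds *)

Section Norms.
Variables (R : realType).

Lemma rV_norm_le (d : nat) (v : 'rV[R]_d) (e : R) : 0 <= e ->
  (forall i, `|v 0 i| <= e) -> `|v| <= e.
Proof.
move=> e0 ve; rewrite [leLHS]/Num.norm /= mx_normrE.
by apply/bigmax_leP; split => // -[i j] _ /=; rewrite (ord1 i).
Qed.

Lemma rV_coord_le (d : nat) (v : 'rV[R]_d) i : `|v 0 i| <= `|v|.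
Proof.
by rewrite [leRHS]/Num.norm /= mx_normrE; apply/bigmax_geP; right; exists (0, i).
Qed.

Lemma mx_coord_le (m n : nat) (v : 'M[R]_(m, n)) i j : `|v i j| <= `|v|.
Proof.
by rewrite [leRHS]/Num.norm /= mx_normrE; apply/bigmax_geP; right; exists (i, j).
Qed.

Lemma mx_norm_le (m n : nat) (v : 'M[R]_(m, n)) (e : R) : 0 <= e ->
  (forall i j, `|v i j| <= e) -> `|v| <= e.
Proof.
move=> e0 ve; rewrite [leLHS]/Num.norm /= mx_normrE.
by apply/bigmax_leP; split => // -[i j] _ /=.
Qed.

(** An upper bound for the operator norm with respect to the sup norm. Vectors are rows, so matrices
    act on the right and products are read from left to right. *)
Definition opb (m n : nat) (A : 'M[R]_(m, n)) (k : R) := forall v : 'rV_m, `|v *m A| <= k * `|v|.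

Lemma opb_norm (m n : nat) (A : 'M[R]_(m, n)) : opb A (m%:R * `|A|).
Proof.
move=> v; apply: rV_norm_le => [|i]; first by rewrite !mulr_ge0.
rewrite !mxE (le_trans (ler_norm_sum _ _ _))//.
have -> : m%:R * `|A| * `|v| = \sum_(j < m) (`|A| * `|v|).
  by rewrite sumr_const card_ord -mulrA mulr_natl.
rewrite ler_sum// => j _; rewrite normrM mulrC.
by rewrite ler_pM ?mx_coord_le ?rV_coord_le.
Qed.

Lemma opbM (m n p : nat) (A : 'M[R]_(m, n)) (B : 'M[R]_(n, p)) a b : 0 <= b ->
  opb A a -> opb B b -> opb (A *m B) (a * b).
Proof.
move=> b0 Aa Bb v; rewrite mulmxA (le_trans (Bb _))//.
by rewrite (mulrC a) -mulrA ler_wpM2l.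
Qed.

Lemma opbD (m n : nat) (A B : 'M[R]_(m, n)) a b :
  opb A a -> opb B b -> opb (A + B) (a + b).
Proof.
by move=> Aa Bb v; rewrite mulmxDr mulrDl (le_trans (ler_normD _ _))// lerD.
Qed.

Lemma opbN (m n : nat) (A : 'M[R]_(m, n)) a : opb A a -> opb (- A) a.
Proof. by move=> Aa v; rewrite mulmxN normrN. Qed.

Lemma opb_le (m n : nat) (A : 'M[R]_(m, n)) a b : a <= b -> opb A a -> opb A b.
Proof. by move=> ab Aa v; rewrite (le_trans (Aa v))// ler_wpM2r. Qed.

Lemma opb1 (m : nat) : opb (1%:M : 'M[R]_m) 1.
Proof. by move=> v; rewrite mulmx1 mul1r. Qed.

Lemma unitmx_inj (m : nat) (A : 'M[R]_m) :
  (forall v : 'rV_m, v *m A = 0 -> v = 0) -> A \in unitmx.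
Proof.
move=> Ai; rewrite -row_free_unit -kermx_eq0; apply/eqP/row_matrixP => i.
by rewrite row0; apply: Ai; rewrite -row_mul mulmx_ker row0.
Qed.

Lemma mulmx_cont (m n : nat) (A : 'M[R]_(m, n)) :
  continuous (fun v : 'rV[R]_m => v *m A).
Proof.
move=> v; apply/(@cvgrPdist_lt _ _ _ (nbhs v)) => /= e e0; near=> w.
rewrite -mulmxBl (le_lt_trans (opb_norm _ _))//.
rewrite (@le_lt_trans _ _ ((m%:R * `|A| + 1) * `|v - w|)) ?ler_wpM2r ?lerDl//.
rewrite mulrC -ltr_pdivlMr ?ltr_wpDl ?mulr_ge0//; near: w.
by apply: cvgr_dist_lt; [exact: cvg_id|rewrite divr_gt0// ltr_wpDl ?mulr_ge0].
Unshelve. all: by end_near. Qed.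

End Norms.

(** * Borel sets and dyadic cubes *)

Section Borel.
Variable (T U : ptopologicalType).

Lemma borel_open (A : set (borel T)) : open (A : set T) -> measurable A.
Proof. by move=> oA; apply: sub_sigma_algebra. Qed.

Lemma borel_closed (A : set (borel T)) : closed (A : set T) -> measurable A.
Proof.
by move=> cA; rewrite -[A]setCK; apply: measurableC; apply: borel_open; exact: closed_openC.
Qed.

Lemma borel_preimage (f : T -> U) (B : set (borel U)) :
  continuous f -> measurable B -> measurable (f @^-1` B : set (borel T)).
Proof.
move=> cf mB; apply: (mB [set B | measurable (f @^-1` B : set (borel T))]).
split=> [|A oA]; last by apply: borel_open; exact: open_comp.
split=> [|A mA|F mF] /=; first by rewrite preimage_set0.
  by rewrite setTD preimage_setC; exact: measurableC.
by rewrite preimage_bigcup; apply: bigcup_measurable => k _; exact: mF.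
Qed.

End Borel.

Section Lebesgue.
Variables (R : realType) (d : nat).
Notation V := 'rV[R]_d.
Implicit Types (a b x v : V) (E : set (borel V)).

Definition cbox a b : set (borel V) := [set x : V | forall i, a 0 i <= x 0 i <= b 0 i].
Definition hbox a b : set (borel V) := [set x : V | forall i, a 0 i <= x 0 i < b 0 i].

Lemma cbox_closed a b : closed (cbox a b : set V).
Proof.
have -> : cbox a b = \bigcap_(i in [set: 'I_d])
   ((fun x : V => x 0 i) @^-1` `[a 0 i, b 0 i]%classic).
  apply/seteqP; split=> x h i => [_|]; first by rewrite /= in_itv/=; exact: h.
  by have := h i I; rewrite /= in_itv.
by apply: closed_bigI => i _; apply: closed_comp; [by move=> x _; exact: (@coord_continuous R 1 d 0 i)|exact: itv_closed].
Qed.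

Lemma measurable_cbox a b : measurable (cbox a b).
Proof. by apply: borel_closed; exact: cbox_closed. Qed.

Lemma measurable_hbox a b : measurable (hbox a b).
Proof.
have -> : hbox a b = \bigcap_(i in [set: 'I_d])
   (((fun x : V => x 0 i) @^-1` `[a 0 i, +oo[%classic) `&`
    ((fun x : V => x 0 i) @^-1` `]-oo, b 0 i[%classic)).
  apply/seteqP; split=> x /= xab i => [_|]; have := xab i.
    by move=> /andP[? ?]; rewrite /= !in_itv/= andbT.
  by move=> /(_ I)[]; rewrite /= !in_itv/= andbT => -> ->.
apply: fin_bigcap_measurable => // i _; apply: measurableI.
  apply: borel_closed; apply: closed_comp; [by move=> x _; exact: (@coord_continuous R 1 d 0 i)|rewrite set_itvE; exact: closed_ge].
by apply: borel_open; apply: open_comp; [by move=> x _; exact: (@coord_continuous R 1 d 0 i)|rewrite set_itvE; exact: open_lt].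
Qed.

Lemma measurable_shift v E : measurable E -> measurable ((fun x : V => x + v) @^-1` E : set (borel V)).
Proof.
have cf : continuous (fun x : V => x + v).
  move=> x; apply: (@continuousD R V V id (cst v) x).
    exact: (@cvg_id _ (nbhs x)).
  exact: (@cst_continuous _ _ v x).
move=> mE; exact: (borel_preimage cf mE).
Qed.

Lemma measurable_mulmx (A : 'M[R]_d) E : measurable E -> measurable ((fun x : V => x *m A) @^-1` E : set (borel V)).
Proof. by apply: borel_preimage; exact: mulmx_cont. Qed.

(** Half-open dyadic cubes, encoded as fibres of the floor function: cubes of one level are disjoint
    by construction, and any two cubes are nested or disjoint. They thus form a pi-system, and they
    generate the Borel sets. *)
Definition dcube (k : nat) (z : {ffun 'I_d -> int}) : set (borel V) :=
  [set x : V | forall i, Num.floor (2 ^+ k * x 0 i) = z i].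

Lemma dcubeE k z : dcube k z =
  hbox (\row_i ((z i)%:~R / 2 ^+ k)) (\row_i ((z i + 1)%:~R / 2 ^+ k)).
Proof.
apply/seteqP; split=> x /= xz i; have := xz i; rewrite !mxE.
  move=> <-; have /andP[h1 h2] := floor_itv (2 ^+ k * x 0 i).
  by rewrite ler_pdivrMr ?ltr_pdivlMr// ![x 0 i * _]mulrC h1.
rewrite ler_pdivrMr ?ltr_pdivlMr// ![x 0 i * _]mulrC => h.
exact: floor_def.
Qed.

Lemma measurable_dcube k z : measurable (dcube k z).
Proof. by rewrite dcubeE; exact: measurable_hbox. Qed.

Lemma floor_half (a b : R) : Num.floor (2 * a) = Num.floor (2 * b) -> Num.floor a = Num.floor b.
Proof.
move=> ab; apply: floor_def.
have /andP[h1 h2] := floor_itv b; have /andP[h3 h4] := floor_itv (2 * a).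
have h5 : (2 * Num.floor b <= Num.floor (2 * b))%R.
  by rewrite -ltzD1 -(ltr_int R); have := floor_itv (2 * b); lra.
have h6 : (Num.floor (2 * b) < 2 * (Num.floor b + 1))%R.
  rewrite -(ltr_int R) rmorphM/=; have := floor_itv (2 * b); lra.
have {}h6 : (Num.floor (2 * b) + 1 <= 2 * (Num.floor b + 1))%R by rewrite lezD1.
move: h5 h6; rewrite -ab -!(ler_int R) !rmorphM/= => h5 h6; apply/andP; split; lra.
Qed.

Lemma dcube_nested k l z w x : (k <= l)%N -> dcube k z x -> dcube l w x -> dcube l w `<=` dcube k z.
Proof.
move=> kl zx wx y wy i; rewrite -(zx i).
have : Num.floor (2 ^+ l * y 0 i) = Num.floor (2 ^+ l * x 0 i) by rewrite wx wy.
rewrite -(subnK kl) exprD; elim: (l - k)%N => [|n IH]; first by rewrite expr0 !mul1r.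
by rewrite exprS -!(mulrA 2) => /floor_half; exact: IH.
Qed.

Definition dcubes : set (set (borel V)) :=
  [set E | E = set0 \/ exists k z, E = dcube k z].

Lemma dcubes_setI : setI_closed dcubes.
Proof.
move=> A B [->|[k [z ->]]]; first by rewrite set0I; left.
move=> [->|[l [w ->]]]; first by rewrite setI0; left.
have [->|/set0P[x [xz xw]]] := eqVneq (dcube k z `&` dcube l w) set0; first by left.
right; case: (leqP k l) => [kl|/ltnW lk].
  by exists l, w; apply: setIidr; exact: dcube_nested kl xz xw.
by exists k, z; apply: setIidl; exact: dcube_nested lk xw xz.
Qed.

Lemma dcubes_measurable : dcubes `<=` measurable.
Proof. by move=> A [->//|[k [z ->]]]; exact: measurable_dcube. Qed.

Lemma dcube_small (x : V) (e : R) : 0 < e -> exists k z, dcube k z x /\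
  dcube k z `<=` [set y : V | `|x - y| < e].
Proof.
move=> e0.
have [k ke] : exists k, (2 ^- k : R) < e.
  have := @cvg_geometric R 1 (2^-1); rewrite ger0_norm// invf_lt1// ltr1n.
  move=> /(_ isT)/cvgrPdist_lt/(_ _ e0)[k _ /(_ k (leqnn k))] /=.
  by rewrite sub0r normrN mul1r exprVn ger0_norm ?invr_ge0 ?exprn_ge0// => ?; exists k.
exists k, [ffun i => Num.floor (2 ^+ k * x 0 i)]; split=> [i|y yz]; first by rewrite ffunE.
rewrite /=; apply: le_lt_trans ke; apply: rV_norm_le => // i.
have := yz i; rewrite ffunE => h; rewrite !mxE.
have := floor_itv (2 ^+ k * x 0 i); have := floor_itv (2 ^+ k * y 0 i); rewrite h rmorphD/=.
move: (Num.floor _)%:~R => t /andP[h1 h2] /andP[h3 h4].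
rewrite -[leRHS]mul1r ler_pdivlMr// -[X in _ * X]ger0_norm// -normrM ler_norml; apply/andP; split; lra.
Qed.

Lemma open_dcubes (A : set V) : open A -> <<s dcubes >> A.
Proof.
move=> oA.
have -> : A = \bigcup_(p : nat * {ffun 'I_d -> int}) (if `[< dcube p.1 p.2 `<=` A >] then dcube p.1 p.2 else set0).
  apply/seteqP; split=> x.
    move=> Ax; have /nbhs_normP[e /= e0 eA] := open_nbhs_nbhs (conj oA Ax).
    have [k [z [xz zs]]] := dcube_small x e0.
    exists (k, z) => //=; case: asboolP => // -[]; exact: subset_trans zs eA.
  by move=> [p _]; case: asboolP => // pA /pA.
pose T := g_sigma_algebraType dcubes.
apply: (@countable_bigcupT_measurable _ T) => // p.
by case: asboolP => // _; apply: sub_sigma_algebra; right; exists p.1, p.2.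
Qed.

Lemma borel_dcubes E : measurable E -> <<s dcubes >> E.
Proof.
move=> mE; apply: (mE [set E | <<s dcubes >> E]); split; last exact: open_dcubes.
exact: smallest_sigma_algebra.
Qed.

Lemma dcubes_cover : exists g : (set (borel V))^nat,
  (forall i, exists z, g i = set0 \/ g i = dcube 0 z) /\ \bigcup_k g k = setT.
Proof.
pose g n : set (borel V) := if @unpickle {ffun 'I_d -> int} n is Some z then dcube 0 z else set0.
exists g; split=> [i|].
  by rewrite /g; case: unpickle => [z|]; [exists z; right|exists [ffun => 0]; left].
apply/seteqP; split=> // x _.
exists (pickle [ffun i => Num.floor (2 ^+ 0 * x 0 i)]) => //.
by rewrite /g pickleK => i; rewrite ffunE.
Qed.

(** Uniqueness on a generating pi-system; the countably many unit cubes supply the exhaustion by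
    sets of finite measure. *)
Lemma borel_measure_unique (m1 m2 : {measure set (borel V) -> \bar R}) :
  (forall k z, m1 (dcube k z) = m2 (dcube k z)) -> (forall z, (m1 (dcube 0 z) < +oo)%E) ->
  forall E, measurable E -> m1 E = m2 E.
Proof.
move=> m12 m1oo E mE; have [g [gG gc]] := dcubes_cover.
apply: (@g_sigma_algebra_measure_unique _ _ _ dcubes dcubes_measurable g) => //.
- by move=> i; have [z [->|->]] := gG i; [left|right; exists 0, z].
- exact: dcubes_setI.
- by move=> A [->|[k [z ->]]]; rewrite ?measure0.
- by move=> k; have [z [->|->]] := gG k; rewrite ?measure0 ?ltry.
- exact: borel_dcubes.
Qed.

End Lebesgue.

(** * Lebesgue measure under linear maps *)

Lemma fsbig_finType (R : Type) (idx : R) (op : Monoid.com_law idx) (I : finType) (F : I -> R) :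
  \big[op/idx]_(i \in [set: I]) F i = \big[op/idx]_i F i.
Proof.
have := @fsbig_seq R idx op I (enum I) F (enum_uniq I).
rewrite big_enum => ->; apply: eq_fsbigl; apply/seteqP; split=> x //= _.
by rewrite mem_enum.
Qed.

Lemma measure_bigcup_fintype d (T : measurableType d) (R : realType)
  (mu : {measure set T -> \bar R}) (I : finType) (F : I -> set T) :
  (forall i, measurable (F i)) -> trivIset setT F ->
  mu (\bigcup_i F i) = (\sum_i mu (F i))%E.
Proof.
move=> mF tF; rewrite (@measure_fin_bigcup _ _ _ mu I setT F)//.
  by rewrite fsbig_finType.
exact: finite_finset.
Qed.

Lemma measure_sub_fintype d (T : measurableType d) (R : realType)
  (mu : {measure set T -> \bar R}) (I : finType) (F : I -> set T) (A : set T) :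
  measurable A -> (forall i, measurable (F i)) -> A `<=` \bigcup_i F i ->
  (mu A <= \sum_i mu (F i))%E.
Proof.
move=> mA mF AF.
have := @content_sub_fsum _ _ _ mu I setT A F.
by rewrite fsbig_finType; apply => //; exact: finite_finset.
Qed.

Section LebesgueScaling.
Variables (R : realType) (d : nat).
Notation V := 'rV[R]_d.
Implicit Types (a b x v l : V) (E : set (borel V)).

Lemma dcube_shift k (z : {ffun 'I_d -> int}) :
  dcube k z = (fun x : V => x + \row_i (- ((z i)%:~R / 2 ^+ k))) @^-1` (dcube k [ffun => 0]).
Proof.
have z2 i (x : V) : 2 ^+ k * (x 0 i - (z i)%:~R / 2 ^+ k) = 2 ^+ k * x 0 i - (z i)%:~R :> R.
  by rewrite mulrBr [X in _ - X]mulrC divfK// expf_neq0.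
apply/seteqP; split=> x xz i; have := xz i; rewrite !mxE !ffunE z2 => h.
  apply: floor_def; have := floor_itv (2 ^+ k * x 0 i); rewrite h !rmorphD/= => ?; lra.
apply: floor_def; have := floor_itv (2 ^+ k * x 0 i - (z i)%:~R).
rewrite h !rmorphD/= => ?; lra.
Qed.

Lemma dcube_tile k : dcube 0 [ffun => 0] =
  \bigcup_(z : {ffun 'I_d -> 'I_(2 ^ k)}) dcube k [ffun i => Posz (z i)] :> set V.
Proof.
have p2 : (0 < 2 ^ k)%N by rewrite expn_gt0.
have c2 : 2 ^+ k = (2 ^ k)%:R :> R by rewrite natrX.
apply/seteqP; split=> x.
  move=> xz.
  have h i : exists j : 'I_(2 ^ k), Num.floor (2 ^+ k * x 0 i) = Posz j.
    have := xz i; rewrite ffunE expr0 mul1r => x0.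
    have /andP[x1 x2] := floor_itv (x 0 i); rewrite x0 in x1 x2.
    have := floor_itv (2 ^+ k * x 0 i).
    have : 0 <= 2 ^+ k * x 0 i < 2 ^+ k by rewrite mulr_ge0//= gtr_pMr.
    case: (Num.floor _) => [n|n] /andP[h1 h2] /andP[h3 h4].
      have nk : (n < 2 ^ k)%N.
        by rewrite -(ltr_nat R) -c2; apply: le_lt_trans h2.
      by exists (Ordinal nk).
    exfalso; have : (Negz n + 1)%:~R <= 0 :> R by rewrite -[0]/(0%:~R) ler_int; lia.
    by move=> ?; lra.
  have /fin_all_exists[j jP] := h.
  by exists [ffun i => j i] => // i; rewrite !ffunE.
move=> [z _ xz] i; have := xz i; rewrite !ffunE expr0 mul1r => h.
have := floor_itv (2 ^+ k * x 0 i); rewrite h => /andP[h1 h2].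
apply: floor_def; rewrite /= add0r; apply/andP; split.
  by rewrite -(@pmulr_rge0 _ (2 ^+ k))//; apply: le_trans h1; rewrite ler0z.
rewrite -(@ltr_pM2l _ (2 ^+ k))// mulr1; apply: lt_le_trans h2 _.
by rewrite c2 -[(2 ^ k)%:R]/((Posz (2 ^ k))%:~R) ler_int; have := ltn_ord (z i); lia.
Qed.

Lemma dcube_trivIset k : trivIset setT (fun z : {ffun 'I_d -> 'I_(2 ^ k)} => dcube k [ffun i => Posz (z i)] : set V).
Proof.
apply/trivIsetP => y z _ _ yz; apply/eqP; apply: contraNT yz => /set0P[x [xy xz]].
apply/eqP/ffunP => i; apply: val_inj; have := xy i; have := xz i.
by rewrite !ffunE => -> [].
Qed.

Definition trans_inv (mu : set (borel V) -> \bar R) := forall v E, measurable E ->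
  mu ((fun x : V => x + v) @^-1` E) = mu E.

Lemma sume_cst (I : finType) (x : \bar R) : (0 <= x)%E -> (\sum_(i : I) x = #|I|%:R%:E * x)%E.
Proof.
move=> x0; rewrite big_const; elim: #|_| => [|n IH]; first by rewrite mul0e.
by rewrite iterS IH -[in RHS]addn1 addnC natrD EFinD ge0_muleDl// mul1e.
Qed.

(** The unit cube consists of 2^(kd) translates of a cube of level k. *)
Lemma trans_inv_dcube (mu : {measure set (borel V) -> \bar R}) k (z : {ffun 'I_d -> int}) :
  trans_inv mu -> mu (dcube 0 [ffun => 0]) = (((2 ^ k) ^ d)%:R%:E * mu (dcube k z))%E.
Proof.
move=> ti.
have h (y : {ffun 'I_d -> int}) : mu (dcube k y) = mu (dcube k [ffun => 0]).
  by rewrite (dcube_shift k y) ti//; exact: measurable_dcube.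
rewrite (dcube_tile k) measure_bigcup_fintype; last 2 first.
  by move=> i; exact: measurable_dcube.
  exact: dcube_trivIset.
rewrite (eq_bigr (fun=> mu (dcube k z))) => [|y _]; last by rewrite (h z) h.
by rewrite sume_cst ?measure_ge0// card_ffun !card_ord.
Qed.

(* Both measures are determined by their common value on unit dyadic cubes, up to the scalar [c]. *)
Lemma trans_inv_unique (m1 m2 : {measure set (borel V) -> \bar R}) (c : R) : 0 <= c ->
  trans_inv m1 -> trans_inv m2 -> m2 (dcube 0 [ffun => 0]) = 1%E ->
  m1 (dcube 0 [ffun => 0]) = c%:E ->
  forall E, measurable E -> m1 E = (c%:E * m2 E)%E.
Proof.
move=> c0 t1 t2 m21 m1c E mE.
have z0 (z : {ffun 'I_d -> int}) : m1 (dcube 0 z) = c%:E.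
  by have := trans_inv_dcube 0 z t1; rewrite expn0 exp1n mul1e m1c => ->.
apply: (@borel_measure_unique R d m1 (mscale (NngNum c0) m2)) => // [k z|z].
  have := trans_inv_dcube k z t1; have := trans_inv_dcube k z t2.
  rewrite m21 m1c; set N := ((2 ^ k) ^ d)%:R => h2 h1.
  have N0 : N != 0 :> R by rewrite pnatr_eq0 -lt0n !expn_gt0.
  have -> : m1 (dcube k z) = (c / N)%:E.
    have : (N^-1%:E * c%:E = N^-1%:E * (N%:E * m1 (dcube k z)))%E by rewrite h1.
    by rewrite muleA -!EFinM mulVf// mul1e mulrC.
  rewrite -[RHS]/(c%:E * m2 (dcube k z))%E; have -> : m2 (dcube k z) = (N^-1)%:E.
    have : (N^-1%:E * 1%:E = N^-1%:E * (N%:E * m2 (dcube k z)))%E by rewrite h2.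
    by rewrite muleA -!EFinM mulVf// mul1e mulr1.
  by [].
by rewrite z0 ltry.
Qed.

Variable leb : {measure set (borel V) -> \bar R}.
Hypothesis hleb : is_lebesgue leb.

Lemma leb_cbox a b : (forall i, a 0 i <= b 0 i) ->
  leb (cbox a b) = (\prod_(i < d) (b 0 i - a 0 i))%:E.
Proof. exact: hleb. Qed.

Lemma prod_bern (I : finType) (F : I -> R) (t : R) : 0 <= t <= 1 -> (forall i, 0 <= F i) ->
  (1 - #|I|%:R * t) * \prod_i F i <= \prod_i ((1 - t) * F i).
Proof.
move=> /andP[t0 t1] F0; rewrite big_split/= prodr_const ler_wpM2r ?prodr_ge0//.
elim: #|I| => [|n IH]; first by rewrite mul0r subr0.
rewrite exprS; apply: le_trans (ler_wpM2l _ IH); last by rewrite subr_ge0.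
have : 0 <= n%:R * t * t by rewrite !mulr_ge0.
by rewrite -[in n.+1%:R]addn1 natrD => ?; nra.
Qed.

(** [is_lebesgue] speaks of closed boxes only. The half-open box is squeezed between its closure and
    the closed boxes with sides shrunk by 1 - t, whose volume is bounded below by Bernoulli's
    inequality [prod_bern]. *)
Lemma leb_hbox a b : (forall i, a 0 i < b 0 i) ->
  leb (hbox a b) = (\prod_(i < d) (b 0 i - a 0 i))%:E.
Proof.
move=> ab.
have p0 i : 0 <= b 0 i - a 0 i by rewrite subr_ge0 ltW.
have le1 : (leb (hbox a b) <= (\prod_(i < d) (b 0 i - a 0 i))%:E)%E.
  rewrite -leb_cbox => [|i]; last exact: ltW.
  apply: le_measure; rewrite ?inE; [exact: measurable_hbox|exact: measurable_cbox|].
  by move=> x xab i; have /andP[-> /ltW] := xab i.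
apply/eqP; rewrite eq_le le1/=.
have fin : leb (hbox a b) \is a fin_num by rewrite ge0_fin_numE// (le_lt_trans le1)// ltry.
rewrite -(fineK fin) lee_fin; set x := fine _; set P := \prod_(i < d) _.
have P0 : 0 <= P by apply: prodr_ge0.
have ht (t : R) : 0 < t -> t <= 1 -> (1 - d%:R * t) * P <= x.
  move=> t0 t1; have := @prod_bern _ (fun i : 'I_d => b 0 i - a 0 i) t.
  rewrite card_ord => /(_ _ p0); rewrite t1 ltW// => /(_ isT) /le_trans; apply.
  rewrite -lee_fin fineK//.
  have -> : (\prod_(i < d) ((1 - t) * (b 0 i - a 0 i)))%:E = leb (cbox a (a + (1 - t) *: (b - a))).
    rewrite leb_cbox => [|i]; last by rewrite !mxE lerDl mulr_ge0// subr_ge0.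
    by congr _%:E; apply: eq_bigr => i _; rewrite !mxE addrAC subrr add0r.
  apply: le_measure; rewrite ?inE; [exact: measurable_cbox|exact: measurable_hbox|].
  move=> y yab i; have := yab i; rewrite !mxE => /andP[-> /le_lt_trans->//].
  have : 0 < t * (b 0 i - a 0 i) by rewrite mulr_gt0// subr_gt0.
  by move=> ?; nra.
apply/ler_addgt0Pr => e e0.
have dP : 0 < 1 + d%:R * P + e by rewrite ltr_wpDl// addr_ge0// mulr_ge0.
(* Chosen so that t <= 1 and the loss d * P * t is at most e. *)
pose t := e / (1 + d%:R * P + e).
have t1 : t <= 1 by rewrite ler_pdivrMr// mul1r lerDr addr_ge0// mulr_ge0.
have := ht t; rewrite divr_gt0// => /(_ isT t1).
have : d%:R * P * t <= e.
  rewrite mulrA ler_pdivrMr//; have : 0 <= d%:R * P * e by rewrite !mulr_ge0// ltW.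
  have : 0 < e * e by rewrite mulr_gt0.
  by move=> ? ?; nra.
nra.
Qed.

Lemma leb_dcube k z : leb (dcube k z) = ((2 ^- k) ^+ d)%:E.
Proof.
rewrite dcubeE leb_hbox => [|i]; last by rewrite !mxE ltr_pM2r ?invr_gt0// ltr_int; lia.
congr _%:E; rewrite (eq_bigr (fun=> 2 ^- k)) ?prodr_const ?card_ord// => i _.
by rewrite !mxE -mulrBl rmorphD/= addrAC subrr add0r mul1r.
Qed.

Lemma leb_trans_inv : trans_inv leb.
Proof.
move=> v E mE.
have mf : measurable_fun [set: borel V] (fun x : borel V => (x : V) + v : borel V).
  by move=> _ B mB; rewrite setTI; exact: measurable_shift.
apply: (@borel_measure_unique R d
  (measure_function_pushforward__canonical__measure_function_Measure leb mf) leb) => // [k z|z].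
  rewrite -[LHS]/(leb ((fun x : V => x + v) @^-1` dcube k z)) leb_dcube dcubeE.
  set a := \row__ _; set b := \row__ _.
  have -> : (fun x : V => x + v) @^-1` hbox a b = hbox (a - v) (b - v).
    by apply/seteqP; split=> x xab i; have := xab i; rewrite !mxE; lra.
  rewrite leb_hbox => [|i]; last by rewrite !mxE ltrD2r ltr_pM2r ?invr_gt0// ltr_int; lia.
  congr _%:E; rewrite (eq_bigr (fun=> 2 ^- k)) ?prodr_const ?card_ord// => i _.
  have -> : (b - v) 0 i - (a - v) 0 i = b 0 i - a 0 i by rewrite !mxE; lra.
  by rewrite !mxE -mulrBl rmorphD/= addrAC subrr add0r mul1r.
rewrite -[X in (X < _)%E]/(leb ((fun x : V => x + v) @^-1` dcube 0 z)) dcubeE.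
set a := \row__ _; set b := \row__ _.
have -> : (fun x : V => x + v) @^-1` hbox a b = hbox (a - v) (b - v).
  by apply/seteqP; split=> x xab i; have := xab i; rewrite !mxE; lra.
by rewrite leb_hbox ?ltry// => i; rewrite !mxE ltrD2r ltr_pM2r ?invr_gt0// ltr_int; lia.
Qed.

Definition Box (l : V) : set (borel V) := cbox (- l) l.

Lemma BoxP l x : Box l x <-> forall i, `|x 0 i| <= l 0 i.
Proof. by split=> xl i; have := xl i; rewrite !mxE ler_norml. Qed.

Lemma measurable_Box l : measurable (Box l).
Proof. exact: measurable_cbox. Qed.

Lemma leb_Box l : (forall i, 0 <= l 0 i) -> leb (Box l) = (2 ^+ d * \prod_(i < d) l 0 i)%:E.
Proof.
move=> l0; rewrite leb_cbox => [|i]; last by rewrite !mxE; have := l0 i; lra.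
have -> : 2 ^+ d = \prod_(i < d) 2 :> R by rewrite prodr_const card_ord.
by rewrite -big_split/=; congr _%:E; apply: eq_bigr => i _; rewrite !mxE; lra.
Qed.

Lemma leb_fin E (r : R) : measurable E -> (forall x, E x -> `|x : V| <= r) -> leb E \is a fin_num.
Proof.
move=> mE Er; rewrite ge0_fin_numE ?measure_ge0//.
have [->|/set0P[y Ey]] := eqVneq E set0; first by rewrite measure0 ltry.
have r0 : 0 <= r by apply: le_trans (Er y Ey).
apply: (@le_lt_trans _ _ (leb (Box (const_mx r)))); last by rewrite leb_Box ?ltry// => i; rewrite mxE.
apply: le_measure; rewrite ?inE//; first exact: measurable_Box.
by move=> x Ex; apply/BoxP => i; rewrite mxE; apply: le_trans (Er x Ex); exact: rV_coord_le.
Qed.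

(* The factor by which a linear map scales Lebesgue measure (that is, its absolute determinant). *)
Definition kap (A : 'M[R]_d) : R := fine (leb ((fun x : V => x *m invmx A) @^-1` (dcube 0 [ffun => 0]))).

Lemma preimage_mulmx_bounded (A : 'M[R]_d) E r : A \in unitmx -> (forall x, E x -> `|x : V| <= r) ->
  forall x, ((fun x : V => x *m invmx A) @^-1` E) x -> `|x : V| <= d%:R * `|A| * r.
Proof.
move=> uA Er x /Er xr; rewrite -[x](mulmxKV uA) (le_trans (opb_norm _ _))//.
by rewrite ler_wpM2l// mulr_ge0.
Qed.

(** The left side, as a function of E, is again translation invariant: translating E by v translates
    its image by v *m A. Uniqueness up to a scalar does the rest. *)
Lemma leb_mulmx (A : 'M[R]_d) E : A \in unitmx -> measurable E ->
  leb ((fun x : V => x *m invmx A) @^-1` E) = ((kap A)%:E * leb E)%E.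
Proof.
move=> uA mE.
have mf : measurable_fun [set: borel V] (fun x : borel V => (x : V) *m invmx A : borel V).
  by move=> _ B mB; rewrite setTI; exact: measurable_mulmx.
apply: (@trans_inv_unique
  (measure_function_pushforward__canonical__measure_function_Measure leb mf) leb) => //.
- by rewrite fine_ge0.
- move=> v F mF.
  rewrite -[LHS]/(leb ((fun x : V => x *m invmx A) @^-1` ((fun x : V => x + v) @^-1` F))).
  rewrite -[RHS]/(leb ((fun x : V => x *m invmx A) @^-1` F)).
  have -> : (fun x : V => x *m invmx A) @^-1` ((fun x : V => x + v) @^-1` F) =
     (fun x : V => x + v *m A) @^-1` ((fun x : V => x *m invmx A) @^-1` F).
    by apply/seteqP; split=> x /=; rewrite mulmxDl mulmxK.
  by rewrite leb_trans_inv//; exact: measurable_mulmx.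
- exact: leb_trans_inv.
- by rewrite leb_dcube expr0 invr1 expr1n.
- rewrite -[LHS]/(leb ((fun x : V => x *m invmx A) @^-1` dcube 0 [ffun => 0])) /kap fineK//.
  apply: (@leb_fin _ (d%:R * `|A| * 1)).
    by apply: measurable_mulmx; exact: measurable_dcube.
  apply: preimage_mulmx_bounded => // x xz; apply: rV_norm_le => // i.
  by have := xz i; rewrite ffunE expr0 mul1r => h; have := floor_itv (x 0 i); rewrite h ler_norml; lra.
Qed.

Lemma leb_Box_gt0 l : (forall i, 0 < l 0 i) -> 0 < 2 ^+ d * \prod_(i < d) l 0 i.
Proof. by move=> l0; rewrite mulr_gt0 ?prodr_gt0. Qed.

Lemma kap_box (A : 'M[R]_d) : A \in unitmx ->
  leb ((fun x : V => x *m invmx A) @^-1` (Box (const_mx 1))) = (kap A * 2 ^+ d)%:E.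
Proof.
move=> uA; rewrite leb_mulmx//; last exact: measurable_Box.
rewrite leb_Box => [|i]; last by rewrite mxE.
by rewrite -EFinM big1 ?mulr1// => i _; rewrite mxE.
Qed.

Lemma kap_ge0 (A : 'M[R]_d) : 0 <= kap A.
Proof. by rewrite fine_ge0. Qed.

Lemma kap1 : kap 1%:M = 1.
Proof.
rewrite /kap invmx1; have -> : (fun x : V => x *m 1%:M) = id by apply/funext => x; rewrite mulmx1.
by rewrite preimage_id leb_dcube expr0 invr1 expr1n.
Qed.

(** Two successive linear maps scale the unit box by the product of their factors. With [kap1] this
    yields positivity and inverses without computing any determinant. *)
Lemma kapM (A B : 'M[R]_d) : A \in unitmx -> B \in unitmx -> kap (A *m B) = kap A * kap B.
Proof.
move=> uA uB; have uAB : A *m B \in unitmx by rewrite unitmx_mul uA.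
have := kap_box uAB.
have -> : (fun x : V => x *m invmx (A *m B)) @^-1` (Box (const_mx 1)) =
   (fun x : V => x *m invmx B) @^-1` ((fun x : V => x *m invmx A) @^-1` (Box (const_mx 1))).
  have -> : invmx (A *m B) = invmx B *m invmx A.
    have h : A *m B *m (invmx B *m invmx A) = 1%:M by rewrite mulmxA mulmxK// mulmxV.
    by rewrite -[RHS](mulKmx uAB) h mulmx1.
  by apply/seteqP; split=> x /=; rewrite mulmxA.
rewrite leb_mulmx//; last by apply: measurable_mulmx; exact: measurable_Box.
rewrite kap_box// -EFinM => -[]; rewrite [kap A * _]mulrC mulrA [kap B * _]mulrC -mulrA.
have p : (2 ^+ d : R) != 0 by rewrite expf_neq0.
by move=> h; apply: (mulIf p); rewrite -h; ring.
Qed.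

Lemma kap_gt0 (A : 'M[R]_d) : A \in unitmx -> 0 < kap A.
Proof.
move=> uA; rewrite lt_neqAle kap_ge0 andbT eq_sym; apply/eqP => A0.
have := kapM uA (_ : invmx A \in unitmx); rewrite unitmx_inv => /(_ uA).
by rewrite mulmxV// kap1 A0 mul0r => /eqP; rewrite oner_eq0.
Qed.

Lemma kapV (A : 'M[R]_d) : A \in unitmx -> kap (invmx A) = (kap A)^-1.
Proof.
move=> uA; have := kapM uA (_ : invmx A \in unitmx); rewrite unitmx_inv => /(_ uA).
by rewrite mulmxV// kap1 => h; apply: (mulfI (lt0r_neq0 (kap_gt0 uA))); rewrite -h mulfV// lt0r_neq0// kap_gt0.
Qed.

(** The image of the unit box lies in the box of half-side k. *)
Lemma kap_le (A : 'M[R]_d) (k : R) : A \in unitmx -> 0 <= k -> opb A k -> kap A <= k ^+ d.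
Proof.
move=> uA k0 Ak; have : (leb ((fun x : V => x *m invmx A) @^-1` (Box (const_mx 1%R))) <= leb (Box (const_mx k)))%E.
  apply: le_measure; rewrite ?inE; [by apply: measurable_mulmx; exact: measurable_Box|exact: measurable_Box|].
  move=> x /= /BoxP x1; apply/BoxP => i; rewrite mxE -[x](mulmxKV uA).
  apply: le_trans (rV_coord_le _ _) _; apply: le_trans (Ak _) _; rewrite ler_piMr//.
  by apply: rV_norm_le => // j; have := x1 j; rewrite [X in _ <= X]mxE.
rewrite kap_box// leb_Box => [|i]; last by rewrite mxE.
rewrite (eq_bigr (fun=> k)) => [|i _]; last by rewrite mxE.
by rewrite prodr_const card_ord lee_fin mulrC ler_pM2l ?exprn_gt0.
Qed.

End LebesgueScaling.

(** * Products of hyperbolic matrices *)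

Section Cone.
Variables (R : realType) (n : nat) (p q : nat -> R).
Hypotheses (p0 : forall k, 0 <= p k) (q0 : forall k, 0 <= q k).
Hypothesis pS : forall k, (k < n)%N -> p k.+1 <= 4^-1 * (p k + q k).
Hypothesis qS : forall k, (k < n)%N -> q k <= 4^-1 * (q k.+1 + p k).

(** The unstable cone p <= q is invariant forward in time: there q k.+1 >= 4 q k - p k >= 3 q k,
    while p k.+1 <= q k / 2. *)
Lemma cone_u k j : (k + j <= n)%N -> p k <= q k ->
  2 ^+ j * q k <= q (k + j)%N /\ p (k + j)%N <= q (k + j)%N.
Proof using p0 q0 pS qS.
move=> + pq; elim: j => [|j IH]; first by rewrite addn0 expr0 mul1r.
rewrite addnS => kj; have [h1 h2] := IH (ltnW kj).
have h3 := pS kj; have h4 := qS kj; rewrite exprS -mulrA.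
have := q0 (k + j); split; nra.
Qed.

(** The stable cone q <= p is invariant backward in time, since leaving it is impossible once
    [cone_u] applies; inside it p at least halves at each step. *)
Lemma cone_s k : (k <= n)%N -> q k <= p k -> 2 ^+ k * p k <= p 0.
Proof using p0 q0 pS qS.
elim: k => [|k IH] kn qp; first by rewrite expr0 mul1r.
have h3 := pS kn; have h4 := qS kn; have := q0 k; have := p0 k => h5 h6.
have qpk : q k <= p k by rewrite leNgt; apply/negP => ?; lra.
have := IH (ltnW kn) qpk; rewrite exprS; have : (0 : R) < 2 ^+ k by rewrite exprn_gt0.
by move=> ? ?; nra.
Qed.

(** At each time one of the two cones holds. In the unstable one the final value of q controls both
    quantities, in the stable one the initial value of p does. This is why stable data at the start
    and unstable data at the end determine an orbit segment. *)
Lemma cone_le k c : (k <= n)%N -> 2 ^- k * p 0 <= c -> 2 ^- (n - k) * q n <= c ->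
  p k <= c /\ q k <= c.
Proof using p0 q0 pS qS.
move=> kn pc qc; case: (leP (p k) (q k)) => [pq|/ltW qp].
  have := @cone_u k (n - k); rewrite subnKC// => /(_ (leqnn _) pq)[h _].
  have qkc : q k <= c by apply: le_trans qc; rewrite mulrC ler_pdivlMr ?exprn_gt0// mulrC.
  by split => //; exact: le_trans qkc.
have h := cone_s kn qp.
have pkc : p k <= c by apply: le_trans pc; rewrite mulrC ler_pdivlMr ?exprn_gt0// mulrC.
by split => //; exact: le_trans pkc.
Qed.

End Cone.

Section Projections.
Variables (R : realType) (d s : nat).
Notation V := 'rV[R]_d.
Definition Ps : 'M[R]_d := pid_mx s.
Definition Qs : 'M[R]_d := 1%:M - Ps.

Lemma PsE (v : V) j : (v *m Ps) 0 j = if (j < s)%N then v 0 j else 0.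
Proof.
rewrite !mxE (bigD1 j)//= big1 => [|i ij]; first by rewrite !mxE eqxx addr0; case: ifP; rewrite ?mulr1 ?mulr0.
by rewrite !mxE (negbTE (ij : val i != val j)) mulr0.
Qed.

Lemma QsE (v : V) j : (v *m Qs) 0 j = if (j < s)%N then 0 else v 0 j.
Proof. by rewrite mulmxBr mulmx1 2!mxE PsE; case: ifP => _; rewrite ?subrr ?subr0. Qed.

Lemma Ps_le (v : V) : `|v *m Ps| <= `|v|.
Proof.
by apply: rV_norm_le => // j; rewrite PsE; case: ifP => _; rewrite ?normr0// rV_coord_le.
Qed.

Lemma Qs_le (v : V) : `|v *m Qs| <= `|v|.
Proof.
by apply: rV_norm_le => // j; rewrite QsE; case: ifP => _; rewrite ?normr0// rV_coord_le.
Qed.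

Lemma PsQs (v : V) : v = v *m Ps + v *m Qs.
Proof. by rewrite -mulmxDr addrC subrK mulmx1. Qed.

Lemma PQ_norm (v : V) (c : R) : `|v *m Ps| <= c -> `|v *m Qs| <= c -> `|v| <= c.
Proof.
move=> h1 h2; apply: rV_norm_le => [|j]; first by apply: le_trans h1.
have := rV_coord_le (v *m Ps) j; have := rV_coord_le (v *m Qs) j.
by rewrite PsE QsE; case: ifP => _ /le_trans h3 /le_trans h4; rewrite ?h4 ?h3.
Qed.

Lemma PQ_normD (v : V) : `|v| <= `|v *m Ps| + `|v *m Qs|.
Proof. by rewrite [in leLHS](PsQs v) ler_normD. Qed.

Lemma mx_ext (m n : nat) (A B : 'M[R]_(m, n)) : (forall v : 'rV_m, v *m A = v *m B) -> A = B.
Proof. by move=> AB; apply/row_matrixP => i; rewrite !rowE AB. Qed.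

Lemma PP : Ps *m Ps = Ps.
Proof. apply: mx_ext => v.
rewrite mulmxA.
apply/rowP => j.
by rewrite PsE; case: ifP => // js; rewrite PsE js. Qed.
Lemma QQ : Qs *m Qs = Qs.
Proof. by rewrite mulmxBl mul1mx mulmxBr mulmx1 PP subrr subr0. Qed.
Lemma PQ : Ps *m Qs = 0.
Proof. by rewrite mulmxBr mulmx1 PP subrr. Qed.
Lemma QP : Qs *m Ps = 0.
Proof. by rewrite mulmxBl mul1mx PP subrr. Qed.
Lemma PQ1 : Ps + Qs = 1%:M.
Proof. by rewrite addrC subrK. Qed.

(* [M] acts on row vectors; it contracts the first [s] coordinates and expands the others. *)
Definition hyp (M : 'M[R]_d) := forall v : V,
  `|v *m M *m Ps| <= 4^-1 * (`|v *m Ps| + `|v *m Qs|) /\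
  `|v *m Qs| <= 4^-1 * (`|v *m M *m Qs| + `|v *m Ps|).

Fixpoint Bp (M : nat -> 'M[R]_d) n : 'M[R]_d := if n is n'.+1 then Bp M n' *m M n' else 1%:M.

Lemma BpD M m n : Bp M (m + n) = Bp M m *m Bp (fun k => M (m + k)%N) n.
Proof.
by elim: n => [|n IH]; rewrite ?addn0 /= ?mulmx1// addnS /= IH mulmxA.
Qed.

Lemma eq_Bp M M' n : (forall k, (k < n)%N -> M k = M' k) -> Bp M n = Bp M' n.
Proof.
elim: n => //= n IH e; rewrite IH ?e// => k kn; rewrite e//.
by apply: leq_trans kn _.
Qed.

(* Maps [v] to the stable part of [v] plus the unstable part of its image after [n] steps.  Unlike those of
   [Bp M n], its determinant is the unstable Jacobian, and prescribing [v *m Jm M n] is a well-conditioned problem. *)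
Definition Jm (M : nat -> 'M[R]_d) n := Ps + Bp M n *m Qs.

Lemma JmP M n (v : V) : v *m Jm M n *m Ps = v *m Ps.
Proof. by rewrite /Jm -mulmxA mulmxDl -mulmxA PP QP mulmx0 addr0. Qed.

Lemma JmQ M n (v : V) : v *m Jm M n *m Qs = v *m Bp M n *m Qs.
Proof. by rewrite /Jm -mulmxA mulmxDl -mulmxA PQ QQ add0r mulmxA. Qed.

Section Sequence.
Variables (M : nat -> 'M[R]_d) (n : nat).
Hypothesis hM : forall k, (k < n)%N -> hyp (M k).

Let pq_hyps (v : V) : let p k := `|v *m Bp M k *m Ps| in let q k := `|v *m Bp M k *m Qs| in
  [/\ forall k, 0 <= p k, forall k, 0 <= q k,
   forall k, (k < n)%N -> p k.+1 <= 4^-1 * (p k + q k) &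
   forall k, (k < n)%N -> q k <= 4^-1 * (q k.+1 + p k)].
Proof.
by split=> // k kn; have [h1 h2] := hM kn (v *m Bp M k); rewrite /= -?mulmxA -?mulmxA in h1 h2 *; rewrite !mulmxA in h1 h2 *.
Qed.

Lemma linear_cone (v : V) k c : (k <= n)%N ->
  2 ^- k * `|v *m Ps| <= c -> 2 ^- (n - k) * `|v *m Bp M n *m Qs| <= c -> `|v *m Bp M k| <= c.
Proof.
move=> kn h1 h2; have [p0 q0 pS qS] := pq_hyps v.
have [] := cone_le p0 q0 pS qS kn _ h2; first by rewrite mulmx1.
exact: PQ_norm.
Qed.

(* The end condition may be tilted: it is read off along the graph of [sg]. *)
Lemma tilted_cone (sg : 'M[R]_d) (v : V) k c : (k <= n)%N -> Ps *m sg = sg -> opb sg 2^-1 ->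
  `|v *m Ps| <= c -> `|v *m Bp M n *m (Qs - sg)| <= c -> `|v *m Bp M k| <= 2 * c.
Proof.
move=> kn Psg sg2 h1 h2; have [p0 q0 pS qS] := pq_hyps v.
set p := (fun k => `|v *m Bp M k *m Ps|) in p0 pS qS *.
set q := (fun k => `|v *m Bp M k *m Qs|) in q0 pS qS *.
have c0 : 0 <= c by apply: le_trans h1.
have k1 : 1 <= 2 ^+ k :> R by rewrite exprn_ege1// ler1n.
have nk1 : 1 <= 2 ^+ (n - k) :> R by rewrite exprn_ege1// ler1n.
have hq : q n <= c + 2^-1 * p n.
  have -> : q n = `|v *m Bp M n *m (Qs - sg) + v *m Bp M n *m Ps *m sg|.
    by rewrite -[_ *m Ps *m sg]mulmxA Psg -mulmxDr subrK.
  by rewrite (le_trans (ler_normD _ _))// lerD.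
rewrite /p /q in hq *.
case: (leP `|v *m Bp M k *m Ps| `|v *m Bp M k *m Qs|) => [pq|/ltW qp].
  have := cone_u p0 q0 pS qS (k := k) (j := n - k); rewrite subnKC// => /(_ (leqnn _) pq)[h3 h4].
  have qk : `|v *m Bp M k *m Qs| <= 2 * c by have := ler_wpM2r (q0 k) nk1; lra.
  by apply: PQ_norm => //; apply: le_trans qk.
have h3 := cone_s p0 q0 pS qS kn qp.
have pk : `|v *m Bp M k *m Ps| <= c.
  by move: h3; rewrite mulmx1; have := ler_wpM2r (p0 k) k1; lra.
by apply: PQ_norm; rewrite ?(le_trans qp)//; lra.
Qed.

(** A vector in the kernel has zero stable part at time 0 and zero unstable part at time n, so the
    cone estimate annihilates it. *)
Lemma Jm_unit : Jm M n \in unitmx.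
Proof.
apply: unitmx_inj => v v0; have := JmP M n v; have := JmQ M n v; rewrite v0 !mul0mx => h1 h2.
have := @linear_cone v 0 0 (leq0n _); rewrite mulmx1 -h1 -h2 normr0 !mulr0 => /(_ (lexx _) (lexx _)).
by rewrite normr_le0 => /eqP.
Qed.

(** The vectors whose unstable part vanishes after n steps form a finite-time stable subspace. It is
    the graph of this map from stable to unstable coordinates, see [tilt_ker]. *)
Definition tilt : 'M[R]_d := Ps *m invmx (Jm M n) *m Qs.

Lemma tiltP : Ps *m tilt = tilt. Proof. by rewrite /tilt !mulmxA PP. Qed.
Lemma tiltQ : tilt *m Qs = tilt. Proof. by rewrite /tilt -!mulmxA QQ. Qed.

Lemma tilt_row : Ps *m invmx (Jm M n) = Ps + tilt.
Proof.
apply/row_matrixP => i; rewrite linearD/= !rowE.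
set w := delta_mx 0 i; rewrite !mulmxA [LHS]PsQs; congr (_ + _).
by rewrite -(JmP M n) mulmxKV ?Jm_unit// -mulmxA PP.
Qed.

Lemma tilt_ker : (Ps + tilt) *m Bp M n *m Qs = 0.
Proof.
apply/row_matrixP => i; rewrite row0 -tilt_row rowE !mulmxA -JmQ mulmxKV ?Jm_unit//.
by rewrite -mulmxA PQ mulmx0.
Qed.

(** A vector w of the graph ends with zero unstable part, so it is never strictly inside the
    unstable cone. Its unstable part is therefore at most its stable part at times 0 and 1, and one
    step of the cone inequalities improves the slope at time 0 to below 1/2. *)
Lemma tilt_opb : opb tilt 2^-1.
Proof.
move=> v; set w := v *m Ps *m invmx (Jm M n).
have wP : w *m Ps = v *m Ps by rewrite -(JmP M n) mulmxKV ?Jm_unit// -mulmxA PP.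
have wQ : w *m Bp M n *m Qs = 0 by rewrite -JmQ mulmxKV ?Jm_unit// -mulmxA PQ mulmx0.
have -> : v *m tilt = w *m Qs by rewrite /tilt !mulmxA.
have [p0 q0 pS qS] := pq_hyps w.
have le_s k : (k <= n)%N -> `|w *m Bp M k *m Qs| <= `|w *m Bp M k *m Ps|.
  move=> kn; rewrite leNgt; apply/negP => pq.
  have := cone_u p0 q0 pS qS (k := k) (j := n - k); rewrite subnKC// => /(_ (leqnn _) (ltW pq))[+ _].
  rewrite wQ normr0 pmulr_rle0 ?exprn_gt0// => q_0.
  by have := lt_le_trans pq q_0; rewrite ltNge normr_ge0.
have := le_s 0 (leq0n _); rewrite mulmx1 => s0.
suff : `|w *m Qs| <= 2^-1 * `|w *m Ps|.
  by move=> /le_trans; apply; rewrite wP ler_wpM2l// Ps_le.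
have [n0|n1] := posnP n.
  by have := wQ; rewrite n0 mulmx1 => ->; rewrite normr0 mulr_ge0.
have := pS 0 n1; have := qS 0 n1; have := le_s 1 n1; rewrite mulmx1; lra.
Qed.

(** Subtracting a vector of the finite-time stable subspace does not change the unstable part at
    time n, so this part depends only on the unstable coordinates measured along that subspace. *)
Lemma tiltE : Bp M n *m Qs = (Qs - tilt) *m (Qs *m Bp M n *m Qs).
Proof.
have h : Ps *m Bp M n *m Qs = - (tilt *m Bp M n *m Qs).
  by apply/eqP; rewrite -addr_eq0 -!mulmxDl tilt_ker.
rewrite mulmxBl !mulmxA QQ tiltQ -h -!mulmxDl (addrC Qs) PQ1 mul1mx//.
Qed.

Lemma tilt_Jm : Jm M n = (1%:M - tilt) *m (Ps + Qs *m Bp M n *m Qs).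
Proof.
have h : Ps *m Bp M n *m Qs = - (tilt *m Bp M n *m Qs).
  by apply/eqP; rewrite -addr_eq0 -!mulmxDl tilt_ker.
have tP : tilt *m Ps = 0 by rewrite -tiltQ -mulmxA QP mulmx0.
rewrite mulmxDr (mulmxBl 1%:M tilt Ps) (mulmxBl 1%:M tilt (Qs *m _ *m _)) !mul1mx tP subr0.
rewrite -(mulmxA Qs) (mulmxA tilt Qs) tiltQ !mulmxA -h /Jm; congr (_ + _).
by rewrite -[in LHS](mul1mx (Bp M n)) -PQ1 mulmxDl mulmxDl addrC.
Qed.

Lemma tilt2 : tilt *m tilt = 0.
Proof. by rewrite -{1}tiltQ -{2}tiltP mulmxA -(mulmxA tilt) QP mulmx0 mul0mx. Qed.

Lemma tilt_units : [/\ 1%:M - tilt \in unitmx, 1%:M + tilt \in unitmx,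
  (1%:M + tilt) *m (1%:M - tilt) = 1%:M & Ps + Qs *m Bp M n *m Qs \in unitmx].
Proof.
have h : (1%:M + tilt) *m (1%:M - tilt) = 1%:M.
  by rewrite mulmxDl mul1mx mulmxBr mulmx1 tilt2 subr0 subrK.
have [u1 u2] := mulmx1_unit h; split => //.
by have := Jm_unit; rewrite tilt_Jm unitmx_mul => /andP[].
Qed.

End Sequence.

(** * Volume factors of concatenated products *)

Section Kappa.
Variable leb : {measure set (borel V) -> \bar R}.
Hypothesis hleb : is_lebesgue leb.
Notation kap := (kap leb).

Lemma kap1D_le (E : 'M[R]_d) (c : R) : 1%:M + E \in unitmx -> opb E c -> 0 <= c ->
  kap (1%:M + E) <= (1 + c) ^+ d.
Proof.
by move=> u Ec c0; apply: kap_le => //; [rewrite addr_ge0|apply: opbD => //; exact: opb1].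
Qed.

Variables (M : nat -> 'M[R]_d).

Lemma Jm_split (P Q G T sg : 'M[R]_d) : P *m P = P -> P *m Q = 0 -> Q *m P = 0 -> Q *m Q = Q ->
  sg *m P = 0 -> T *m Q = (Q - sg) *m (Q *m T *m Q) ->
  P + G *m T *m Q = (P + G *m (Q - sg)) *m (P + Q *m T *m Q).
Proof.
move=> pp pq qp qq sp e.
have z : (Q - sg) *m P = 0 by rewrite mulmxBl qp sp subrr.
rewrite -mulmxA e [RHS]mulmxDr (mulmxDl P _ P) (mulmxDl P _ (Q *m T *m Q)) pp -(mulmxA G _ P) z mulmx0 addr0; congr (_ + _).
by rewrite -(mulmxA Q T) (mulmxA P Q) pq mul0mx add0r mulmxA.
Qed.

Lemma Jm_perturb (P Q G sg : 'M[R]_d) : P + G *m Q \in unitmx ->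
  P + G *m (Q - sg) = (P + G *m Q) *m (1%:M + - (invmx (P + G *m Q) *m G *m sg)).
Proof.
have -> : P + G *m (Q - sg) = P + G *m Q - G *m sg by rewrite mulmxBr addrA.
by set X := P + G *m Q => u; rewrite mulmxDr mulmx1 mulmxN !mulmxA mulmxV// mul1mx.
Qed.

Lemma Jm_projP (P G Y : 'M[R]_d) (v : V) : P *m P = P -> Y *m P = 0 ->
  v *m (P + G *m Y) *m P = v *m P.
Proof. by move=> pp yp; rewrite -mulmxA mulmxDl pp -mulmxA yp mulmx0 addr0. Qed.

Lemma Jm_projQ (P Q G Y : 'M[R]_d) (v : V) : P *m Q = 0 -> Y *m Q = Y ->
  v *m (P + G *m Y) *m Q = v *m G *m Y.
Proof. by move=> pq yq; rewrite -mulmxA mulmxDl pq -mulmxA yq add0r mulmxA. Qed.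

(** The product splits at time m: in the first factor the last n steps appear only through the slope
    of their finite-time stable subspace, and the second factor is the unstable block of the last n
    steps alone. *)
Lemma Jm_tilt m n : (forall k, (k < m + n)%N -> hyp (M k)) ->
  let sg := tilt (fun k => M (m + k)%N) n in let T := Bp (fun k => M (m + k)%N) n in
  Jm M (m + n) = (Ps + Bp M m *m (Qs - sg)) *m (Ps + Qs *m T *m Qs).
Proof.
move=> hM sg T.
have hM' k : (k < n)%N -> hyp (M (m + k)%N) by move=> kn; apply: hM; rewrite ltn_add2l.
have e := tiltE hM'; have sgP : sg *m Ps = 0 by rewrite /sg -(tiltQ (fun k => M (m + k)%N) n) -mulmxA QP mulmx0.
by rewrite /Jm BpD; apply: Jm_split; rewrite ?PP ?PQ ?QP ?QQ.
Qed.

Lemma Jm_tilt_unit m n : (forall k, (k < m + n)%N -> hyp (M k)) ->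
  Ps + Bp M m *m (Qs - tilt (fun k => M (m + k)%N) n) \in unitmx.
Proof.
by move=> hM; have := Jm_unit hM; rewrite Jm_tilt// unitmx_mul => /andP[].
Qed.

(** The solution of a boundary problem with tilted end condition is bounded at all intermediate
    times, with a constant free of m and n; this is what makes a perturbation of one step
    harmless. *)
Lemma Jm_tilt_inv m n k (w : V) : (forall k, (k < m + n)%N -> hyp (M k)) -> (k <= m)%N ->
  `|w *m invmx (Ps + Bp M m *m (Qs - tilt (fun k => M (m + k)%N) n)) *m Bp M k| <= 2 * `|w|.
Proof.
move=> hM km; have u := Jm_tilt_unit hM; set sg := tilt _ _ in u *; set X := _ + _ in u *.
have hM' i : (i < n)%N -> hyp (M (m + i)%N) by move=> kn; apply: hM; rewrite ltn_add2l.
have hM1 i : (i < m)%N -> hyp (M i) by move=> kn; apply: hM; rewrite ltn_addr.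
have sgP : sg *m Ps = 0 by rewrite /sg -(tiltQ (fun k => M (m + k)%N) n) -mulmxA QP mulmx0.
have sgQ : sg *m Qs = sg by exact: tiltQ.
have QsP : (Qs - sg) *m Ps = 0 by rewrite (mulmxBl Qs sg Ps) QP sgP subr0.
have QsQ : (Qs - sg) *m Qs = Qs - sg by rewrite (mulmxBl Qs sg Qs) QQ sgQ.
set v := w *m invmx X; have vX : v *m X = w by rewrite mulmxKV.
apply: (@tilted_cone M m hM1 sg) => //; [exact: tiltP|exact: tilt_opb| |].
  have -> : v *m Ps = w *m Ps.
    by rewrite -vX /X Jm_projP ?PP.
  exact: Ps_le.
have -> : v *m Bp M m *m (Qs - sg) = w *m Qs.
  by rewrite -vX /X (@Jm_projQ _ Qs) ?PQ.
exact: Qs_le.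
Qed.

Lemma Jm_concat m n : (forall k, (k < m + n)%N -> hyp (M k)) ->
  kap (Jm M (m + n)) <= (9 / 4) ^+ d * (kap (Jm M m) * kap (Jm (fun k => M (m + k)%N) n)).
Proof.
move=> hM.
have hM' i : (i < n)%N -> hyp (M (m + i)%N) by move=> kn; apply: hM; rewrite ltn_add2l.
have hM1 i : (i < m)%N -> hyp (M i) by move=> kn; apply: hM; rewrite ltn_addr.
have [u1 u2 u12 u3] := tilt_units hM'; have u := Jm_tilt_unit hM.
have u0 := Jm_unit hM1; have u4 := Jm_unit hM'.
rewrite Jm_tilt// kapM//.
set sg := tilt _ _ in u1 u2 u12 u *; set T := Bp _ n in u3 *.
have sg2 : opb sg 2^-1 by exact: tilt_opb.
(* The tilt, of slope at most 1/2, is paid for twice: when the end condition at time m is tilted,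
   and when the unstable block of the later steps is replaced by their [Jm]. *)
have -> : (9 / 4 : R) = (1 + 2^-1) * (1 + 2^-1) by lra.
rewrite exprMn mulrACA ler_pM ?kap_ge0//.
  set X := Jm M m in u0 *; set Y := _ + _ in u *.
  have XY : Y = X *m (1%:M + - (invmx X *m Bp M m *m sg)) by exact: Jm_perturb.
  have uE : 1%:M + - (invmx X *m Bp M m *m sg) \in unitmx by move: u; rewrite XY unitmx_mul => /andP[].
  rewrite XY kapM// mulrC ler_wpM2r ?kap_ge0//; apply: kap1D_le => //; apply: opbN.
  move=> v; rewrite mulmxA (le_trans (sg2 _))// ler_wpM2l// mulmxA.
  apply: (linear_cone hM1) => //.
    rewrite -(JmP M m) -/X mulmxKV//.
    by rewrite (le_trans (ler_wpM2l _ (Ps_le _))) ?invr_ge0 ?exprn_ge0// ler_piMl// invf_le1 ?exprn_gt0// exprn_ege1// ler1n.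
  rewrite subnn expr0 invr1 mul1r -JmQ -/X mulmxKV//; exact: Qs_le.
have -> : Ps + Qs *m T *m Qs = (1%:M + sg) *m Jm (fun k => M (m + k)%N) n.
  by rewrite (tilt_Jm hM') mulmxA u12 mul1mx.
by rewrite kapM// ler_wpM2r ?kap_ge0//; apply: kap1D_le.
Qed.

End Kappa.

(** * Distortion of the unstable Jacobian *)

Section Distortion.
Variable leb : {measure set (borel V) -> \bar R}.
Hypothesis hleb : is_lebesgue leb.
Notation kap := (kap leb).

(** Split right after step m: only the first factor X changes, and X^-1 X' differs from the identity
    by X^-1 * Bp M m * (M' m - M m) * (Qs - tilt). The product of the first two terms is bounded by
    2 and the last term by 3/2, whence 3 c wherever the step m lies and however long the product
    is. *)
Lemma Jm_change (M M' : nat -> 'M[R]_d) m n (c : R) :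
  (forall k, (k < m.+1 + n)%N -> hyp (M k)) -> (forall k, (k < m.+1 + n)%N -> hyp (M' k)) ->
  (forall k, k != m -> M k = M' k) -> 0 <= c -> opb (M' m - M m) c ->
  kap (Jm M' (m.+1 + n)) <= (1 + 3 * c) ^+ d * kap (Jm M (m.+1 + n)).
Proof.
move=> hM hM' MM' c0 Mc.
have u := Jm_tilt_unit hM; have u' := Jm_tilt_unit hM'.
have hT i : (i < n)%N -> hyp (M (m.+1 + i)%N) by move=> kn; apply: hM; rewrite ltn_add2l.
have [_ _ _ u3] := tilt_units hT.
rewrite (Jm_tilt hM) (Jm_tilt hM').
have eT : (fun k => M (m.+1 + k)%N) = (fun k => M' (m.+1 + k)%N).
  by apply/funext => k; rewrite MM'// gtn_eqF// ltnS leq_addr.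
have vinv := fun w => @Jm_tilt_inv M m.+1 n m w hM (leqnSn m).
have sg2 := tilt_opb hT.
rewrite -eT in u' *; set sg := tilt _ n in sg2 vinv u u' *; set T := Bp _ n in u3 *.
set X := Ps + Bp M _ *m _ in vinv u *; set X' := Ps + Bp M' _ *m _ in u' *.
have XX' : X' = X *m (1%:M + invmx X *m Bp M m *m (M' m - M m) *m (Qs - sg)).
  have -> : X' = X + Bp M m *m (M' m - M m) *m (Qs - sg).
    rewrite /X /X' /= -(@eq_Bp M M' m) => [|k km]; last by rewrite MM'// ltn_eqF.
    have alg (P G A B Y : 'M[R]_d) : P + G *m A *m Y = P + G *m B *m Y + G *m (A - B) *m Y.
      by rewrite -addrA -mulmxDl -mulmxDr [B + _]addrC subrK.
    exact: alg.
  have alg (Z A B C : 'M[R]_d) : Z \in unitmx -> Z + A *m B *m C = Z *m (1%:M + invmx Z *m A *m B *m C).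
    by move=> uZ; rewrite mulmxDr mulmx1 !mulmxA mulmxV// mul1mx.
  exact: alg.
rewrite XX' in u' *; have uE : 1%:M + invmx X *m Bp M m *m (M' m - M m) *m (Qs - sg) \in unitmx.
  by move: u'; rewrite unitmx_mul => /andP[].
rewrite !kapM// mulrA ler_wpM2r ?kap_ge0// mulrC ler_wpM2r ?kap_ge0//.
apply: kap1D_le => //; last by rewrite mulr_ge0.
have hQ : opb (Qs - sg) (3 / 2).
  have -> : (3 / 2 : R) = 1 + 2^-1 by lra.
  by apply: opbD; [move=> v; rewrite mul1r Qs_le|exact: opbN].
have -> : 3 * c = 2 * c * (3 / 2) by lra.
apply: opbM => //; apply: opbM => // v; rewrite mulmxA; exact: vinv.
Qed.

(* Telescoping: the factors are changed one at a time. *)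
Lemma Jm_distortion (M M' : nat -> 'M[R]_d) n (c : nat -> R) :
  (forall k, (k < n)%N -> hyp (M k)) -> (forall k, (k < n)%N -> hyp (M' k)) ->
  (forall k, 0 <= c k) -> (forall k, (k < n)%N -> opb (M' k - M k) (c k)) ->
  kap (Jm M' n) <= (\prod_(k < n) (1 + 3 * c k)) ^+ d * kap (Jm M n).
Proof.
move=> hM hM' c0 Mc.
pose N m k := if (k < m)%N then M' k else M k.
have hN m k : (k < n)%N -> hyp (N m k) by move=> kn; rewrite /N; case: ifP => _; auto.
have -> : Jm M' n = Jm (N n) n by rewrite /Jm (@eq_Bp M' (N n))// /N => k ->.
have -> : Jm M n = Jm (N 0) n by [].
suff h m : (m <= n)%N -> kap (Jm (N m) n) <= (\prod_(k < m) (1 + 3 * c k)) ^+ d * kap (Jm (N 0) n) by exact: h.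
elim: m => [|m IH] mn; first by rewrite big_ord0 expr1n mul1r.
have e : n = (m.+1 + (n - m.+1))%N by rewrite subnKC.
have := @Jm_change (N m) (N m.+1) m (n - m.+1) (c m); rewrite -e => h.
apply: le_trans (h (hN _) (hN _) _ (c0 m) _) _.
- by move=> k km; rewrite /N (ltnS k m) (leq_eqVlt k m) (negbTE km).
- by rewrite /N ltnSn ltnn; exact: Mc.
rewrite big_ord_recr/= exprMn mulrAC [leRHS]mulrC ler_wpM2l ?IH 1?ltnW//.
by rewrite exprn_ge0// addr_ge0// mulr_ge0.
Qed.

(** A crude bound that grows with n. It only serves to make the measures of all strips of a given
    length bounded below. *)
Lemma Jm_le (M : nat -> 'M[R]_d) n (L : R) : 0 <= L -> (forall k, (k < n)%N -> hyp (M k)) ->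
  (forall k, (k < n)%N -> opb (M k) L) -> kap (Jm M n) <= (1 + L ^+ n) ^+ d.
Proof.
move=> L0 hM ML; apply: kap_le => //; first exact: Jm_unit.
  by rewrite addr_ge0// exprn_ge0.
apply: opbD; first by move=> v; rewrite mul1r Ps_le.
rewrite -[L ^+ n]mulr1; apply: opbM => //; last by move=> v; rewrite mul1r Qs_le.
elim: n hM ML => [|n IH] hM ML; first by rewrite expr0; exact: opb1.
rewrite exprSr; apply: opbM => //; last exact: ML.
by apply: IH => k kn; [apply: hM|apply: ML]; exact: ltnW.
Qed.

End Distortion.
End Projections.

(** * Orbits of nearly hyperbolic maps *)

Section RightInverse.
Variables (R : realType) (d s : nat).
Notation V := 'rV[R]_d.
Notation Ps := (@Ps R d s).
Notation Qs := (@Qs R d s).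

(** W inverts the unstable block of A. It exists because [Jm] of the single step A is invertible,
    and its bounds by 1/4 are the expansion inequality of [hyp] read backward. *)
Lemma hyp_right_inverse (A : 'M[R]_d) : hyp s A -> exists W : 'M[R]_d,
  [/\ W *m Ps = 0, W *m Qs = W, W *m A *m Qs = Qs, Qs *m A *m W = Qs &
   forall v : V, `|v *m W| <= 4^-1 * `|v| /\ `|v *m Ps *m A *m W| <= 4^-1 * `|v *m Ps|].
Proof.
move=> hA; have uX : Ps + A *m Qs \in unitmx.
  by have := @Jm_unit R d s (fun=> A) 1 (fun _ _ => hA); rewrite /Jm /= mul1mx.
exists (Qs *m invmx (Ps + A *m Qs)); set W := Qs *m _.
have QP0 : Qs *m Ps = 0 by exact: QP.
have QQ1 : Qs *m Qs = Qs by exact: QQ.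
have PQ0 : Ps *m Qs = 0 by exact: PQ.
have PP1 : Ps *m Ps = Ps by exact: PP.
have WP : W *m Ps = 0.
  apply: mx_ext => z; rewrite mulmx0 mulmxA /W mulmxA.
  by rewrite -[LHS](@Jm_projP R d Ps A Qs)// mulmxKV// -mulmxA QP0 mulmx0.
have WAQ : W *m A *m Qs = Qs.
  apply: mx_ext => z; rewrite /W 3!mulmxA.
  by rewrite -[LHS](@Jm_projQ R d Ps Qs)// mulmxKV// -mulmxA QQ1.
have WQ : W *m Qs = W.
  by have : W *m (Ps + Qs) = W; [rewrite PQ1 mulmx1|rewrite mulmxDr WP add0r].
have uA (v : V) : v *m A *m W *m A *m Qs = v *m A *m Qs.
  by rewrite -(mulmxA _ A Qs) -(mulmxA _ W) (mulmxA W) WAQ.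
have u_le (v : V) : `|(v - v *m A *m W) *m Qs| <= 4^-1 * `|v *m Ps|.
  have [_ /le_trans] := hA (v - v *m A *m W); apply.
  rewrite ler_wpM2l// (mulmxBl v _ A) (mulmxBl (v *m A) _ Qs) uA subrr normr0 add0r.
  by rewrite (mulmxBl v _ Ps) -(mulmxA _ W) WP mulmx0 subr0.
split => //.
  apply: mx_ext => v; have := u_le (v *m Qs).
  rewrite -(mulmxA v Qs Ps) QP0 mulmx0 normr0 mulr0 normr_le0 (mulmxBl (v *m Qs)) -(mulmxA _ W) WQ.
  by rewrite -(mulmxA v Qs Qs) QQ1 subr_eq0 => /eqP e; rewrite 2!mulmxA -e.
move=> v; split.
  have [_] := hA (v *m W).
  rewrite -(mulmxA v W Qs) WQ -(mulmxA v W Ps) WP mulmx0 normr0 addr0 -(mulmxA v W A) -(mulmxA v _ Qs) WAQ.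
  by move=> /le_trans; apply; rewrite ler_wpM2l// Qs_le.
have := u_le (v *m Ps).
by rewrite (mulmxBl (v *m Ps)) -(mulmxA v Ps Qs) PQ0 mulmx0 sub0r normrN -(mulmxA _ W) WQ -(mulmxA v Ps Ps) PP1.
Qed.

End RightInverse.

(** Sequences are stored below as matrices, and Banach's fixed point theorem asks for a complete
    normed space. *)
HB.instance Definition _ (R : realType) m n := Complete.on 'M[R]_(m, n).

Section Perron.
Variables (R : realType) (d s : nat).
Notation V := 'rV[R]_d.
Notation Ps := (@Ps R d s).
Notation Qs := (@Qs R d s).

(** The inequalities of [hyp] for differences of two points, so that the cone estimates apply to
    pairs of orbits of nonlinear maps. *)
Definition nhyp (r : R) (F : V -> V) := forall y y' : V, `|y| <= r -> `|y'| <= r ->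
  `|(F y - F y') *m Ps| <= 4^-1 * (`|(y - y') *m Ps| + `|(y - y') *m Qs|) /\
  `|(y - y') *m Qs| <= 4^-1 * (`|(F y - F y') *m Qs| + `|(y - y') *m Ps|).

Variables (F : nat -> V -> V) (n : nat) (r : R).
Hypothesis hF : forall k, (k < n)%N -> nhyp r (F k).

Definition forbit (y : nat -> V) := forall k, (k < n)%N -> y k.+1 = F k (y k).

Lemma orbit_cone y y' k (c : R) : forbit y -> forbit y' ->
  (forall i, (i <= n)%N -> `|y i| <= r) -> (forall i, (i <= n)%N -> `|y' i| <= r) -> (k <= n)%N ->
  2 ^- k * `|(y 0 - y' 0) *m Ps| <= c -> 2 ^- (n - k) * `|(y n - y' n) *m Qs| <= c ->
  `|y k - y' k| <= c.
Proof.
move=> oy oy' yr yr' kn h1 h2.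
have [] := @cone_le R n (fun k => `|(y k - y' k) *m Ps|) (fun k => `|(y k - y' k) *m Qs|) _ _ _ _ k c kn h1 h2 => //.
- by move=> i i_n; rewrite oy// oy'//; have [] := hF i_n (yr i (ltnW i_n)) (yr' i (ltnW i_n)).
- by move=> i i_n; rewrite oy// oy'//; have [] := hF i_n (yr i (ltnW i_n)) (yr' i (ltnW i_n)).
exact: PQ_norm.
Qed.

Variable A : nat -> 'M[R]_d.
Hypothesis FA : forall k (y y' : V), (k < n)%N -> `|y| <= r -> `|y'| <= r ->
  `|F k y - F k y' - (y - y') *m A k| <= `|y - y'|.

Variable W : nat -> 'M[R]_d.
Hypothesis hW : forall k, (k < n)%N ->
  [/\ W k *m Ps = 0, W k *m Qs = W k, W k *m A k *m Qs = Qs, Qs *m A k *m W k = Qs &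
   forall v : V, `|v *m W k| <= 4^-1 * `|v| /\ `|v *m Ps *m A k *m W k| <= 4^-1 * `|v *m Ps|].

(* Perron's method: the orbit with stable part [w *m Ps] at time 0 and unstable part [w *m Qs] at time [n] is the
   fixed point of a contraction of the space of sequences. *)
Definition perron (w : V) (y : nat -> V) k : V :=
  (if k is k'.+1 then F k' (y k') else w) *m Ps +
  (if (k < n)%N then y k *m Qs - (F k (y k) - y k.+1) *m W k else w *m Qs).

Lemma perronP w y k : (k <= n)%N -> perron w y k *m Ps = (if k is k'.+1 then F k' (y k') else w) *m Ps.
Proof.
move=> kn; rewrite /perron mulmxDl -mulmxA PP; case: ifP => [k_n|_].
  have [WP _ _ _ _] := hW k_n.
  by rewrite (mulmxBl (y k *m Qs)) -(mulmxA _ Qs) QP -(mulmxA _ (W k)) WP !mulmx0 subrr addr0.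
by rewrite -(mulmxA w Qs) QP mulmx0 addr0.
Qed.

Lemma perronQ w y k : (k <= n)%N -> perron w y k *m Qs =
  (if (k < n)%N then y k *m Qs - (F k (y k) - y k.+1) *m W k else w *m Qs).
Proof.
move=> kn; rewrite /perron mulmxDl -mulmxA PQ mulmx0 add0r; case: ifP => [k_n|_].
  have [_ WQ _ _ _] := hW k_n.
  by rewrite (mulmxBl (y k *m Qs)) -(mulmxA _ Qs) QQ -(mulmxA _ (W k)) WQ.
by rewrite -(mulmxA w Qs) QQ.
Qed.

(** The unstable component is updated by a Newton step with the approximate inverse X. In the
    difference of two updates the main linear part cancels, leaving an off-diagonal term, the
    linearization error and the influence of the next point. *)
Lemma newton_alg (P Q B X : 'M[R]_d) (a b f g x y : V) : P + Q = 1%:M -> Q *m B *m X = Q ->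
  a *m Q - (f - x) *m X - (b *m Q - (g - y) *m X) =
  - ((a - b) *m P *m B *m X) - (f - g - (a - b) *m B) *m X + (x - y) *m X.
Proof.
move=> PQe QBX; have e : (a - b) *m Q = (a - b) *m B *m X - (a - b) *m P *m B *m X.
  rewrite -[X in _ = X *m B *m _ - _](mulmx1) -PQe (mulmxDr (a - b)) (mulmxDl _ _ B) (mulmxDl _ _ X).
  by rewrite addrAC subrr add0r -!mulmxA (mulmxA Q) QBX.
move: e; rewrite !(mulmxBl, mulmxDl, mulNmx).
move: (a *m Q) (b *m Q) (f *m X) (x *m X) (g *m X) (y *m X) => aQ bQ fX xX gX yX.
move: (a *m B *m X) (b *m B *m X) (a *m P *m B *m X) (b *m P *m B *m X) => c1 c2 c3 c4 e.
apply/rowP => j; move/rowP/(_ j): e; rewrite !mxE => e; lra.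
Qed.

(** In the unstable component each of the three terms of [newton_alg] contributes a factor 1/4,
    because W is bounded by 1/4; the stable component contracts by 1/2. *)
Lemma perron_lip w y y' k (m : R) : (k <= n)%N -> (forall i, (i <= n)%N -> `|y i| <= r) ->
  (forall i, (i <= n)%N -> `|y' i| <= r) -> (forall i, (i <= n)%N -> `|y i - y' i| <= m) ->
  `|perron w y k - perron w y' k| <= 3 / 4 * m.
Proof.
move=> kn yr yr' ym; have m0 : 0 <= m by apply: le_trans (ym 0 (leq0n _)).
apply: (@PQ_norm R d s); rewrite mulmxBl.
  rewrite !perronP//; case: k kn => [|k] kn; first by rewrite subrr normr0 mulr_ge0.
  rewrite -mulmxBl; have [+ _] := hF kn (yr k (ltnW kn)) (yr' k (ltnW kn)).
  have := ym k (ltnW kn); have := Ps_le s (y k - y' k); have := Qs_le s (y k - y' k); lra.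
rewrite !perronQ//; case: ifP => [k_n|_]; last by rewrite subrr normr0 mulr_ge0.
have [_ _ _ QAW W4] := hW k_n.
rewrite (newton_alg _ _ _ _ _ _ (PQ1 R d s) QAW).
rewrite (le_trans (ler_normD _ _))// (le_trans (lerD (ler_normB _ _) (lexx _)))// normrN.
have [_ h1] := W4 (y k - y' k); have [h2 _] := W4 (y k.+1 - y' k.+1).
have [h3 _] := W4 (F k (y k) - F k (y' k) - (y k - y' k) *m A k).
have h4 := FA k_n (yr k kn) (yr' k kn); have h5 := Ps_le s (y k - y' k).
have h6 := ym k kn; have h7 := ym k.+1 k_n; lra.
Qed.

Lemma perron0 w (rho : R) k : `|w| <= rho -> (forall i, (i < n)%N -> `|F i 0| <= rho) -> (k <= n)%N ->
  `|perron w (fun=> 0) k| <= rho.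
Proof.
move=> wr Fr kn; have rho0 : 0 <= rho by apply: le_trans wr.
apply: (@PQ_norm R d s).
  rewrite perronP//; apply: le_trans (Ps_le _ _) _.
  by case: k kn => [|k] kn //; exact: Fr.
rewrite perronQ//; case: ifP => [k_n|_]; last exact: le_trans (Qs_le _ _) wr.
have [_ _ _ _ /(_ (F k 0 - 0))[h1 _]] := hW k_n.
rewrite mul0mx sub0r normrN (le_trans h1)// subr0; have := Fr k k_n; lra.
Qed.

Lemma perron_fixed w y : (forall k, (k <= n)%N -> y k = perron w y k) ->
  [/\ forbit y, y 0 *m Ps = w *m Ps & y n *m Qs = w *m Qs].
Proof.
move=> yT; split.
- move=> k kn; rewrite [LHS](PsQs s) [RHS](PsQs s); congr (_ + _).
    by rewrite yT// perronP.
  have := congr1 (mulmx^~ Qs) (yT k (ltnW kn)); rewrite perronQ ?kn 1?ltnW// => /eqP.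
  rewrite -subr_eq0 subKr => /eqP h.
  have [_ _ WAQ _ _] := hW kn.
  (* At a fixed point the Newton correction vanishes; as W *m A *m Qs = Qs, multiplying by A *m Qs
     recovers the unstable part of the defect. *)
  have := congr1 (fun z => z *m A k *m Qs) h.
  rewrite -(mulmxA _ (W k)) -(mulmxA _ _ Qs) WAQ !mul0mx => /eqP.
  by rewrite mulmxBl subr_eq0 => /eqP.
- by rewrite yT// perronP.
- by rewrite yT// perronQ// ltnn.
Qed.

Lemma perron_exists w (rho : R) : `|w| <= rho -> (forall i, (i < n)%N -> `|F i 0| <= rho) -> 4 * rho <= r ->
  exists y, [/\ forbit y, y 0 *m Ps = w *m Ps, y n *m Qs = w *m Qs &
     forall k, (k <= n)%N -> `|y k| <= 4 * rho].
Proof.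
move=> wr Fr rr; have rho0 : 0 <= rho by apply: le_trans wr.
pose seqm (Y : 'M[R]_(n.+1, d)) k : V := row (inord k) Y.
(* The radius is rho / (1 - 3/4): the zero sequence moves by at most rho and the map contracts by
   3/4, so this ball is mapped into itself. *)
pose U : set 'M[R]_(n.+1, d) := [set Y | `|Y| <= 4 * rho].
pose f (Y : 'M[R]_(n.+1, d)) : 'M[R]_(n.+1, d) := \matrix_i perron w (seqm Y) i.
have seq_le Y k : `|seqm Y k| <= `|Y|.
  by apply: rV_norm_le => // j; rewrite !mxE mx_coord_le.
have seqB Y Y' k : seqm Y k - seqm Y' k = seqm (Y - Y') k.
  by apply/rowP => j; rewrite !mxE.
have seqf Y k : (k <= n)%N -> seqm (f Y) k = perron w (seqm Y) k.
  by move=> kn; apply/rowP => j; rewrite !mxE inordK.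
have f_lip Y Y' : U Y -> U Y' -> `|f Y - f Y'| <= 3 / 4 * `|Y - Y'|.
  move=> UY UY'; apply: mx_norm_le => [|i j]; first by rewrite mulr_ge0.
  have := @perron_lip w (seqm Y) (seqm Y') i `|Y - Y'| (ltn_ord i).
  rewrite !mxE => h; have := rV_coord_le (perron w (seqm Y) i - perron w (seqm Y') i) j.
  rewrite !mxE => /le_trans; apply; apply: h => k kn.
  - by apply: le_trans (seq_le _ _) _; apply: le_trans rr.
  - by apply: le_trans (seq_le _ _) _; apply: le_trans rr.
  - by rewrite seqB.
have U0 : U 0 by rewrite /U /= normr0 mulr_ge0.
have f0 : `|f 0| <= rho.
  apply: mx_norm_le => // i j; rewrite mxE.
  have -> : seqm 0 = fun=> 0 by apply/funext => k; apply/rowP => l; rewrite !mxE.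
  by apply: le_trans (rV_coord_le _ _) _; apply: perron0 => //; rewrite -ltnS.
have fU : isFun _ _ U U f.
  split=> Y UY; rewrite /U /= -[f Y](subrK (f 0)) (le_trans (ler_normD _ _))//.
  have := f_lip Y 0 UY U0; rewrite subr0; have : `|Y| <= 4 * rho := UY; lra.
pose ff : {fun U >-> U} := HB.pack f fU.
have ctr : is_contraction ff.
  have q0 : 0 <= 3 / 4 :> R by lra.
  exists (NngNum q0); split => /=; first lra.
  by move=> [Y Y'] [/= UY UY']; exact: f_lip.
have clU : closed U.
  have -> : U = (fun Y : 'M[R]_(n.+1, d) => `|Y|) @^-1` [set x | x <= 4 * rho] by [].
  by apply: closed_comp => [Y _|]; [exact: norm_continuous|exact: closed_le].
have [Y UY Yf] : exists2 Y : 'M[R]_(n.+1, d), U Y & Y = f Y.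
  exact: (@banach_fixed_point R 'M[R]_(n.+1, d) U ff ctr clU (ex_intro _ _ U0)).
have Yfix k : (k <= n)%N -> seqm Y k = perron w (seqm Y) k.
  by move=> kn; rewrite {1}Yf; exact: seqf.
have [Y1 Y2 Y3] := perron_fixed Yfix.
exists (seqm Y); split => // k kn.
exact: le_trans (seq_le _ _) UY.
Qed.

End Perron.

(** * Volume of sets of orbits with prescribed end data *)

Lemma nbhs_norm_le (R : realType) (V : normedModType R) (x : V) (e : R) : 0 < e ->
  \forall y \near x, `|x - y| <= e.
Proof. by move=> e0; apply/nbhs_normP; exists e => //= y /ltW. Qed.

Section Volume.
Variables (R : realType) (d s : nat).
Notation V := 'rV[R]_d.
Notation Ps := (@Ps R d s).
Notation Qs := (@Qs R d s).
Variable leb : {measure set (borel V) -> \bar R}.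
Hypothesis hleb : is_lebesgue leb.
Notation kap := (kap leb).

Variables (F : nat -> V -> V) (M : nat -> V -> 'M[R]_d) (n : nat) (r L rho : R).
Hypothesis F_hyp : forall k, (k < n)%N -> nhyp s r (F k).
Hypothesis M_hyp : forall k y, (k < n)%N -> `|y| <= r -> hyp s (M k y).
Hypothesis F_lin : forall k (y y' z : V), (k < n)%N -> `|y| <= r -> `|y'| <= r -> `|z| <= r ->
  `|F k y - F k y' - (y - y') *m M k z| <= `|y - y'|.
Hypothesis F_diff : forall eta : R, 0 < eta -> exists2 e : R, 0 < e &
  forall k (y y' : V), (k < n)%N -> `|y| <= r -> `|y'| <= r -> `|y - y'| <= e ->
  `|F k y - F k y' - (y - y') *m M k y'| <= eta * `|y - y'|.
Hypothesis L0 : 0 <= L.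
Hypothesis M_le : forall k y, (k < n)%N -> `|y| <= r -> opb (M k y) L.
Hypothesis F0 : forall k, (k < n)%N -> `|F k 0| <= rho.
Hypothesis rho0 : 0 < rho.
Hypothesis rho_r : 5 * rho <= r.

Fixpoint orb (y : V) k : V := if k is k'.+1 then F k' (orb y k') else y.
Definition good y := forall k, (k <= n)%N -> `|orb y k| <= r.
(** The coordinates in which a strip becomes a box: stable part at time 0, unstable part at time n.
    Their differential is [jac]. *)
Definition bdry y : V := y *m Ps + orb y n *m Qs.
Definition jac y := Jm s (fun i => M i (orb y i)) n.

Lemma bdryP y : bdry y *m Ps = y *m Ps.
Proof. by rewrite /bdry mulmxDl -!mulmxA PP QP mulmx0 addr0. Qed.

Lemma bdryQ y : bdry y *m Qs = orb y n *m Qs.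
Proof. by rewrite /bdry mulmxDl -!mulmxA PQ QQ mulmx0 add0r. Qed.

Lemma orb_lip y y' k : good y -> good y' -> (k <= n)%N ->
  `|orb y k - orb y' k| <= (L + 1) ^+ k * `|y - y'|.
Proof.
move=> gy gy'; elim: k => [|k IH] kn /=; first by rewrite expr0 mul1r.
have {}IH := IH (ltnW kn); have h1 := F_lin kn (gy _ (ltnW kn)) (gy' _ (ltnW kn)) (gy' _ (ltnW kn)).
have h2 := M_le kn (gy' _ (ltnW kn)) (orb y k - orb y' k).
set a := F k _ - F k _ in h1 *; set b := (orb y k - orb y' k) *m _ in h1 h2.
have : `|a| <= `|a - b| + `|b| by rewrite -{1}(subrK b a) ler_normD.
rewrite exprS -mulrA => h3.
have : (L + 1) * `|orb y k - orb y' k| <= (L + 1) * ((L + 1) ^+ k * `|y - y'|) by rewrite ler_wpM2l// addr_ge0.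
lra.
Qed.

(** The Lipschitz bound is valid only inside radius r, so closeness to y' and staying inside are
    proved by one induction. The initial distance keeps the drift below rho, and 4 rho + rho fits
    into r. *)
Lemma good_nbhs y y' : `|y - y'| <= rho / (L + 1) ^+ n -> (forall k, (k <= n)%N -> `|orb y' k| <= 4 * rho) ->
  good y.
Proof.
move=> yy' gy'.
have L1 : 1 <= L + 1 by rewrite lerDr.
have step j : (j <= n)%N -> `|orb y j - orb y' j| <= (L + 1) ^+ j * `|y - y'| -> `|orb y j| <= r.
  move=> jn h; rewrite -(subrK (orb y' j) (orb y j)) (le_trans (ler_normD _ _))//.
  have h2 : (L + 1) ^+ j * `|y - y'| <= rho.
    apply: (@le_trans _ _ ((L + 1) ^+ n * `|y - y'|)); first by rewrite ler_wpM2r// ler_weXn2l.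
    by rewrite mulrC -ler_pdivlMr// exprn_gt0// (lt_le_trans ltr01).
  have := le_trans h h2; have := gy' j jn; have := rho_r; lra.
suff h j : (j <= n)%N -> `|orb y j - orb y' j| <= (L + 1) ^+ j * `|y - y'| /\ `|orb y j| <= r.
  by move=> j jn; have [] := h j jn.
elim: j => [|k IH] kn.
  have h : `|orb y 0 - orb y' 0| <= (L + 1) ^+ 0 * `|y - y'| by rewrite expr0 mul1r.
  by split => //; exact: step.
have [IH1 IH2] := IH (ltnW kn).
suff h : `|orb y k.+1 - orb y' k.+1| <= (L + 1) ^+ k.+1 * `|y - y'| by split => //; exact: step.
have gk' : `|orb y' k| <= r by apply: le_trans (gy' _ (ltnW kn)) _; have := rho0; have := rho_r; lra.
have h1 := F_lin kn IH2 gk' gk'; have h2 := M_le kn gk' (orb y k - orb y' k).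
rewrite /=; set a := F k _ - F k _ in h1 *; set b := (orb y k - orb y' k) *m _ in h1 h2.
have : `|a| <= `|a - b| + `|b| by rewrite -{1}(subrK b a) ler_normD.
rewrite exprS -mulrA => h3.
have : (L + 1) * `|orb y k - orb y' k| <= (L + 1) * ((L + 1) ^+ k * `|y - y'|) by rewrite ler_wpM2l// addr_ge0.
lra.
Qed.

(** The chain rule along n steps, with an error uniform in both points: the grid arguments linearize
    around all cell centres at once. *)
Lemma orb_diff (eta : R) k : 0 < eta -> (k <= n)%N -> exists2 e : R, 0 < e &
  forall y y', good y -> good y' -> `|y - y'| <= e ->
  `|orb y k - orb y' k - (y - y') *m Bp (fun i => M i (orb y' i)) k| <= eta * `|y - y'|.
Proof.
elim: k eta => [|k IH] eta eta0 kn.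
  by exists 1 => // y y' _ _ _; rewrite /= mulmx1 subrr normr0 mulr_ge0// ltW.
have L1 : 0 < L + 1 by rewrite ltr_wpDl.
have LL : 0 < (L + 1) ^+ k by rewrite exprn_gt0.
have [e1 e10 h1] := IH (eta / 2 / (L + 1)) (divr_gt0 (divr_gt0 eta0 (ltr0Sn _ 1)) L1) (ltnW kn).
have [e2 e20 h2] := F_diff (divr_gt0 (divr_gt0 eta0 (ltr0Sn _ 1)) LL).
exists (Num.min e1 (e2 / (L + 1) ^+ k)); first by rewrite lt_min e10 divr_gt0.
move=> y y' gy gy'; rewrite le_min => /andP[ye1 ye2].
have kn' := ltnW kn; have lip := orb_lip gy gy' kn'.
have h3 : `|orb y k - orb y' k| <= e2 by apply: le_trans lip _; rewrite mulrC -ler_pdivlMr.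
have {}h2 := h2 k _ _ kn (gy k kn') (gy' k kn') h3.
have {}h1 := h1 y y' gy gy' ye1.
have h4 := M_le kn (gy' k kn') (orb y k - orb y' k - (y - y') *m Bp (fun i => M i (orb y' i)) k).
rewrite /=; set a := F k _ - F k _ in h2 *; set b := orb y k - orb y' k in h1 h2 h4 lip *.
set c := (y - y') *m Bp _ k in h1 h4; rewrite mulmxA -/c.
have -> : a - c *m M k (orb y' k) = (a - b *m M k (orb y' k)) + (b - c) *m M k (orb y' k).
  have alg (u v w : V) (N : 'M[R]_d) : u - w *m N = u - v *m N + (v - w) *m N.
    by rewrite mulmxBl addrA subrK.
  exact: alg.
rewrite (le_trans (ler_normD _ _))//.
have h5 : eta / 2 / (L + 1) ^+ k * `|b| <= eta / 2 * `|y - y'|.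
  rewrite -(mulrA (eta / 2)); apply: ler_wpM2l; first by rewrite divr_ge0// ltW.
  by rewrite ler_pdivrMl.
have h6 : L * `|b - c| <= eta / 2 * `|y - y'|.
  apply: (@le_trans _ _ ((L + 1) * `|b - c|)); first by rewrite ler_wpM2r// lerDl.
  apply: le_trans (ler_wpM2l (ltW L1) h1) _.
  by rewrite mulrA [(L + 1) * _]mulrC divfK// gt_eqF.
lra.
Qed.

Lemma bdry_diff (eta : R) : 0 < eta -> exists2 e : R, 0 < e &
  forall y y', good y -> good y' -> `|y - y'| <= e ->
  `|bdry y - bdry y' - (y - y') *m jac y'| <= eta * `|y - y'|.
Proof.
move=> eta0; have [e e0 h] := orb_diff eta0 (leqnn n); exists e => // y y' gy gy' ye.
have -> : bdry y - bdry y' - (y - y') *m jac y' =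
  (orb y n - orb y' n - (y - y') *m Bp (fun i => M i (orb y' i)) n) *m Qs.
  have alg (a b u v : V) (P Q B : 'M[R]_d) :
    a *m P + u *m Q - (b *m P + v *m Q) - (a - b) *m (P + B *m Q) = (u - v - (a - b) *m B) *m Q.
    rewrite !(mulmxBl, mulmxDl, mulmxDr, mulmxA, mulNmx).
    by apply/rowP => j; rewrite !mxE; lra.
  exact: alg.
exact: le_trans (Qs_le _ _) (h _ _ gy gy' ye).
Qed.

Lemma orbit_orb (y : nat -> V) : forbit F n y -> forall k, (k <= n)%N -> y k = orb (y 0) k.
Proof. by move=> oy; elim=> // k IH kn /=; rewrite -IH ?oy// ltnW. Qed.

Lemma bsol_exists w : `|w| <= rho -> exists y, bdry y = w /\ (forall k, (k <= n)%N -> `|orb y k| <= 4 * rho).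
Proof.
move=> wr; have r0 : 0 <= r by have := rho0; have := rho_r; lra.
have hA k : (k < n)%N -> hyp s (M k 0) by move=> kn; apply: M_hyp => //; rewrite normr0.
have hW k : exists W : 'M[R]_d, (k < n)%N ->
  [/\ W *m Ps = 0, W *m Qs = W, W *m M k 0 *m Qs = Qs, Qs *m M k 0 *m W = Qs &
   forall v : V, `|v *m W| <= 4^-1 * `|v| /\ `|v *m Ps *m M k 0 *m W| <= 4^-1 * `|v *m Ps|].
  case: (ltnP k n) => kn; last by exists 0.
  by have [W hW] := hyp_right_inverse (hA k kn); exists W.
have [W {}hW] := choice hW.
have FA k (y y' : V) : (k < n)%N -> `|y| <= r -> `|y'| <= r -> `|F k y - F k y' - (y - y') *m M k 0| <= `|y - y'|.
  by move=> kn h1 h2; apply: F_lin => //; rewrite normr0.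
have rr : 4 * rho <= r by have := rho0; have := rho_r; lra.
have [y [oy y0 yn yr]] := perron_exists F_hyp FA hW wr F0 rr.
exists (y 0); split=> [|k kn]; last by rewrite -orbit_orb// yr.
by rewrite /bdry -orbit_orb// y0 yn -PsQs.
Qed.

Definition bsol w := xget 0 [set y | bdry y = w /\ (forall k, (k <= n)%N -> `|orb y k| <= 4 * rho)].

Lemma bsolP w : `|w| <= rho -> bdry (bsol w) = w /\ (forall k, (k <= n)%N -> `|orb (bsol w) k| <= 4 * rho).
Proof. by move=> /bsol_exists[y yP]; rewrite /bsol; case: xgetP => [z -> //|/(_ y)]. Qed.

Lemma good4 y : (forall k, (k <= n)%N -> `|orb y k| <= 4 * rho) -> good y.
Proof. by move=> h k kn; apply: le_trans (h k kn) _; have := rho0; have := rho_r; lra. Qed.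

Lemma bsol_good w : `|w| <= rho -> good (bsol w).
Proof. by move=> /bsolP[_ /good4]. Qed.

(** The cone estimate at time 0. It makes the solution of the boundary problem unique and
    1-Lipschitz in its data. *)
Lemma bdry_expand y y' : good y -> good y' -> `|y - y'| <= `|bdry y - bdry y'|.
Proof.
move=> gy gy'; apply: (@orbit_cone R d s F n r F_hyp (orb y) (orb y') 0) => //.
  rewrite expr0 invr1 mul1r -[X in `|X|]/((y - y') *m Ps) (mulmxBl y y').
  by rewrite -(bdryP y) -(bdryP y') -(mulmxBl (bdry y) (bdry y')) Ps_le.
rewrite subn0 (mulmxBl (orb y n) (orb y' n)) -(bdryQ y) -(bdryQ y') -(mulmxBl (bdry y) (bdry y')).
rewrite (le_trans (ler_wpM2l _ (Qs_le _ _))) ?invr_ge0 ?exprn_ge0//.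
by rewrite ler_piMl// invf_le1 ?exprn_gt0// exprn_ege1// ler1n.
Qed.

Lemma bsolK y : good y -> `|bdry y| <= rho -> bsol (bdry y) = y.
Proof.
move=> gy yr; have [h1 h2] := bsolP yr; apply/eqP; rewrite -subr_eq0 -normr_le0.
by have := bdry_expand (bsol_good yr) gy; rewrite h1 subrr normr0.
Qed.

Lemma bsol_lip w w' : `|w| <= rho -> `|w'| <= rho -> `|bsol w - bsol w'| <= `|w - w'|.
Proof.
move=> wr wr'; have := bdry_expand (bsol_good wr) (bsol_good wr').
by have [-> _] := bsolP wr; have [-> _] := bsolP wr'.
Qed.

Lemma jac_hyp y k : good y -> (k < n)%N -> hyp s (M k (orb y k)).
Proof. by move=> gy kn; apply: M_hyp => //; apply: gy; exact: ltnW. Qed.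

Lemma jac_unit y : good y -> jac y \in unitmx.
Proof. by move=> gy; apply: Jm_unit => k kn; exact: jac_hyp. Qed.

Lemma jac_inv y (v : V) : good y -> `|v *m invmx (jac y)| <= `|v|.
Proof.
move=> gy; have hM k (kn : (k < n)%N) := jac_hyp gy kn.
have := @linear_cone R d s _ n hM (v *m invmx (jac y)) 0 `|v| (leq0n n).
rewrite mulmx1; apply.
  by rewrite expr0 invr1 mul1r -(JmP s (fun i => M i (orb y i)) n) mulmxKV ?jac_unit// Ps_le.
rewrite -JmQ mulmxKV ?jac_unit// subn0.
rewrite (le_trans (ler_wpM2l _ (Qs_le _ _))) ?invr_ge0 ?exprn_ge0//.
by rewrite ler_piMl// invf_le1 ?exprn_gt0// exprn_ege1// ler1n.
Qed.

Lemma Box_norm (l : V) (c : R) x : 0 <= c -> (forall i, l 0 i <= c) -> Box l x -> `|x : V| <= c.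
Proof.
by move=> c0 lc /BoxP xl; apply: rV_norm_le => // i; apply: le_trans (xl i) (lc i).
Qed.

Definition Dset (l : V) : set (borel V) := [set y : V | good y /\ Box l (bdry y)].

Lemma DsetE (l : V) : (forall i, l 0 i <= rho) -> Dset l = bsol @` Box l.
Proof.
move=> lr; have nr := fun x => @Box_norm l rho x (ltW rho0) lr.
apply/seteqP; split=> y.
  by move=> [gy yl]; exists (bdry y) => //; apply: bsolK => //; exact: nr.
move=> [w wl <-]; have wr := nr w wl; have [h1 h2] := bsolP wr.
by split; [exact: bsol_good|rewrite h1].
Qed.

Lemma Box_compact (l : V) : compact (Box l : set V).
Proof.
apply: bounded_closed_compact; last exact: cbox_closed.
exists (`|l|); split; first by rewrite realE normr_ge0.
move=> c lc x /= /BoxP xl; apply: (@Box_norm l); [by apply: le_trans (ltW lc)|move=> i|exact/BoxP].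
by apply: le_trans (ler_norm _) _; apply: le_trans (rV_coord_le _ _) (ltW lc).
Qed.

(** The set is the image of a compact box under the Lipschitz map [bsol]. Measurability of strips
    and of their images in the space follows from this compactness. *)
Lemma Dset_compact (l : V) : (forall i, l 0 i <= rho) -> compact (Dset l : set V).
Proof.
move=> lr; rewrite DsetE//; apply: continuous_compact; last exact: Box_compact.
apply/subspace_continuousP => x xl; apply/cvgrPdist_le => e e0.
rewrite near_withinE; apply: filterS (nbhs_norm_le x e0) => y xy yl.
have nr := fun x => @Box_norm l rho x (ltW rho0) lr.
exact: le_trans (bsol_lip (nr _ xl) (nr _ yl)) xy.
Qed.

Lemma measurable_Dset (l : V) : (forall i, l 0 i <= rho) -> measurable (Dset l).
Proof.
move=> lr; apply: borel_closed; apply: compact_closed; last exact: Dset_compact.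
exact: norm_hausdorff.
Qed.

Variables (K J : R).
Hypothesis K0 : 0 < K.
Hypothesis J0 : 0 < J.
Hypothesis jac_J : forall y, good y -> `|bdry y| <= rho -> J <= K * kap (jac y) /\ kap (jac y) <= K * J.

Definition vb (l : V) : R := 2 ^+ d * \prod_(i < d) l 0 i.

(** The parallelepiped that approximates, near y, the set of points whose boundary data lie in a
    small box; its volume is known exactly. *)
Definition parall (y : V) (X : 'M[R]_d) (l : V) : set (borel V) :=
  (fun x : V => x + (- y)) @^-1` ((fun x : V => x *m invmx (invmx X)) @^-1` (Box l)).

Lemma parallE (y : V) (X : 'M[R]_d) (l : V) x : parall y X l x = Box l ((x - y) *m X).
Proof. by rewrite /parall /= invmxK. Qed.

Lemma measurable_parall y X l : measurable (parall y X l).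
Proof. by apply: measurable_shift; apply: measurable_mulmx; exact: measurable_Box. Qed.

Lemma leb_parall y X (l : V) : X \in unitmx -> (forall i, 0 <= l 0 i) ->
  leb (parall y X l) = ((kap X)^-1 * vb l)%:E.
Proof.
move=> uX l0; rewrite leb_trans_inv//; last by apply: measurable_mulmx; exact: measurable_Box.
by rewrite leb_mulmx ?unitmx_inv//; [rewrite leb_Box// kapV|exact: measurable_Box].
Qed.

Lemma grid_sum N (a : R) : \sum_(i : {ffun 'I_d -> 'I_N}) a = N%:R ^+ d * a.
Proof. by rewrite big_const iter_addr_0 card_ffun !card_ord -natrX mulr_natl. Qed.

Section Grid.
Variables (l : V) (N : nat).
Hypothesis l0 : forall i, 0 < l 0 i.
Hypothesis N0 : (0 < N)%N.

Definition gctr (c : {ffun 'I_d -> 'I_N}) : V := \row_j (l 0 j * ((2 * (c j)%:R + 1) / N%:R - 1)).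

Lemma gctr_le c j : `|gctr c 0 j| <= l 0 j * (1 - N%:R^-1).
Proof.
rewrite mxE normrM gtr0_norm// ler_pM2l// ler_norml.
have cN : (c j)%:R + 1 <= N%:R :> R by rewrite natr1 ler_nat ltn_ord.
have Np : 0 < N%:R :> R by rewrite ltr0n.
have c0 : 0 <= (c j)%:R :> R by [].
have -> : (2 * (c j)%:R + 1) / N%:R - 1 = (2 * (c j)%:R + 1 - N%:R) / N%:R :> R by field; rewrite gt_eqF.
have -> : 1 - N%:R^-1 = (N%:R - 1) / N%:R :> R by field; rewrite gt_eqF.
rewrite -mulNr !ler_pM2r ?invr_gt0//; lra.
Qed.

Lemma gctr_Box c : Box l (gctr c).
Proof.
apply/BoxP => j; apply: le_trans (gctr_le c j) _.
by rewrite ger_pMr// gerBl invr_ge0.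
Qed.

Lemma grid_cover w : Box l w -> exists c, Box (N%:R^-1 *: l) (w - gctr c).
Proof.
move=> /BoxP wl.
have Np : 0 < N%:R :> R by rewrite ltr0n.
have h j : exists c : 'I_N, `|w 0 j - l 0 j * ((2 * c%:R + 1) / N%:R - 1)| <= N%:R^-1 * l 0 j.
  have lj := l0 j; have := wl j; rewrite ler_norml => /andP[w1 w2].
  pose t := (w 0 j / l 0 j + 1) * N%:R / 2.
  have t0 : 0 <= t by rewrite divr_ge0// mulr_ge0// -lerBlDr sub0r ler_pdivlMr// mulN1r.
  have tN : t <= N%:R.
    rewrite ler_pdivrMr// mulrC ler_pM2l// -lerBrDr ler_pdivrMr//; lra.
  have [c [c1 c2]] : exists c : 'I_N, c%:R <= t /\ t <= c%:R + 1.
    have /andP[f1 f2] := truncn_itv t0.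
    have [tn|nt] := ltnP (Num.truncn t) N.
      by exists (Ordinal tn); split => //; rewrite natr1 ltW.
    have N1 : (N.-1 < N)%N by rewrite prednK.
    exists (Ordinal N1); rewrite /= natr1 prednK//; split => //.
    by apply: le_trans f1; rewrite ler_nat (leq_trans (leq_pred _)).
  exists c.
  have -> : w 0 j = l 0 j * (2 * t / N%:R - 1).
    rewrite /t; field; rewrite gt_eqF// gt_eqF//.
  rewrite -mulrBr normrM (gtr0_norm lj) mulrC ler_pM2r//.
  have -> : 2 * t / N%:R - 1 - ((2 * c%:R + 1) / N%:R - 1) = (2 * (t - c%:R) - 1) / N%:R by field; rewrite gt_eqF.
  rewrite normrM normfV (gtr0_norm Np) ler_pdivrMr// mulVf ?gt_eqF// ler_norml; lra.
have /choice[c cP] := h.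
by exists [ffun j => c j]; apply/BoxP => j; have := cP j; rewrite !mxE ffunE.
Qed.

Lemma grid_disjoint w c c' : Box ((2 * N%:R)^-1 *: l) (w - gctr c) -> Box ((2 * N%:R)^-1 *: l) (w - gctr c') -> c = c'.
Proof.
have Np : 0 < N%:R :> R by rewrite ltr0n.
move=> /BoxP h /BoxP h'; apply/ffunP => j; apply: val_inj => /=; apply/eqP; apply: contraT => cc.
have lj := l0 j; have := h j; have := h' j; rewrite !mxE !ler_norml => /andP[a1 a2] /andP[b1 b2].
have key (a b : R) : a + 1 <= b -> l 0 j * ((2 * b + 1) / N%:R - 1) - l 0 j * ((2 * a + 1) / N%:R - 1) >= 2 * (N%:R^-1 * l 0 j).
  move=> ab; rewrite -mulrBr [_ - 1 - _](_ : _ = 2 * (b - a) / N%:R); last by field; rewrite gt_eqF.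
  rewrite [2 * _]mulrC [N%:R^-1 * _]mulrC -mulrA ler_pM2l// mulrC ler_pM2r ?invr_gt0//; lra.
have e : (2 * N%:R)^-1 * l 0 j = 2^-1 * (N%:R^-1 * l 0 j) by rewrite invfM mulrA.
have p : 0 < N%:R^-1 * l 0 j by rewrite mulr_gt0 ?invr_gt0.
rewrite e in a1 a2 b1 b2.
have [cl|cl|/eqP] := ltngtP (c j) (c' j); last by rewrite (negbTE cc).
  have /key : (c j)%:R + 1 <= (c' j)%:R :> R by rewrite natr1 ler_nat.
  by move=> ?; exfalso; lra.
have /key : (c' j)%:R + 1 <= (c j)%:R :> R by rewrite natr1 ler_nat.
by move=> ?; exfalso; lra.
Qed.

Lemma vbZ (t : R) : vb (t *: l) = t ^+ d * vb l.
Proof.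
rewrite /vb (eq_bigr (fun i => t * l 0 i)) => [|i _]; last by rewrite mxE.
by rewrite big_split/= prodr_const card_ord mulrCA.
Qed.

Lemma vb_gt0 : 0 < vb l.
Proof. exact: leb_Box_gt0. Qed.

End Grid.

Lemma Box_lim (l : V) : (0 < d)%N -> (forall i, 0 < l 0 i) -> exists2 c : R, 0 < c & forall i, c <= l 0 i.
Proof.
move=> d0 l0; pose i0 := Ordinal d0.
exists (l 0 [arg min_(i < i0) l 0 i]%O); first exact: l0.
by move=> i; case: arg_minP => // j _ /(_ i isT).
Qed.

Lemma min_coord (l : V) : (forall i, 0 < l 0 i) -> exists2 c : R, 0 < c & forall i, c <= l 0 i.
Proof.
move=> l0; case: (posnP d) => [d0|/Box_lim]; last exact.
by exists 1 => // i; have := ltn_ord i; rewrite {2}d0.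
Qed.

Lemma fine_grid (l : V) (e : R) : 0 < e -> exists2 N, (0 < N)%N & N%:R^-1 * `|l| <= e.
Proof.
move=> e0; exists (Num.truncn (`|l| / e)).+1 => //.
rewrite ler_pdivrMl// -ler_pdivrMr//; have /andP[_ /ltW] := truncn_itv (divr_ge0 (normr_ge0 l) (ltW e0)).
by [].
Qed.

Lemma Box_scale_norm (l : V) (t : R) x : 0 <= t -> Box (t *: l) x -> `|x : V| <= t * `|l|.
Proof.
move=> t0; apply: Box_norm => [|i]; first by rewrite mulr_ge0.
rewrite mxE ler_wpM2l//; apply: le_trans (ler_norm _) (rV_coord_le _ _).
Qed.

Lemma vol_upper (l : V) : (forall i, 0 < l 0 i <= rho) ->
  (leb (Dset l) <= (2 ^+ d * (K / J) * vb l)%:E)%E.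
Proof.
move=> lr; have l0 i : 0 < l 0 i by have /andP[] := lr i.
have lr' i : l 0 i <= rho by have /andP[] := lr i.
have nr := fun x => @Box_norm l rho x (ltW rho0) lr'.
have [c c0 cl] := min_coord l0.
(* With this tolerance the nonlinear error over one grid cell is at most c / N, hence below each
   half-side l_j / N of the cell. *)
have [e e0 he] := bdry_diff (divr_gt0 c0 (ltr_pwDl ltr01 (normr_ge0 l))).
have [N N0 hN] := fine_grid l e0.
have Np : 0 < N%:R :> R by rewrite ltr0n.
pose ctr := @gctr l N.
have cB i := gctr_Box l0 N0 i.
have cr i : `|ctr i| <= rho by apply: nr; exact: cB.
(* Cells of doubled size absorb the nonlinear error, so they cover the set; this costs the factor
   2^d. *)
pose P i := parall (bsol (ctr i)) (jac (bsol (ctr i))) ((2 / N%:R) *: l).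
have sub : Dset l `<=` \bigcup_i P i.
  rewrite DsetE// => _ [w wl <-]; have wr := nr w wl.
  have [i iP] := grid_cover l0 N0 wl; exists i => //; rewrite /P parallE.
  have wi : `|w - ctr i| <= N%:R^-1 * `|l| by apply: Box_scale_norm => //; rewrite invr_ge0.
  have yi := le_trans (bsol_lip wr (cr i)) wi.
  have := he _ _ (bsol_good wr) (bsol_good (cr i)) (le_trans yi hN).
  have [-> _] := bsolP wr; have [-> _] := bsolP (cr i).
  set Z := (bsol w - _) *m _ => hZ; apply/BoxP => j.
  move/BoxP/(_ j): iP; rewrite [(_ *: l) 0 j]mxE [((2 / _) *: l) 0 j]mxE -/(ctr i) => h1.
  have h2 : `|(w - ctr i - Z) 0 j| <= N%:R^-1 * l 0 j.
    apply: le_trans (rV_coord_le _ _) _; apply: le_trans hZ _.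
    apply: (@le_trans _ _ (c / (1 + `|l|) * (N%:R^-1 * `|l|))); first by rewrite ler_wpM2l// divr_ge0// ltW// addr_ge0.
    rewrite mulrCA ler_wpM2l ?invr_ge0//; apply: le_trans (cl j).
    by rewrite mulrAC -mulrA ler_piMr ?(ltW c0)// ler_pdivrMr ?mul1r ?lerDr// ltr_pwDl.
  have -> : Z 0 j = (w - ctr i) 0 j - (w - ctr i - Z) 0 j by rewrite !mxE; lra.
  rewrite (le_trans (ler_normB _ _))// (le_trans (lerD h1 h2))// -mulrDl ler_pM2r ?l0//; lra.
have := @measure_sub_fintype _ _ _ leb _ P (Dset l) (measurable_Dset lr') (fun i => measurable_parall _ _ _) sub.
move=> /le_trans; apply.
have N2 : 0 <= 2 / N%:R :> R by rewrite divr_ge0.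
rewrite (@le_trans _ _ (\sum_(i : {ffun 'I_d -> 'I_N}) ((K / J) * ((2 / N%:R) ^+ d * vb l))%:E)%E)//.
  apply: lee_sum => i _; rewrite /P leb_parall; last 2 first.
    exact/jac_unit/bsol_good.
    by move=> j; rewrite mxE mulr_ge0// ltW.
  rewrite lee_fin vbZ ler_wpM2r//; first by rewrite mulr_ge0 ?exprn_ge0// ltW// vb_gt0.
  have gi := bsol_good (cr i); have [e1 _] := bsolP (cr i).
  have [|J1 _] := jac_J gi; first by rewrite e1.
  have kp := kap_gt0 hleb (jac_unit gi).
  by rewrite ler_pdivlMr// ler_pdivrMl// mulrC.
rewrite sumEFin lee_fin grid_sum.
rewrite expr_div_n [leRHS](_ : _ = N%:R ^+ d * (K / J * (2 ^+ d / N%:R ^+ d * vb l)))//.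
by field; rewrite !gt_eqF// exprn_gt0.
Qed.

Lemma vol_lower (l : V) : (forall i, 0 < l 0 i <= rho) ->
  (((4 ^+ d * K * J)^-1 * vb l)%:E <= leb (Dset l))%E.
Proof.
move=> lr; have l0 i : 0 < l 0 i by have /andP[] := lr i.
have lr' i : l 0 i <= rho by have /andP[] := lr i.
have nr := fun x => @Box_norm l rho x (ltW rho0) lr'.
have [c c0 cl] := min_coord l0.
have [e e0 he] := bdry_diff (divr_gt0 c0 (ltr_pwDl ltr01 (normr_ge0 l))).
have L1 : 0 < (L + 1) ^+ n by rewrite exprn_gt0// ltr_wpDl.
have e'0 : 0 < Num.min e (rho / (L + 1) ^+ n) by rewrite lt_min e0 divr_gt0.
have [N N0 hN] := fine_grid l e'0; rewrite le_min in hN; have /andP[hN1 hN2] := hN.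
have Np : 0 < N%:R :> R by rewrite ltr0n.
pose ctr := @gctr l N.
have cB i := gctr_Box l0 N0 i.
have cr i : `|ctr i| <= rho by apply: nr; exact: cB.
(* A parallelepiped of a quarter of the size, plus an error of the same size, lands in the half-size
   cell. Half-size cells are disjoint and stay in the box, so these parallelepipeds are disjoint and
   inside the set; this costs 4^d. *)
pose P i := parall (bsol (ctr i)) (jac (bsol (ctr i))) ((4 * N%:R)^-1 *: l).
have key i y : P i y -> good y /\ Box ((2 * N%:R)^-1 *: l) (bdry y - ctr i).
  rewrite /P parallE; set Z := (y - _) *m _ => ZB.
  have gi := bsol_good (cr i); have [e1 g4] := bsolP (cr i).
  have Zn : `|Z| <= (4 * N%:R)^-1 * `|l| by apply: Box_scale_norm => //; rewrite invr_ge0 mulr_ge0.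
  have N4 : (4 * N%:R)^-1 <= N%:R^-1 :> R by rewrite lef_pV2 ?posrE ?mulr_gt0//; have : 1 <= N%:R :> R; [rewrite ler1n|lra].
  have yn : `|y - bsol (ctr i)| <= (4 * N%:R)^-1 * `|l|.
    apply: le_trans Zn; have := jac_inv Z gi; rewrite /Z mulmxK//; exact: jac_unit.
  have yn' : `|y - bsol (ctr i)| <= N%:R^-1 * `|l| by apply: le_trans yn _; rewrite ler_wpM2r.
  have gy : good y by apply: (@good_nbhs _ (bsol (ctr i))) => //; exact: le_trans yn' hN2.
  split => //; have := he _ _ gy gi (le_trans yn' hN1); rewrite e1 -/Z => hZ.
  apply/BoxP => j; move/BoxP/(_ j): ZB; rewrite [(_ *: l) 0 j]mxE [((2 * _)^-1 *: l) 0 j]mxE => h1.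
  have h2 : `|(bdry y - ctr i - Z) 0 j| <= (4 * N%:R)^-1 * l 0 j.
    apply: le_trans (rV_coord_le _ _) _; apply: le_trans hZ _.
    apply: (@le_trans _ _ (c / (1 + `|l|) * ((4 * N%:R)^-1 * `|l|))); first by rewrite ler_wpM2l// divr_ge0// ltW// addr_ge0.
    rewrite mulrCA ler_wpM2l ?invr_ge0 ?mulr_ge0//; apply: le_trans (cl j).
    by rewrite mulrAC -mulrA ler_piMr ?(ltW c0)// ler_pdivrMr ?mul1r ?lerDr// ltr_pwDl.
  have -> : (bdry y - ctr i) 0 j = Z 0 j + (bdry y - ctr i - Z) 0 j by rewrite !mxE; lra.
  rewrite (le_trans (ler_normD _ _))// (le_trans (lerD h1 h2))// -mulrDl ler_pM2r ?l0//.
  have -> : (2 * N%:R)^-1 = 2^-1 * N%:R^-1 :> R by rewrite invfM.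
  by have -> : (4 * N%:R)^-1 = 4^-1 * N%:R^-1 :> R; [rewrite invfM|lra].
have tP : trivIset setT P.
  apply/trivIsetP => i j _ _ ij; apply/eqP; apply: contraNT ij => /set0P[y [yi yj]].
  have [_ h1] := key i y yi; have [_ h2] := key j y yj.
  by apply/eqP; exact: (@grid_disjoint l N l0 N0 (bdry y)).
have sub : \bigcup_i P i `<=` Dset l.
  move=> y [i _ /key[gy yi]]; split => //; apply/BoxP => j.
  move/BoxP/(_ j): yi; rewrite [(_ *: l) 0 j]mxE => h1; have h2 := gctr_le l0 N0 i j.
  have -> : bdry y 0 j = (bdry y - ctr i) 0 j + ctr i 0 j by rewrite !mxE; lra.
  rewrite (le_trans (ler_normD _ _))// (le_trans (lerD h1 h2))//.
  have Ni : 0 < N%:R^-1 :> R by rewrite invr_gt0.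
  have -> : (2 * N%:R)^-1 = 2^-1 * N%:R^-1 :> R by rewrite invfM.
  by have := mulr_gt0 Ni (l0 j); lra.
have mP i : measurable (P i) by exact: measurable_parall.
apply: (@le_trans _ _ (leb (\bigcup_i P i))); last first.
  apply: le_measure; rewrite ?inE//; last exact: measurable_Dset.
  by apply: fin_bigcup_measurable => //; exact: finite_finset.
rewrite measure_bigcup_fintype//.
rewrite (@le_trans _ _ (\sum_(i : {ffun 'I_d -> 'I_N}) ((K * J)^-1 * (((4 * N%:R)^-1) ^+ d * vb l))%:E)%E)//; last first.
  apply: lee_sum => i _; rewrite /P leb_parall; last 2 first.
    exact/jac_unit/bsol_good.
    by move=> j; rewrite mxE mulr_ge0// ?invr_ge0 ?mulr_ge0// ltW.
  rewrite lee_fin vbZ; apply: ler_wpM2r.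
    apply: mulr_ge0; last exact/ltW/vb_gt0.
    by rewrite exprn_ge0// invr_ge0 mulr_ge0.
  have gi := bsol_good (cr i); have [e1 _] := bsolP (cr i).
  have [|_ J1] := jac_J gi; first by rewrite e1.
  have kp := kap_gt0 hleb (jac_unit gi).
  by rewrite lef_pV2 ?posrE ?mulr_gt0.
rewrite sumEFin lee_fin grid_sum.
rewrite exprVn exprMn [leRHS](_ : _ = (4 ^+ d * K * J)^-1 * vb l)//.
by field; rewrite !gt_eqF// exprn_gt0.
Qed.

End Volume.

(** * Coverings by strips *)

(** Disjoint sets of measure at least c number at most 1/c, so there is a disjoint family of maximal
    cardinality; any further set must meet one of its members. *)
Lemma finite_vitali d (T : measurableType d) (R : realType) (m : probability T R)
    (X : set T) (S : T -> set T) (c : R) : 0 < c ->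
  (forall x, X x -> measurable (S x)) -> (forall x, X x -> (c%:E <= m (S x))%E) ->
  exists (k : nat) (f : 'I_k -> T), [/\ forall i, X (f i), trivIset setT (S \o f) &
    forall x, X x -> exists i, S x `&` S (f i) !=set0].
Proof.
move=> c0 mS cS.
pose P k := `[< exists f : 'I_k -> T, (forall i, X (f i)) /\ trivIset setT (S \o f) >].
have P0 : exists k, P k.
  by exists 0%N; apply/asboolP; exists (fun i : 'I_0 => match notF (valP i) with end); split; case.
have Pb k : P k -> (k <= Num.truncn c^-1)%N.
  move=> /asboolP[f [Xf tf]].
  have : (m (\bigcup_i S (f i)) <= 1)%E.
    by apply: probability_le1; apply: fin_bigcup_measurable => [|i _]; [exact: finite_finset|exact: mS].
  rewrite measure_bigcup_fintype//; last by move=> i; exact: mS.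
  have : (\sum_(i < k) c%:E <= \sum_(i < k) m (S (f i)))%E by apply: lee_sum => i _; exact: cS.
  move=> /le_trans h /h; rewrite sumEFin lee_fin sumr_const card_ord => h1.
  rewrite truncn_ge_nat; last by rewrite invr_ge0 ltW.
  by rewrite -[c^-1]mul1r ler_pdivlMr// mulr_natl.
case: (ex_maxnP P0 Pb) => k /asboolP[f [Xf tf]] kmax.
exists k, f; split => // x Xx.
apply: contrapT => h.
have dj i : S x `&` S (f i) = set0.
  by apply: contrapT => /eqP/set0P ne; apply: h; exists i.
have : P k.+1.
  apply/asboolP; exists (fun i => if unlift ord0 i is Some j then f j else x); split.
    by move=> i; case: unliftP => [j _|_].
  move=> i j _ _; rewrite /=; case: (unliftP ord0 i) => [i' ->|->]; case: (unliftP ord0 j) => [j' ->|->] //.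
  - by move=> ne; rewrite (tf i' j' I I ne).
  - by rewrite setIC dj => -[z].
  - by rewrite dj => -[z].
by move/kmax; rewrite ltnn.
Qed.

(** * Inner and outer regularity of Borel probability measures *)

Section Regularity.
Variables (R : realType) (T : ptopologicalType) (m : probability (borel T) R).

Definition regular (A : set (borel T)) := forall eta : R, 0 < eta ->
  exists K W : set (borel T), [/\ closed (K : set T), open (W : set T), K `<=` A, A `<=` W & (m (W `\` K) <= eta%:E)%E].

Lemma regularC A : regular A -> regular (~` A).
Proof.
move=> rA eta /rA[K [W [cK oO KA AO h]]]; exists (~` W), (~` K); split.
- exact: open_closedC.
- exact: closed_openC.
- exact: subsetC.
- exact: subsetC.
- by rewrite setDE setCK setIC -setDE.
Qed.

Lemma regular_bigcup (F : nat -> set (borel T)) : (forall i, regular (F i)) -> regular (\bigcup_i F i).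
Proof.
move=> rF eta eta0.
(* One half of eta pays for the approximation of all sets, the other for replacing the union of the
   closed sets by a finite union, which is closed. *)
have ei i : 0 < eta / 2 / (2 ^ i.+1)%:R by rewrite !divr_gt0// ltr0n expn_gt0.
have [K KP] := choice (fun i => rF i _ (ei i)).
have [W OP] := choice KP.
have oO i : open (W i : set T) by have [] := OP i.
have cK i : closed (K i : set T) by have [] := OP i.
have mO i : measurable (W i) by exact: borel_open.
have mK i : measurable (K i) by exact: borel_closed.
have oUO : open (\bigcup_i W i : set T) by apply: bigcup_open.
pose D N := \bigcup_i W i `\` \bigcup_(i in `I_N) K i.
have mUK N : measurable (\bigcup_(i in `I_N) K i) by apply: fin_bigcup_measurable.
have mD N : measurable (D N) by apply: measurableD => //; exact: borel_open.
have mUKi : measurable (\bigcup_i K i) by exact: bigcupT_measurable.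
have capD : \bigcap_N D N = \bigcup_i W i `\` \bigcup_i K i.
  apply/seteqP; split=> [x h|x [h1 h2] N _].
    have [h1 _] := h 0%N I; split => // -[i _ Kx].
    by have [_] := h i.+1 I; apply; exists i => /=.
  by split => // -[i _ Kx]; apply: h2; exists i.
have lim_le : (m (\bigcap_N D N) <= (eta / 2)%:E)%E.
  rewrite capD.
  apply: (@le_trans _ _ (\sum_(i <oo) m (W i `\` K i))%E).
    apply: measure_sigma_subadditive => //.
    - by move=> i; apply: measurableD.
    - by apply: measurableD => //; exact: borel_open.
    - move=> x [[i _ Ox] h]; exists i => //; split => // Kx; apply: h; exists i => //.
  apply: le_trans (epsilon_trick0 _ _); last by rewrite ltW// divr_gt0.
  by apply: lee_nneseries => [i _|i _]; rewrite ?measure_ge0//; have [] := OP i.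
have cv : m \o D @ \oo --> m (\bigcap_N D N).
  apply: nonincreasing_cvg_mu => //.
  - exact: le_lt_trans (probability_le1 _ (mD 0%N)) (ltry _).
  - by apply: bigcapT_measurable.
  - apply/nonincreasing_seqP => N; apply/subsetPset => x [h1 h2]; split => // -[i iN Kx].
    by apply: h2; exists i => //=; exact: ltnW.
have : \forall N \near \oo, ((m \o D) N < eta%:E)%E.
  apply: (cv [set z | (z < eta%:E)%E]); apply: open_nbhs_nbhs; split; first exact: open_ereal_lt_ereal.
  by apply: le_lt_trans lim_le _; rewrite lte_fin; lra.
move=> [N _ /(_ N (leqnn N)) h].
exists (\bigcup_(i in `I_N) K i), (\bigcup_i W i); split.
- by apply: closed_bigcup => //.
- exact: oUO.
- by move=> x [i _ Kx]; exists i => //; have [_ _ h' _ _] := OP i; exact: h'.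
- by move=> x [i _ Fx]; exists i => //; have [_ _ _ h' _] := OP i; exact: h'.
- exact: ltW.
Qed.

Lemma borel_regular : (forall W : set (borel T), open (W : set T) -> regular W) ->
  forall A, measurable A -> regular A.
Proof.
move=> ro A mA; apply: (mA regular); split => //; split.
- by apply: ro; exact: open0.
- by move=> B; rewrite setTD; exact: regularC.
- exact: regular_bigcup.
Qed.

End Regularity.

(** * Hopf's argument from abstract properties of strips *)

Section StripErgodicity.
Variables (R : realType) (d : nat) (T : ptopologicalType) (m : probability (borel T) R).
Notation V := 'rV[R]_d.
Variables (g : T -> T) (psi : T -> V -> T) (strip : T -> nat -> R -> R -> set (borel T)).
Variables (rho Lc r2 Kv : R) (Kc : R -> R) (cl : nat -> R -> R -> R).
Notation mr := (fun E : set (borel T) => fine (m E)).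
Hypotheses (cT : compact [set: T]) (kT : connected [set: T]).
Hypothesis g_cont : continuous g.
Hypothesis g_pres : preserves m (g : borel T -> borel T).
Hypotheses (rho0 : 0 < rho) (Lc1 : 1 <= Lc) (r20 : 0 < r2) (Kv0 : 0 < Kv) (Kc0 : forall dl, 0 < dl -> 0 < Kc dl).
Hypothesis psi_near : forall (p0 : T) (e : R), 0 < e ->
  exists2 U : set T, open U /\ U p0 & forall x x', U x -> U x' -> exists2 v : V, `|v| <= e & x' = psi x v.
Hypothesis psi_small : forall (O : set T) (p0 : T), open O -> O p0 ->
  exists2 e : R, 0 < e & \forall p \near p0, forall v : V, `|v| <= e -> O (psi p v).
Hypothesis strip_meas : forall p n a b, 0 < a <= rho -> 0 < b <= rho -> measurable (strip p n a b).
Hypothesis strip_lb : forall p n a b, 0 < a <= rho -> 0 < b <= rho -> cl n a b <= mr (strip p n a b).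
Hypothesis cl0 : forall n a b, 0 < a -> 0 < b -> 0 < cl n a b.
Hypothesis strip_sub : forall p n a b z, 0 < a <= rho -> 0 < b <= rho -> strip p n a b z ->
  (exists2 v : V, `|v| <= Num.max a (2 ^- n * b) & z = psi p v) /\
  (exists2 v : V, `|v| <= Num.max (2 ^- n * a) b & iter n g z = psi (iter n g p) v).
Hypothesis strip_meet : forall p p' n a b, 0 < a -> 0 < b -> 2 ^- n * a <= b -> 2 ^- n * b <= a ->
  (1 + Lc) * a <= rho -> (1 + Lc) * b <= rho -> a <= r2 -> b <= r2 ->
  strip p n a b `&` strip p' n a b !=set0 -> strip p n ((1 + Lc) * a) ((1 + Lc) * b) p'.
Hypothesis strip_dbl : forall p n a b, 0 < a -> 0 < b -> (1 + Lc) * a <= rho -> (1 + Lc) * b <= rho ->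
  mr (strip p n ((1 + Lc) * a) ((1 + Lc) * b)) <= Kv * mr (strip p n a b).
Hypothesis strip_cross : forall p q n e rho1 dl, (0 < n)%N -> 0 < e -> 0 < rho1 -> e <= rho1 -> 0 < dl ->
  5 * Lc * rho1 <= dl -> dl <= rho -> dl <= r2 -> 2 ^- n * dl <= e ->
  (exists2 v : V, `|v| <= rho1 & iter n g p = psi q v) ->
  measurable (iter n g @^-1` strip q n dl e : set (borel T)) ->
  mr (strip p n e dl) * mr (strip q n dl e) <= Kc dl * mr (strip p n e dl `&` iter n g @^-1` strip q n dl e).

Let mrE E : measurable E -> m E = (mr E)%:E.
Proof. by move=> mE; rewrite fineK// fin_num_measure. Qed.

Let mr0 (E : set (borel T)) : 0 <= mr E. Proof. by rewrite fine_ge0. Qed.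

Let mr_le (E F : set (borel T)) : measurable E -> measurable F -> E `<=` F -> mr E <= mr F.
Proof. by move=> mE mF EF; rewrite -lee_fin -!mrE//; apply: le_measure; rewrite ?inE. Qed.

Let mrU (E F : set (borel T)) : measurable E -> measurable F -> mr (E `|` F) <= mr E + mr F.
Proof.
move=> mE mF; rewrite -lee_fin EFinD -!mrE//; last exact: measurableU.
exact: measureU2.
Qed.

Let iter_cont n : continuous (iter n g).
Proof.
elim: n => [|n IH] x; first exact: cvg_id.
by apply: (@continuous_comp _ _ _ (iter n g) g); [exact: IH|exact: g_cont].
Qed.

Let iter_meas n (E : set (borel T)) : measurable E -> measurable (iter n g @^-1` E : set (borel T)).
Proof. by move=> mE; apply: borel_preimage => //; exact: iter_cont. Qed.

Let iter_pres n (E : set (borel T)) : measurable E -> m (iter n g @^-1` E) = m E.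
Proof.
elim: n E => [|n IH] E mE //.
have -> : iter n.+1 g @^-1` E = iter n g @^-1` (g @^-1` E) by [].
by rewrite IH ?g_pres//; exact: (iter_meas 1).
Qed.

(** The coordinates [psi] act as a metric: an open set is exhausted by the closures of the sets of
    points whose [psi]-ball of radius 1/(n+1) stays inside. *)
Let open_regular (O : set (borel T)) : open (O : set T) -> regular m O.
Proof.
move=> oO eta eta0.
pose K n : set T := [set p | forall v : V, `|v| <= n.+1%:R^-1 -> O (psi p v)].
have clK n : closure (K n) `<=` O.
  move=> p pK; have n0 : 0 < n.+1%:R^-1 :> R by rewrite invr_gt0.
  have [U [oU Up] hU] := psi_near p n0.
  have [x [Kx Ux]] := pK U (open_nbhs_nbhs (conj oU Up)).
  by have [v v1 ->] := hU x p Ux Up; exact: Kx.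
have mK n : measurable (closure (K n) : set (borel T)) by apply: borel_closed; exact: closed_closure.
have KO : \bigcup_n closure (K n) = O.
  apply/seteqP; split => [x [n _]|x Ox]; first exact: clK.
  have [e e0 /nbhs_singleton he] := psi_small oO Ox.
  exists (Num.truncn e^-1) => //; apply: subset_closure => v v1; apply: he.
  apply: le_trans v1 _; rewrite -[leRHS]invrK lef_pV2 ?posrE ?invr_gt0//.
  by apply/ltW; exact: truncnS_gt.
have ndK : nondecreasing_seq (fun n => closure (K n) : set (borel T)).
  apply/nondecreasing_seqP => n; apply/subsetPset; apply: closureS => p Kp v v1; apply: Kp.
  by apply: le_trans v1 _; rewrite lef_pV2 ?posrE// ler_nat.
have mO : measurable O by exact: borel_open.
have cv : m \o (fun n => closure (K n) : set (borel T)) @ \oo --> m O.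
  have -> : m O = m (\bigcup_n closure (K n) : set (borel T)) by rewrite KO.
  by apply: nondecreasing_cvg_mu => //; rewrite KO.
have : \forall n \near \oo, (m O - eta%:E < (m (closure (K n) : set (borel T))))%E.
  apply: (cv [set z | (m O - eta%:E < z)%E]); apply: open_nbhs_nbhs; split; first exact: open_ereal_gt_ereal.
  by rewrite /= (mrE mO) -EFinB lte_fin; lra.
move=> [n _ /(_ n (leqnn n)) h].
exists (closure (K n)), O; split; [exact: closed_closure|exact: oO|exact: clK|by []|].
have -> : (m (O `\` closure (K n)) = m O - m (closure (K n) : set (borel T)))%E.
  rewrite measureD//; last exact: le_lt_trans (probability_le1 _ mO) (ltry _).
  by rewrite setIidr//; exact: clK.
move: h; rewrite (mrE mO) (mrE (mK n)) -!EFinB lte_fin lee_fin; lra.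
Qed.

Let regular_meas (A : set (borel T)) : measurable A -> regular m A.
Proof. by move=> mA; apply: borel_regular => //; exact: open_regular. Qed.

Let unif_small (K O : set T) : closed K -> open O -> K `<=` O ->
  exists2 e : R, 0 < e & forall p (v : V), K p -> `|v| <= e -> O (psi p v).
Proof.
move=> cK oO KO.
have coK : compact K by exact: (subclosed_compact cK cT).
move/compact_near_coveringP: coK => ncK.
have := ncK nat \oo (fun n p => forall v : V, `|v| <= n.+1%:R^-1 -> O (psi p v)) _.
have h : forall x, K x -> \forall x' \near x & i \near \oo, forall v : V, `|v| <= i.+1%:R^-1 -> O (psi x' v).
  move=> x Kx; have [e e0 he] := psi_small oO (KO _ Kx).
  exists ([set p | forall v : V, `|v| <= e -> O (psi p v)], [set n | (Num.truncn e^-1 <= n)%N]).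
    by split => //=; exists (Num.truncn e^-1).
  move=> [p n] /= [hp hn] v v1; apply: hp; apply: le_trans v1 _.
  rewrite -[leRHS]invrK lef_pV2 ?posrE ?invr_gt0//.
  by apply: le_trans (ltW (truncnS_gt _)) _; rewrite ler_nat.
move=> /(_ _)/(_ h)[n _ /(_ n (leqnn n)) hn]; exists n.+1%:R^-1; first by rewrite invr_gt0.
by move=> p v Kp v1; exact: hn.
Qed.

(** Take a maximal disjoint family. Every point of X lies in a member enlarged by 1 + Lc, and the
    enlargement costs only the factor Kv. The lower bound [cl] may degenerate with n, as it only
    makes the family finite. *)
Lemma strip_cover n a b (X : set (borel T)) : 0 < a -> 0 < b -> 2 ^- n * a <= b -> 2 ^- n * b <= a ->
  (1 + Lc) * a <= rho -> (1 + Lc) * b <= rho -> a <= r2 -> b <= r2 -> measurable X ->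
  exists (k : nat) (f : 'I_k -> T), [/\ forall i, X (f i), trivIset setT (fun i => strip (f i) n a b) &
    mr X <= Kv * \sum_(i < k) mr (strip (f i) n a b)].
Proof.
move=> a0 b0 ab ba ar br a2 b2 mX.
have Lp : 0 < 1 + Lc by rewrite addr_gt0// (lt_le_trans ltr01).
have le1 c : 0 < c -> c <= (1 + Lc) * c.
  by move=> cc; apply: ler_peMl; [exact: ltW|rewrite lerDl (le_trans ler01)].
have ha : 0 < a <= rho by rewrite a0 (le_trans (le1 a a0)).
have hb : 0 < b <= rho by rewrite b0 (le_trans (le1 b b0)).
have ha' : 0 < (1 + Lc) * a <= rho by rewrite mulr_gt0.
have hb' : 0 < (1 + Lc) * b <= rho by rewrite mulr_gt0.
have [||k [f [Xf tf cov]]] := @finite_vitali _ (borel T) R m X (fun x => strip x n a b) _ (cl0 n a0 b0).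
- by move=> x _; exact: strip_meas.
- by move=> x _; rewrite (mrE (strip_meas _ _ ha hb)) lee_fin; exact: strip_lb.
exists k, f; split => //.
have h : (m X <= \sum_(i < k) m (strip (f i) n ((1 + Lc) * a) ((1 + Lc) * b)))%E.
  apply: measure_sub_fintype => // [i|x Xx]; first exact: strip_meas.
  have [i [z [z1 z2]]] := cov x Xx; exists i => //.
  by apply: strip_meet => //; exists z.
rewrite mulr_sumr -lee_fin -mrE//; apply: le_trans h _.
rewrite -sumEFin; apply: lee_sum => i _.
by rewrite (mrE (strip_meas _ _ ha' hb')) lee_fin; exact: strip_dbl.
Qed.

Lemma local_null (A : set (borel T)) (p0 : T) : measurable A -> g @^-1` A = A ->
  exists2 U : set (borel T), open (U : set T) /\ U p0 & m (A `&` U) = 0%E \/ m (~` A `&` U) = 0%E.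
Proof.
move=> mA gA; pose B := ~` A.
have mB : measurable B by exact: measurableC.
have gB : g @^-1` B = B by rewrite /B -[in RHS]gA.
have inv n (E : set (borel T)) : g @^-1` E = E -> iter n g @^-1` E = E.
  by move=> gE; elim: n => // n IH; rewrite -[RHS]IH -[in RHS]gE.
have Lp : 0 < 1 + Lc by rewrite addr_gt0// (lt_le_trans ltr01).
have L0 : 0 < Lc by exact: lt_le_trans ltr01 Lc1.
(* The large width is fixed before any approximation, since the crossing constant depends on it;
   only e and n will depend on eta. *)
pose dl := Num.min (rho / (1 + Lc)) r2.
have dl0 : 0 < dl by rewrite lt_min divr_gt0.
have dl_rho' : (1 + Lc) * dl <= rho by rewrite mulrC -ler_pdivlMr// ge_min lexx.
have dl_r2 : dl <= r2 by rewrite ge_min lexx orbT.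
have le1 c : 0 < c -> c <= (1 + Lc) * c.
  by move=> cc; apply: ler_peMl; [exact: ltW|rewrite lerDl (le_trans ler01)].
have dl_rho : dl <= rho by exact: le_trans (le1 _ dl0) dl_rho'.
pose rho1 := dl / (5 * Lc).
have rho10 : 0 < rho1 by rewrite divr_gt0// mulr_gt0.
have rho1_dl : 5 * Lc * rho1 <= dl by rewrite /rho1 mulrC mulfVK// gt_eqF// mulr_gt0.
have [U [oU Up0] hU] := psi_near p0 rho10.
exists U => //; apply: contrapT => nn.
have mU : measurable (U : set (borel T)) by exact: borel_open.
have pos (E : set (borel T)) : measurable E -> m E <> 0%E -> 0 < mr E.
  by move=> mE nE; rewrite lt_def mr0 andbT; apply/eqP => h; apply: nE; rewrite mrE// h.
have mAU : measurable (A `&` U : set (borel T)) by exact: measurableI.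
have mBU : measurable (B `&` U : set (borel T)) by exact: measurableI.
have al : 0 < mr (A `&` U) by apply: pos => // h; apply: nn; left.
have be : 0 < mr (B `&` U) by apply: pos => // h; apply: nn; right.
set al_ := mr (A `&` U) in al; set be_ := mr (B `&` U) in be.
have Kcd := Kc0 dl0.
(* The total measure of crossings that will be guaranteed: the product of the masses covered by the
   two families, divided by the crossing constant. Choosing eta <= c' / 4 contradicts the upper
   bound 2 * eta. *)
pose c' := (be_ / 2 / Kv) * (al_ / 2 / Kv) / Kc dl.
have c'0 : 0 < c' by rewrite /c' divr_gt0// mulr_gt0// !divr_gt0.
pose eta := Num.min (Num.min (al_ / 2) (be_ / 2)) (c' / 4).
have al2 : 0 < al_ / 2 by rewrite divr_gt0.
have be2 : 0 < be_ / 2 by rewrite divr_gt0.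
have eta0 : 0 < eta by rewrite !lt_min al2 be2 divr_gt0.
have eta1 : eta <= al_ / 2 by rewrite !ge_min lexx.
have eta2 : eta <= be_ / 2 by rewrite !ge_min lexx orbT.
have eta3 : eta <= c' / 4 by rewrite !ge_min lexx !orbT.
have [KA [OA [cKA oOA KAA AOA hA]]] := regular_meas mA eta0.
have [KB [OB [cKB oOB KBB BOB hB]]] := regular_meas mB eta0.
have [eA eA0 smA] := unif_small cKA oOA (subset_trans KAA AOA).
have [eB eB0 smB] := unif_small cKB oOB (subset_trans KBB BOB).
pose e := Num.min (Num.min eA eB) rho1.
have e0 : 0 < e by rewrite !lt_min eA0 eB0 rho10.
have eeA : e <= eA by rewrite !ge_min lexx.
have eeB : e <= eB by rewrite !ge_min lexx orbT.
have e_rho1 : e <= rho1 by rewrite !ge_min lexx !orbT.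
have rho1_le : rho1 <= dl.
  have : 0 <= (Lc - 1) * rho1 by rewrite mulr_ge0 ?subr_ge0// ltW.
  by move: rho1_dl rho10; lra.
have e_dl : e <= dl by exact: le_trans e_rho1 rho1_le.
(* After this many steps the width dl, contracted by 2^-n, is at most e: the strips of widths dl, e
   are e-thin at time n, those of widths e, dl at time 0. *)
have [n n0 ne] : exists2 n, (0 < n)%N & 2 ^- n * dl <= e.
  exists (Num.truncn (dl / e)).+1 => //.
  rewrite mulrC ler_pdivrMr ?exprn_gt0// mulrC -ler_pdivrMr//.
  apply: le_trans (ltW (truncnS_gt _)) _.
  by rewrite -natrX ler_nat ltnW// ltn_expl.
have i1 : 2 ^- n <= 1 :> R by rewrite invf_le1 ?exprn_gt0// exprn_ege1// ler1n.
have ne' : 2 ^- n * e <= dl by apply: le_trans e_dl; apply: ler_piMl => //; exact: ltW.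
have er : (1 + Lc) * e <= rho by apply: le_trans dl_rho'; rewrite ler_pM2l.
have e2 : e <= r2 by exact: le_trans dl_r2.
have mOA : measurable (OA : set (borel T)) by exact: borel_open.
have mOB : measurable (OB : set (borel T)) by exact: borel_open.
have mKA : measurable (KA : set (borel T)) by exact: borel_closed.
have mKB : measurable (KB : set (borel T)) by exact: borel_closed.
have he : 0 < e <= rho by rewrite e0 (le_trans e_dl).
have hd : 0 < dl <= rho by rewrite dl0.
pose XS : set (borel T) := U `&` iter n g @^-1` KA.
pose XQ : set (borel T) := KB `&` iter n g @^-1` U.
have mXS : measurable XS by apply: measurableI => //; exact: iter_meas.
have mXQ : measurable XQ by apply: measurableI => //; exact: iter_meas.
have hA' : mr (OA `\` KA) <= eta by rewrite -lee_fin -mrE//; exact: measurableD.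
have hB' : mr (OB `\` KB) <= eta by rewrite -lee_fin -mrE//; exact: measurableD.
have XS_ge : al_ / 2 <= mr XS.
  have : al_ <= mr XS + mr (OA `\` KA).
    have -> : mr (OA `\` KA) = mr (iter n g @^-1` (OA `\` KA)) by rewrite iter_pres//; exact: measurableD.
    have m1 : measurable (iter n g @^-1` (OA `\` KA) : set (borel T)) by apply: iter_meas; exact: measurableD.
    apply: le_trans (mrU mXS m1); apply: mr_le => //; first exact: measurableU.
    move=> x [Ax Ux]; have Ax' : A (iter n g x) by rewrite -[A (iter n g x)]/((iter n g @^-1` A) x) inv.
    case: (pselect (KA (iter n g x))) => h; [left|right]; split => //=; exact: AOA.
  by move: eta1 hA'; lra.
have XQ_ge : be_ / 2 <= mr XQ.
  have : be_ <= mr XQ + mr (OB `\` KB).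
    have -> : be_ = mr (iter n g @^-1` (B `&` U)) by rewrite /be_ iter_pres.
    apply: le_trans (mrU mXQ (measurableD mOB mKB)); apply: mr_le => //.
    - exact: iter_meas.
    - by apply: measurableU => //; exact: measurableD.
    move=> x [Bx Ux]; have Bx' : B x by rewrite -(inv n _ gB).
    case: (pselect (KB x)) => h; [left|right]; split => //=; exact: BOB.
  by move: eta2 hB'; lra.
have [ks [fs [Xfs tfs covS]]] := strip_cover dl0 e0 ne ne' dl_rho' er dl_r2 e2 mXS.
have [kq [fq [Xfq tfq covQ]]] := strip_cover e0 dl0 ne' ne er dl_rho' e2 dl_r2 mXQ.
have mS i : measurable (strip (fs i) n dl e) by exact: strip_meas.
have mQ i : measurable (strip (fq i) n e dl) by exact: strip_meas.
have mgS i : measurable (iter n g @^-1` strip (fs i) n dl e : set (borel T)) by exact: iter_meas.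
have SOA i x : strip (fs i) n dl e x -> OA (iter n g x).
  move=> /(strip_sub hd he)[_ [v v1 ->]]; apply: smA; first by have [] := Xfs i.
  by apply: le_trans v1 _; rewrite ge_max (le_trans ne).
have QOB i x : strip (fq i) n e dl x -> OB x.
  move=> /(strip_sub he hd)[[v v1 ->] _]; apply: smB; first by have [] := Xfq i.
  by apply: le_trans v1 _; rewrite ge_max (le_trans ne) ?andbT.
pose W (ij : 'I_kq * 'I_ks) : set (borel T) := strip (fq ij.1) n e dl `&` iter n g @^-1` strip (fs ij.2) n dl e.
have mW ij : measurable (W ij) by exact: measurableI.
have tW : trivIset setT W.
  move=> [i j] [i' j'] _ _ [z [[/= z1 z2] [/= z3 z4]]].
  have -> : i = i' by apply: (tfq i i' I I); exists z.
  by have -> : j = j' by apply: (tfs j j' I I); exists (iter n g z).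
(* A crossing point lies in OB and its image under g^2n in OA. If it is in KB, hence not in A, then
   by invariance its image is not in A, hence not in KA. *)
have WU : \bigcup_ij W ij `<=` (OB `\` KB) `|` iter n g @^-1` (iter n g @^-1` (OA `\` KA)).
  move=> x [[i j] _ [/= /QOB x1 /SOA x2]].
  case: (pselect (KB x)) => h; [right|by left].
  split => // /KAA hh; apply: (KBB _ h).
  by rewrite -(inv n _ gA) -(inv n _ gA).
have mDA : measurable (OA `\` KA : set (borel T)) by exact: measurableD.
have mDB : measurable (OB `\` KB : set (borel T)) by exact: measurableD.
have sumW : \sum_ij mr (W ij) <= 2 * eta.
  have : mr (\bigcup_ij W ij) <= 2 * eta.
    have mm : measurable (iter n g @^-1` (iter n g @^-1` (OA `\` KA)) : set (borel T)) by do 2 apply: iter_meas.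
    apply: (@le_trans _ _ (mr (OB `\` KB) + mr (iter n g @^-1` (iter n g @^-1` (OA `\` KA))))).
      apply: le_trans (mrU mDB mm); apply: mr_le => //.
        by apply: fin_bigcup_measurable => //; exact: finite_finset.
      exact: measurableU.
    rewrite iter_pres ?iter_pres//; last exact: iter_meas.
    by move: hA' hB'; lra.
  rewrite measure_bigcup_fintype// -sum_fine// => ij _; exact: fin_num_measure.
have : c' <= 2 * eta.
  apply: le_trans sumW; rewrite /c' ler_pdivrMr// mulr_suml.
  apply: (@le_trans _ _ ((\sum_(i < kq) mr (strip (fq i) n e dl)) * (\sum_(j < ks) mr (strip (fs j) n dl e)))).
    apply: ler_pM; rewrite ?divr_ge0 ?mr0//; try exact: ltW.
      by rewrite ler_pdivrMr// [leRHS]mulrC; exact: le_trans covQ.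
    by rewrite ler_pdivrMr// [leRHS]mulrC; exact: le_trans covS.
  (* Every pair of strips crosses: the n-th image of the centre of the first and the centre of the
     second both lie in U, so they are within rho1 in coordinates. *)
  rewrite big_distrlr/= pair_big/=; apply: ler_sum => -[i j] _; rewrite [leRHS]mulrC; apply: (strip_cross n0 e0 rho10) => //=.
  have [_ U1] := Xfq i; have [U2 _] := Xfs j; exact: hU.
by move: eta3 c'0; lra.
Qed.

(** An open set contains a small strip of length 0 around each of its points. *)
Lemma open_pos (U : set (borel T)) p : open (U : set T) -> U p -> m U <> 0%E.
Proof.
move=> oU Up; have [e e0 /nbhs_singleton he] := psi_small oU Up.
pose a := Num.min e rho; have a0 : 0 < a by rewrite lt_min e0.
have ha : 0 < a <= rho by rewrite a0 ge_min lexx orbT.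
have mS := strip_meas p 0 ha ha.
have : mr (strip p 0 a a) <= mr U.
  apply: mr_le => //; first exact: borel_open.
  move=> z /(strip_sub ha ha)[[v v1 ->] _]; apply: he; apply: le_trans v1 _.
  by rewrite expr0 invr1 mul1r maxxx ge_min lexx.
move=> h h0; have := lt_le_trans (cl0 0 a0 a0) (le_trans (strip_lb p 0 ha ha) h).
by rewrite h0 ltxx.
Qed.

(** The points near which A is null and those near which its complement is null form two open sets.
    They cover the space by [local_null] and are disjoint by [open_pos], so connectedness leaves one
    of them; compactness turns local nullity into global nullity. *)
Lemma strip_ergodic : ergodic m (g : borel T -> borel T).
Proof.
move=> A mA gA.
have mB : measurable (~` A) by exact: measurableC.
pose N (E : set (borel T)) : set T := [set p | exists2 U : set (borel T), open (U : set T) /\ U p & m (E `&` U) = 0%E].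
have oN E : open (N E).
  rewrite openE => p [U [oU Up] h]; rewrite /interior nbhsE; exists U => //.
  by move=> q Uq; exists U.
have cover p : N A p \/ N (~` A) p.
  by have [U oU [h|h]] := local_null p mA gA; [left|right]; exists U.
have mI (E U : set (borel T)) : measurable E -> open (U : set T) -> measurable (E `&` U).
  by move=> mE oU; apply: measurableI => //; exact: borel_open.
have disj p : N A p -> N (~` A) p -> False.
  move=> [U [oU Up] hU] [U' [oU' Up'] hU'].
  have oI : open (U `&` U' : set T) by exact: openI.
  apply: (@open_pos (U `&` U') p) => //; apply/eqP; rewrite -measure_le0.
  have sub : U `&` U' `<=` (A `&` U) `|` (~` A `&` U').
    by move=> x [x1 x2]; case: (pselect (A x)) => h; [left|right].
  have m1 := mI _ _ mA oU; have m2 := mI _ _ mB oU'.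
  apply: (@le_trans _ _ (m ((A `&` U) `|` (~` A `&` U')))).
    by apply: le_measure; rewrite ?inE//; [exact: borel_open|exact: measurableU].
  have h3 : (m ((A `&` U) `|` (~` A `&` U')) <= m (A `&` U) + m (~` A `&` U'))%E by exact: measureU2.
  by apply: le_trans h3 _; rewrite hU hU' adde0.
have full E : measurable E -> (forall p, N E p) -> m E = 0%E.
  move=> mE hN.
  have /choice[f fP] : forall p, exists U : set (borel T), [/\ open (U : set T), U p & m (E `&` U) = 0%E].
    by move=> p; have [U [oU Up] h] := hN p; exists U.
  have := cT; rewrite compact_cover => /(_ T setT f).
  case=> [p _|p _|D _ cov0]; first by have [] := fP p.
    by exists p => //; have [] := fP p.
  have [D' fD cov] : exists2 D', finite_set D' & setT `<=` classical_sets.cover D' f.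
    exact: (ex_intro2 _ _ _ (finite_fset D) cov0).
  apply/eqP; rewrite -measure_le0.
  have h : E `<=` \bigcup_(p in D') (E `&` f p).
    by move=> x Ex; have [p pD fx] := cov x I; exists p.
  have mf p : measurable (E `&` f p) by apply: mI => //; have [] := fP p.
  apply: le_trans (content_sub_fsum m fD _ _ h) _ => //.
  by rewrite fsbig1// => p _; have [] := fP p.
case: (pselect (N A !=set0)) => [ne|/forallNP nN].
  left; apply: full => // p.
  have -> // : N A = setT.
  apply: kT => //; exists (N A); rewrite ?setTI//.
  rewrite -[N A]setCK; apply: open_closedC.
  have -> : ~` N A = N (~` A); last exact: oN.
  apply/seteqP; split => q; first by move=> h; case: (cover q).
  by move=> h1 h2; exact: disj h2 h1.
right; have h : m (~` A) = 0%E by apply: full => // p; case: (cover p) => // h; case: (nN p).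
by rewrite -[A]setCK probability_setC// h sube0.
Qed.

End StripErgodicity.

(** * Crossing strips and the ergodicity criterion *)

Section GeomDistortion.
Variables (R : realType) (d s : nat).
Notation V := 'rV[R]_d.
Variable leb : {measure set (borel V) -> \bar R}.
Hypothesis hleb : is_lebesgue leb.
Notation kap := (kap leb).
Variables (C nu : R).
Hypotheses (C0 : 0 <= C) (nu0 : 0 <= nu) (nu1 : nu < 1).

(** The product of the factors 1 + 3 c_k is at most the exponential of 3 C times two geometric
    series, one from each end of the orbit segment. *)
Definition Kdist : R := expR (6 * C / (1 - nu)) ^+ d.

Lemma Kdist_gt0 : 0 < Kdist.
Proof. by rewrite exprn_gt0// expR_gt0. Qed.

Lemma Jm_geom_distortion (M M' : nat -> 'M[R]_d) n :
  (forall k, (k < n)%N -> hyp s (M k)) -> (forall k, (k < n)%N -> hyp s (M' k)) ->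
  (forall k, (k < n)%N -> opb (M' k - M k) (C * (nu ^+ k + nu ^+ (n - k.+1)))) ->
  kap (Jm s M' n) <= Kdist * kap (Jm s M n).
Proof.
move=> hM hM' Mc.
have c0 k : 0 <= C * (nu ^+ k + nu ^+ (n - k.+1)) by rewrite mulr_ge0// addr_ge0// exprn_ge0.
apply: le_trans (Jm_distortion hleb hM hM' c0 Mc) _.
rewrite ler_wpM2r ?kap_ge0// lerXn2r ?nnegrE ?expR_ge0 ?prodr_ge0//.
  by move=> k _; rewrite addr_ge0// mulr_ge0.
apply: (@le_trans _ _ (expR (\sum_(k < n) 3 * (C * (nu ^+ k + nu ^+ (n - k.+1)))))).
  rewrite expR_sum; apply: ler_prod => k _; apply/andP; split; last exact: expR_ge1Dx.
  by rewrite addr_ge0// mulr_ge0.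
rewrite ler_expR.
have sumk : \sum_(k < n) nu ^+ k <= (1 - nu)^-1.
  have p : 0 < 1 - nu by rewrite subr_gt0.
  have e : (1 - nu) * \sum_(k < n) nu ^+ k = 1 - nu ^+ n.
    by have := subrX1 nu n; rewrite -[1 - nu]opprB mulNr => <-; rewrite opprB.
  rewrite -[leRHS]mul1r ler_pdivlMr// mulrC e gerBl exprn_ge0//.
have sumk' : \sum_(k < n) nu ^+ (n - k.+1) <= (1 - nu)^-1.
  apply: le_trans sumk; rewrite (reindex_inj rev_ord_inj)/=; apply: ler_sum => k _.
  by have -> : (n - (n - k.+1).+1 = k)%N by have := ltn_ord k; lia.
rewrite -!mulr_sumr big_split/= [6](_ : _ = 3 * 2 :> R); last by lra.
rewrite -!mulrA ler_wpM2l// mulrCA ler_wpM2l//; lra.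
Qed.

End GeomDistortion.

Opaque Kdist.

Section Bx.
Variables (R : realType) (d s : nat).
Notation V := 'rV[R]_d.

Definition bx (a b : R) : V := \row_j (if (j < s)%N then a else b).

Lemma bxP (a b : R) (w : V) : 0 <= a -> 0 <= b ->
  Box (bx a b) w <-> `|w *m Ps R d s| <= a /\ `|w *m Qs R d s| <= b.
Proof.
move=> a0 b0; split=> [/BoxP h|[hP hQ]].
  split; apply: rV_norm_le => // j; have := h j; rewrite mxE ?PsE ?QsE; case: ifP => //; by rewrite normr0.
apply/BoxP => j; rewrite mxE; have := le_trans (rV_coord_le _ j) hP; have := le_trans (rV_coord_le _ j) hQ.
by rewrite PsE QsE; case: ifP.
Qed.

Lemma bxZ t (a b : R) : bx (t * a) (t * b) = t *: bx a b.
Proof. by apply/rowP => j; rewrite !mxE; case: ifP. Qed.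

(** In each coordinate a and b merely trade places. This cancels the small width e in the crossing
    estimate. *)
Lemma vb_bx (a b : R) : vb (bx a b) * vb (bx b a) = vb (bx a a) * vb (bx b b).
Proof.
rewrite /vb mulrACA [RHS]mulrACA; congr (_ * _); rewrite -!big_split/=; apply: eq_bigr => j _.
by rewrite !mxE; case: ifP => // _; rewrite mulrC.
Qed.

Lemma vb_bx_gt0 (a b : R) : 0 < a -> 0 < b -> 0 < vb (bx a b).
Proof. by move=> a0 b0; apply: vb_gt0 => j; rewrite mxE; case: ifP. Qed.

End Bx.

(** * Strips in adapted coordinates: distortion, engulfing, crossing *)

Section Strips.
Variables (R : realType) (d s : nat) (T : ptopologicalType).
Notation V := 'rV[R]_d.
Notation Ps := (@Ps R d s).
Notation Qs := (@Qs R d s).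
Variable leb : {measure set (borel V) -> \bar R}.
Hypothesis hleb : is_lebesgue leb.
Notation kap := (kap leb).
Variables (g : T -> T) (psi : T -> V -> T) (Fm : T -> T -> V -> V) (Mm : T -> T -> V -> 'M[R]_d).
Variables (r r0 rho L C nu Lc r2 : R).

(** One step of a pseudo-orbit: the image of p is visible in the coordinates at q within rho. All
    constants below are uniform over such pairs. *)
Definition nr p q := exists2 v : V, `|v| <= rho & g p = psi q v.

Hypothesis psi0 : forall p, psi p 0 = p.
Hypothesis psi_inj : forall p (v v' : V), `|v| <= r0 -> `|v'| <= r0 -> psi p v = psi p v' -> v = v'.
Hypothesis Fm_psi : forall p q y, nr p q -> `|y| <= r -> psi q (Fm p q y) = g (psi p y) /\ `|Fm p q y| <= r0.
Hypothesis Fm_hyp : forall p q, nr p q -> nhyp s r (Fm p q).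
Hypothesis Mm_hyp : forall p q y, nr p q -> `|y| <= r -> hyp s (Mm p q y).
Hypothesis Fm_lin : forall p q (y y' z : V), nr p q -> `|y| <= r -> `|y'| <= r -> `|z| <= r ->
  `|Fm p q y - Fm p q y' - (y - y') *m Mm p q z| <= `|y - y'|.
Hypothesis Fm_diff : forall eta : R, 0 < eta -> exists2 e : R, 0 < e &
  forall p q (y y' : V), nr p q -> `|y| <= r -> `|y'| <= r -> `|y - y'| <= e ->
  `|Fm p q y - Fm p q y' - (y - y') *m Mm p q y'| <= eta * `|y - y'|.
Hypothesis L0 : 0 <= L.
Hypothesis Mm_le : forall p q y, nr p q -> `|y| <= r -> opb (Mm p q y) L.
Hypothesis rho0 : 0 < rho.
Hypothesis rho_r : 5 * rho <= r.
Hypothesis r_r0 : r <= r0.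
Hypotheses (nu0 : 0 <= nu) (nu1 : nu < 1) (C2L : 2 * L <= C).
Hypothesis Mm_holder : forall p q (y y' : V) k, nr p q -> `|y| <= r -> `|y'| <= r -> `|y - y'| <= 2 ^- k * r ->
  opb (Mm p q y - Mm p q y') (C * nu ^+ k).
Hypothesis Lc1 : 1 <= Lc.
Hypothesis psi_change : forall p q (y y' v : V), `|y| <= r2 -> `|y'| <= r2 -> `|v| <= r2 -> psi p y = psi q y' ->
  exists v', psi q v = psi p v' /\ `|v' - y| <= Lc * `|v - y'|.

Let C0 : 0 <= C. Proof. by apply: le_trans C2L; rewrite mulr_ge0. Qed.
Let r_gt0 : 0 < r. Proof. by have := rho0; have := rho_r; lra. Qed.
Notation K := (Kdist d C nu).

Section PseudoOrbit.
Variables (x : nat -> T) (n : nat).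
Hypothesis xnr : forall k, (k < n)%N -> nr (x k) (x k.+1).

Definition Fx k := Fm (x k) (x k.+1).
Definition Mx k := Mm (x k) (x k.+1).
Notation ob := (orb Fx).
Notation gd := (good Fx n r).
Notation ps := (bdry s Fx n).
Notation jc := (jac s Fx Mx n).

Lemma Fx0 k : (k < n)%N -> `|Fx k 0| <= rho.
Proof.
move=> kn; have [v vr gv] := xnr kn; have z : `|0 : V| <= r by rewrite normr0 ltW.
have [h1 h2] := Fm_psi (xnr kn) z.
suff -> : Fx k 0 = v by [].
apply: (@psi_inj (x k.+1)) => //.
  by apply: le_trans vr _; have := rho_r; have := r_r0; have := rho0; lra.
by rewrite h1 psi0.
Qed.

Lemma orb_psi y k : gd y -> (k <= n)%N -> psi (x k) (ob y k) = iter k g (psi (x 0) y).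
Proof.
move=> gy; elim: k => // k IH kn; rewrite iterS -IH 1?ltnW//=.
by have [] := Fm_psi (xnr kn) (gy k (ltnW kn)).
Qed.

Lemma Fx_hyp k : (k < n)%N -> nhyp s r (Fx k). Proof. by move=> kn; exact: Fm_hyp (xnr kn). Qed.
Lemma Mx_hyp k y : (k < n)%N -> `|y| <= r -> hyp s (Mx k y). Proof. by move=> kn; exact: Mm_hyp (xnr kn). Qed.
Lemma Fx_lin k (y y' z : V) : (k < n)%N -> `|y| <= r -> `|y'| <= r -> `|z| <= r ->
  `|Fx k y - Fx k y' - (y - y') *m Mx k z| <= `|y - y'|.
Proof. by move=> kn; exact: Fm_lin (xnr kn). Qed.
Lemma Fx_diff (eta : R) : 0 < eta -> exists2 e : R, 0 < e &
  forall k (y y' : V), (k < n)%N -> `|y| <= r -> `|y'| <= r -> `|y - y'| <= e ->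
  `|Fx k y - Fx k y' - (y - y') *m Mx k y'| <= eta * `|y - y'|.
Proof. by move=> /Fm_diff[e e0 h]; exists e => // k y y' kn; exact: h (xnr kn). Qed.
Lemma Mx_le k y : (k < n)%N -> `|y| <= r -> opb (Mx k y) L. Proof. by move=> kn; exact: Mm_le (xnr kn). Qed.

Lemma orb_close y y' (c : R) k : gd y -> gd y' -> (k <= n)%N ->
  `|(y - y') *m Ps| <= c -> `|(ob y n - ob y' n) *m Qs| <= c ->
  `|ob y k - ob y' k| <= 2 ^- k * c \/ `|ob y k - ob y' k| <= 2 ^- (n - k) * c.
Proof.
move=> gy gy' kn h1 h2.
have hh : `|ob y k - ob y' k| <= Num.max (2 ^- k * c) (2 ^- (n - k) * c).
  apply: (@orbit_cone R d s Fx n r Fx_hyp) => //.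
    by rewrite le_max; apply/orP; left; rewrite ler_wpM2l// invr_ge0 exprn_ge0.
  by rewrite le_max; apply/orP; right; rewrite ler_wpM2l// invr_ge0 exprn_ge0.
by move: hh; rewrite le_max => /orP.
Qed.

(** The cone estimate gives closeness 2^-k or 2^-(n-k), and the Hoelder bound turns whichever holds
    into a power of nu. *)
Lemma Mx_close y y' (c : R) k : gd y -> gd y' -> (k < n)%N -> c <= r ->
  `|(y - y') *m Ps| <= c -> `|(ob y n - ob y' n) *m Qs| <= c ->
  opb (Mx k (ob y k) - Mx k (ob y' k)) (C * (nu ^+ k + nu ^+ (n - k))).
Proof.
move=> gy gy' kn cr h1 h2; have kn' := ltnW kn.
have [gk gk'] := (gy k kn', gy' k kn').
have h m : `|ob y k - ob y' k| <= 2 ^- m * c -> opb (Mx k (ob y k) - Mx k (ob y' k)) (C * nu ^+ m).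
  move=> h3; apply: Mm_holder (xnr kn) gk gk' _; apply: le_trans h3 _.
  by rewrite ler_wpM2l// invr_ge0 exprn_ge0.
case: (orb_close gy gy' kn' h1 h2) => /h; apply: opb_le; rewrite ler_wpM2l//.
  by rewrite lerDl exprn_ge0.
by rewrite lerDr exprn_ge0.
Qed.

Lemma jac_compare y y' : gd y -> gd y' -> `|ps y| <= rho -> `|ps y'| <= rho ->
  kap (jc y) <= K * kap (jc y').
Proof.
move=> gy gy' hy hy'; apply: Jm_geom_distortion => //.
- by move=> k kn; apply: Mx_hyp => //; exact/gy'/ltnW.
- by move=> k kn; apply: Mx_hyp => //; exact/gy/ltnW.
(* The exponent n - k is weakened to the n - k.+1 of [Jm_geom_distortion], which in [cross_jac]
   leaves room for a jump at the last step. *)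
move=> k kn; apply: (@opb_le _ _ _ _ (C * (nu ^+ k + nu ^+ (n - k)))).
  by rewrite ler_wpM2l// lerD2l; apply: ler_wiXn2l; rewrite ?leq_sub2l// ltW.
apply: (@Mx_close y y' (2 * rho)) => //; first by have := rho_r; have := rho0; lra.
  rewrite mulmxBl -(bdryP s Fx n y) -(bdryP s Fx n y') -mulmxBl (le_trans (Ps_le _ _))//.
  by rewrite (le_trans (ler_normB _ _))//; lra.
rewrite mulmxBl -(bdryQ s Fx n y) -(bdryQ s Fx n y') -mulmxBl (le_trans (Qs_le _ _))//.
by rewrite (le_trans (ler_normB _ _))//; lra.
Qed.

Definition Dx (a b : R) := Dset s Fx n r (bx d s a b).

Lemma Dx_compact a b : 0 < a <= rho -> 0 < b <= rho -> compact (Dx a b : set V).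
Proof.
move=> /andP[a0 ar] /andP[b0 br].
apply: (Dset_compact Fx_hyp Mx_hyp Fx_lin Fx0) => // i.
by rewrite mxE; case: ifP.
Qed.

Lemma Dx_vol y a b : 0 < a <= rho -> 0 < b <= rho -> gd y -> `|ps y| <= rho ->
  (((4 ^+ d * K * kap (jc y))^-1 * vb (bx d s a b))%:E <= leb (Dx a b))%E /\
  (leb (Dx a b) <= (2 ^+ d * (K / kap (jc y)) * vb (bx d s a b))%:E)%E.
Proof.
move=> /andP[a0 ar] /andP[b0 br] gy hy.
have K0 : 0 < K by exact: Kdist_gt0.
have J0 : 0 < kap (jc y).
  by apply: kap_gt0 => //; apply: Jm_unit => k kn; apply: Mx_hyp => //; exact/gy/ltnW.
have jJ z : gd z -> `|ps z| <= rho -> kap (jc y) <= K * kap (jc z) /\ kap (jc z) <= K * kap (jc y).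
  by move=> gz hz; split; exact: jac_compare.
have lr i : 0 < bx d s a b 0 i <= rho by rewrite mxE; case: ifP => _; apply/andP.
split.
  exact: (vol_lower hleb Fx_hyp Mx_hyp Fx_lin Fx_diff L0 Mx_le Fx0 rho0 rho_r K0 J0 jJ lr).
exact: (vol_upper hleb Fx_hyp Mx_hyp Fx_lin Fx_diff L0 Mx_le Fx0 rho0 rho_r J0 jJ lr).
Qed.

Lemma DxP a b y : 0 <= a -> 0 <= b ->
  Dx a b y <-> [/\ gd y, `|y *m Ps| <= a & `|ob y n *m Qs| <= b].
Proof.
move=> a0 b0; rewrite /Dx /Dset /= bxP// bdryP bdryQ.
by split=> [[? [? ?]]|[? ? ?]].
Qed.

Lemma Dx_small y a b c k : gd y -> (k <= n)%N -> `|y *m Ps| <= a -> `|ob y n *m Qs| <= b ->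
  (forall k, (k < n)%N -> Fx k 0 = 0) -> 2 ^- k * a <= c -> 2 ^- (n - k) * b <= c ->
  `|ob y k| <= c.
Proof.
move=> gy kn h1 h2 F00 ac bc.
have ob0 j : (j <= n)%N -> ob 0 j = 0.
  by elim: j => // j IH jn; rewrite /= IH ?F00// ltnW.
have g0 : gd 0 by move=> j jn; rewrite ob0// normr0 ltW.
rewrite -(subr0 (ob y k)) -(ob0 k kn).
apply: (@orbit_cone R d s Fx n r Fx_hyp) => //.
  by apply: le_trans ac; rewrite ler_wpM2l ?invr_ge0 ?exprn_ge0//= subr0.
by apply: le_trans bc; rewrite ler_wpM2l ?invr_ge0 ?exprn_ge0//= ob0// subr0.
Qed.

(** By uniqueness y is the orbit produced by Perron's method, whose size is known; the a priori
    bound r thus improves to 4 c. *)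
Lemma Dx_rho y c k : gd y -> (k <= n)%N -> 0 < c -> 5 * c <= r -> (forall k, (k < n)%N -> `|Fx k 0| <= c) ->
  `|y *m Ps| <= c -> `|ob y n *m Qs| <= c -> `|ob y k| <= 4 * c.
Proof.
move=> gy kn c0 cr Fc h1 h2; have hy : `|ps y| <= c by apply: (@PQ_norm R d s); rewrite ?bdryP ?bdryQ.
have [e1 e2] := bsolP Fx_hyp Mx_hyp Fx_lin Fc c0 cr hy.
have := bsolK Fx_hyp Mx_hyp Fx_lin Fc c0 cr gy hy => e3.
by rewrite -e3; exact: e2.
Qed.

End PseudoOrbit.

Definition orbx (p : T) k := iter k g p.

Lemma nr_orbx p k : nr (orbx p k) (orbx p k.+1).
Proof. by exists 0; rewrite ?normr0 ?ltW// psi0. Qed.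

Lemma Fx_orbx0 p k : Fx (orbx p) k 0 = 0.
Proof.
have z : `|0 : V| <= r by rewrite normr0 ltW.
have [h1 h2] := Fm_psi (nr_orbx p k) z; apply: (@psi_inj (orbx p k.+1)) => //.
  by rewrite normr0 (le_trans _ r_r0)// ltW.
by rewrite h1 !psi0.
Qed.

Definition strip p n a b : set (borel T) := psi p @` Dx (orbx p) n a b.
Definition Jac p n : R := kap (jac s (Fx (orbx p)) (Mx (orbx p)) n 0).

Lemma good0 p n : good (Fx (orbx p)) n r 0.
Proof.
move=> k kn; have -> : orb (Fx (orbx p)) 0 k = 0 by elim: k kn => // k IH kn /=; rewrite IH ?Fx_orbx0// ltnW.
by rewrite normr0 ltW.
Qed.

Lemma Jac_gt0 p n : 0 < Jac p n.
Proof.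
apply: kap_gt0 => //; apply: Jm_unit => k kn; apply: (@Mx_hyp _ n) => //; last exact/good0/ltnW.
by move=> *; exact: nr_orbx.
Qed.

Lemma strip_vol p n a b : 0 < a <= rho -> 0 < b <= rho ->
  (((4 ^+ d * K * Jac p n)^-1 * vb (bx d s a b))%:E <= leb (Dx (orbx p) n a b))%E /\
  (leb (Dx (orbx p) n a b) <= (2 ^+ d * (K / Jac p n) * vb (bx d s a b))%:E)%E.
Proof.
move=> ha hb; apply: Dx_vol => //.
- by move=> *; exact: nr_orbx.
- exact: good0.
- have e : orb (Fx (orbx p)) 0 n = 0 by elim: n => // k IH /=; rewrite IH Fx_orbx0.
  by apply: (@PQ_norm R d s); rewrite ?bdryP ?bdryQ ?e mul0mx normr0 ltW.
Qed.

Section Vitali.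
Variables (p p' : T) (n : nat) (a b : R).
Hypotheses (a0 : 0 < a) (b0 : 0 < b) (ab : 2 ^- n * a <= b) (ba : 2 ^- n * b <= a).
Hypotheses (ar : (1 + Lc) * a <= rho) (br : (1 + Lc) * b <= rho) (a2 : a <= r2) (b2 : b <= r2).

(** The orbit of p' is written in the coordinates u k along the orbit of p. At the common point z
    the two coordinate systems are related by [psi_change], so u k differs from the coordinate of z
    by at most Lc times its coordinate at p'. Being small at all times, u is an orbit of the
    coordinate maps, with end data enlarged by at most 1 + Lc. *)
Lemma strip_vitali : strip p n a b `&` strip p' n a b !=set0 -> strip p n ((1 + Lc) * a) ((1 + Lc) * b) p'.
Proof.
move=> [z [[y yD zy] [y' yD' zy']]].
have [a0' b0'] := (ltW a0, ltW b0).
have [gy y1 y2] := (DxP (orbx p) n y a0' b0').1 yD.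
have [gy' y1' y2'] := (DxP (orbx p') n y' a0' b0').1 yD'.
have i1 m : 2 ^- m <= 1 :> R by rewrite invf_le1 ?exprn_gt0// exprn_ege1// ler1n.
have c_le (c : R) m : 0 <= c -> 2 ^- m * c <= c by move=> c0; rewrite ler_piMl.
have ym k : (k <= n)%N -> `|orb (Fx (orbx p)) y k| <= Num.max a b.
  move=> kn; apply: (@Dx_small (orbx p) n _ y a b) => //; try by move=> *; exact: nr_orbx.
  - by move=> *; exact: Fx_orbx0.
  - by rewrite le_max c_le.
  - by rewrite le_max c_le ?orbT.
have ym' k : (k <= n)%N -> `|orb (Fx (orbx p')) y' k| <= Num.max a b.
  move=> kn; apply: (@Dx_small (orbx p') n _ y' a b) => //; try by move=> *; exact: nr_orbx.
  - by move=> *; exact: Fx_orbx0.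
  - by rewrite le_max c_le.
  - by rewrite le_max c_le ?orbT.
have y0' : `|y'| <= a.
  apply: (@Dx_small (orbx p') n _ y' a b a 0) => //; try by move=> *; exact: nr_orbx.
  - by move=> *; exact: Fx_orbx0.
  - exact: c_le.
  - by rewrite subn0.
have yn' : `|orb (Fx (orbx p')) y' n| <= b.
  apply: (@Dx_small (orbx p') n _ y' a b b n) => //; try by move=> *; exact: nr_orbx.
  - by move=> *; exact: Fx_orbx0.
  - by rewrite subnn c_le.
have m2 : Num.max a b <= r2 by rewrite ge_max a2.
have r20 : 0 <= r2 by apply: le_trans a2.
have nrp q k : (k < n)%N -> nr (orbx q k) (orbx q k.+1) by move=> _; exact: nr_orbx.
have zk k : (k <= n)%N -> psi (orbx p k) (orb (Fx (orbx p)) y k) = psi (orbx p' k) (orb (Fx (orbx p')) y' k).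
  move=> kn; rewrite (orb_psi (nrp p) gy kn) (orb_psi (nrp p') gy' kn).
  by rewrite /orbx /= zy zy'.
have hu k : exists u : V, (k <= n)%N -> orbx p' k = psi (orbx p k) u /\
    `|u - orb (Fx (orbx p)) y k| <= Lc * `|orb (Fx (orbx p')) y' k|.
  case: (leqP k n) => kn; last by exists 0.
  have [|||u [u1 u2]] := @psi_change _ _ _ _ 0 _ _ _ (zk k kn).
  - exact: le_trans (ym k kn) m2.
  - exact: le_trans (ym' k kn) m2.
  - by rewrite normr0.
  by exists u => _; rewrite -u1 psi0; split => //; move: u2; rewrite sub0r normrN.
have [u uP] := choice hu.
have ur k : (k <= n)%N -> `|u k| <= rho.
  move=> kn; have [_ h] := uP k kn; rewrite -(subrK (orb (Fx (orbx p)) y k) (u k)).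
  rewrite (le_trans (ler_normD _ _))//; have h1 := ym k kn; have h2 := ym' k kn.
  have : (1 + Lc) * Num.max a b <= rho by rewrite maxr_pMr ?ge_max ?ar// addr_ge0// (le_trans ler01).
  have : Lc * `|orb (Fx (orbx p')) y' k| <= Lc * Num.max a b by rewrite ler_wpM2l// (le_trans ler01).
  by move=> ? ?; lra.
have rr : rho <= r by have := rho_r; have := rho0; lra.
have uo k : (k <= n)%N -> u k = orb (Fx (orbx p)) (u 0) k.
  elim: k => // k IH kn; rewrite /= -IH 1?ltnW//.
  have ukr := le_trans (ur k (ltnW kn)) rr.
  have [f1 f2] := Fm_psi (nr_orbx p k) ukr.
  apply: (@psi_inj (orbx p k.+1)) => //; first by apply: le_trans (ur k.+1 kn) _; exact: le_trans rr r_r0.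
  have [e1 _] := uP k.+1 kn; have [e2 _] := uP k (ltnW kn).
  by rewrite -e1 /Fx f1 -e2.
have [u0e u0h] := uP 0 (leq0n _); have [_ unh] := uP n (leqnn _).
exists (u 0); last by rewrite -u0e.
have L0' : 0 <= 1 + Lc by rewrite addr_ge0// (le_trans ler01).
apply/DxP; [by rewrite mulr_ge0|by rewrite mulr_ge0|split].
- by move=> k kn; rewrite -uo//; exact: le_trans (ur k kn) rr.
- rewrite -(subrK y (u 0)) mulmxDl (le_trans (ler_normD _ _))// mulrDl mul1r addrC lerD//.
  apply: le_trans (Ps_le _ _) _; apply: le_trans u0h _; rewrite ler_wpM2l// (le_trans ler01)//.
- rewrite -uo// -(subrK (orb (Fx (orbx p)) y n) (u n)) mulmxDl (le_trans (ler_normD _ _))// mulrDl mul1r addrC lerD//.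
  apply: le_trans (Qs_le _ _) _; apply: le_trans unh _; rewrite ler_wpM2l// (le_trans ler01)//.
Qed.

End Vitali.

(* Only a pseudo-orbit, as [q] is merely close to g^n p. *)
Section Cross.
Variables (p q : T) (n : nat) (e rho1 dl : R).
Hypothesis n0 : (0 < n)%N.
Hypotheses (e0 : 0 < e) (rho10 : 0 < rho1) (e1 : e <= rho1) (dl0 : 0 < dl).
Hypotheses (rho1_dl : 5 * Lc * rho1 <= dl) (dl_rho : dl <= rho) (dl_r2 : dl <= r2).
Hypothesis pq : exists2 v : V, `|v| <= rho1 & iter n g p = psi q v.

(** At time n the value is already q, so the only jump occurs in the step from time n - 1 to time
    n. *)
Definition cat_orb k := if (k < n)%N then orbx p k else orbx q (k - n).

Let rho1_rho : 5 * rho1 <= rho.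
Proof.
have : 0 <= (Lc - 1) * rho1 by rewrite mulr_ge0 ?subr_ge0// ltW.
by have := dl_rho; have := rho1_dl; lra.
Qed.

Lemma cat_lt k : (k < n)%N -> cat_orb k = orbx p k.
Proof. by rewrite /cat_orb => ->. Qed.

Lemma cat_ge k : cat_orb (n + k) = orbx q k.
Proof. by rewrite /cat_orb ltnNge leq_addr/= addKn. Qed.

Lemma cat_n : cat_orb n = q.
Proof. by rewrite -[n]addn0 cat_ge. Qed.

Lemma cat_cases k : [\/ (k.+1 < n)%N, k.+1 = n | exists j, k = (n + j)%N].
Proof.
case: (ltngtP k.+1 n) => kn; [exact: Or31| |exact: Or32].
by apply: Or33; exists (k - n)%N; rewrite subnKC.
Qed.

Lemma cat_nr k : nr (cat_orb k) (cat_orb k.+1).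
Proof.
have [kn|kn|[j ->]] := cat_cases k.
- by rewrite !cat_lt// 1?ltnW//; exact: nr_orbx.
- rewrite kn cat_n cat_lt -?kn//; have [v vr h] := pq; exists v; last by rewrite -[RHS]h -kn.
  by apply: le_trans vr _; have := rho1_rho; have := rho10; lra.
- by rewrite -addnS !cat_ge; exact: nr_orbx.
Qed.

Let cn (k : nat) (_ : (k < n + n)%N) := cat_nr k.

Lemma Fx_cat_lt k : (k.+1 < n)%N -> Fx cat_orb k = Fx (orbx p) k.
Proof. by move=> kn; rewrite /Fx !cat_lt// ltnW. Qed.

Lemma Fx_cat_ge k : Fx cat_orb (n + k) = Fx (orbx q) k.
Proof. by rewrite /Fx -addnS !cat_ge. Qed.

Lemma Mx_cat_lt k : (k.+1 < n)%N -> Mx cat_orb k = Mx (orbx p) k.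
Proof. by move=> kn; rewrite /Mx !cat_lt// ltnW. Qed.

Lemma Mx_cat_ge k : Mx cat_orb (n + k) = Mx (orbx q) k.
Proof. by rewrite /Mx -addnS !cat_ge. Qed.

Lemma cat_F0 k : `|Fx cat_orb k 0| <= rho1.
Proof.
have z : `|0 : V| <= r by rewrite normr0 ltW.
have [kn|kn|[j ->]] := cat_cases k.
- by rewrite Fx_cat_lt// Fx_orbx0 normr0 ltW.
- have [v vr h] := pq; have [h1 h2] := Fm_psi (cat_nr k) z.
  suff -> : Fx cat_orb k 0 = v by [].
  apply: (@psi_inj (cat_orb k.+1)) => //.
    by apply: le_trans vr _; have := rho1_rho; have := rho10; have := rho_r; have := r_r0; lra.
  rewrite /Fx h1 psi0 cat_lt -?kn// -[k.+1]addn0 {1}kn cat_ge -[RHS]h -kn //.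
- by rewrite Fx_cat_ge Fx_orbx0 normr0 ltW.
Qed.

Lemma cat_ob_lt y k : (k < n)%N -> orb (Fx cat_orb) y k = orb (Fx (orbx p)) y k.
Proof. by elim: k => // k IH kn; rewrite /= IH 1?ltnW// Fx_cat_lt. Qed.

Lemma cat_ob_ge y k : orb (Fx cat_orb) y (n + k) = orb (Fx (orbx q)) (orb (Fx cat_orb) y n) k.
Proof. by elim: k => [|k IH]; rewrite ?addn0// addnS /= IH Fx_cat_ge. Qed.

Section CrossPoint.
Variable y : V.
Hypothesis yD : Dx cat_orb (n + n) e e y.

Let yP := (DxP cat_orb (n + n) y (ltW e0) (ltW e0)).1 yD.

Lemma cross_small k : (k <= n + n)%N -> `|orb (Fx cat_orb) y k| <= 4 * rho1.
Proof.
move=> kn; have [gy h1 h2] := yP.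
apply: (@Dx_rho cat_orb (n + n)%N cn y rho1 k) => //.
- by have := rho1_rho; have := rho_r; have := rho0; lra.
- by move=> *; exact: cat_F0.
- exact: le_trans h1 e1.
- exact: le_trans h2 e1.
Qed.

Lemma cross_future : Dx (orbx q) n dl e (orb (Fx cat_orb) y n).
Proof.
have [gy h1 h2] := yP; apply/DxP; [exact: ltW|exact: ltW|split].
- by move=> k kn; rewrite -cat_ob_ge; apply: gy; rewrite leq_add2l.
- apply: le_trans (Ps_le _ _) _; apply: le_trans (cross_small (leq_addr _ _)) _.
  have : 0 <= (Lc - 1) * rho1 by rewrite mulr_ge0 ?subr_ge0// ltW.
  by have := rho1_dl; have := rho10; lra.
- by rewrite -cat_ob_ge.
Qed.

Lemma cross_past : Dx (orbx p) n e dl y.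
Proof.
have [gy h1 h2] := yP.
have [m mn] : exists m, n = m.+1 by exists n.-1; rewrite prednK.
have zn : psi (orbx p n) 0 = psi (cat_orb n) 0 -> True by [].
have gyn k : (k < n)%N -> `|orb (Fx (orbx p)) y k| <= r.
  by move=> kn; rewrite -cat_ob_lt//; apply: gy; apply: leq_trans (ltnW kn) (leq_addr _ _).
have [v vr h] := pq.
have r20 : 0 <= r2 by apply: le_trans dl_r2; rewrite ltW.
have Lr : 0 <= (Lc - 1) * rho1 by rewrite mulr_ge0 ?subr_ge0// ltW.
have c1 : psi (orbx p n) 0 = psi q v by rewrite psi0.
have [||| v' [v1 v2]] := psi_change (v := orb (Fx cat_orb) y n) _ _ _ c1.
- by rewrite normr0.
- by apply: le_trans vr _; have := rho1_dl; have := dl_r2; lra.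
- apply: le_trans (cross_small (leq_addr _ _)) _; have := rho1_dl; have := dl_r2; lra.
(* The coordinates at q are exchanged for those at g^n p: the point is within 4 rho1 and g^n p
   within rho1 of q, and the change costs Lc. This is the origin of 5 * Lc * rho1 <= dl. *)
have v'dl : `|v'| <= dl.
  move: v2; rewrite subr0 => /le_trans; apply; apply: (@le_trans _ _ (Lc * (4 * rho1 + rho1))).
    rewrite ler_wpM2l ?(le_trans ler01)//.
    by rewrite (le_trans (ler_normB _ _))// lerD// (cross_small (leq_addr _ _)).
  by have := rho1_dl; lra.
have vE : orb (Fx (orbx p)) y n = v'.
  have rr : rho <= r by have := rho_r; have := rho0; lra.
  have mlt : (m < n)%N by rewrite mn.
  rewrite {1}mn /=; have [f1 f2] := Fm_psi (nr_orbx p m) (gyn m mlt).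
  apply: (@psi_inj (orbx p m.+1)) => //.
    by apply: le_trans v'dl _; apply: le_trans dl_rho _; exact: le_trans rr r_r0.
  rewrite /Fx f1 -mn -v1 -[q]/(orbx q 0) -(cat_ge 0) addn0.
  rewrite (orb_psi cn gy (leq_addr _ _)) -cat_ob_lt//.
  have := orb_psi cn gy (leq_trans (ltnW mlt) (leq_addr _ _)).
  by rewrite (cat_lt mlt) => ->; rewrite -iterS -mn.
apply/DxP; [exact: ltW|exact: ltW|split] => //.
- move=> k; rewrite leq_eqVlt => /orP[/eqP ->|]; last exact: gyn.
  by rewrite vE; apply: le_trans v'dl _; have := dl_rho; have := rho_r; have := rho0; lra.
- by rewrite vE; exact: le_trans (Qs_le _ _) v'dl.
Qed.

Lemma cross_iter : iter n g (psi p y) = psi q (orb (Fx cat_orb) y n).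
Proof.
have [gy _ _] := yP; have := orb_psi cn gy (leq_addr n n).
have -> : cat_orb n = q by rewrite -[n]addn0 cat_ge.
by rewrite cat_lt.
Qed.

End CrossPoint.

Lemma cross_sub : psi p @` Dx cat_orb (n + n) e e `<=` strip p n e dl `&` (iter n g @^-1` strip q n dl e).
Proof.
move=> _ [y yD <-]; split; first by exists y => //; exact: cross_past.
by rewrite /= cross_iter//; exists (orb (Fx cat_orb) y n) => //; exact: cross_future.
Qed.

Let rho1_r : 5 * rho1 <= r.
Proof. by have := rho1_rho; have := rho_r; have := rho0; lra. Qed.

(** [Jm_concat] separates the two halves, and the distortion bound compares each half with the true
    orbit of p or q. *)
Lemma cross_jac y : good (Fx cat_orb) (n + n) r y -> (forall k, (k <= n + n)%N -> `|orb (Fx cat_orb) y k| <= 4 * rho1) ->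
  kap (jac s (Fx cat_orb) (Mx cat_orb) (n + n) y) <= (9 / 4) ^+ d * (K * Jac p n * (K * Jac q n)).
Proof.
move=> gy ysm.
have hM k : (k < n + n)%N -> hyp s (Mx cat_orb k (orb (Fx cat_orb) y k)).
  by move=> kn; apply: (Mx_hyp cn kn); exact/gy/ltnW.
apply: le_trans (Jm_concat hleb hM) _; rewrite ler_wpM2l ?exprn_ge0//.
have [m mn] : exists m, n = m.+1 by exists n.-1; rewrite prednK.
have mlt : (m < n)%N by rewrite mn.
have nrp k : nr (orbx p k) (orbx p k.+1) by exact: nr_orbx.
have nrq k : nr (orbx q k) (orbx q k.+1) by exact: nr_orbx.
have ob0 k : orb (Fx (orbx p)) 0 k = 0 by elim: k => // k IH /=; rewrite IH Fx_orbx0.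
have r40 : 4 * rho1 <= r by have := rho1_r; have := rho10; lra.
apply: ler_pM; rewrite ?kap_ge0//.
  apply: Jm_geom_distortion => //.
  - by move=> k kn; apply: (@Mx_hyp (orbx p) n _ k) => //; rewrite ob0 normr0 ltW.
  - by move=> k kn; apply: hM; exact: ltn_addr.
  (* At the last step of the first half the target coordinates are those at q rather than at g^n p,
     so the two matrices need not be close. The trivial bound 2 L <= C suffices, as the weight nu ^+
     (n - k.+1) is 1 there. *)
  move=> k; rewrite {1}mn ltnS leq_eqVlt => /orP[/eqP ->|km].
    apply: (@opb_le _ _ _ _ (L + L)).
      apply: le_trans (_ : C <= _); first by have := C2L; lra.
      by rewrite -mn subnn expr0 ler_peMr// lerDr exprn_ge0.
    apply: opbD; last apply: opbN.
      by apply: (Mx_le (k := m) cn); [exact: ltn_addr|apply/gy/(leq_trans (ltnW mlt))/leq_addr].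
    by apply: (@Mx_le (orbx p) n _ m) => //; rewrite ob0 normr0 ltW.
  have kn : (k.+1 < n)%N by rewrite mn ltnS.
  have -> : (n - k.+1 = m - k)%N by rewrite mn subSS.
  rewrite Mx_cat_lt// cat_ob_lt 1?ltnW//.
  apply: (@Mx_close (orbx p) m _ y 0 (4 * rho1) k) => //.
  - move=> j jm; have jn : (j < n)%N by rewrite mn ltnS.
    by rewrite -cat_ob_lt//; apply: gy; apply: leq_trans (ltnW jn) (leq_addr _ _).
  - by move=> j _; rewrite ob0 normr0 ltW.
  - by rewrite subr0; apply: le_trans (Ps_le _ _) _; have := ysm 0 (leq0n _).
  - rewrite ob0 subr0; apply: le_trans (Qs_le _ _) _; rewrite -cat_ob_lt//.
    by apply: ysm; apply: leq_trans (ltnW mlt) (leq_addr _ _).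
have -> : Jm s (fun k => Mx cat_orb (n + k) (orb (Fx cat_orb) y (n + k))) n =
   jac s (Fx (orbx q)) (Mx (orbx q)) n (orb (Fx cat_orb) y n).
  rewrite /jac /Jm; congr (_ + _ *m _); apply: eq_Bp => k kn.
  by rewrite Mx_cat_ge cat_ob_ge.
have gq : good (Fx (orbx q)) n r (orb (Fx cat_orb) y n).
  by move=> k kn; rewrite -cat_ob_ge; apply: gy; rewrite leq_add2l.
apply: jac_compare => //.
- exact: good0.
- apply: (@PQ_norm R d s); rewrite ?bdryP ?bdryQ.
    by apply: le_trans (Ps_le _ _) _; apply: le_trans (ysm _ (leq_addr _ _)) _; have := rho1_rho; have := rho10; lra.
  by rewrite -cat_ob_ge; apply: le_trans (Qs_le _ _) _; apply: le_trans (ysm _ (leqnn _)) _; have := rho1_rho; have := rho10; lra.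
- have e' : orb (Fx (orbx q)) 0 n = 0 by elim: n => // k IH /=; rewrite IH Fx_orbx0.
  by apply: (@PQ_norm R d s); rewrite ?bdryP ?bdryQ ?e' mul0mx normr0 ltW.
Qed.

Lemma cross_vol : (((4 ^+ d * K * ((9 / 4) ^+ d * (K * Jac p n * (K * Jac q n))))^-1 * vb (bx d s e e))%:E <=
  leb (Dx cat_orb (n + n) e e))%E.
Proof.
have F01 k : (k < n + n)%N -> `|Fx cat_orb k 0| <= rho1 by move=> _; exact: cat_F0.
have z1 : `|0 : V| <= rho1 by rewrite normr0 ltW.
have Fh := Fx_hyp cn; have Mh := Mx_hyp cn; have Fl := Fx_lin cn.
(* Zero need not be an orbit of a pseudo-orbit's coordinate maps; the orbit with zero boundary data
   is the reference instead. *)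
have [b0 bs] := bsolP Fh Mh Fl F01 rho10 rho1_r z1.
have gy := bsol_good Fh Mh Fl F01 rho10 rho1_r z1.
set y := bsol _ _ _ _ _ in b0 bs gy.
have er : 0 < e <= rho by rewrite e0; have := e1; have := rho1_rho; have := rho10; lra.
have hy : `|bdry s (Fx cat_orb) (n + n) y| <= rho by rewrite b0 normr0 ltW.
have [+ _] := Dx_vol cn er er gy hy; apply: le_trans; rewrite lee_fin.
have v0 : 0 < vb (bx d s e e) by exact: vb_bx_gt0.
have K0 : 0 < K by exact: Kdist_gt0.
have J0 : 0 < kap (jac s (Fx cat_orb) (Mx cat_orb) (n + n) y).
  by apply: kap_gt0 => //; apply: Jm_unit => k kn; apply: Mh => //; exact/gy/ltnW.
have := cross_jac gy bs; have := Jac_gt0 p n; have := Jac_gt0 q n => Jq Jp hJ.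
have A0 : 0 < 4 ^+ d * K by rewrite mulr_gt0// exprn_gt0.
have B0 : 0 < (9 / 4) ^+ d * (K * Jac p n * (K * Jac q n)).
  have p9 : 0 < (9 / 4) ^+ d :> R by rewrite exprn_gt0// divr_gt0.
  by rewrite !mulr_gt0.
apply: ler_wpM2r; first exact: ltW.
by rewrite lef_pV2 ?posrE ?mulr_gt0// ler_pM2l.
Qed.

End Cross.

Section StripMeasure.
Variable m : probability (borel T) R.
Hypothesis hT : hausdorff_space T.
Variables (c0 c1 : R).
Hypotheses (c00 : 0 < c0) (c10 : 0 < c1).
Hypothesis psi_cont : forall p, {within [set y : V | `|y| <= r], continuous (psi p)}.
Hypothesis psi_vol : forall p (E : set (borel V)), compact (E : set V) -> (forall y, E y -> `|y : V| <= r) ->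
  (c0%:E * leb E <= m (psi p @` E : set (borel T)))%E /\ (m (psi p @` E : set (borel T)) <= c1%:E * leb E)%E.

Lemma Dx_ball x n a b y : Dx x n a b y -> `|y : V| <= r.
Proof. by move=> [gy _]; exact: gy 0 (leq0n n). Qed.

Lemma image_compact x n a b p : (forall k, (k < n)%N -> nr (x k) (x k.+1)) -> 0 < a <= rho -> 0 < b <= rho ->
  compact (psi p @` Dx x n a b : set T).
Proof.
move=> xnr ha hb; apply: continuous_compact; last exact: Dx_compact.
have sub : (Dx x n a b : set V) `<=` [set y : V | `|y| <= r] by move=> y; exact: Dx_ball.
exact: (continuous_subspaceW sub (@psi_cont p)).
Qed.

Lemma measurable_image x n a b p : (forall k, (k < n)%N -> nr (x k) (x k.+1)) -> 0 < a <= rho -> 0 < b <= rho ->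
  measurable (psi p @` Dx x n a b : set (borel T)).
Proof.
by move=> xnr ha hb; apply: borel_closed; apply: compact_closed => //; exact: image_compact.
Qed.

Lemma measurable_strip p n a b : 0 < a <= rho -> 0 < b <= rho -> measurable (strip p n a b).
Proof. by move=> ha hb; apply: measurable_image => // *; exact: nr_orbx. Qed.

Definition mr (E : set (borel T)) : R := fine (m E).

Lemma mrE E : measurable E -> m E = (mr E)%:E.
Proof. by move=> mE; rewrite /mr fineK// fin_num_measure. Qed.

Lemma strip_upper p n a b : 0 < a <= rho -> 0 < b <= rho ->
  mr (strip p n a b) <= c1 * (2 ^+ d * (K / Jac p n) * vb (bx d s a b)).
Proof.
move=> ha hb; rewrite -lee_fin -mrE; last exact: measurable_strip.
have nrp k : (k < n)%N -> nr (orbx p k) (orbx p k.+1) by move=> _; exact: nr_orbx.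
have [_ /le_trans] := psi_vol p (Dx_compact nrp ha hb) (@Dx_ball _ _ _ _); apply.
by have [_ h] := strip_vol p n ha hb; rewrite EFinM; apply: lee_wpmul2l => //; rewrite lee_fin ltW.
Qed.

Lemma strip_lower p n a b : 0 < a <= rho -> 0 < b <= rho ->
  c0 * ((4 ^+ d * K * Jac p n)^-1 * vb (bx d s a b)) <= mr (strip p n a b).
Proof.
move=> ha hb; rewrite -lee_fin -mrE; last exact: measurable_strip.
have nrp k : (k < n)%N -> nr (orbx p k) (orbx p k.+1) by move=> _; exact: nr_orbx.
have [+ _] := psi_vol p (Dx_compact nrp ha hb) (@Dx_ball _ _ _ _); apply: le_trans.
by have [h _] := strip_vol p n ha hb; rewrite EFinM; apply: lee_wpmul2l => //; rewrite lee_fin ltW.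
Qed.

Lemma Jac_le p n : Jac p n <= (1 + L ^+ n) ^+ d.
Proof.
have nrp k : (k < n)%N -> nr (orbx p k) (orbx p k.+1) by move=> _; exact: nr_orbx.
apply: Jm_le => // k kn; [apply: (Mx_hyp nrp kn)|apply: (Mx_le nrp kn)]; exact/good0/ltnW.
Qed.

Definition Kvit : R := c1 * 2 ^+ d * K * (1 + Lc) ^+ d * (4 ^+ d * K) / c0.

Let K0 : 0 < K. Proof. exact: Kdist_gt0. Qed.
Let Lc0 : 0 < 1 + Lc. Proof. by rewrite addr_gt0// (lt_le_trans ltr01). Qed.

Lemma strip_doubling p n a b : 0 < a -> 0 < b -> (1 + Lc) * a <= rho -> (1 + Lc) * b <= rho ->
  mr (strip p n ((1 + Lc) * a) ((1 + Lc) * b)) <= Kvit * mr (strip p n a b).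
Proof.
move=> a0 b0 ar br.
have le1 c : 0 < c -> c <= (1 + Lc) * c.
  by move=> cc; apply: ler_peMl; [exact: ltW|rewrite lerDl (le_trans ler01)].
have ha : 0 < a <= rho by rewrite a0 (le_trans (le1 a a0)).
have hb : 0 < b <= rho by rewrite b0 (le_trans (le1 b b0)).
have ha' : 0 < (1 + Lc) * a <= rho by rewrite mulr_gt0.
have hb' : 0 < (1 + Lc) * b <= rho by rewrite mulr_gt0.
apply: le_trans (strip_upper p n ha' hb') _.
have Kv0 : 0 <= Kvit by rewrite /Kvit divr_ge0 ?mulr_ge0 ?exprn_ge0// ltW.
apply: le_trans (ler_wpM2l Kv0 (strip_lower p n ha hb)).
rewrite bxZ vbZ /Kvit le_eqVlt; apply/orP; left; apply/eqP.
have := Jac_gt0 p n; have := K0; have p4 : 0 < 4 ^+ d :> R by rewrite exprn_gt0.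
move: (4 ^+ d) (2 ^+ d) ((1 + Lc) ^+ d) p4 => u v w u0 k0 j0; field.
by rewrite !gt_eqF.
Qed.

(** The two upper bounds for strips over the lower bound for the crossing. The unstable Jacobians
    cancel, and by [vb_bx] only a box of width dl remains, so neither n nor e enters. *)
Definition Kcross (dl : R) : R :=
  c1 * (2 ^+ d * K) * (c1 * (2 ^+ d * K)) * vb (bx d s dl dl) * (4 ^+ d * K * ((9 / 4) ^+ d * (K * K))) / c0.

Lemma Kcross_gt0 dl : 0 < dl -> 0 < Kcross dl.
Proof.
move=> dl0; have v0 : 0 < vb (bx d s dl dl) by exact: vb_bx_gt0.
have p9 : 0 < (9 / 4) ^+ d :> R by rewrite exprn_gt0// divr_gt0.
have p4 : 0 < 4 ^+ d :> R by rewrite exprn_gt0.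
have p2 : 0 < 2 ^+ d :> R by rewrite exprn_gt0.
by rewrite /Kcross; apply: divr_gt0 => //; repeat (apply: mulr_gt0 => //).
Qed.

Lemma cross_measure p q n e rho1 dl : (0 < n)%N -> 0 < e -> 0 < rho1 -> e <= rho1 -> 0 < dl ->
  5 * Lc * rho1 <= dl -> dl <= rho -> dl <= r2 ->
  (exists2 v : V, `|v| <= rho1 & iter n g p = psi q v) ->
  measurable (iter n g @^-1` strip q n dl e : set (borel T)) ->
  mr (strip p n e dl) * mr (strip q n dl e) <= Kcross dl * mr (strip p n e dl `&` iter n g @^-1` strip q n dl e).
Proof.
move=> n0 e0 rho10 e1 dl0 rho1_dl dl_rho dl_r2 pq mg.
have e_dl : e <= dl.
  have : 0 <= (Lc - 1) * rho1 by rewrite mulr_ge0 ?subr_ge0// ltW.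
  by lra.
have he : 0 < e <= rho by rewrite e0 (le_trans e_dl).
have hd : 0 < dl <= rho by rewrite dl0.
have cn k (_ : (k < n + n)%N) : nr (cat_orb p q n k) (cat_orb p q n k.+1).
  exact: (cat_nr rho10 rho1_dl dl_rho pq k).
have sub := @cross_sub p q n e rho1 dl.
have mi : measurable (psi p @` Dx (cat_orb p q n) (n + n) e e : set (borel T)) by exact: measurable_image.
have le1 : mr (psi p @` Dx (cat_orb p q n) (n + n) e e) <= mr (strip p n e dl `&` iter n g @^-1` strip q n dl e).
  rewrite -lee_fin -!mrE//; last by apply: measurableI => //; exact: measurable_strip.
  apply: le_measure; rewrite ?inE//; first by apply: measurableI => //; exact: measurable_strip.
  exact: sub.
have le2 : c0 * ((4 ^+ d * K * ((9 / 4) ^+ d * (K * Jac p n * (K * Jac q n))))^-1 * vb (bx d s e e)) <=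
   mr (psi p @` Dx (cat_orb p q n) (n + n) e e).
  rewrite -lee_fin -mrE//.
  have [+ _] := psi_vol p (Dx_compact cn he he) (@Dx_ball _ _ _ _); apply: le_trans.
  rewrite EFinM; apply: lee_wpmul2l; first by rewrite lee_fin ltW.
  exact: (@cross_vol p q n e rho1 dl).
have Kc := Kcross_gt0 dl0.
apply: le_trans (ler_wpM2l (ltW Kc) (le_trans le2 le1)).
have up := strip_upper p n he hd; have uq := strip_upper q n hd he.
have mr0 E : 0 <= mr E by rewrite fine_ge0.
apply: le_trans (ler_pM (mr0 _) (mr0 _) up uq) _.
rewrite le_eqVlt; apply/orP; left; apply/eqP.
have e3 := vb_bx d s e dl.
rewrite [LHS](_ : _ = c1 * (2 ^+ d * (K / Jac p n)) * (c1 * (2 ^+ d * (K / Jac q n))) * (vb (bx d s e dl) * vb (bx d s dl e))); last by ring.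
rewrite e3 /Kcross.
have := Jac_gt0 p n; have := Jac_gt0 q n; have := K0.
have p4 : 0 < 4 ^+ d :> R by rewrite exprn_gt0.
have p9 : 0 < (9 / 4) ^+ d :> R by rewrite exprn_gt0// divr_gt0.
move: (4 ^+ d) (2 ^+ d) ((9 / 4) ^+ d) p4 p9 => u v w u0 w0 k0 j0 j1; field.
by rewrite !gt_eqF.
Qed.

Hypotheses (cT : compact [set: T]) (kT : connected [set: T]).
Hypothesis g_cont : continuous g.
Hypothesis g_pres : preserves m (g : borel T -> borel T).
Hypothesis r20 : 0 < r2.
Hypothesis psi_near : forall (p0 : T) (e : R), 0 < e ->
  exists2 U : set T, open U /\ U p0 & forall x x', U x -> U x' -> exists2 v : V, `|v| <= e & x' = psi x v.
Hypothesis psi_small : forall (O : set T) (p0 : T), open O -> O p0 ->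
  exists2 e : R, 0 < e & \forall p \near p0, forall v : V, `|v| <= e -> O (psi p v).

Lemma hyperbolic_ergodic : ergodic m (g : borel T -> borel T).
Proof.
(* The lower bound of [strip_lower] with the Jacobian replaced by its crude bound: uniform in the
   centre, though not in n. *)
pose cl n a b := c0 * ((4 ^+ d * K * (1 + L ^+ n) ^+ d)^-1 * vb (bx d s a b)).
have i1 n : 2 ^- n <= 1 :> R by rewrite invf_le1 ?exprn_gt0// exprn_ege1// ler1n.
have nrp p k : nr (orbx p k) (orbx p k.+1) by exact: nr_orbx.
have p4 : 0 < 4 ^+ d * K by rewrite mulr_gt0// exprn_gt0.
have L1 n : 0 < (1 + L ^+ n) ^+ d by rewrite exprn_gt0// ltr_wpDr// exprn_ge0.
apply: (@strip_ergodic R d T m g psi strip rho Lc r2 Kvit Kcross cl) => //.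
- by rewrite /Kvit; apply: divr_gt0 => //; repeat (apply: mulr_gt0 => //); rewrite ?exprn_gt0.
- exact: Kcross_gt0.
- by move=> p n a b; exact: measurable_strip.
- move=> p n a b ha hb; apply: le_trans (strip_lower p n ha hb).
  have [a0 _] := andP ha; have [b0 _] := andP hb.
  apply: ler_wpM2l; first exact: ltW.
  apply: ler_wpM2r; first exact/ltW/vb_bx_gt0.
  rewrite lef_pV2 ?posrE ?mulr_gt0 ?Jac_gt0// ler_pM2l//; exact: Jac_le.
- move=> n a b a0 b0; rewrite /cl; apply: mulr_gt0 => //; apply: mulr_gt0; last exact: vb_bx_gt0.
  by rewrite invr_gt0 mulr_gt0.
- move=> p n a b z /andP[a0 _] /andP[b0 _] [y yD <-].
  have [gy y1 y2] := (DxP (orbx p) n y (ltW a0) (ltW b0)).1 yD.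
  have sm (c : R) k : (k <= n)%N -> 2 ^- k * a <= c -> 2 ^- (n - k) * b <= c -> `|orb (Fx (orbx p)) y k| <= c.
    move=> kn; apply: (@Dx_small (orbx p) n _ y a b c k) => // j _; exact: Fx_orbx0.
  split; [exists y|exists (orb (Fx (orbx p)) y n)] => //.
  - by apply: (sm _ 0%N) => //; rewrite ?subn0 ?expr0 ?invr1 ?mul1r le_max lexx ?orbT.
  - by apply: (sm _ n) => //; rewrite ?subnn ?expr0 ?invr1 ?mul1r le_max lexx ?orbT.
  - by rewrite -(orb_psi (fun k _ => nrp p k) gy (leqnn n)).
- by move=> p p' n a b *; exact: strip_vitali.
- by move=> p n a b *; exact: strip_doubling.
- by move=> p q n e rho1 dl *; exact: (@cross_measure p q n e rho1 dl).
Qed.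

End StripMeasure.
End Strips.

(** * Uniformity on compact sets *)

Section Uniform.

(** All constants are encoded by one natural number n, radii as 1/(n+1) and upper bounds as n. The
    properties then persist as n grows, and local thresholds merge into one. *)
Lemma compact_unif (X : topologicalType) (K : set X) (P : nat -> X -> Prop) : compact K ->
  (forall x, K x -> exists n0, \forall y \near x, forall n, (n0 <= n)%N -> P n y) ->
  exists n0, forall n x, (n0 <= n)%N -> K x -> P n x.
Proof.
move=> /compact_near_coveringP ncK hP.
have h : forall x, K x -> \forall x' \near x & i \near \oo, P i x'.
  move=> x /hP[n0 hn]; exists ([set y | forall n, (n0 <= n)%N -> P n y], [set n | (n0 <= n)%N]).
    by split => //=; exists n0.
  by move=> [y n] /= [hy hn']; exact: hy.
have [n0 _ hn] := ncK nat \oo P _ h.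
by exists n0 => n x ln Kx; exact: (hn n ln).
Qed.

Lemma fin_unif (I : finType) (P : nat -> I -> Prop) :
  (forall i, exists n0, forall n, (n0 <= n)%N -> P n i) ->
  exists n0, forall n i, (n0 <= n)%N -> P n i.
Proof.
move=> /choice[f fP]; exists (\max_i f i)%N => n i h; apply: fP.
exact: leq_trans (leq_bigmax i) h.
Qed.

Lemma fin_near (I : finType) (X : topologicalType) (x : X) (P : I -> X -> Prop) :
  (forall i, \forall y \near x, P i y) -> \forall y \near x, forall i, P i y.
Proof.
move=> h.
suff H (s : seq I) : \forall y \near x, forall i, i \in s -> P i y.
  by have := H (enum I); apply: filterS => y hy i; apply: hy; rewrite mem_enum.
elim: s => [|j s IH]; first by apply: filterE.
by apply: filterS2 (h j) IH => y h1 h2 i; rewrite inE => /orP[/eqP ->|]; [exact: h1|exact: h2].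
Qed.

End Uniform.

(** * Differentials and the mean value inequality *)

Section Differentials.
Variables (R : realType).
Implicit Types (V W : normedModType R).

Lemma differentiable_epsP V W (f : V -> W) x (D : {linear V -> W}) : continuous D ->
  (forall e : R, 0 < e -> \forall y \near x, `|f y - f x - D (y - x)| <= e * `|y - x|) ->
  differentiable f x /\ 'd f x = D :> (V -> W).
Proof.
move=> cD h.
have e : f \o shift x = cst (f x) + D +o_ 0 id.
  apply/eqaddoP => e e0.
  have := h e e0; rewrite (near_shift 0 x) => h1.
  apply: filterS h1 => z /=; rewrite subr0 addrK.
  by rewrite opprD addrA.
have dE := diff_unique cD e; split => //.
by apply/diff_locallyP; split; rewrite dE.
Qed.

Lemma differentiable_eps V W (f : V -> W) x : differentiable f x ->
  forall e : R, 0 < e -> \forall y \near x, `|f y - f x - 'd f x (y - x)| <= e * `|y - x|.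
Proof.
move=> df e e0; have [_ /eqaddoP/(_ e e0) h] := (diff_locallyP x f).1 df.
rewrite (near_shift 0 x); apply: filterS h => z /=.
by rewrite subr0 addrK opprD addrA.
Qed.

Lemma near_differentiable V W (f g : V -> W) x : (\forall y \near x, f y = g y) -> differentiable f x ->
  differentiable g x /\ 'd g x = 'd f x :> (V -> W).
Proof.
move=> fg df; apply: differentiable_epsP; first exact: diff_continuous.
move=> e e0; have fgx := nbhs_singleton fg.
apply: filterS2 fg (differentiable_eps df e0) => y e1.
by rewrite e1 fgx.
Qed.

Section MeanValue.
Variables (d d' : nat) (H : 'rV[R]_d -> 'rV[R]_d').

(** The one-variable mean value theorem along the segment, applied to each coordinate of H after
    subtracting D; the sup norm needs no more. *)
Lemma mean_value (A : set 'rV[R]_d) (D : 'M[R]_(d, d')) (k : R) (z z' : 'rV[R]_d) :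
  (forall t : R, 0 <= t <= 1 -> A (z' + t *: (z - z'))) ->
  (forall w, A w -> differentiable H w /\ forall v, `|'d H w v - v *m D| <= k * `|v|) ->
  `|H z - H z' - (z - z') *m D| <= k * `|z - z'|.
Proof.
move=> seg hA; set u := z - z'.
have k0 : 0 <= k * `|u|.
  have h01 : 0 <= (0 : R) <= 1 by rewrite lexx ler01.
  by have [_ /(_ u)] := hA _ (seg 0 h01); apply: le_trans.
apply: rV_norm_le => // j.
pose gam (t : R^o) : 'rV[R]_d := z' + t *: u.
pose f (t : R^o) : R^o := (H (gam t)) 0 j - t * (u *m D) 0 j.
pose df (t : R) : R := ('d H (gam t) u - u *m D) 0 j.
have der t : 0 <= t <= 1 -> is_derive (t : R^o) 1 f (df t).
  move=> ht; have [dH _] := hA _ (seg t ht).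
  have h : forall e : R, 0 < e -> \forall y \near (t : R^o), `|f y - f t - (y - t) *: (df t : R^o)| <= e * `|y - t|.
    move=> e e0.
    have e1 : 0 < e / (1 + `|u|) by rewrite divr_gt0// ltr_wpDr.
    have hd := differentiable_eps dH e1.
    have cg : {for t, continuous gam}.
      by apply: cvgD; [exact: cvg_cst|apply: cvgZr_tmp; exact: cvg_id].
    have hd' : \forall y \near (t : R^o), `|H (gam y) - H (gam t) - 'd H (gam t) (gam y - gam t)| <= e / (1 + `|u|) * `|gam y - gam t|.
      exact: (cg _ hd).
    apply: filterS hd' => y /=.
    have -> : gam y - gam t = (y - t) *: u.
      by rewrite /gam opprD addrACA subrr add0r scalerBl.
    rewrite linearZ/= normrZ => hy.
    have -> : f y - f t - (y - t) *: (df t : R^o) = (H (gam y) - H (gam t) - (y - t) *: 'd H (gam t) u) 0 j.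
      by rewrite /f /df !mxE /GRing.scale/=; ring.
    apply: le_trans (rV_coord_le _ j) _; apply: le_trans hy _.
    have u1 : `|u| / (1 + `|u|) <= 1 by rewrite ler_pdivrMr ?ltr_wpDr// mul1r lerDr ler01.
    rewrite [leLHS](_ : _ = e * `|y - t| * (`|u| / (1 + `|u|))); last by ring.
    by apply: ler_piMr => //; rewrite mulr_ge0// ltW.
  have cv : (fun h0 : R => h0^-1 *: ((f \o shift (t : R^o)) (h0 *: 1) - f t)) @ 0^' --> (df t : R^o).
    apply/cvgrPdist_le => e e0; rewrite near_withinE.
    have := h e e0; rewrite (near_shift 0 (t : R^o)); apply: filterS => y /= hy y0.
    move: hy; rewrite subr0 addrK => hy.
    have -> : df t - y^-1 *: (f (y *: 1 + t) - f t) = - (y^-1 *: (f (y + t) - f t - y *: (df t : R^o))).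
      by rewrite /GRing.scale/= mulr1; field.
    by rewrite normrN normrZ normfV ler_pdivrMl ?normr_gt0// mulrC.
  split; first by apply/cvg_ex; exists (df t).
  exact: cvg_lim cv.
have cf : {within `[0, 1], continuous f}.
  apply: derivable_within_continuous => t; rewrite in_itv/= => ht.
  by have [] := der t ht.
have [|c c01] := @MVT_segment R f df 0 1 ler01 _ cf.
  by move=> t; rewrite in_itv/= => /andP[t0 t1]; apply: der; rewrite !ltW.
move=> e; have [_ /(_ u) hc] := hA _ (seg c c01).
have -> : (H z - H z' - u *m D) 0 j = f 1 - f 0.
  by rewrite /f /gam scale1r scale0r addr0 /u subrKC !mxE; ring.
rewrite e subr0 mulr1; exact: le_trans (rV_coord_le _ _) hc.
Qed.

End MeanValue.

Lemma seg_ball d (x z z' : 'rV[R]_d) (rho t : R) : `|z - x| <= rho -> `|z' - x| <= rho -> 0 <= t <= 1 ->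
  `|z' + t *: (z - z') - x| <= rho.
Proof.
move=> hz hz' /andP[t0 t1].
have -> : z' + t *: (z - z') - x = t *: (z - x) + (1 - t) *: (z' - x).
  by apply/rowP => j; rewrite !mxE; ring.
apply: le_trans (ler_normD _ _) _; rewrite !normrZ ger0_norm// ger0_norm ?subr_ge0//.
have -> : rho = t * rho + (1 - t) * rho by ring.
by apply: lerD; apply: ler_wpM2l => //; rewrite subr_ge0.
Qed.

Lemma cball_compact d (x : 'rV[R]_d) (rho : R) : compact [set z : 'rV[R]_d | `|z - x| <= rho].
Proof.
apply: bounded_closed_compact.
  exists (`|x| + rho); split; first exact: num_real.
  move=> y hy z /= hz; apply: le_trans (ltW hy); rewrite -(subrK x z).
  by apply: le_trans (ler_normD _ _) _; rewrite addrC lerD2l.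
move=> p hp; apply/ler_addgt0Pr => e e0.
have /hp[z [/= hz]] : nbhs p (ball p e) by exact: nbhsx_ballx.
rewrite -ball_normE/= => pz; rewrite -(subrKA z) (le_trans (ler_normD _ _))// addrC lerD//.
exact: ltW.
Qed.

End Differentials.

(** * Adapted orthogonal frames *)

Section AdaptedFrame.
Variables (R : realType) (d : nat).
Notation V := 'rV[R]_d.

Definition dot (u v : V) : R := (u *m v^T) 0 0.

Lemma dotE (u v : V) : dot u v = \sum_j u 0 j * v 0 j.
Proof. by rewrite /dot mxE; apply: eq_bigr => j _; rewrite mxE. Qed.

Lemma dot_gt0 (u : V) : u != 0 -> 0 < dot u u.
Proof.
move=> u0; have [j uj] : exists j, u 0 j != 0.
  apply: contrapT => h; case/eqP: u0; apply/rowP => j; rewrite mxE.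
  by apply/eqP/negPn/negP => hj; apply: h; exists j.
rewrite dotE (bigD1 j)//= ltr_pwDl//; first by rewrite -expr2 lt_def sqrf_eq0 uj sqr_ge0.
by apply: sumr_ge0 => i _; rewrite -expr2 sqr_ge0.
Qed.

(** The Householder reflection in the direction row k Q - u carries row k of Q to u, and it fixes
    the earlier rows because they are orthogonal to that direction. *)
Lemma orth_step (Q : 'M[R]_d) (k : 'I_d) (u : V) : Q *m Q^T = 1%:M -> dot u u = 1 ->
  (forall i : 'I_d, (i < k)%N -> dot (row i Q) u = 0) ->
  exists Q' : 'M[R]_d, [/\ Q' *m Q'^T = 1%:M, row k Q' = u & forall i : 'I_d, (i < k)%N -> row i Q' = row i Q].
Proof.
move=> QQ uu uQ; pose w := row k Q - u.
have dQ i j : dot (row i Q) (row j Q) = (i == j)%:R.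
  have -> : (i == j)%:R = (1%:M : 'M[R]_d) i j by rewrite mxE.
  by rewrite -QQ mxE dotE; apply: eq_bigr => l _; rewrite !mxE.
case: (eqVneq w 0) => [/eqP|w0]; first by rewrite subr_eq0 => /eqP h; exists Q.
have N0 := dot_gt0 w0; set N := dot w w in N0.
pose c := 2 / N; pose H : 'M[R]_d := 1%:M - c *: (w^T *m w).
have wwT : w *m w^T = N%:M by apply/matrixP => i j; rewrite !ord1 [RHS]mxE eqxx mulr1n.
have HT : H^T = H by rewrite /H linearB/= linearZ/= trmx1 trmx_mul trmxK.
have HH : H *m H = 1%:M.
  have e : (w^T *m w) *m (w^T *m w) = N *: (w^T *m w).
    by rewrite mulmxA -[w^T *m w *m w^T]mulmxA wwT mul_mx_scalar -scalemxAl.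
  rewrite /H; move: e; move: (w^T *m w) => W e.
  rewrite mulmxBl mul1mx mulmxBr mulmx1 -scalemxAl -scalemxAr e !scalerA.
  have -> : c * c * N = c + c by rewrite /c; field; rewrite gt_eqF.
  by rewrite scalerDl opprB -addrA; apply/eqP; rewrite -subr_eq0; apply/eqP/matrixP => i j; rewrite !mxE; ring.
have rH (v : V) : v *m H = v - (c * dot v w) *: w.
  rewrite /H mulmxBr mulmx1 -scalemxAr mulmxA.
  have -> : v *m w^T = (dot v w)%:M by apply/matrixP => i j; rewrite !ord1 [RHS]mxE eqxx mulr1n.
  by rewrite mul_scalar_mx scalerA.
exists (Q *m H); split.
- by rewrite trmx_mul HT mulmxA -[Q *m H *m H]mulmxA HH mulmx1.
- rewrite row_mul rH.
  have dB (x y z : V) : dot x (y - z) = dot x y - dot x z by rewrite /dot linearB/= mulmxBr !mxE.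
  have dS (x y : V) : dot x y = dot y x by rewrite !dotE; apply: eq_bigr => j _; rewrite mulrC.
  have e1 : dot (row k Q) w = 1 - dot (row k Q) u by rewrite dB dQ eqxx.
  have e2 : N = 2 * dot (row k Q) w.
    have e3 : dot u w = dot (row k Q) u - 1 by rewrite dB uu (dS u).
    have -> : N = dot w (row k Q) - dot w u by rewrite /N -dB.
    rewrite (dS w) (dS w) e1 e3; ring.
  have -> : c * dot (row k Q) w = 1.
    by rewrite /c e2; field; move: N0; rewrite e2; case: eqVneq => // ->; rewrite mulr0 ltxx.
  by rewrite scale1r /w opprB subrKC.
- move=> i ik; rewrite row_mul rH.
  have -> : dot (row i Q) w = 0.
    have dB (x y z : V) : dot x (y - z) = dot x y - dot x z by rewrite /dot linearB/= mulmxBr !mxE.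
    by rewrite dB dQ uQ// subr0; case: eqVneq => // ie; move: ik; rewrite ie ltnn.
  by rewrite mulr0 scale0r subr0.
Qed.

Variable U : {vspace V}.
Notation m := (\dim U).

Definition basis_mx : 'M[R]_(m, d) := \matrix_(i < m) (vbasis U)`_i.

Lemma basis_mx_in (x : 'rV_m) : x *m basis_mx \in U.
Proof.
rewrite mulmx_sum_row; apply: memv_suml => i _; apply: memvZ.
by rewrite rowK; apply: vbasis_mem; apply: mem_nth; rewrite size_tuple.
Qed.

Lemma basis_mx_free : row_free basis_mx.
Proof.
apply: inj_row_free => x; rewrite mulmx_sum_row => h.
have /freeP fr := basis_free (vbasisP U).
apply/rowP => i; rewrite mxE; apply: (fr (fun i => x 0 i)).
by rewrite -[RHS]h; apply: eq_bigr => j _; rewrite rowK.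
Qed.

Lemma basis_mxP (v : V) : v \in U -> (v <= basis_mx)%MS.
Proof.
move=> vU; apply/submxP; exists (\row_i coord (vbasis U) i v).
rewrite mulmx_sum_row {1}(coord_vbasis vU); apply: eq_bigr => i _.
by rewrite rowK mxE.
Qed.

Lemma dim_le_d : (m <= d)%N.
Proof. by rewrite -(eqP basis_mx_free) rank_leq_col. Qed.

Lemma orth_rows k : (k <= m)%N -> exists Q : 'M[R]_d, Q *m Q^T = 1%:M /\ forall i : 'I_d, (i < k)%N -> row i Q \in U.
Proof.
elim: k => [|k IH] km; first by exists 1%:M; rewrite trmx1 mulmx1.
have [Q [QQ QU]] := IH (ltnW km).
have kd : (k < d)%N by exact: leq_trans km dim_le_d.
(* In basis coordinates, the kernel of G consists of the vectors of U orthogonal to the first k rows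
   of Q; it is nonzero as the rank of G is at most k. *)
pose G := basis_mx *m Q^T *m Ps R d k.
have rG : (\rank G < m)%N.
  apply: leq_ltn_trans (mxrankM_maxr _ _) _; rewrite /Ps rank_pid_mx//; exact: ltnW.
have kG : kermx G != 0 by rewrite -mxrank_eq0 mxrank_ker subn_eq0 -ltnNge.
pose x := nz_row (kermx G).
have x0 : x != 0 by rewrite nz_row_eq0.
have xG : x *m G = 0 by apply/sub_kermxP; exact: nz_row_sub.
pose y := x *m basis_mx.
have y0 : y != 0.
  by apply: contraNneq x0 => h; rewrite -(mulmx_free_eq0 _ basis_mx_free); exact/eqP.
have N0 := dot_gt0 y0.
pose u := (Num.sqrt (dot y y))^-1 *: y.
have dZ (a : R) (p q : V) : dot p (a *: q) = a * dot p q.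
  by rewrite !dotE mulr_sumr; apply: eq_bigr => j _; rewrite mxE; ring.
have dZl (a : R) (p q : V) : dot (a *: p) q = a * dot p q.
  by rewrite !dotE mulr_sumr; apply: eq_bigr => j _; rewrite mxE; ring.
have uu : dot u u = 1.
  rewrite dZ dZl mulrA -invfM -expr2 sqr_sqrtr; last exact: ltW.
  by rewrite mulVf// gt_eqF.
have [|Q' [QQ' uQ' rQ']] := @orth_step Q (Ordinal kd) u QQ uu.
  move=> i /= ik; rewrite dZ.
  have -> : dot (row i Q) y = (y *m Q^T) 0 i.
    by rewrite dotE mxE; apply: eq_bigr => j _; rewrite !mxE mulrC.
  have := PsE k (y *m Q^T) i; rewrite ik => <-.
  by rewrite /y -!mulmxA [basis_mx *m _]mulmxA xG mxE mulr0.
exists Q'; split => // i; rewrite ltnS leq_eqVlt => /orP[/eqP ik|ik].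
  have -> : i = Ordinal kd by exact: val_inj.
  by rewrite uQ'; apply: memvZ; exact: basis_mx_in.
by rewrite rQ'// QU.
Qed.

(** The first m rows of Q span U. Orthogonal frames are bounded by d whatever U is, so one may be
    chosen at each point independently with uniform bounds. *)
Lemma adapted_frame : exists Q : 'M[R]_d, Q *m Q^T = 1%:M /\
  forall v : V, v \in U <-> v *m Q^T *m Qs R d m = 0.
Proof.
have [Q [QQ QU]] := orth_rows (leqnn m).
have Qu : Q \in unitmx by have [] := mulmx1_unit QQ.
have QTQ : Q^T *m Q = 1%:M by exact: mulmx1C.
have PQ_in (w : V) : w *m Ps R d m *m Q \in U.
  rewrite mulmx_sum_row; apply: memv_suml => i _; rewrite PsE.
  by case: ifP => im; [apply: memvZ; exact: QU|rewrite scale0r mem0v].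
exists Q; split => // v; split=> h.
  have sub : (Ps R d m *m Q <= basis_mx)%MS.
    apply/row_subP => i; apply: basis_mxP; rewrite row_mul rowE; exact: PQ_in.
  have eqm : (Ps R d m *m Q == basis_mx)%MS.
    rewrite -(geq_leqif (mxrank_leqif_eq sub)) (eqP basis_mx_free).
    by rewrite mxrankMfree ?row_free_unit// rank_pid_mx// dim_le_d.
  have : (v <= Ps R d m *m Q)%MS by rewrite (eqmxP eqm); exact: basis_mxP.
  case/submxP => D ->; rewrite mulmxA -[D *m _ *m Q *m Q^T]mulmxA QQ mulmx1.
  by rewrite -mulmxA PQ mulmx0.
have -> : v = v *m Q^T *m Ps R d m *m Q; last exact: PQ_in.
rewrite -[LHS]mulmx1 -QTQ mulmxA; congr (_ *m _).
by rewrite -[LHS]mulmx1 -(subrK (Ps R d m) 1%:M) -/(Qs R d m) mulmxDr h add0r.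
Qed.

Lemma orth_le (Q : 'M[R]_d) : Q *m Q^T = 1%:M -> `|Q| <= 1.
Proof.
move=> QQ; apply: mx_norm_le => // i j.
have h : \sum_k Q i k ^+ 2 = 1.
  have : (Q *m Q^T) i i = 1 by rewrite QQ mxE eqxx.
  rewrite mxE => <-.
  by apply: eq_bigr => k _; rewrite mxE expr2.
rewrite -(@ler_pXn2r _ 2)// ?nnegrE// real_normK ?num_real// expr1n -h (bigD1 j)//= lerDl.
by apply: sumr_ge0 => k _; rewrite sqr_ge0.
Qed.

Lemma orth_opb (Q : 'M[R]_d) : Q *m Q^T = 1%:M -> opb Q d%:R /\ opb Q^T d%:R.
Proof.
move=> QQ; have h (A : 'M[R]_d) : A *m A^T = 1%:M -> opb A d%:R.
  by move=> AA; apply: opb_le (opb_norm A); rewrite ler_piMr// orth_le.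
split; apply: h => //; rewrite trmxK; exact: mulmx1C.
Qed.

End AdaptedFrame.

(** * Nonvanishing of alternating forms on frames *)

Section AlternatingForm.
Variables (R : realType) (d : nat).
Notation mx := 'M[R]_d.

Definition multilinear_form (f : mx -> R) := forall (A B C : mx) (i : 'I_d) (b c : R),
  row i A = b *: row i B + c *: row i C -> row' i B = row' i A -> row' i C = row' i A -> f A = b * f B + c * f C.
Definition alternating_form (f : mx -> R) := forall (A : mx) (i j : 'I_d), i != j -> row i A = row j A -> f A = 0.

Definition set_row (A : mx) (i : 'I_d) (u : 'rV[R]_d) : mx := \matrix_(j < d) (if j == i then u else row j A).

Lemma row_set_row A i u : row i (set_row A i u) = u. Proof. by rewrite rowK eqxx. Qed.
Lemma row_set_row_neq A i j u : j != i -> row j (set_row A i u) = row j A.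
Proof. by move=> h; rewrite rowK (negbTE h). Qed.
Lemma row'_set_row A i u v : row' i (set_row A i u) = row' i (set_row A i v).
Proof. by apply/matrixP => j k; rewrite !mxE eq_sym (negbTE (neq_lift _ _)). Qed.
Lemma set_row_id A i : set_row A i (row i A) = A.
Proof. by apply/row_matrixP => j; case: (eqVneq j i) => [->|h]; rewrite ?row_set_row ?row_set_row_neq. Qed.

Section Form.
Variable f : mx -> R.
Hypotheses (mf : multilinear_form f) (af : alternating_form f).

Lemma form_lin A i b c u v : f (set_row A i (b *: u + c *: v)) = b * f (set_row A i u) + c * f (set_row A i v).
Proof. by apply: (mf (i := i)); rewrite ?row_set_row//; exact: row'_set_row. Qed.

Lemma form_vanish A i : (forall j, f (set_row A i (delta_mx 0 j)) = 0) -> f A = 0.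
Proof.
move=> h; rewrite -(set_row_id A i) (row_sum_delta (row i A)).
apply: (big_ind (fun u => f (set_row A i u) = 0)) => [|u v hu hv|j _].
- by have := form_lin A i 0 0 0 0; rewrite !scale0r addr0 !mul0r addr0.
- by have := form_lin A i 1 1 u v; rewrite !scale1r hu hv !mulr0 addr0.
- by have := form_lin A i (row i A 0 j) 0 (delta_mx 0 j) 0; rewrite scaler0 addr0 h mulr0 mul0r addr0.
Qed.

Lemma form_swap A i j : i != j -> f (xrow i j A) = - f A.
Proof.
move=> ij; pose G u v := set_row (set_row A i u) j v.
have ji : j != i by rewrite eq_sym.
have Gi u v : row i (G u v) = u by rewrite row_set_row_neq// row_set_row.
have Gj u v : row j (G u v) = v by rewrite row_set_row.
have sw u v : G u v = set_row (set_row A j v) i u.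
  apply/row_matrixP => k; rewrite !rowK; case: (eqVneq k j) => [->|kj]; last by case: ifP => //; rewrite rowK (negbTE kj).
  by rewrite (negbTE ji).
have Gl u u' v : f (G (u + u') v) = f (G u v) + f (G u' v).
  by rewrite !sw; have := form_lin (set_row A j v) i 1 1 u u'; rewrite !scale1r !mul1r.
have Gr u v v' : f (G u (v + v')) = f (G u v) + f (G u v').
  by have := form_lin (set_row A i u) j 1 1 v v'; rewrite !scale1r !mul1r.
have G0 u : f (G u u) = 0 by apply: (af (i := i) (j := j)) => //; rewrite Gi Gj.
have -> : xrow i j A = G (row j A) (row i A).
  apply/row_matrixP => k; rewrite !rowK; case: (eqVneq k j) => [->|kj].
    by apply/rowP => l; rewrite !mxE tpermR.
  case: (eqVneq k i) => [->|ki]; first by apply/rowP => l; rewrite !mxE tpermL.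
  by apply/rowP => l; rewrite !mxE tpermD// eq_sym.
have -> : f A = f (G (row i A) (row j A)).
  by congr f; apply/row_matrixP => k; rewrite !rowK; case: eqVneq => [->|_]//; case: eqVneq => [->|].
have := G0 (row i A + row j A); rewrite Gl !Gr !G0 addr0 add0r => /eqP.
by rewrite addrC addr_eq0 => /eqP.
Qed.

Lemma form_perm (s : 'S_d) : f 1%:M = 0 -> f (perm_mx s) = 0.
Proof.
move=> f1; have [ts -> _] := prod_tpermP s.
elim: ts => [|t ts IH] //=; first by rewrite big_nil perm_mx1.
rewrite big_cons perm_mxM; case: (eqVneq t.1 t.2) => [->|ne].
  by rewrite tperm1 perm_mx1 mul1mx.
by rewrite -/(tperm_mx t.1 t.2) -xrowE form_swap// IH oppr0.
Qed.

(** Induction on the number k of leading rows that are not yet basis vectors; multilinearity expands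
    one of them. When all rows are basis vectors, either two coincide or the matrix is a permutation
    matrix, which swaps reduce to the identity. *)
Lemma form_zero : f 1%:M = 0 -> forall A, f A = 0.
Proof.
move=> f1.
have H k : (k <= d)%N -> forall A, (forall i : 'I_d, (k <= i)%N -> exists j, row i A = delta_mx 0 j) -> f A = 0.
  elim: k => [_ A h|k IH kd A h].
    have [phi phiP] := choice (fun i => h i (leq0n _)).
    case: (pselect (injective phi)) => [inj|ninj].
      have -> : A = perm_mx (perm inj); last exact: form_perm.
      by apply/row_matrixP => i; rewrite phiP; apply/rowP => j; rewrite !mxE permE eqxx/= eq_sym.
    have [i [j [ij e]]] : exists i j, i != j /\ phi i = phi j.
      apply: contrapT => hh; apply: ninj => i j e; apply/eqP/negPn/negP => ij; apply: hh.
      by exists i, j.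
    by apply: (af ij); rewrite !phiP e.
  apply: (@form_vanish A (Ordinal kd)) => j; apply: IH; first exact: ltnW.
  move=> i; rewrite leq_eqVlt => /orP[/eqP ki|ki].
    have -> : i = Ordinal kd by exact: val_inj.
    by exists j; rewrite row_set_row.
  rewrite row_set_row_neq; first exact: h.
  by apply/eqP => e; move: ki; rewrite e ltnn.
move=> A; apply: (H d) => // i di; have := ltn_ord i; by rewrite ltnNge di.
Qed.

End Form.

Lemma form_unit_neq0 (f : mx -> R) : multilinear_form f -> alternating_form f -> (exists A, f A != 0) ->
  forall B, B \in unitmx -> f B != 0.
Proof.
move=> mf af [A fA] B uB; apply: contraNneq fA => fB.
have mf' : multilinear_form (fun X => f (X *m B)).
  move=> X Y Z i b c h1 h2 h3; apply: (mf _ _ _ i); first by rewrite !row_mul h1 mulmxDl !scalemxAl.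
    by rewrite !row'Esub -!mul_rowsub_mx -!row'Esub h2.
  by rewrite !row'Esub -!mul_rowsub_mx -!row'Esub h3.
have af' : alternating_form (fun X => f (X *m B)).
  by move=> X i j ij h; apply: (af _ i j ij); rewrite !row_mul h.
have := form_zero mf' af' _ (A *m invmx B); rewrite mul1mx mulmxKV//= => ->//.
Qed.

End AlternatingForm.

(** * Maps between charts *)

Section OpbTools.
Variable R : realType.

Lemma opb_rows (m n : nat) (A : 'M[R]_(m, n)) (k : R) : 0 <= k -> (forall j, `|row j A| <= k) -> opb A (m%:R * k).
Proof.
move=> k0 h; apply: opb_le (opb_norm A); rewrite ler_wpM2l// mx_norm_le// => i j.
by have := rV_coord_le (row i A) j; rewrite mxE => /le_trans; apply.
Qed.

Lemma opb_mulB (m n p : nat) (A A' : 'M[R]_(m, n)) (B B' : 'M[R]_(n, p)) (a b ea eb : R) :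
  0 <= b -> 0 <= eb -> 0 <= a -> 0 <= ea ->
  opb A a -> opb B' b -> opb (A' - A) ea -> opb (B' - B) eb -> opb (A' *m B' - A *m B) (ea * b + a * eb).
Proof.
move=> b0 eb0 a0 ea0 hA hB hA' hB'.
have -> : A' *m B' - A *m B = (A' - A) *m B' + A *m (B' - B).
  by rewrite mulmxBl mulmxBr addrA subrK.
by apply: opbD; apply: opbM.
Qed.

End OpbTools.

HB.lock Definition hc (R : realType) (d : nat) (M : topologicalType) (h : M -> M) (c c' : chart R d M) : 'rV[R]_d -> 'rV[R]_d :=
  cmap c' \o h \o cinv c.

(* Locked, as unification otherwise unfolds the choice operator in ['d]. *)
HB.lock Definition Jh (R : realType) (d : nat) (M : topologicalType) (h : M -> M) (c c' : chart R d M) (y : 'rV[R]_d) : 'M[R]_d :=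
  'J (cmap c' \o h \o cinv c) y.

Section AtlasCalculus.
Variables (R : realType) (d : nat) (M : ptopologicalType) (X : manifold R d M).
Notation V := 'rV[R]_d.
Implicit Types (c : chart R d M) (h : M -> M) (y : V).

Definition img c : set V := cmap c @` cdom c.
Lemma hcE h c c' y : hc h c c' y = cmap c' (h (cinv c y)). Proof. by rewrite hc.unlock. Qed.
Definition ov h c c' : set V := chart_overlap setT h c c'.

Lemma imgP c y : img c y -> cdom c (cinv c y) /\ cmap c (cinv c y) = y.
Proof. by move=> [p dp <-]; rewrite cmapK. Qed.

Lemma img_cmap c p : cdom c p -> img c (cmap c p). Proof. by exists p. Qed.

Lemma ovP h c c' y : ov h c c' y <-> img c y /\ cdom c' (h (cinv c y)).
Proof.
split=> [[p [[_ dp] /= hp] <-]|[[p dp <-] hp]]; first by rewrite cmapK//; split => //; exists p.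
by exists p; rewrite cmapK// in hp.
Qed.

Lemma cinv_cont c y : img c y -> {for y, continuous (cinv c)}.
Proof. exact: cinv_continuous. Qed.

Lemma img_open c : open (img c). Proof. exact: cimg_open. Qed.

Lemma open_near (T : topologicalType) (A : set T) x : open A -> A x -> \forall y \near x, A y.
Proof. by move=> oA Ax; apply: open_nbhs_nbhs. Qed.

Lemma hc_cont_pre h c y (A : set M) : continuous h -> img c y -> nbhs (h (cinv c y)) A ->
  \forall z \near y, A (h (cinv c z)).
Proof. by move=> ch iy nA; exact: (cinv_cont iy (ch (cinv c y) A nA)). Qed.

Lemma ov_near h c c' y : continuous h -> ov h c c' y -> \forall z \near y, ov h c c' z.
Proof.
move=> ch /ovP[iy hy]; apply: filterS2 (open_near (img_open (c := c)) iy) (hc_cont_pre ch iy (open_near (cdom_open c') hy)).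
by move=> z h1 h2; apply/ovP.
Qed.

Lemma hc_cont h c c' y : continuous h -> ov h c c' y -> {for y, continuous (hc h c c')}.
Proof.
move=> ch /ovP[iy hy]; rewrite hc.unlock; apply: (@continuous_comp _ _ _ (h \o cinv c) (cmap c')); last exact: cmap_continuous.
by apply: (@continuous_comp _ _ _ (cinv c) h); [exact: cinv_cont|exact: ch].
Qed.

Lemma hcK h c c' y : ov h c c' y -> cinv c' (hc h c c' y) = h (cinv c y).
Proof. by move=> /ovP[_ hy]; rewrite hcE cmapK. Qed.

Lemma hc_img h c c' y : ov h c c' y -> img c' (hc h c c' y).
Proof. by move=> /ovP[_ hy]; rewrite hcE; exists (h (cinv c y)). Qed.

Lemma ov_comp h1 h2 c c' c'' y : ov h1 c c' y -> ov h2 c' c'' (hc h1 c c' y) <-> ov (h2 \o h1) c c'' y.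
Proof.
move=> o1; have [iy _] := (ovP h1 c c' y).1 o1.
by rewrite !ovP hcK//=; split=> [[_ ?]|[_ ?]]; split => //; exact: hc_img.
Qed.

Lemma hc_comp_near h1 h2 c c' c'' y : continuous h1 -> ov h1 c c' y ->
  \forall z \near y, (hc h2 c' c'' \o hc h1 c c') z = hc (h2 \o h1) c c'' z.
Proof.
move=> ch /(ov_near ch); apply: filterS => z oz.
by rewrite /= !hcE cmapK//; have [_] := (ovP h1 c c' z).1 oz.
Qed.

Lemma JhE h c c' y (v : V) : 'd (hc h c c') y v = v *m Jh h c c' y.
Proof. by rewrite Jh.unlock hc.unlock /jacobian mul_rV_lin1. Qed.

Lemma dE h c c' y (v : V) : 'd (cmap c' \o h \o cinv c) y v = v *m Jh h c c' y.
Proof. by rewrite -JhE hc.unlock. Qed.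

Lemma JhB_le h c c' y z (v : V) (k : R) :
  `|'d (cmap c' \o h \o cinv c) y v - 'd (cmap c' \o h \o cinv c) z v| <= k -> `|v *m (Jh h c c' y - Jh h c c' z)| <= k.
Proof. by rewrite mulmxBr -(dE h c c' y v) -(dE h c c' z v). Qed.

(** Continuity of the derivative is expressed by operator bounds on Jacobian matrices, the form used
    in products. *)
Definition C1m h := continuous h /\ forall c c', atlas X c -> atlas X c' -> forall y, ov h c c' y ->
  differentiable (hc h c c') y /\
  forall e : R, 0 < e -> \forall z \near y, opb (Jh h c c' z - Jh h c c' y) e.

Lemma C1mP h : C1_on X setT h -> C1m h.
Proof.
move=> [ch C1]; split; first by move=> p; exact: ch.
move=> c c' ac ac' y oy; have [df cf] := C1 c c' ac ac'; split; first by rewrite hc.unlock; exact: df.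
move=> e e0; have e1 : 0 < e / (d%:R + 1) by rewrite divr_gt0// ltr_wpDl.
have : \forall z \near y, forall j : 'I_d, `|row j (Jh h c c' z - Jh h c c' y)| <= e / (d%:R + 1).
  apply: fin_near => j; have := cf (delta_mx 0 j) y oy; move=> /cvgrPdist_le/(_ _ e1).
  apply: filterS => z; rewrite distrC => /JhB_le.
  by rewrite -rowE.
apply: filterS => z hz; apply: opb_le (opb_rows (ltW e1) hz).
by rewrite mulrC -mulrA ler_piMr ?(ltW e0)// mulrC ler_pdivrMr ?ltr_wpDl// mul1r lerDl.
Qed.

Lemma C1m_bound h c c' y : C1m h -> atlas X c -> atlas X c' -> ov h c c' y ->
  exists2 K : R, 0 <= K & \forall z \near y, opb (Jh h c c' z) K.
Proof.
move=> [_ C1] ac ac' oy; have [_ /(_ _ ltr01) hJ] := C1 c c' ac ac' y oy.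
exists (1 + d%:R * `|Jh h c c' y|); first by rewrite addr_ge0// mulr_ge0.
apply: filterS hJ => z hz; rewrite -(subrK (Jh h c c' y) (Jh h c c' z)).
by apply: opbD => //; exact: opb_norm.
Qed.

Lemma chain h1 h2 c c' c'' y : C1m h1 -> C1m h2 -> atlas X c -> atlas X c' -> atlas X c'' ->
  ov h1 c c' y -> ov h2 c' c'' (hc h1 c c' y) ->
  differentiable (hc (h2 \o h1) c c'') y /\
  Jh (h2 \o h1) c c'' y = Jh h1 c c' y *m Jh h2 c' c'' (hc h1 c c' y).
Proof.
move=> [ch1 C1] [ch2 C2] ac ac' ac'' o1 o2.
have [d1 _] := C1 c c' ac ac' y o1; have [d2 _] := C2 c' c'' ac' ac'' _ o2.
have dc : differentiable (hc h2 c' c'' \o hc h1 c c') y by exact: differentiable_comp.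
have [dd e] := @near_differentiable R V V (hc h2 c' c'' \o hc h1 c c') (hc (h2 \o h1) c c'') y (hc_comp_near h2 c'' ch1 o1) dc.
split; first exact: dd.
apply/row_matrixP => j; rewrite [LHS]rowE -(JhE _ c c'' y).
apply: etrans (congr1 (fun F : V -> V => F (delta_mx 0 j)) e) _.
have e2 := diff_comp d1 d2.
apply: etrans (congr1 (fun F : V -> V => F (delta_mx 0 j)) e2) _.
apply: etrans (JhE h2 c' c'' (hc h1 c c' y) ('d (hc h1 c c') y (delta_mx 0 j))) _.
apply: etrans (congr1 (fun u : V => u *m Jh h2 c' c'' (hc h1 c c' y)) (JhE h1 c c' y (delta_mx 0 j))) _.
by rewrite rowE mulmxA.
Qed.

Lemma C1m_comp h1 h2 : C1m h1 -> C1m h2 -> C1m (h2 \o h1).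
Proof.
move=> C1 C2; have [ch1 D1] := C1; have [ch2 D2] := C2; split.
  by move=> p; apply: (@continuous_comp _ _ _ h1 h2); [exact: ch1|exact: ch2].
move=> c c'' ac ac'' y oy; pose c' := chart_at X (h1 (cinv c y)).
have ac' : atlas X c' by exact: chart_at_atlas.
have [iy hy] := (ovP (h2 \o h1) c c'' y).1 oy.
have o1 : ov h1 c c' y by apply/ovP; split => //; exact: mem_chart_at.
have o2 : ov h2 c' c'' (hc h1 c c' y) by apply/(ov_comp h2 c'' o1).
have [dd _] := chain C1 C2 ac ac' ac'' o1 o2; split => // e e0.
have [K1 K10 b1] := C1m_bound C1 ac ac' o1; have [K2 K20 b2] := C1m_bound C2 ac' ac'' o2.
have [_ J1] := D1 c c' ac ac' y o1; have [_ J2] := D2 c' c'' ac' ac'' _ o2.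
pose e' := e / (K1 + K2 + 1); have K3 : 0 < K1 + K2 + 1 by rewrite ltr_wpDl// addr_ge0.
have e'0 : 0 < e' by rewrite divr_gt0.
have g1 := hc_cont ch1 o1.
have n1 := ov_near ch1 o1; have n2 := ov_near (h := h2 \o h1) (c := c) (c' := c'') _ oy.
have {}n2 : \forall z \near y, ov (h2 \o h1) c c'' z.
  by apply: n2 => p; apply: (@continuous_comp _ _ _ h1 h2); [exact: ch1|exact: ch2].
have n3 : \forall z \near y, opb (Jh h2 c' c'' (hc h1 c c' z) - Jh h2 c' c'' (hc h1 c c' y)) e' := g1 _ (J2 _ e'0).
have n4 := J1 _ e'0.
have n5 : \forall z \near y, opb (Jh h2 c' c'' (hc h1 c c' z)) K2 := g1 _ b2.
apply: filter_app n5; apply: filter_app n4; apply: filter_app n3; apply: filter_app n2; apply: filterS n1.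
move=> z z1 z2 z3 z4 z5.
have [_ ->] := chain C1 C2 ac ac' ac'' o1 o2.
have z6 : ov h2 c' c'' (hc h1 c c' z) by apply/(ov_comp h2 c'' z1).
have [_ ->] := chain C1 C2 ac ac' ac'' z1 z6.
apply: (@opb_le _ _ _ _ (e' * K2 + K1 * e')).
  have : e' * (K1 + K2 + 1) = e by rewrite /e' mulfVK// gt_eqF.
  by move: e'0; lra.
apply: opb_mulB => //; try exact: ltW; exact: nbhs_singleton b1.
Qed.

Lemma C1m_id : C1m id.
Proof.
apply: C1mP; split; first by move=> p _; exact: cvg_id.
move=> c c' ac ac'; have := atlas_smooth ac ac' 1.
rewrite /chart_overlap.
have -> : setT `&` cdom c `&` id @^-1` cdom c' = cdom c `&` cdom c' by rewrite setTI.
by [].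
Qed.

Lemma C1m_iter h n : C1m h -> C1m (iter n h).
Proof.
move=> C1; elim: n => [|n IH]; first exact: C1m_id.
exact: (C1m_comp IH C1).
Qed.

Definition hol (alpha : R) h := forall c c', atlas X c -> atlas X c' -> forall y, ov h c c' y ->
  exists2 K : R, 0 <= K & exists2 e : R, 0 < e & forall z z', `|z - y| <= e -> `|z' - y| <= e ->
    ov h c c' z /\ opb (Jh h c c' z - Jh h c c' z') (K * `|z - z'| `^ alpha).

Lemma near_ball (A : set V) y : (\forall z \near y, A z) -> exists2 e : R, 0 < e & forall z, `|z - y| <= e -> A z.
Proof.
move=> /nbhs_ballP[e /= e0 he]; exists (e / 2); first by rewrite divr_gt0.
move=> z hz; apply: he; rewrite -ball_normE/= distrC; apply: le_lt_trans hz _.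
by rewrite ltr_pdivrMr// ltr_pMr// ltr1n.
Qed.

Lemma holP (alpha : R) h : holder_derivative X alpha h -> hol alpha h.
Proof.
move=> hh c c' ac ac' y oy; have [U [K [nU UO hU]]] := hh c c' ac ac' y oy.
have [e e0 he] := near_ball nU.
exists `|K| => //; exists e => // z z' hz hz'; split; first exact/UO/he.
move=> v; have := hU z z' (he _ hz) (he _ hz') v; move=> /JhB_le/le_trans; apply.
by rewrite ler_wpM2r// ler_wpM2r ?powR_ge0// ler_norm.
Qed.

Lemma hc_lip h c c' y (e K : R) : C1m h -> atlas X c -> atlas X c' ->
  (forall z, `|z - y| <= e -> ov h c c' z /\ opb (Jh h c c' z) K) ->
  forall z z', `|z - y| <= e -> `|z' - y| <= e -> `|hc h c c' z - hc h c c' z'| <= K * `|z - z'|.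
Proof.
move=> [_ C1] ac ac' hb z z' hz hz'.
have := @mean_value R d d (hc h c c') [set w | `|w - y| <= e] 0 K z z'.
rewrite mulmx0 subr0; apply; first by move=> t; exact: seg_ball.
move=> w hw; have [ow bw] := hb w hw; split; first by have [] := C1 c c' ac ac' w ow.
by move=> v; rewrite mulmx0 subr0 JhE.
Qed.

Lemma hol_comp (alpha : R) h1 h2 : 0 < alpha -> C1m h1 -> C1m h2 -> hol alpha h1 -> hol alpha h2 -> hol alpha (h2 \o h1).
Proof.
move=> al0 C1 C2 H1 H2 c c'' ac ac'' y oy; pose c' := chart_at X (h1 (cinv c y)).
have [ch1 D1] := C1; have [ch2 D2] := C2.
have ac' : atlas X c' by exact: chart_at_atlas.
have [iy hy] := (ovP (h2 \o h1) c c'' y).1 oy.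
have o1 : ov h1 c c' y by apply/ovP; split => //; exact: mem_chart_at.
have o2 : ov h2 c' c'' (hc h1 c c' y) by apply/(ov_comp h2 c'' o1).
have [K1 K10 b1] := C1m_bound C1 ac ac' o1; have [K2 K20 b2] := C1m_bound C2 ac' ac'' o2.
have [k1 k10 [e1 e10 h1h]] := H1 c c' ac ac' y o1.
have [k2 k20 [e2 e20 h2h]] := H2 c' c'' ac' ac'' _ o2.
have g1 := hc_cont ch1 o1.
have n2 : \forall z \near y, `|hc h1 c c' z - hc h1 c c' y| <= e2.
  by move: g1 => /cvgrPdist_le/(_ _ e20); apply: filterS => z; rewrite distrC.
have nn : \forall z \near y, [/\ ov h1 c c' z, opb (Jh h1 c c' z) K1, opb (Jh h2 c' c'' (hc h1 c c' z)) K2 &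
    `|hc h1 c c' z - hc h1 c c' y| <= e2].
  have n3 : \forall z \near y, opb (Jh h2 c' c'' (hc h1 c c' z)) K2 := g1 _ b2.
  apply: filter_app n2; apply: filter_app n3; apply: filter_app b1.
  by apply: filterS (ov_near ch1 o1) => z.
have [e3 e30 he3] := near_ball nn.
pose e := Num.min e1 e3.
have ee1 z : `|z - y| <= e -> `|z - y| <= e1 by move=> /le_trans; apply; rewrite ge_min lexx.
have ee3 z : `|z - y| <= e -> `|z - y| <= e3 by move=> /le_trans; apply; rewrite ge_min lexx orbT.
(* Product rule for Hoelder bounds: the variation of the first Jacobian times the size of the
   second, plus the size of the first times the variation of the second, taken at points that h1
   spreads by at most K1. *)
exists (k1 * K2 + K1 * (k2 * K1 `^ alpha)).
  by rewrite addr_ge0// !mulr_ge0// powR_ge0.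
exists e; first by rewrite lt_min e10.
move=> z z' hz hz'.
have [oz bz bz2 dz] := he3 z (ee3 z hz); have [oz' bz' bz2' dz'] := he3 z' (ee3 z' hz').
have [p1 J1] := h1h z z' (ee1 z hz) (ee1 z' hz').
have [p2 J2] := h2h _ _ dz dz'.
have [p3 _] := h2h _ _ dz' dz.
split; first by apply/(ov_comp h2 c'' oz).
have [_ ->] := chain C1 C2 ac ac' ac'' oz p2; have [_ ->] := chain C1 C2 ac ac' ac'' oz' p3.
have lip : `|hc h1 c c' z - hc h1 c c' z'| <= K1 * `|z - z'|.
  apply: (@hc_lip h1 c c' y e3 K1 C1 ac ac') => //; try exact: ee3.
  by move=> w hw; have [] := he3 w hw.
have po : (K1 * `|z - z'|) `^ alpha = K1 `^ alpha * `|z - z'| `^ alpha by rewrite powRM.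
have lp : `|hc h1 c c' z - hc h1 c c' z'| `^ alpha <= K1 `^ alpha * `|z - z'| `^ alpha.
  by rewrite -po; apply: ge0_ler_powR => //; rewrite ?nnegrE ?mulr_ge0// ltW.
have P0 := powR_ge0 (`|z - z'|) alpha; have P1 := powR_ge0 K1 alpha.
have P2 := powR_ge0 (`|hc h1 c c' z - hc h1 c c' z'|) alpha.
apply: (@opb_le _ _ _ _ ((k1 * `|z - z'| `^ alpha) * K2 + K1 * (k2 * `|hc h1 c c' z - hc h1 c c' z'| `^ alpha))).
  rewrite mulrDl lerD//; first by rewrite mulrAC.
  by rewrite -!mulrA ler_wpM2l// ler_wpM2l.
by apply: (opb_mulB K20 _ K10 _ bz' bz2 J1 J2); rewrite mulr_ge0.
Qed.

Lemma hol_iter (alpha : R) h n : 0 < alpha -> C1m h -> hol alpha h -> hol alpha (iter n.+1 h).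
Proof.
move=> al0 C1 hh; elim: n => [|n IH]; first exact: hh.
exact: (hol_comp al0 (C1m_iter _ C1) C1 IH hh).
Qed.

End AtlasCalculus.

(** * Uniform constants over finitely many charts *)

Section Pieces.
Variables (R : realType) (d : nat) (M : ptopologicalType) (X : manifold R d M).
Notation V := 'rV[R]_d.
Hypotheses (hM : hausdorff_space M) (cM : compact [set: M]).

Lemma nat_bound (e K : R) : 0 < e -> exists n0, forall n, (n0 <= n)%N -> n.+1%:R^-1 <= e /\ K <= n%:R.
Proof.
move=> e0; exists (maxn (Num.truncn e^-1) (Num.truncn `|K|).+1) => n; rewrite geq_max => /andP[h1 h2]; split.
  rewrite -[leRHS]invrK lef_pV2 ?posrE ?invr_gt0//.
  by apply: le_trans (ltW (truncnS_gt _)) _; rewrite ler_nat.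
by apply: le_trans (ler_norm _) _; apply: le_trans (ltW (truncnS_gt _)) _; rewrite ler_nat.
Qed.

(** The cores of radius Rc cover the manifold, and the collar of width Rm still lies in the chart;
    so around every point one chart can be used on a scale independent of the point. *)
Definition pieces (I : finType) (ch : I -> chart R d M) (yc : I -> V) (Rc : I -> R) (Rm : R) :=
  [/\ 0 < Rm, forall i, atlas X (ch i), forall i z, `|z - yc i| <= Rc i + Rm -> img (ch i) z &
   forall p, exists i, cdom (ch i) p /\ `|cmap (ch i) p - yc i| <= Rc i].

Lemma pieces_exist : exists (k : nat) (ch : 'I_k -> chart R d M) yc Rc Rm, pieces ch yc Rc Rm.
Proof.
have he p : exists e : R, 0 < e /\ forall z, `|z - cmap (chart_at X p) p| <= e -> img (chart_at X p) z.
  have h : img (chart_at X p) (cmap (chart_at X p) p) by apply: img_cmap; exact: mem_chart_at.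
  by have [e e0 he] := near_ball (open_near (img_open (c := chart_at X p)) h); exists e.
have [e eP] := choice he.
have e0 p : 0 < e p by have [] := eP p.
pose U p : set M := cdom (chart_at X p) `&` [set q | `|cmap (chart_at X p) q - cmap (chart_at X p) p| < e p / 2].
have oU p : open (U p).
  rewrite openE => q [dq /= hq]; apply: filterI; first exact: (open_near (cdom_open _)).
  have h0 : 0 < e p / 2 - `|cmap (chart_at X p) q - cmap (chart_at X p) p| by rewrite subr_gt0.
  have := cmap_continuous dq; move=> /cvgrPdist_lt/(_ _ h0); apply: filterS => z /= hz.
  rewrite -(subrKA (cmap (chart_at X p) q)); apply: le_lt_trans (ler_normD _ _) _.
  by rewrite -ltrBrDr [`|cmap _ z - _|]distrC.
have Up p : U p p by split; [exact: mem_chart_at|rewrite /= subrr normr0 divr_gt0].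
have := cM; rewrite compact_cover => /(_ M setT U).
case=> [p _|p _|D _ cov0]; first exact: oU.
  by exists p.
have [D' fD cov] : exists2 D', finite_set D' & setT `<=` classical_sets.cover D' U.
  exact: (ex_intro2 _ _ _ (finite_fset D) cov0).
move/finite_seqP: fD => [s sD].
pose t (i : 'I_(size s)) := tnth (in_tuple s) i.
have [|n0 hn] := @fin_unif 'I_(size s) (fun n i => n.+1%:R^-1 <= e (t i) / 2) _.
  move=> i; have h : 0 < e (t i) / 2 by rewrite divr_gt0.
  by have [n0 hn] := nat_bound 0 h; exists n0 => n /hn[].
exists (size s), (fun i => chart_at X (t i)), (fun i => cmap (chart_at X (t i)) (t i)), (fun i => e (t i) / 2), n0.+1%:R^-1.
split.
- by rewrite invr_gt0.
- by move=> i; exact: chart_at_atlas.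
- move=> i z hz; have [_ he'] := eP (t i); apply: he'; apply: le_trans hz _.
  rewrite [leRHS](_ : _ = e (t i) / 2 + e (t i) / 2); last by field.
  by rewrite lerD2l; exact: hn.
- move=> p; have [q qD [pd pU]] := cov p I.
  have qs : q \in s by move: qD; rewrite sD.
  have [i qi] : exists i, q = t i.
    by have := qs; rewrite -[s]/(tval (in_tuple s)) => /tnthP.
  by exists i; rewrite -qi; split => //; exact: ltW.
Qed.

Variables (I : finType) (ch : I -> chart R d M) (yc : I -> V) (Rc : I -> R) (Rm : R).
Hypothesis hp : pieces ch yc Rc Rm.

Definition piece i (z : V) := `|z - yc i| <= Rc i + Rm.
Definition hit h i j (z : V) := piece i z /\ exists w, piece j w /\ h (cinv (ch i) z) = cinv (ch j) w.

Lemma big_img i z : piece i z -> img (ch i) z. Proof. by have [_ _ h _] := hp; exact: h. Qed.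
Lemma ch_atlas i : atlas X (ch i). Proof. by have [_ h _ _] := hp. Qed.

Lemma big_compact i : compact [set z | piece i z]. Proof. exact: cball_compact. Qed.

Lemma big_image_closed i : closed (cinv (ch i) @` [set z | piece i z]).
Proof.
apply: compact_closed => //; apply: continuous_compact; last exact: big_compact.
apply/subspace_continuousP => z hz; apply: cvg_within_filter.
exact: (cinv_cont (big_img hz)).
Qed.

(** If the image of z0 misses the closed piece j, so do the images of nearby points and nothing is
    to be shown; otherwise z0 is in the overlap and the local hypothesis applies. Compactness of the
    pieces makes the threshold uniform. *)
Lemma ov_unif h (Q : I -> I -> nat -> V -> Prop) : continuous h ->
  (forall i j z0, piece i z0 -> ov h (ch i) (ch j) z0 -> exists n0, \forall z \near z0, forall n, (n0 <= n)%N -> Q i j n z) ->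
  exists n0, forall n i j z, (n0 <= n)%N -> hit h i j z -> Q i j n z.
Proof.
move=> ch_ hQ.
have [|n0 hn] := @fin_unif (I * I)%type (fun n ij => forall z, hit h ij.1 ij.2 z -> Q ij.1 ij.2 n z).
  move=> [i j] /=.
  pose Z : set M := cinv (ch j) @` [set z | piece j z].
  have [|n0 hn] := @compact_unif V [set z | piece i z] (fun n z => Z (h (cinv (ch i) z)) -> Q i j n z) (@big_compact i).
    move=> z0 bz0; case: (pselect (Z (h (cinv (ch i) z0)))) => hz.
      have o : ov h (ch i) (ch j) z0.
        apply/ovP; split; first exact: big_img.
        by have [w bw <-] := hz; have [] := imgP (big_img bw).
      have [n0 hn] := hQ i j z0 bz0 o; exists n0; apply: filterS hn => z hz' n ln _; exact: hz'.
    exists 0%N; have := hc_cont_pre ch_ (big_img bz0) (open_near (closed_openC (@big_image_closed j)) hz).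
    by apply: filterS => z hz' n _ /hz'.
  exists n0 => n ln z [bz [w [bw e]]]; apply: hn => //; exists w => //.
by exists n0 => n i j z ln; exact: (hn n (i, j) ln z).
Qed.

Lemma C1_unif h : C1m X h -> exists2 rho : R, 0 < rho & exists2 K : R, 0 <= K & forall i j z z', hit h i j z -> `|z' - z| <= rho ->
  ov h (ch i) (ch j) z' /\ opb (Jh h (ch i) (ch j) z') K.
Proof.
move=> C1; have [ch_ _] := C1.
have [|n0 hn] := @ov_unif h (fun i j n z => forall z', `|z' - z| <= n.+1%:R^-1 ->
    ov h (ch i) (ch j) z' /\ opb (Jh h (ch i) (ch j) z') n%:R) ch_.
  move=> i j z0 bz0 o; have [K K0 hK] := C1m_bound C1 (ch_atlas i) (ch_atlas j) o.
  have [e e0 he] := near_ball (filterI (ov_near ch_ o) hK).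
  have e2 : 0 < e / 2 by rewrite divr_gt0.
  have [n0 hn] := nat_bound K e2; exists n0.
  have : \forall z \near z0, `|z - z0| <= e / 2.
    by apply/nbhs_ballP; exists (e / 2) => //= z; rewrite -ball_normE/= distrC => /ltW.
  apply: filterS => z hz n /hn[h1 h2] z' hz'.
  have [|o' b'] := he z'; last by split => //; exact: opb_le b'.
  rewrite -(subrKA z) (le_trans (ler_normD _ _))// [leRHS](_ : _ = e / 2 + e / 2); last by field.
  by rewrite lerD// (le_trans hz').
exists n0.+1%:R^-1; first by rewrite invr_gt0.
by exists n0%:R => // i j z z' hz; exact: (hn n0 i j z).
Qed.

Lemma hol_unif (alpha : R) h : C1m X h -> hol X alpha h -> exists2 rho : R, 0 < rho & exists2 K : R, 0 <= K &
  forall i j z z' z'', hit h i j z -> `|z' - z| <= rho -> `|z'' - z| <= rho ->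
  opb (Jh h (ch i) (ch j) z' - Jh h (ch i) (ch j) z'') (K * `|z' - z''| `^ alpha).
Proof.
move=> C1 hh; have [ch_ _] := C1.
have [|n0 hn] := @ov_unif h (fun i j n z => forall z' z'', `|z' - z| <= n.+1%:R^-1 -> `|z'' - z| <= n.+1%:R^-1 ->
    opb (Jh h (ch i) (ch j) z' - Jh h (ch i) (ch j) z'') (n%:R * `|z' - z''| `^ alpha)) ch_.
  move=> i j z0 bz0 o; have [K K0 [e e0 he]] := hh _ _ (ch_atlas i) (ch_atlas j) _ o.
  have e2 : 0 < e / 2 by rewrite divr_gt0.
  have [n0 hn] := nat_bound K e2; exists n0.
  have : \forall z \near z0, `|z - z0| <= e / 2.
    by apply/nbhs_ballP; exists (e / 2) => //= z; rewrite -ball_normE/= distrC => /ltW.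
  apply: filterS => z hz n /hn[h1 h2] z' z'' hz' hz''.
  have tri w : `|w - z| <= n.+1%:R^-1 -> `|w - z0| <= e.
    move=> hw; rewrite -(subrKA z) (le_trans (ler_normD _ _))// [leRHS](_ : _ = e / 2 + e / 2); last by field.
    by rewrite lerD// (le_trans hw).
  have [_] := he z' z'' (tri _ hz') (tri _ hz''); apply: opb_le.
  by rewrite ler_wpM2r// powR_ge0.
exists n0.+1%:R^-1; first by rewrite invr_gt0.
by exists n0%:R => // i j z z' z'' hz; exact: (hn n0 i j z).
Qed.

End Pieces.

Section JhId.
Variables (R : realType) (d : nat) (M : ptopologicalType) (X : manifold R d M).
Notation V := 'rV[R]_d.

Lemma Jh_id (c : chart R d M) y : img c y -> Jh id c c y = 1%:M.
Proof.
move=> iy; apply/row_matrixP => j; rewrite !rowE mulmx1 -JhE.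
have hy : hc id c c y = y by have [_ e] := imgP iy; rewrite hcE e.
have [||_ e] := @differentiable_epsP R V V (hc id c c) y (idfun : {linear V -> V}).
- by move=> z; exact: cvg_id.
- move=> e e0; apply: filterS (open_near (img_open (c := c)) iy) => z /imgP[_ ez].
  by rewrite [hc id c c z]hcE ez hy /= subrr normr0 mulr_ge0// ltW.
exact: (congr1 (fun F : V -> V => F (delta_mx 0 j)) e).
Qed.

Lemma Jh_inv (c c' : chart R d M) y : atlas X c -> atlas X c' -> ov id c c' y ->
  Jh id c c' y *m Jh id c' c (hc id c c' y) = 1%:M.
Proof.
move=> ac ac' o; have [iy hy] := (ovP id c c' y).1 o.
have o' : ov id c' c (hc id c c' y).
  by apply/ovP; split; [exact: hc_img|rewrite hcK//; have [] := imgP iy].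
have C := C1m_id X; have [_ e] := chain C C ac ac' ac o o'.
by rewrite -e; exact: Jh_id.
Qed.

End JhId.

(** * Riemannian norms in charts *)

Section RealFunctions.
Variable R : realType.

Lemma real_cont_sum (T : topologicalType) (J : finType) (F : J -> T -> R) x :
  (forall j, {for x, continuous (F j)}) -> {for x, continuous (fun y => \sum_j F j y : R)}.
Proof.
move=> h; rewrite /continuous_at.
suff H (s : seq J) : (fun y => \sum_(j <- s) F j y : R) @ x --> (\sum_(j <- s) F j x : R).
  by have := H (index_enum J).
elim: s => [|j s IH].
  by rewrite big_nil; under eq_fun do rewrite big_nil; exact: cvg_cst.
by rewrite big_cons; under eq_fun do rewrite big_cons; apply: cvgD; [exact: h|exact: IH].
Qed.

Lemma real_contM (T : topologicalType) (F G : T -> R) x :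
  {for x, continuous F} -> {for x, continuous G} -> {for x, continuous (fun y => F y * G y : R)}.
Proof. by move=> hF hG; apply: cvgM. Qed.

Lemma real_cont_le (T : topologicalType) (f : T -> R) x :
  (forall e : R, 0 < e -> \forall y \near x, `|f x - f y| <= e) -> {for x, continuous f}.
Proof. by move=> h; apply/(@cvgrPdist_le R R). Qed.

Lemma real_cont_near (T : topologicalType) (f h : T -> R) x :
  (\forall y \near x, f y = h y) -> {for x, continuous f} -> {for x, continuous h}.
Proof.
move=> fh cf; apply: real_cont_le => e e0; have fhx := nbhs_singleton fh.
have := cf; move=> /(@cvgrPdist_le R R)/(_ _ e0); apply: filterS2 fh => y <-.
by rewrite fhx.
Qed.

Lemma real_cont_cst (T : topologicalType) (k : R) (x : T) : {for x, continuous (fun _ : T => k)}.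
Proof. by apply: real_cont_le => e e0; apply: filterE => y; rewrite subrr normr0 ltW. Qed.

End RealFunctions.

Section Metric.
Variables (R : realType) (d : nat) (M : ptopologicalType) (X : manifold R d M) (g : riemannian_metric X).
Notation V := 'rV[R]_d.
Implicit Types (c : chart R d M) (h : M -> M).

Lemma metricD p u v w : metric g p (u + v) w = metric g p u w + metric g p v w.
Proof. by have := metric_linear g p 1 u v w; rewrite scale1r mul1r. Qed.
Lemma metric0 p w : metric g p 0 w = 0.
Proof. by have := metricD p 0 0 w; rewrite addr0 => /eqP; rewrite -subr_eq0 opprD addNKr oppr_eq0 => /eqP. Qed.
Lemma metricZ p a u w : metric g p (a *: u) w = a * metric g p u w.
Proof. by have := metric_linear g p a u 0 w; rewrite !addr0 metric0 addr0. Qed.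

(* The squared Riemannian norm of the image under [h] of the vector with coordinates [w] at [y] in the chart [c]. *)
Definition bil h c (y u w : V) : R :=
  metric g (h (cinv c y)) (u *m Jh h c (chart_at X (h (cinv c y))) y) (w *m Jh h c (chart_at X (h (cinv c y))) y).
Definition q h c y w := bil h c y w w.

Lemma bilD h c y u v w : bil h c y (u + v) w = bil h c y u w + bil h c y v w.
Proof. by rewrite /bil mulmxDl metricD. Qed.
Lemma bilZ h c y a u w : bil h c y (a *: u) w = a * bil h c y u w.
Proof. by rewrite /bil -scalemxAl metricZ. Qed.
Lemma bil_sym h c y u w : bil h c y u w = bil h c y w u.
Proof. exact: Defs.metric_sym. Qed.

Lemma bil_sum h c y u w : bil h c y u w = \sum_a \sum_b u 0 a * w 0 b * bil h c y (delta_mx 0 a) (delta_mx 0 b).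
Proof.
have h0 (w' : V) : bil h c y 0 w' = 0 by have := bilZ h c y 0 0 w'; rewrite scale0r mul0r.
have one (u' w' : V) : bil h c y u' w' = \sum_a u' 0 a * bil h c y (delta_mx 0 a) w'.
  rewrite {1}(row_sum_delta u').
  by elim/big_rec2: _ => [|a x z _ <-]; rewrite ?h0// bilD bilZ.
rewrite one; apply: eq_bigr => a _.
rewrite bil_sym one mulr_sumr; apply: eq_bigr => b _.
by rewrite bil_sym mulrA.
Qed.

Lemma q_ge0 h c y w : 0 <= q h c y w.
Proof.
rewrite /q /bil; set u := w *m _; case: (eqVneq u 0) => [->|u0]; first by rewrite metric0.
exact/ltW/metric_pos.
Qed.

Lemma qZ h c y a w : q h c y (a *: w) = a ^+ 2 * q h c y w.
Proof. by rewrite /q bilZ bil_sym bilZ mulrA expr2. Qed.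

Lemma qN h c y w : q h c y (- w) = q h c y w.
Proof. by rewrite -scaleN1r qZ sqrrN expr1n mul1r. Qed.

Lemma qD h c y u w : q h c y (u + w) <= 2 * q h c y u + 2 * q h c y w.
Proof.
have e1 : q h c y (u + w) = q h c y u + q h c y w + 2 * bil h c y u w.
  by rewrite /q bilD bil_sym bilD (bil_sym _ _ _ w (u + w)) bilD (bil_sym _ _ _ w u); ring.
have e2 : q h c y (u - w) = q h c y u + q h c y w - 2 * bil h c y u w.
  rewrite -[u - w]/(u + (- w)) /q bilD bil_sym bilD (bil_sym _ _ _ (- w) (u + (- w))) bilD.
  have N (x z : V) : bil h c y (- x) z = - bil h c y x z by rewrite -scaleN1r bilZ mulN1r.
  by rewrite !N !(bil_sym _ _ _ _ (- w)) !N (bil_sym _ _ _ w u); ring.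
by have := q_ge0 h c y (u - w); rewrite e1 e2; lra.
Qed.

Lemma q_comp h1 h2 c c' y w : C1m X h1 -> C1m X h2 -> atlas X c -> atlas X c' -> ov h1 c c' y ->
  q (h2 \o h1) c y w = q h2 c' (hc h1 c c' y) (w *m Jh h1 c c' y).
Proof.
move=> C1 C2 ac ac' o1; rewrite /q /bil /=.
have e0 := hcK o1; rewrite e0.
set c'' := chart_at X (h2 (h1 (cinv c y))).
have o2 : ov h2 c' c'' (hc h1 c c' y).
  by apply/ovP; split; [exact: hc_img|rewrite e0; exact: mem_chart_at].
have [_ e] := chain C1 C2 ac ac' (chart_at_atlas X _) o1 o2.
by rewrite -/c'' e mulmxA.
Qed.

Lemma of_chartE c y v : of_chart X c y v = v *m Jh id c (chart_at X (cinv c y)) y.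
Proof. exact: (dE id c (chart_at X (cinv c y)) y v). Qed.

(** [bil] passes through the preferred chart at a moving point, which may jump. Rewritten in a fixed
    chart c', it is a polynomial in continuous quantities and the smooth metric coefficients. *)
Lemma q_local h c c' y u w : C1m X h -> atlas X c -> atlas X c' -> ov h c c' y ->
  bil h c y u w = \sum_a \sum_b (u *m Jh h c c' y) 0 a * (w *m Jh h c c' y) 0 b *
     metric g (cinv c' (hc h c c' y)) (of_chart X c' (hc h c c' y) (delta_mx 0 a)) (of_chart X c' (hc h c c' y) (delta_mx 0 b)).
Proof.
move=> C1 ac ac' o; set z := hc h c c' y.
have e (v : V) : v *m Jh h c (chart_at X (h (cinv c y))) y = of_chart X c' z (v *m Jh h c c' y).
  rewrite of_chartE -mulmxA; congr (_ *m _).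
  have ez : cinv c' z = h (cinv c y) by exact: hcK.
  have o2 : ov id c' (chart_at X (h (cinv c y))) z.
    by apply/ovP; split; [exact: hc_img|rewrite ez; exact: mem_chart_at].
  have [_ e] := chain C1 (C1m_id X) ac ac' (chart_at_atlas X _) o o2.
  by rewrite ez; exact: e.
have -> : bil h c y u w = bil id c' z (u *m Jh h c c' y) (w *m Jh h c c' y).
  by rewrite /bil !e !of_chartE (hcK o).
rewrite bil_sum; apply: eq_bigr => a _; apply: eq_bigr => b _; congr (_ * _).
by rewrite /bil !of_chartE.
Qed.

Lemma bil_cont h c y u w : C1m X h -> atlas X c -> img c y -> {for y, continuous (fun z => bil h c z u w)}.
Proof.
move=> C1 ac iy; have [ch D1] := C1; pose c' := chart_at X (h (cinv c y)).
have ac' : atlas X c' by exact: chart_at_atlas.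
have o : ov h c c' y by apply/ovP; split => //; exact: mem_chart_at.
have near_e : \forall z \near y, \sum_a \sum_b (u *m Jh h c c' z) 0 a * (w *m Jh h c c' z) 0 b *
     metric g (cinv c' (hc h c c' z)) (of_chart X c' (hc h c c' z) (delta_mx 0 a)) (of_chart X c' (hc h c c' z) (delta_mx 0 b)) = bil h c z u w.
  by apply: filterS (ov_near ch o) => z oz; rewrite (q_local u w C1 ac ac' oz).
have Jc (v : V) a : {for y, continuous (fun z : V => (v *m Jh h c c' z) 0 a : R)}.
  have [_ hJ] := D1 c c' ac ac' y o; apply: real_cont_le => e e0.
  have e1 : 0 < e / (1 + `|v|) by rewrite divr_gt0// ltr_wpDr.
  apply: filterS (hJ _ e1) => z hz.
  have -> : (v *m Jh h c c' y) 0 a - (v *m Jh h c c' z) 0 a = - (v *m (Jh h c c' z - Jh h c c' y)) 0 a.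
    by rewrite mulmxBr !mxE opprB.
  rewrite normrN; apply: le_trans (rV_coord_le _ a) _; apply: le_trans (hz v) _.
  rewrite mulrAC ler_pdivrMr ?ltr_wpDr//; apply: ler_wpM2l; first exact: ltW.
  by rewrite lerDr ler01.
apply: (real_cont_near near_e).
apply: real_cont_sum => a; apply: real_cont_sum => b.
apply: real_contM; first by apply: real_contM; exact: Jc.
have := metric_smooth g ac' (delta_mx 0 a) (delta_mx 0 b) 0 _ (hc_img o).
move=> hm; apply: (@continuous_comp _ _ _ (hc h c c') (fun z => metric g (cinv c' z) (of_chart X c' z (delta_mx 0 a)) (of_chart X c' z (delta_mx 0 b)) : R)); last exact: hm.
exact: hc_cont.
Qed.

Lemma q_pos c y w : atlas X c -> img c y -> w != 0 -> 0 < q id c y w.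
Proof.
move=> ac iy w0; apply: metric_pos.
have o : ov id c (chart_at X (cinv c y)) y by apply/ovP; split => //; exact: mem_chart_at.
have e := Jh_inv ac (chart_at_atlas X _) o.
apply: contraNneq w0 => h; rewrite -[w]mulmx1 -e mulmxA.
by rewrite /= in h; rewrite h mul0mx.
Qed.

Lemma tangent_mapE h p v : tangent_map X h p v = v *m Jh h (chart_at X p) (chart_at X (h p)) (cmap (chart_at X p) p).
Proof. by rewrite /tangent_map lfunE; exact: (dE h (chart_at X p) (chart_at X (h p)) _ v). Qed.

Definition to_T c (y v : V) : V := v *m Jh id c (chart_at X (cinv c y)) y.

Lemma q_tnorm h c y v : C1m X h -> atlas X c -> img c y ->
  q h c y v = tnorm g (h (cinv c y)) (tangent_map X h (cinv c y) (to_T c y v)) ^+ 2.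
Proof.
move=> C1 ac iy; set p := cinv c y.
have o : ov id c (chart_at X p) y by apply/ovP; split => //; exact: mem_chart_at.
rewrite -[h]/(h \o id) (q_comp v (C1m_id X) C1 ac (chart_at_atlas X p) o).
have e1 : hc id c (chart_at X p) y = cmap (chart_at X p) p by rewrite hcE.
rewrite /tnorm sqr_sqrtr.
  rewrite tangent_mapE /to_T /q /bil e1 cmapK//; exact: mem_chart_at.
set u := tangent_map _ _ _ _; case: (eqVneq u 0) => [->|u0]; first by rewrite metric0.
exact/ltW/metric_pos.
Qed.

Variables (I : finType) (ch : I -> chart R d M) (yc : I -> V) (Rc : I -> R) (Rm : R).
Hypothesis hp : pieces X ch yc Rc Rm.
Notation big := (piece yc Rc Rm).

Lemma big_unif (J : finType) (G : I -> J -> V -> R) (zeta : R) : 0 < zeta ->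
  (forall i j y, big i y -> {for y, continuous (G i j)}) ->
  exists n0, forall n i j y, (n0 <= n)%N -> big i y -> `|G i j y| <= n%:R /\ forall y', `|y' - y| <= n.+1%:R^-1 -> `|G i j y' - G i j y| <= zeta.
Proof.
move=> z0 Gc.
have [|n0 hn] := @fin_unif (I * J)%type (fun n ij => forall y, big ij.1 y -> `|G ij.1 ij.2 y| <= n%:R /\
   forall y', `|y' - y| <= n.+1%:R^-1 -> `|G ij.1 ij.2 y' - G ij.1 ij.2 y| <= zeta).
  move=> [i j] /=.
  have [|n0 hn] := @compact_unif V [set z | big i z] (fun n y => `|G i j y| <= n%:R /\
   forall y', `|y' - y| <= n.+1%:R^-1 -> `|G i j y' - G i j y| <= zeta) (@big_compact R d I yc Rc Rm i).
    move=> y0 by0; have z2 : 0 < zeta / 2 by rewrite divr_gt0.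
    have := Gc i j y0 by0; move=> /cvgrPdist_le/(_ _ z2)/near_ball[e e0 he].
    have e2 : 0 < e / 2 by rewrite divr_gt0.
    have [n0 hn] := nat_bound (`|G i j y0| + zeta) e2; exists n0.
    have : \forall z \near y0, `|z - y0| <= e / 2.
      by apply/nbhs_ballP; exists (e / 2) => //= z; rewrite -ball_normE/= distrC => /ltW.
    apply: filterS => y hy n /hn[h1 h2].
    have hye : `|G i j y0 - G i j y| <= zeta / 2 by apply: he; apply: le_trans hy _; rewrite ler_pdivrMr// ler_peMr ?ler1n// ltW.
    split.
      apply: le_trans h2; rewrite -(subrK (G i j y0) (G i j y)); apply: le_trans (ler_normD _ _) _.
      by rewrite addrC lerD2l distrC; move: hye z0; lra.
    move=> y' hy'; have hye' : `|G i j y0 - G i j y'| <= zeta / 2.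
      apply: he; rewrite -(subrKA y) (le_trans (ler_normD _ _))// [leRHS](_ : _ = e / 2 + e / 2); last by field.
      by rewrite lerD// (le_trans hy').
    rewrite -(subrKA (G i j y0)); apply: le_trans (ler_normD _ _) _.
    rewrite [`|G i j y' - _|]distrC [leRHS](_ : _ = zeta / 2 + zeta / 2); last by field.
    exact: lerD.
  by exists n0 => n ln y by0; exact: hn.
by exists n0 => n i j y ln; exact: (hn n (i, j) ln y).
Qed.

Lemma sum_ab_le (w : V) (G : 'I_d -> 'I_d -> R) (k : R) : (forall a b, `|G a b| <= k) ->
  `|\sum_a \sum_b w 0 a * w 0 b * G a b| <= d%:R ^+ 2 * k * `|w| ^+ 2.
Proof.
move=> h.
have -> : d%:R ^+ 2 * k * `|w| ^+ 2 = \sum_(a < d) \sum_(b < d) `|w| ^+ 2 * k.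
  by rewrite !sumr_const !card_ord -mulrnA -[RHS]mulr_natr natrM; ring.
apply: le_trans (ler_norm_sum _ _ _) _; apply: ler_sum => a _.
apply: le_trans (ler_norm_sum _ _ _) _; apply: ler_sum => b _.
rewrite !normrM; apply: ler_pM (h a b) => //.
by rewrite expr2; apply: ler_pM => //; exact: rV_coord_le.
Qed.

Lemma q_unif h (zeta : R) : C1m X h -> 0 < zeta -> exists2 rho : R, 0 < rho &
  forall i y y' w, big i y -> `|y' - y| <= rho -> `|q h (ch i) y' w - q h (ch i) y w| <= zeta * `|w| ^+ 2.
Proof.
move=> C1 z0.
have z1 : 0 < zeta / (d%:R ^+ 2 + 1) by rewrite divr_gt0// ltr_wpDl// sqr_ge0.
have [|n0 hn] := @big_unif ('I_d * 'I_d)%type (fun i ab y => bil h (ch i) y (delta_mx 0 ab.1) (delta_mx 0 ab.2)) _ z1.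
  by move=> i ab y by0; apply: bil_cont => //; [exact: (ch_atlas hp)|exact: (big_img hp)].
exists n0.+1%:R^-1; first by rewrite invr_gt0.
move=> i y y' w by0 hy'; rewrite /q bil_sum [X in _ - X]bil_sum -sumrB.
under eq_bigr do rewrite -sumrB; under eq_bigr do under eq_bigr do rewrite -mulrBr.
apply: le_trans (@sum_ab_le w _ (zeta / (d%:R ^+ 2 + 1)) _) _.
  by move=> a b; have [_ ] := hn n0 i (a, b) y (leqnn _) by0; apply.
rewrite ler_wpM2r ?sqr_ge0// mulrCA ler_piMr ?(ltW z0)// ler_pdivrMr ?ltr_wpDl ?sqr_ge0//.
by rewrite mul1r lerDl.
Qed.

Lemma q_upper h : C1m X h -> exists2 B : R, 0 < B & forall i y w, big i y -> q h (ch i) y w <= B * `|w| ^+ 2.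
Proof.
move=> C1.
have [|n0 hn] := @big_unif ('I_d * 'I_d)%type (fun i ab y => bil h (ch i) y (delta_mx 0 ab.1) (delta_mx 0 ab.2)) _ ltr01.
  by move=> i ab y by0; apply: bil_cont => //; [exact: (ch_atlas hp)|exact: (big_img hp)].
exists (d%:R ^+ 2 * n0%:R + 1); first by rewrite ltr_wpDl// mulr_ge0// sqr_ge0.
move=> i y w by0; apply: le_trans (_ : d%:R ^+ 2 * n0%:R * `|w| ^+ 2 <= _); last first.
  by rewrite ler_wpM2r ?sqr_ge0// lerDl.
rewrite /q bil_sum; apply: le_trans (ler_norm _) _.
by apply: sum_ab_le => a b; have [] := hn n0 i (a, b) y (leqnn _) by0.
Qed.

(** At one point: compactness of the unit sphere and homogeneity. Nearby: [q_unif] with half of that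
    bound. Then compactness of the pieces. *)
Lemma q_lower : exists2 c : R, 0 < c & forall i y w, big i y -> c * `|w| ^+ 2 <= q id (ch i) y w.
Proof.
pose S : set V := [set w | `|w| = 1].
have cS : compact S.
  apply: (@subclosed_compact _ S [set w | `|w - 0| <= 1]); last by move=> w /=; rewrite subr0 => ->.
    have -> : S = (fun w : V => `|w|) @^-1` [set t : R | t = 1] by [].
    by apply: closed_comp => [w _|]; [exact: norm_continuous|exact: closed_eq].
  exact: cball_compact.
have pos y0 i : big i y0 -> exists2 c : R, 0 < c & forall w, c * `|w| ^+ 2 <= q id (ch i) y0 w.
  move=> by0; have [|n0 hn] := @compact_unif V S (fun n w => n.+1%:R^-1 <= q id (ch i) y0 w) cS.
    move=> w0 /= w01.
    have q0 : 0 < q id (ch i) y0 w0.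
      apply: q_pos; [exact: (ch_atlas hp)|exact: (big_img hp)|].
      by rewrite -normr_gt0 w01.
    have q2 : 0 < q id (ch i) y0 w0 / 2 by rewrite divr_gt0.
    have [n0 hn] := nat_bound 0 q2; exists n0.
    have qc : {for w0, continuous (fun w => q id (ch i) y0 w)}.
      have -> : q id (ch i) y0 = (fun w => \sum_a \sum_b w 0 a * w 0 b * bil id (ch i) y0 (delta_mx 0 a) (delta_mx 0 b)).
        by apply/funext => w; exact: bil_sum.
      apply: real_cont_sum => a; apply: real_cont_sum => b.
      apply: real_contM; last exact: real_cont_cst.
      by apply: real_contM; exact: (@coord_continuous R 1 d).
    move: qc => /cvgrPdist_le/(_ _ q2); apply: filterS => w hw n /hn[h1 _].
    apply: le_trans h1 _; move: hw; rewrite ler_norml => /andP[_]; lra.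
  exists n0.+1%:R^-1; first by rewrite invr_gt0.
  move=> w; case: (eqVneq w 0) => [->|w0]; first by rewrite normr0 expr0n/= mulr0 q_ge0.
  have nw : `|w| != 0 by rewrite normr_eq0.
  have -> : w = `|w| *: (`|w|^-1 *: w) by rewrite scalerA mulfV// scale1r.
  rewrite qZ normrZ normr_id normrZ normfV normr_id mulVf// mulr1 mulrC ler_wpM2l ?sqr_ge0//.
  by apply: hn => //; rewrite /S /= normrZ normfV normr_id mulVf.
have [|n0 hn] := @fin_unif I (fun n i => forall y w, big i y -> n.+1%:R^-1 * `|w| ^+ 2 <= q id (ch i) y w).
  move=> i; have [|n0 hn] := @compact_unif V [set z | big i z] (fun n y => forall w, n.+1%:R^-1 * `|w| ^+ 2 <= q id (ch i) y w) (@big_compact R d I yc Rc Rm i).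
    move=> y0 by0; have [c c0 hc0] := pos y0 i by0.
    have c2 : 0 < c / 2 by rewrite divr_gt0.
    have [rho rho0 hrho] := q_unif (C1m_id X) c2.
    have [n0 hn] := nat_bound 0 c2; exists n0.
    have : \forall z \near y0, `|z - y0| <= rho.
      by apply/nbhs_ballP; exists rho => //= z; rewrite -ball_normE/= distrC => /ltW.
    apply: filterS => y hy n /hn[h1 _] w.
    apply: le_trans (_ : c / 2 * `|w| ^+ 2 <= _); first by rewrite ler_wpM2r// sqr_ge0.
    have := hrho i y0 y w by0 hy; rewrite ler_norml => /andP[h2 _].
    by have := hc0 w; move: h2; lra.
  by exists n0 => n ln y w by0; exact: hn.
exists n0.+1%:R^-1; first by rewrite invr_gt0.
by move=> i y w; exact: (hn n0 i (leqnn _)).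
Qed.

End Metric.

(** * Continuity of the stable subspaces and hyperbolic frames *)

Section HyperbolicEstimates.
Variables (R : realType) (d : nat) (I : Type).
Notation V := 'rV[R]_d.
Variables (bg : I -> V -> Prop) (q : nat -> I -> V -> V -> R) (S U : I -> V -> {vspace V}) (A La : R).
Hypothesis q_ge0 : forall n i y w, 0 <= q n i y w.
Hypothesis qN : forall n i y w, q n i y (- w) = q n i y w.
Hypothesis qD : forall n i y u w, q n i y (u + w) <= 2 * q n i y u + 2 * q n i y w.
Hypothesis q_unif : forall n (zeta : R), 0 < zeta -> exists2 rho : R, 0 < rho &
  forall i y y' w, bg i y -> `|y' - y| <= rho -> `|q n i y' w - q n i y w| <= zeta * `|w| ^+ 2.
Hypothesis q_upper : forall n, exists2 B : R, 0 < B & forall i y w, bg i y -> q n i y w <= B * `|w| ^+ 2.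
Hypothesis q_lower : exists2 c : R, 0 < c & forall i y w, bg i y -> c * `|w| ^+ 2 <= q 0 i y w.
Hypotheses (A1 : 1 <= A) (La1 : 1 < La).
Hypothesis SU : forall i y, bg i y -> (S i y + U i y = fullv)%VS /\ (S i y :&: U i y = 0)%VS.
Hypothesis S_dec : forall N n i y w, bg i y -> w \in S i y -> q (N + n) i y w <= A * La ^- n * q N i y w.
Hypothesis U_inc : forall N n i y w, bg i y -> w \in U i y -> A^-1 * La ^+ n * q N i y w <= q (N + n) i y w.

Let A0 : 0 < A. Proof. exact: lt_le_trans ltr01 A1. Qed.
Let La0 : 0 < La. Proof. exact: lt_trans ltr01 La1. Qed.
Let Lan (n : nat) : 0 < La ^+ n. Proof. by rewrite exprn_gt0. Qed.
Let Lan1 (n : nat) : La ^- n <= 1.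
Proof. by rewrite invf_le1// exprn_ege1// ltW. Qed.
Let sq0 (w : V) : 0 <= `|w| ^+ 2. Proof. exact: sqr_ge0. Qed.

Lemma pow_large (K : R) : exists n0, forall n, (n0 <= n)%N -> K <= La ^+ n.
Proof.
have b n : 1 + n%:R * (La - 1) <= La ^+ n.
  elim: n => [|n IH]; first by rewrite mul0r addr0 expr0.
  rewrite exprS -natr1; have := ler_wpM2l (ltW La0) IH.
  have : 0 <= n%:R * (La - 1) * (La - 1) by rewrite !mulr_ge0// subr_ge0 ltW.
  by move: La1; nra.
exists (Num.truncn (`|K| / (La - 1))).+1 => n ln.
apply: le_trans (b n); apply: le_trans (ler_norm K) _.
have L1 : 0 < La - 1 by rewrite subr_gt0.
apply: (@le_trans _ _ (n%:R * (La - 1))); last by rewrite lerDr.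
rewrite -ler_pdivrMr//; apply: le_trans (ltW (truncnS_gt _)) _.
by rewrite ler_nat.
Qed.

Lemma sq_le (x k y : R) : 0 <= k -> 0 <= y -> x ^+ 2 <= k ^+ 2 * y ^+ 2 -> x <= k * y.
Proof.
move=> k0 y0; rewrite -exprMn => h; case: (lerP x 0) => x0; first by apply: le_trans x0 _; rewrite mulr_ge0.
by rewrite -(@ler_pXn2r _ 2)// nnegrE ?mulr_ge0// ltW.
Qed.

Lemma normD2 (u w : V) : `|u + w| ^+ 2 <= 2 * `|u| ^+ 2 + 2 * `|w| ^+ 2.
Proof.
have h := ler_normD u w; have : `|u + w| ^+ 2 <= (`|u| + `|w|) ^+ 2.
  by rewrite lerXn2r// nnegrE// addr_ge0.
have := sqr_ge0 (`|u| - `|w|); rewrite !expr2; nra.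
Qed.

(** If a + b is small against b, then a is close to -b; but after n steps q of a is at most A times
    its initial value, while q of b has grown by any factor wanted. *)
Lemma angle : exists2 K : R, 0 < K & forall i y a b, bg i y -> a \in S i y -> b \in U i y ->
  `|a| ^+ 2 <= K * `|a + b| ^+ 2 /\ `|b| ^+ 2 <= K * `|a + b| ^+ 2.
Proof.
have [c c0 lo] := q_lower; have [B0 B00 up0] := q_upper 0.
(* Growth by 5 A is wanted for b: two uses of [qD] cost 4 A, so A times q of b at time 0 remains on
   the left. *)
have [n /(_ n (leqnn n)) hn] := pow_large (5 * A * A).
have [Bn Bn0 upn] := q_upper n.
pose Kb := (2 * Bn + 4 * A * B0) / c.
have Kb0 : 0 < Kb by rewrite divr_gt0// addr_gt0// !mulr_gt0.
exists (2 + 2 * Kb); first by rewrite addr_gt0// mulr_gt0.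
move=> i y a b by_ aS bU; set w := a + b.
have hb : `|b| ^+ 2 <= Kb * `|w| ^+ 2.
  have e1 : q n i y b <= 2 * q n i y w + 2 * q n i y a.
    have -> : b = w + (- a) by rewrite /w addrC addKr.
    by apply: le_trans (qD _ _ _ _ _) _; rewrite qN.
  have e2 : q 0 i y a <= 2 * q 0 i y w + 2 * q 0 i y b.
    have -> : a = w + (- b) by rewrite /w addrK.
    by apply: le_trans (qD _ _ _ _ _) _; rewrite qN.
  have e3 : q n i y a <= A * q 0 i y a.
    apply: le_trans (S_dec 0 n by_ aS) _; rewrite -mulrA ler_wpM2l ?(ltW A0)// ler_piMl//.
  have e4 : 5 * A * q 0 i y b <= q n i y b.
    apply: le_trans (U_inc 0 n by_ bU); rewrite ler_wpM2r// [leRHS]mulrC ler_pdivlMr//.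
  have e5 := upn i y w by_; have e6 := up0 i y w by_; have e7 := lo i y b by_.
  have e8 : A * q 0 i y b <= (2 * Bn + 4 * A * B0) * `|w| ^+ 2.
    have := ler_wpM2l (ltW A0) e2; have := ler_wpM2l (ltW A0) e6; move: e1 e3 e4 e5.
    by move: (`|w| ^+ 2) => W; nra.
  rewrite /Kb mulrAC ler_pdivlMr// mulrC; apply: le_trans e7 (le_trans _ e8).
  by rewrite ler_peMl.
split; last by apply: le_trans hb _; rewrite ler_wpM2r//; move: Kb0; lra.
have -> : a = w + (- b) by rewrite /w addrK.
apply: le_trans (normD2 _ _) _; rewrite normrN; move: hb; lra.
Qed.

(** Decay up to a single time n nearly forces a vector into S: a sizeable U-component would have
    grown, and q at time n varies little from y to y'. This is the continuity of the stable
    subspaces. *)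
Lemma near_stable (eta : R) : 0 < eta -> exists n, exists2 rho : R, 0 < rho & forall i y y' w a b, bg i y -> bg i y' ->
  `|y' - y| <= rho -> q n i y w <= A * La ^- n * q 0 i y w -> a \in S i y' -> b \in U i y' -> w = a + b ->
  `|b| ^+ 2 <= eta * `|w| ^+ 2.
Proof.
move=> eta0; have [c c0 lo] := q_lower; have [B0 B00 up0] := q_upper 0; have [K K0 ang] := angle.
pose E := 2 * A * B0 + 2 + 2 * A * B0 * K.
have E0 : 0 < E by rewrite !addr_gt0// !mulr_gt0.
have [n /(_ n (leqnn n)) hn] := pow_large (A * E / (c * eta)).
have [rho rho0 uni] := q_unif n ltr01.
exists n, rho => // i y y' w a b by_ by' yy' qw aS bU wE.
have [ha hb] := ang i y' a b by' aS bU; rewrite -wE in ha hb.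
have e1 : q n i y' b <= 2 * q n i y' w + 2 * q n i y' a.
  have -> : b = w + (- a) by rewrite wE addrC addKr.
  by apply: le_trans (qD _ _ _ _ _) _; rewrite qN.
have e2 : q n i y' w <= q n i y w + `|w| ^+ 2.
  by have := uni i y y' w by_ yy'; rewrite ler_norml mul1r => /andP[_]; lra.
have i0 : 0 <= La ^- n by rewrite invr_ge0 ltW.
have e3 : q n i y w <= A * B0 * `|w| ^+ 2.
  apply: le_trans qw _; rewrite -!mulrA ler_wpM2l ?(ltW A0)//.
  by apply: le_trans (up0 i y w by_); rewrite ler_piMl.
have e4 : q n i y' a <= A * B0 * K * `|w| ^+ 2.
  apply: le_trans (S_dec 0 n by' aS) _; rewrite -!mulrA ler_wpM2l ?(ltW A0)//.
  apply: (@le_trans _ _ (q 0 i y' a)); first by rewrite ler_piMl.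
  by apply: le_trans (up0 i y' a by') _; rewrite ler_wpM2l// ltW.
have e5 : q n i y' b <= E * `|w| ^+ 2 by move: e1 e2 e3 e4; rewrite /E; move: (`|w| ^+ 2) => W; lra.
have e6 := U_inc 0 n by' bU; have e7 := lo i y' b by'.
have e8 : La ^+ n * (c * `|b| ^+ 2) <= A * (E * `|w| ^+ 2).
  have h1 : La ^+ n * (c * `|b| ^+ 2) <= La ^+ n * q 0 i y' b by rewrite ler_pM2l.
  apply: le_trans h1 _.
  have := ler_wpM2l (ltW A0) (le_trans e6 e5); by rewrite !mulrA mulfV ?gt_eqF// mul1r.
rewrite ler_pdivrMr ?mulr_gt0// in hn.
have e9 : A * E * (c * `|b| ^+ 2) <= La ^+ n * (c * eta) * (c * `|b| ^+ 2).
  by apply: ler_wpM2r => //; rewrite mulr_ge0// ltW.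
have e10 : (A * E * c) * `|b| ^+ 2 <= (A * E * c) * (eta * `|w| ^+ 2).
  have := ler_wpM2l (ltW (mulr_gt0 c0 eta0)) e8; move: e9; move: (`|w| ^+ 2) (`|b| ^+ 2) (La ^+ n) => W b2 L; lra.
by move: e10; rewrite ler_pM2l// !mulr_gt0.
Qed.

(** A vector that has expanded for n steps is not nearly stable at a nearby point: the stable part a
    carries only a bounded multiple of its squared norm at time n, so the remainder must carry the
    growth. This takes the place of a continuity statement for U, which depends on the chosen
    past. *)
Lemma near_unstable (K' : R) : 0 < K' -> exists2 c1 : R, 0 < c1 & exists n, exists2 rho : R, 0 < rho &
  forall i y y' w a c, bg i y -> bg i y' -> `|y' - y| <= rho -> A^-1 * La ^+ n * q 0 i y w <= q n i y w ->
  a \in S i y' -> w = a + c -> `|a| ^+ 2 <= K' * `|w| ^+ 2 -> c1 * `|w| ^+ 2 <= `|c| ^+ 2.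
Proof.
move=> K'0; have [c c0 lo] := q_lower; have [B0 B00 up0] := q_upper 0.
have [n /(_ n (leqnn n)) hn] := pow_large (A * (2 + 2 * A * B0 * K') / c).
have [Bn Bn0 upn] := q_upper n; have [rho rho0 uni] := q_unif n ltr01.
exists (2 * Bn)^-1; first by rewrite invr_gt0 mulr_gt0.
exists n, rho => // i y y' w a c' by_ by' yy' qw aS wE ha.
have e1 : q n i y' w <= 2 * q n i y' a + 2 * q n i y' c' by rewrite wE; exact: qD.
have e2 : q n i y w - `|w| ^+ 2 <= q n i y' w.
  by have := uni i y y' w by_ yy'; rewrite ler_norml mul1r => /andP[+ _]; lra.
have i0 : 0 <= La ^- n by rewrite invr_ge0 ltW.
have e4 : q n i y' a <= A * B0 * K' * `|w| ^+ 2.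
  apply: le_trans (S_dec 0 n by' aS) _; rewrite -!mulrA ler_wpM2l ?(ltW A0)//.
  apply: (@le_trans _ _ (q 0 i y' a)); first by rewrite ler_piMl.
  by apply: le_trans (up0 i y' a by') _; rewrite ler_wpM2l// ltW.
have e5 := upn i y' c' by'.
have e6 : (2 + 2 * A * B0 * K') * `|w| ^+ 2 <= q n i y w.
  apply: le_trans qw; apply: (@le_trans _ _ (A^-1 * La ^+ n * (c * `|w| ^+ 2))).
    rewrite [leRHS]mulrA ler_wpM2r//; rewrite ler_pdivrMr// in hn.
    by rewrite -(mulrA A^-1) [leRHS]mulrC ler_pdivlMr// [leLHS]mulrC.
  by rewrite ler_pM2l ?mulr_gt0 ?invr_gt0//; exact: lo.
rewrite mulrC ler_pdivrMr ?mulr_gt0//; move: e1 e2 e4 e5 e6; move: (`|w| ^+ 2) (`|c'| ^+ 2) => W C2; lra.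
Qed.

(** Vectors of S i y decay, so by [near_stable] none of them but 0 lies in U i y', whose complement
    is S i y'. *)
Lemma dim_le : exists2 rho : R, 0 < rho & forall i y y', bg i y -> bg i y' -> `|y' - y| <= rho ->
  (\dim (S i y) <= \dim (S i y'))%N.
Proof.
have h2 : 0 < 2^-1 :> R by rewrite invr_gt0.
have [n [rho rho0 st]] := near_stable h2; exists rho => // i y y' by_ by' yy'.
have dis : (S i y :&: U i y' = 0)%VS.
  apply/eqP; rewrite -subv0; apply/subvP => w; rewrite memv_cap => /andP[wS wU].
  have h := st i y y' w 0 w by_ by' yy' (S_dec 0 n by_ wS) (mem0v _) wU (esym (add0r w)).
  rewrite memv0 -normr_eq0 -sqrf_eq0; apply/eqP; apply: le_anti; rewrite sqr_ge0 andbT.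
  by move: h; lra.
have e1 := dimv_disjoint_sum dis.
have [f0 d0] := SU by'; have e2 := dimv_disjoint_sum d0.
rewrite f0 in e2.
by rewrite -(leq_add2r (\dim (U i y'))) -e1 -e2; exact: dimvS (subvf _).
Qed.

Section Margin.
Variables (s : nat) (Q : I -> V -> 'M[R]_d).
Notation Ps := (@Ps R d s).
Notation Qs := (@Qs R d s).
Hypothesis hQ : forall i y, bg i y -> Q i y *m (Q i y)^T = 1%:M /\ forall v, v \in S i y <-> v *m (Q i y)^T *m Qs = 0.

(* [S] being invariant, the only off-diagonal block that is not small is multiplied by [kappa]. *)
Definition frame (kappa : R) i y : 'M[R]_d := (kappa^-1 *: Ps + Qs) *m Q i y.
Definition coframe (kappa : R) i y : 'M[R]_d := (Q i y)^T *m (kappa *: Ps + Qs).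

Lemma frameK kappa i y : kappa != 0 -> bg i y -> frame kappa i y *m coframe kappa i y = 1%:M.
Proof.
move=> k0 by_; have [e _] := hQ by_.
have alg (P P' : 'M[R]_d) : P *m P = P -> P *m P' = 0 -> P' *m P = 0 -> P' *m P' = P' ->
    (kappa^-1 *: P + P') *m (kappa *: P + P') = P + P'.
  move=> h1 h2 h3 h4; rewrite mulmxDl !mulmxDr -!scalemxAl -!scalemxAr h1 h2 h3 h4.
  by rewrite scalerA mulVf// scale1r !scaler0 addr0 add0r.
rewrite /frame /coframe mulmxA -[_ *m Q i y *m _]mulmxA e mulmx1.
by rewrite (alg Ps Qs)// ?PP ?PQ ?QP ?QQ// PQ1.
Qed.

Lemma frame_opb kappa i y : 0 < kappa <= 1 -> bg i y ->
  opb (frame kappa i y) ((kappa^-1 + 1) * d%:R) /\ opb (coframe kappa i y) (d%:R * 2).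
Proof.
move=> /andP[k0 k1] by_; have [e _] := hQ by_; have [op1 op2] := orth_opb e.
have hP (k : R) : 0 <= k -> opb (k *: Ps) k.
  by move=> kk v; rewrite -scalemxAr normrZ ger0_norm// ler_wpM2l//; exact: Ps_le.
have hQs : opb Qs 1 by move=> v; rewrite mul1r; exact: Qs_le.
have ki : 0 <= kappa^-1 by rewrite invr_ge0 ltW.
split; apply: opbM => //.
  by apply: opbD => //; exact: hP.
apply: opb_le (opbD (hP kappa (ltW k0)) hQs); lra.
Qed.

(* [lra] reads the whole context, so irrelevant hypotheses make it slow. *)
Ltac purge := repeat match goal with H : ?T |- _ =>
  lazymatch type of T with Prop => idtac end;
  tryif first [constr_eq H q_ge0 | constr_eq H qN | constr_eq H qD | constr_eq H q_unif | constr_eq H q_upper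
    | constr_eq H q_lower | constr_eq H A1 | constr_eq H La1 | constr_eq H SU | constr_eq H S_dec | constr_eq H U_inc
    | constr_eq H A0 | constr_eq H La0 | constr_eq H Lan | constr_eq H Lan1 | constr_eq H sq0 | constr_eq H hQ]
  then fail else clear H end.

(* The frame at the target is taken at a point [z'] that is only close to the image [z], as needed for pseudo-orbits. *)
Lemma margin : exists N, exists2 kappa : R, 0 < kappa <= 1 & exists2 rho : R, 0 < rho &
  forall i y j z z' (D : 'M[R]_d), bg i y -> bg j z -> bg j z' -> `|z' - z| <= rho ->
  (forall n w, q (N.+1 + n) i y w = q n j z (w *m D)) -> forall v : V,
  let M := frame kappa i y *m D *m coframe kappa j z' in
  `|v *m M *m Ps| <= 8^-1 * (`|v *m Ps| + `|v *m Qs|) /\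
  `|v *m Qs| <= 8^-1 * (`|v *m M *m Qs| + `|v *m Ps|).
Proof.
have [c c0 lo] := q_lower; have [B0 B00 up0] := q_upper 0; have [K K0 ang] := angle.
pose dd : R := d%:R + 1.
have dd1 : 1 <= dd by rewrite /dd lerDr.
have dd0 : 0 < dd by exact: lt_le_trans ltr01 dd1.
have opQ i y : bg i y -> opb (Q i y) dd /\ opb (Q i y)^T dd.
  move=> by_; have [e _] := hQ by_; have [op1 op2] := orth_opb e.
  by split; [apply: opb_le op1|apply: opb_le op2]; rewrite /dd lerDl.
have K'0 : 0 < (dd * dd) ^+ 2 by rewrite exprn_gt0// mulr_gt0.
have [c1 c10 [n1 [rho1 rho10 unst]]] := near_unstable K'0.
pose ep := (16 * (dd * dd) * (1 + K))^-1.
have ep0 : 0 < ep by rewrite invr_gt0 !mulr_gt0// addr_gt0.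
(* The first bound makes the iterate contract S by ep. The second, where 289 = 17^2, gives the
   factor 17 on the unstable component after the losses in frames and angles. *)
have [N0 hN0] := pow_large (Num.max (A * B0 / (c * ep ^+ 2)) (289 * (dd * dd) ^+ 2 * (A * B0) / (c * c1))).
pose N := N0.+1; have := hN0 N (leqnSn _); rewrite ge_max => /andP[hN1 hN2].
rewrite ler_pdivrMr ?mulr_gt0 ?exprn_gt0// in hN1; rewrite ler_pdivrMr ?mulr_gt0// in hN2.
have [BN BN0 upN] := q_upper N.
pose be := BN / c + 1; have be0 : 0 < be by rewrite addr_gt0// divr_gt0.
(* Chosen after N: the block from unstable to stable coordinates is bounded only by [be], which
   depends on N, and kappa makes it small. *)
pose kappa := Num.min 1 (16 * (dd * dd) * be)^-1.
have k0 : 0 < kappa by rewrite lt_min ltr01 invr_gt0 !mulr_gt0.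
have k1 : kappa <= 1 by rewrite ge_min lexx.
have kb : kappa * (16 * (dd * dd) * be) <= 1.
  by rewrite -ler_pdivlMr ?mulr_gt0// mul1r ge_min lexx orbT.
have eta0 : 0 < (kappa / 16) ^+ 2 by rewrite exprn_gt0// divr_gt0.
have [n2 [rho2 rho20 stab]] := near_stable eta0.
exists N0, kappa; first by rewrite k0.
exists (Num.min rho1 rho2); first by rewrite lt_min rho10.
move=> i y j z z' D by_ bz bz'; rewrite le_min => /andP[zz1 zz2] hD v M.
have [QQ1 SQ] := hQ by_; have [QQ2 SQ'] := hQ bz'.
have [op1 op2] := opQ _ _ by_; have [op3 op4] := opQ _ _ bz'.
have QTQ2 : (Q j z')^T *m Q j z' = 1%:M by exact: mulmx1C.
set Qy := Q i y in QQ1 SQ op1 op2 *; set Qz := Q j z' in QQ2 SQ' op3 op4 QTQ2 *.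
have hD0 w : q 0 j z (w *m D) = q N i y w by rewrite -hD addn0.
have contr u : u \in S i y -> `|u *m D| <= ep * `|u|.
  move=> uS; apply: sq_le => //; first exact: ltW.
  have e1 := lo j z (u *m D) bz; rewrite hD0 in e1.
  have e2 := S_dec 0 N by_ uS; rewrite add0n in e2.
  have e3 := up0 i y u by_.
  have e4 : La ^+ N * (c * `|u *m D| ^+ 2) <= A * (B0 * `|u| ^+ 2).
    have h := le_trans e1 e2; have := ler_wpM2l (ltW (Lan N)) h.
    have -> : La ^+ N * (A * La ^- N * q 0 i y u) = A * q 0 i y u by field; rewrite gt_eqF.
    by move/le_trans; apply; rewrite ler_pM2l.
  have e5 : A * B0 * `|u| ^+ 2 <= La ^+ N * (c * ep ^+ 2) * `|u| ^+ 2 by rewrite ler_wpM2r.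
  have P0 : 0 < La ^+ N * c by rewrite mulr_gt0.
  rewrite -(ler_pM2l P0); move: e4 e5; move: (`|u| ^+ 2) (`|u *m D| ^+ 2) (ep ^+ 2) (La ^+ N) => x1 x2 x3 x4; purge; lra.
pose u1 := kappa^-1 *: (v *m Ps) *m Qy; pose u2 := v *m Qs *m Qy.
have vL : v *m frame kappa i y = u1 + u2.
  by rewrite /frame mulmxA mulmxDr mulmxDl -scalemxAr.
have vME : v *m M = (u1 + u2) *m D *m Qz^T *m (kappa *: Ps + Qs) by rewrite -vL !mulmxA.
have vMP : v *m M *m Ps = kappa *: ((u1 + u2) *m D *m Qz^T *m Ps).
  rewrite vME -[LHS]mulmxA (mulmxDl (kappa *: Ps) Qs Ps) -scalemxAl PP QP addr0.
  by rewrite -scalemxAr.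
have vMQ : v *m M *m Qs = (u1 + u2) *m D *m Qz^T *m Qs.
  by rewrite vME -[LHS]mulmxA (mulmxDl (kappa *: Ps) Qs Qs) -scalemxAl PQ QQ scaler0 add0r.
have ki : 0 <= kappa^-1 by rewrite invr_ge0 ltW.
have nP (w : V) : `|w *m Qz^T *m Ps| <= dd * `|w| by apply: le_trans (Ps_le _ _) _.
have nQ (w : V) : `|w *m Qz^T *m Qs| <= dd * `|w| by apply: le_trans (Qs_le _ _) _.
have u1S : u1 \in S i y.
  by apply/SQ; rewrite /u1 -[_ *m Qy *m Qy^T]mulmxA QQ1 mulmx1 -scalemxAl -mulmxA PQ mulmx0 scaler0.
have u1n : `|u1| <= dd * (kappa^-1 * `|v *m Ps|).
  by apply: le_trans (op1 _) _; rewrite normrZ ger0_norm.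
have u2n : `|u2| <= dd * `|v *m Qs| by exact: op1.
have w1n := contr u1 u1S.
have ddep : dd * dd * ep * (1 + K) <= 16^-1.
  rewrite /ep le_eqVlt; apply/orP; left; apply/eqP; field.
  by rewrite !gt_eqF// addr_gt0.
have K1 : 1 <= 1 + K by rewrite lerDl ltW.
have ddep1 : dd * dd * ep <= 16^-1.
  by apply: le_trans ddep; rewrite ler_peMr// !mulr_ge0// ltW.
have vP0 := normr_ge0 (v *m Ps); have vQ0 := normr_ge0 (v *m Qs).
have w1k : kappa * (dd * `|u1 *m D|) <= 16^-1 * `|v *m Ps|.
  have h : kappa * (dd * `|u1 *m D|) <= kappa * (dd * (ep * (dd * (kappa^-1 * `|v *m Ps|)))).
    rewrite ler_pM2l// ler_pM2l//; apply: le_trans w1n _; by rewrite ler_pM2l.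
  apply: le_trans h _.
  have -> : kappa * (dd * (ep * (dd * (kappa^-1 * `|v *m Ps|)))) = dd * dd * ep * `|v *m Ps|.
    by field; rewrite gt_eqF.
  by rewrite ler_wpM2r.
have a1P : kappa * `|u1 *m D *m Qz^T *m Ps| <= 16^-1 * `|v *m Ps|.
  by apply: le_trans w1k; rewrite ler_pM2l.
have [fz dz] := SU bz'.
have dec_z w : exists a b, [/\ a \in S j z', b \in U j z' & w = a + b].
  have /memv_addP[a aS [b bU e]] : w \in (S j z' + U j z')%VS by rewrite fz memvf.
  by exists a, b.
have [fy dy] := SU by_.
(* The image of a stable vector keeps decaying, so by [near_stable] it is almost in S at z' too; the
   error is prepared to beat the kappa^-1 contained in u1. *)
have a1Q : `|u1 *m D *m Qz^T *m Qs| <= 16^-1 * `|v *m Ps|.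
  have [a [b [aS bU e]]] := dec_z (u1 *m D).
  have h : q n2 j z (u1 *m D) <= A * La ^- n2 * q 0 j z (u1 *m D).
    by rewrite hD0 -hD; exact: S_dec.
  have hb := stab j z z' _ a b bz bz' zz2 h aS bU e.
  have {}hb : `|b| <= kappa / 16 * `|u1 *m D|.
    by apply: sq_le => //; rewrite ltW// divr_gt0.
  rewrite e mulmxDl mulmxDl ((SQ' a).1 aS) add0r.
  apply: le_trans (nQ b) _; apply: (@le_trans _ _ (dd * (kappa / 16 * `|u1 *m D|))); first by rewrite ler_pM2l.
  have -> : dd * (kappa / 16 * `|u1 *m D|) = 16^-1 * (kappa * (dd * `|u1 *m D|)) by ring.
  apply: le_trans (_ : 16^-1 * (16^-1 * `|v *m Ps|) <= _); first by rewrite ler_pM2l// invr_gt0.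
  by move: vP0; purge; lra.
have a2P : kappa * `|u2 *m D *m Qz^T *m Ps| <= 16^-1 * `|v *m Qs|.
  have w2n : `|u2 *m D| <= be * `|u2|.
    apply: sq_le => //; first exact: ltW.
    have e1 := lo j z (u2 *m D) bz; rewrite hD0 in e1.
    have e2 := le_trans e1 (upN i y u2 by_).
    apply: (@le_trans _ _ (BN / c * `|u2| ^+ 2)); first by rewrite mulrAC ler_pdivlMr// mulrC.
    rewrite ler_wpM2r//; have b0 : 0 < BN / c by rewrite divr_gt0.
    by rewrite /be; move: b0; move: (BN / c) => x x0; rewrite expr2; move: x0; purge; nra.
  apply: (@le_trans _ _ (kappa * (dd * (be * (dd * `|v *m Qs|))))).
    rewrite ler_pM2l//; apply: le_trans (nP _) _; rewrite ler_pM2l//; apply: le_trans w2n _.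
    by rewrite ler_pM2l.
  have := ler_wpM2r vQ0 kb; rewrite mul1r; purge; lra.
(* u2 is orthogonal to S but need not lie in U. Its S-part is contracted to 1/16, its U-part has the
   same unstable coordinates and gains the factor 17. *)
have a2Q : 16 * `|v *m Qs| <= `|u2 *m D *m Qz^T *m Qs|.
  have /memv_addP[a aS [b bU e]] : u2 \in (S i y + U i y)%VS by rewrite fy memvf.
  have [ha hb] := ang i y a b by_ aS bU; rewrite -e in ha hb.
  have {}ha : `|a| <= (1 + K) * `|u2|.
    apply: sq_le => //; first by rewrite addr_ge0// ltW.
    apply: le_trans ha _; rewrite ler_wpM2r//; rewrite expr2; move: K0; purge; nra.
  have aD : `|a *m D *m Qz^T *m Qs| <= 16^-1 * `|v *m Qs|.
    apply: le_trans (nQ _) _.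
    apply: (@le_trans _ _ (dd * (ep * ((1 + K) * (dd * `|v *m Qs|))))).
      rewrite ler_pM2l//; apply: le_trans (contr a aS) _; rewrite ler_pM2l//; apply: le_trans ha _.
      by rewrite ler_pM2l// addr_gt0.
    have := ler_wpM2r vQ0 ddep; purge; lra.
  have vQb : `|v *m Qs| <= dd * `|b|.
    have -> : v *m Qs = b *m Qy^T *m Qs.
      have : u2 *m Qy^T *m Qs = v *m Qs by rewrite /u2 -[_ *m Qy *m Qy^T]mulmxA QQ1 mulmx1 -mulmxA QQ.
      by rewrite e !mulmxDl ((SQ a).1 aS) add0r => <-.
    by apply: le_trans (Qs_le _ _) _; exact: op2.
  set wb := b *m D.
  have hw : A^-1 * La ^+ n1 * q 0 j z wb <= q n1 j z wb by rewrite hD0 -hD; exact: U_inc.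
  pose a' := wb *m Qz^T *m Ps *m Qz; pose c' := wb *m Qz^T *m Qs *m Qz.
  have wbE : wb = a' + c'.
    by rewrite /a' /c' -!mulmxDl -mulmxDr PQ1 mulmx1 -mulmxA QTQ2 mulmx1.
  have a'S : a' \in S j z'.
    by apply/SQ'; rewrite /a' -[_ *m Qz *m Qz^T]mulmxA QQ2 mulmx1 -mulmxA PQ mulmx0.
  have a'n : `|a'| ^+ 2 <= (dd * dd) ^+ 2 * `|wb| ^+ 2.
    have dd2 : 0 <= dd * dd * `|wb| by rewrite mulr_ge0// mulr_ge0// ltW.
    rewrite -exprMn lerXn2r ?nnegrE//.
    by apply: le_trans (op3 _) _; rewrite -mulrA ler_pM2l.
  have hc' := unst j z z' wb a' c' bz bz' zz1 hw a'S wbE a'n.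
  have c'n : `|c'| <= dd * `|wb *m Qz^T *m Qs| by exact: op3.
  have e1 : A^-1 * La ^+ N * (c * `|b| ^+ 2) <= B0 * `|wb| ^+ 2.
    apply: le_trans (up0 j z wb bz); rewrite hD0; have := U_inc 0 N by_ bU; rewrite add0n; apply: le_trans.
    by rewrite ler_pM2l ?mulr_gt0 ?invr_gt0//; exact: lo.
  have big : 17 * `|v *m Qs| <= `|wb *m Qz^T *m Qs|.
    set t := `|wb *m Qz^T *m Qs| in c'n *.
    have t0 : 0 <= t by rewrite /t.
    have s1 : `|c'| ^+ 2 <= dd ^+ 2 * t ^+ 2 by rewrite -exprMn lerXn2r// nnegrE// mulr_ge0// ltW.
    have s2 : `|v *m Qs| ^+ 2 <= dd ^+ 2 * `|b| ^+ 2 by rewrite -exprMn lerXn2r// nnegrE// mulr_ge0// ltW.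
    rewrite -[leRHS]mul1r; apply: sq_le => //; rewrite expr1n mul1r exprMn.
    have s3 : La ^+ N * (c * `|b| ^+ 2) <= A * (B0 * `|wb| ^+ 2).
      by have := ler_wpM2l (ltW A0) e1; rewrite !mulrA mulfV ?gt_eqF// mul1r.
    have P0 : 0 < A * B0 * dd ^+ 2 by rewrite !mulr_gt0// exprn_gt0.
    rewrite -(ler_pM2l P0).
    have h1 : A * B0 * dd ^+ 2 * (17 ^+ 2 * `|v *m Qs| ^+ 2) <= 289 * (dd * dd) ^+ 2 * (A * B0) * `|b| ^+ 2.
      have P1 : 0 <= A * B0 * dd ^+ 2 * 17 ^+ 2 by rewrite mulr_ge0// ?ltW// exprn_gt0.
      have := ler_wpM2l P1 s2; move: (`|v *m Qs| ^+ 2) (`|b| ^+ 2) => x1 x2.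
      by rewrite !expr2; purge; lra.
    have h2 : 289 * (dd * dd) ^+ 2 * (A * B0) * `|b| ^+ 2 <= La ^+ N * (c * c1) * `|b| ^+ 2 by rewrite ler_wpM2r.
    have h3 : La ^+ N * (c * c1) * `|b| ^+ 2 <= c1 * (A * (B0 * `|wb| ^+ 2)).
      have := ler_wpM2l (ltW c10) s3; purge; lra.
    have h4 : c1 * (A * (B0 * `|wb| ^+ 2)) <= A * B0 * `|c'| ^+ 2.
      have := ler_wpM2l (ltW (mulr_gt0 A0 B00)) hc'; purge; lra.
    apply: le_trans h1 (le_trans h2 (le_trans h3 (le_trans h4 _))).
    by rewrite -[leRHS]mulrA ler_pM2l// mulr_gt0.
  have -> : u2 *m D *m Qz^T *m Qs = a *m D *m Qz^T *m Qs + wb *m Qz^T *m Qs by rewrite e !mulmxDl.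
  have := lerB_normD (wb *m Qz^T *m Qs) (a *m D *m Qz^T *m Qs); rewrite [X in _ <= `|X|]addrC.
  by move: big aD vQ0; purge; lra.
split.
  rewrite vMP normrZ ger0_norm ?(ltW k0)// !mulmxDl.
  apply: (@le_trans _ _ (kappa * (`|u1 *m D *m Qz^T *m Ps| + `|u2 *m D *m Qz^T *m Ps|))).
    by rewrite ler_pM2l//; exact: ler_normD.
  by rewrite mulrDr; move: a1P a2P vP0 vQ0; purge; lra.
rewrite vMQ !mulmxDl.
have := lerB_normD (u2 *m D *m Qz^T *m Qs) (u1 *m D *m Qz^T *m Qs); rewrite [X in _ <= `|X|]addrC.
by move: a2Q a1Q vP0 vQ0; purge; lra.
Qed.

End Margin.
End HyperbolicEstimates.

(** * Splittings of an Anosov endomorphism *)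

Section Orbits.
Variable T : Type.

(** Extends the forward orbit of p by a backward branch given by a section s of f. The splitting at
    p may depend on this branch; the estimates used later concern its forward half. *)
Definition orbit_of (f s : T -> T) (p : T) (i : int) : T := if i is Negz n then iter n.+1 s p else iter `|i|%N f p.

Lemma orbit_ofP f s p : (forall q, f (s q) = q) -> is_orbit f (orbit_of f s p).
Proof.
move=> fs [n|[|n]].
- have -> : Posz n + 1 = Posz n.+1 by rewrite -[1]/(Posz 1) -PoszD addn1.
  by [].
- have -> : Negz 0 + 1 = 0 by [].
  exact: fs.
have -> : Negz n.+1 + 1 = Negz n by rewrite !NegzE; lia.
exact: fs.
Qed.

End Orbits.

Section AnosovSplitting.
Variables (R : realType) (d : nat) (M : ptopologicalType) (X : manifold R d M) (g : riemannian_metric X).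
Notation V := 'rV[R]_d.
Hypotheses (hM : hausdorff_space M) (cM : compact [set: M]) (kM : connected [set: M]).

(** The image is open by the local inverses and closed by compactness, hence everything. *)
Lemma local_diffeo_surj f : C1_local_diffeo X f -> exists s, forall q, f (s q) = q.
Proof.
move=> ld.
have fc : continuous f.
  move=> p; have [U [g' [oU Up _ _ [[cf _] _]]]] := ld p; exact: cf.
have oim : open (f @` [set: M]).
  rewrite openE => _ [p _ <-]; have [U [g' [oU Up ofU _ _]]] := ld p.
  apply: filterS (open_near ofU _) => [q [z Uz <-]|]; first by exists z.
  by exists p.
have cim : closed (f @` [set: M]).
  by apply: compact_closed => //; apply: continuous_compact => //; apply: continuous_subspaceT.
have e : f @` [set: M] = setT.
  apply: kM; first by exists (f point), point.
  - by exists (f @` [set: M]); rewrite ?setTI.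
  - by exists (f @` [set: M]); rewrite ?setTI.
have h q : exists p, f p = q by have : [set: M] q by []; rewrite -e => -[p _ <-]; exists p.
by have [s sP] := choice h; exists s.
Qed.

Lemma tangent_comp h1 h2 p v : C1m X h1 -> C1m X h2 ->
  tangent_map X (h2 \o h1) p v = tangent_map X h2 (h1 p) (tangent_map X h1 p v).
Proof.
move=> C1 C2.
have dp := mem_chart_at X p; have d1 := mem_chart_at X (h1 p).
have o1 : ov h1 (chart_at X p) (chart_at X (h1 p)) (cmap (chart_at X p) p).
  by apply/ovP; rewrite cmapK//; split => //; exact: img_cmap.
have e1 : hc h1 (chart_at X p) (chart_at X (h1 p)) (cmap (chart_at X p) p) = cmap (chart_at X (h1 p)) (h1 p).
  by rewrite hcE cmapK.
have o2 : ov h2 (chart_at X (h1 p)) (chart_at X (h2 (h1 p))) (cmap (chart_at X (h1 p)) (h1 p)).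
  by apply/ovP; rewrite cmapK//; split; [exact: img_cmap|exact: mem_chart_at].
rewrite -e1 in o2; have [_ e] := chain C1 C2 (chart_at_atlas X _) (chart_at_atlas X _) (chart_at_atlas X _) o1 o2.
apply: etrans (@tangent_mapE R d M X (h2 \o h1) p v) _; apply: esym.
apply: etrans (@tangent_mapE R d M X h2 (h1 p) (tangent_map X h1 p v)) _.
apply: etrans (congr1 (mulmx^~ _) (@tangent_mapE R d M X h1 p v)) _.
by rewrite -mulmxA; congr (_ *m _); rewrite -e1; exact: esym.
Qed.

Definition tn (f : M -> M) p n v : R := tnorm g (iter n f p) (tangent_map X (iter n f) p v) ^+ 2.

Lemma tnorm_ge0 p v : 0 <= tnorm g p v.
Proof. exact: sqrtr_ge0. Qed.

Lemma anosov_split f : C1m X f -> anosov_endomorphism g f -> exists A La : R, [/\ 1 <= A, 1 < La &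
  forall p, exists Es Eu : {vspace V}, [/\ (Es + Eu = fullv)%VS, (Es :&: Eu = 0)%VS,
   forall N n v, v \in Es -> tn f p (N + n) v <= A * La ^- n * tn f p N v &
   forall N n v, v \in Eu -> A^-1 * La ^+ n * tn f p N v <= tn f p (N + n) v]].
Proof.
move=> C1 [ld [C [la [C0 la1 an]]]].
have [s fs] := local_diffeo_surj ld.
(* The Anosov estimates hold for n > 0; a constant at least 1 extends them to n = 0. *)
pose C' := Num.max C 1; have C'1 : 1 <= C' by rewrite le_max lexx orbT.
have CC' : C <= C' by rewrite le_max lexx.
have C'0 : 0 < C' by exact: lt_le_trans ltr01 C'1.
have la0 : 0 < la by exact: lt_trans ltr01 la1.
exists (C' ^+ 2), (la ^+ 2); split.
- exact: exprn_ege1.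
- exact: exprn_egt1.
move=> p; have [Es [Eu [sp inv expand contract]]] := an _ (orbit_ofP p fs).
have xN (N : nat) : orbit_of f s p N%:Z = iter N f p by [].
have C1n n : C1m X (iter n f) by exact: C1m_iter.
have tS N v : tangent_map X (iter N.+1 f) p v = tangent_map X f (iter N f p) (tangent_map X (iter N f) p v).
  exact: (tangent_comp p v (C1n N) C1).
have t0 v : tangent_map X (iter 0 f) p v = v.
  apply: etrans (@tangent_mapE R d M X id p v) _.
  rewrite Jh_id ?mulmx1//; exact: img_cmap (mem_chart_at X p).
have inS N v : v \in Es 0 -> tangent_map X (iter N f) p v \in Es N%:Z.
  elim: N => [|N IH] vS; first by rewrite t0.
  have [e _] := inv N%:Z; have -> : N.+1%:Z = N%:Z + 1 by rewrite -PoszD addn1.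
  by rewrite tS -e xN; apply: memv_img; exact: IH.
have inU N v : v \in Eu 0 -> tangent_map X (iter N f) p v \in Eu N%:Z.
  elim: N => [|N IH] vS; first by rewrite t0.
  have [_ e] := inv N%:Z; have -> : N.+1%:Z = N%:Z + 1 by rewrite -PoszD addn1.
  by rewrite tS -e xN; apply: memv_img; exact: IH.
have tD N n v : tn f p (N + n) v = tnorm g (iter n f (iter N f p)) (tangent_map X (iter n f) (iter N f p) (tangent_map X (iter N f) p v)) ^+ 2.
  rewrite /tn; have -> : iter (N + n) f = iter n f \o iter N f by apply/funext => z; rewrite addnC iterD.
  exact: (congr1 (fun w => tnorm g (iter n f (iter N f p)) w ^+ 2) (tangent_comp p v (C1n N) (C1n n))).
have keyS N n u : u \in Es N%:Z -> tnorm g (iter n.+1 f (iter N f p)) (tangent_map X (iter n.+1 f) (iter N f p) u) ^+ 2 <=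
    C' ^+ 2 * (la ^+ 2) ^- n.+1 * tnorm g (iter N f p) u ^+ 2.
  move=> uS; have h : tnorm g (iter n.+1 f (iter N f p)) (tangent_map X (iter n.+1 f) (iter N f p) u) <= C * la ^- n.+1 * tnorm g (iter N f p) u.
    exact: contract n.+1 N%:Z u isT uS.
  have h' : tnorm g (iter n.+1 f (iter N f p)) (tangent_map X (iter n.+1 f) (iter N f p) u) <= C' * la ^- n.+1 * tnorm g (iter N f p) u.
    by apply: le_trans h _; rewrite ler_wpM2r ?tnorm_ge0// ler_wpM2r// invr_ge0 exprn_ge0// ltW.
  move: (tnorm g _ _) (tnorm_ge0 (iter n.+1 f (iter N f p)) (tangent_map X (iter n.+1 f) (iter N f p) u)) h' => x x0 h'.
  rewrite -exprM mulnC exprM -exprVn -!exprMn lerXn2r ?nnegrE//.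
  by apply: mulr_ge0; rewrite ?tnorm_ge0// mulr_ge0 ?invr_ge0 ?exprn_ge0// ltW.
have keyU N n u : u \in Eu N%:Z -> (C' ^+ 2)^-1 * (la ^+ 2) ^+ n.+1 * tnorm g (iter N f p) u ^+ 2 <=
    tnorm g (iter n.+1 f (iter N f p)) (tangent_map X (iter n.+1 f) (iter N f p) u) ^+ 2.
  move=> uU; have h : C^-1 * la ^+ n.+1 * tnorm g (iter N f p) u <= tnorm g (iter n.+1 f (iter N f p)) (tangent_map X (iter n.+1 f) (iter N f p) u).
    exact: expand n.+1 N%:Z u isT uU.
  have h' : C'^-1 * la ^+ n.+1 * tnorm g (iter N f p) u <= tnorm g (iter n.+1 f (iter N f p)) (tangent_map X (iter n.+1 f) (iter N f p) u).
    apply: le_trans h; rewrite ler_wpM2r ?tnorm_ge0// ler_wpM2r ?exprn_ge0 ?(ltW la0)//.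
    by rewrite lef_pV2.
  move: (tnorm g (iter n.+1 f (iter N f p)) _) (tnorm_ge0 (iter n.+1 f (iter N f p)) (tangent_map X (iter n.+1 f) (iter N f p) u)) h' => x x0 h'.
  rewrite -exprM mulnC exprM -exprVn -!exprMn lerXn2r ?nnegrE//.
  by apply: mulr_ge0; rewrite ?tnorm_ge0// mulr_ge0 ?invr_ge0 ?exprn_ge0// ltW.
have C2 : 1 <= C' ^+ 2 by exact: exprn_ege1.
have [sp1 sp2] := sp 0; exists (Es 0), (Eu 0); split; [exact: sp1|exact: sp2| |].
- move=> N [|n] v vS.
    rewrite addn0 expr0 invr1 mulr1; apply: ler_peMl => //; exact: sqr_ge0.
  have := keyS N n _ (inS N v vS); rewrite -(tD N n.+1 v); exact.
- move=> N [|n] v vU.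
    rewrite addn0 expr0 mulr1; apply: ler_piMl; first exact: sqr_ge0.
    by rewrite invf_le1// (lt_le_trans ltr01).
  have := keyU N n _ (inU N v vU); rewrite -(tD N n.+1 v); exact.
Qed.

Lemma to_T_inj c y v : atlas X c -> img c y -> to_T X c y v = 0 -> v = 0.
Proof.
move=> ac iy; rewrite /to_T => h.
have o : ov id c (chart_at X (cinv c y)) y by apply/ovP; split => //; exact: mem_chart_at.
have e := Jh_inv ac (chart_at_atlas X _) o.
by rewrite -[v]mulmx1 -e mulmxA h mul0mx.
Qed.

(* The subspace of R^d corresponding to E in T_pM, p = cinv c y, under the coordinates of the chart [c]. *)
Definition pull c y (E : {vspace V}) : {vspace V} :=
  (linfun (fun v : V => v *m Jh id (chart_at X (cinv c y)) c (cmap (chart_at X (cinv c y)) (cinv c y))) @: E)%VS.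

Section Pull.
Variables (c : chart R d M) (y : V).
Hypotheses (ac : atlas X c) (iy : img c y).
Let c' := chart_at X (cinv c y).
Let o : ov id c c' y. Proof. by apply/ovP; split => //; exact: mem_chart_at. Qed.
Let y' := cmap c' (cinv c y).
Let ey : hc id c c' y = y'. Proof. by rewrite hcE. Qed.
Let J := Jh id c c' y.
Let J' := Jh id c' c y'.
Let JJ' : J *m J' = 1%:M.
Proof. by rewrite /J /J' -ey; apply: (Jh_inv ac (chart_at_atlas X _) o). Qed.
Let J'J : J' *m J = 1%:M. Proof. exact: mulmx1C. Qed.

Let linE v : linfun (fun v : V => v *m J') v = v *m J'.
Proof. by have := @lfunE R _ _ (mulmxr J' : {linear V -> V}) v. Qed.

Lemma pullP E v : v \in pull c y E <-> to_T X c y v \in E.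
Proof.
split.
  move=> /memv_imgP[u uE ->]; rewrite -/c' -/y' -/J' linE /to_T -/c' -/J -mulmxA J'J mulmx1//.
move=> h; have -> : v = linfun (fun v : V => v *m J') (to_T X c y v).
  by rewrite linE /to_T -/c' -/J -mulmxA JJ' mulmx1.
exact: memv_img.
Qed.

Lemma pull_dim E : \dim (pull c y E) = \dim E.
Proof.
apply: limg_dim_eq; apply/eqP; rewrite -subv0; apply/subvP => v; rewrite memv_cap memv_ker => /andP[_].
rewrite -/c' -/y' -/J' linE memv0 => /eqP h.
by rewrite -[v]mulmx1 -J'J mulmxA h mul0mx.
Qed.

Lemma pull_split E F : (E + F = fullv)%VS -> (E :&: F = 0)%VS ->
  (pull c y E + pull c y F = fullv)%VS /\ (pull c y E :&: pull c y F = 0)%VS.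
Proof.
move=> e f; split.
  apply/vspaceP => v; rewrite memvf; apply/idP.
  have /memv_addP[a aE [b bF h]] : to_T X c y v \in (E + F)%VS by rewrite e memvf.
  apply/memv_addP; exists (a *m J'); first by apply/pullP; rewrite /to_T -/c' -/J -mulmxA J'J mulmx1.
  exists (b *m J'); first by apply/pullP; rewrite /to_T -/c' -/J -mulmxA J'J mulmx1.
  by rewrite -mulmxDl -h /to_T -/c' -/J -mulmxA JJ' mulmx1.
apply/eqP; rewrite -subv0; apply/subvP => v; rewrite memv_cap => /andP[/pullP h1 /pullP h2].
have : to_T X c y v \in (E :&: F)%VS by rewrite memv_cap h1.
rewrite f !memv0 => /eqP h; apply/eqP; exact: to_T_inj h.
Qed.

End Pull.
End AnosovSplitting.

(** * Hyperbolic coordinates *)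

Section HypPerturb.
Variables (R : realType) (d s : nat).
Notation V := 'rV[R]_d.
Notation Ps := (@Ps R d s).
Notation Qs := (@Qs R d s).

(** Margins of 1/8 leave room below 1/4 for an error of 1/16, caused by the nonlinearity or by
    moving the base point. *)
Lemma hyp_perturb (x0 x v : V) (th : R) : th <= 16^-1 -> `|x - x0| <= th * `|v| ->
  `|x0 *m Ps| <= 8^-1 * (`|v *m Ps| + `|v *m Qs|) -> `|v *m Qs| <= 8^-1 * (`|x0 *m Qs| + `|v *m Ps|) ->
  `|x *m Ps| <= 4^-1 * (`|v *m Ps| + `|v *m Qs|) /\ `|v *m Qs| <= 4^-1 * (`|x *m Qs| + `|v *m Ps|).
Proof.
move=> th1 hx h1 h2.
have hv := PQ_normD s v.
have e : `|x - x0| <= 16^-1 * (`|v *m Ps| + `|v *m Qs|).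
  apply: le_trans hx _; apply: (@le_trans _ _ (16^-1 * `|v|)); first by rewrite ler_wpM2r.
  by rewrite ler_wpM2l// invr_ge0.
have eP : `|x *m Ps| <= `|x0 *m Ps| + `|x - x0|.
  have -> : x *m Ps = x0 *m Ps + (x - x0) *m Ps by rewrite -mulmxDl subrKC.
  by apply: le_trans (ler_normD _ _) _; rewrite lerD2l; exact: Ps_le.
have eQ : `|x0 *m Qs| <= `|x *m Qs| + `|x - x0|.
  have -> : x0 *m Qs = x *m Qs + (x0 - x) *m Qs by rewrite -mulmxDl subrKC.
  by apply: le_trans (ler_normD _ _) _; rewrite lerD2l (distrC x); exact: Qs_le.
have p0 := normr_ge0 (v *m Ps); have q0 := normr_ge0 (v *m Qs); have x0' := normr_ge0 (x *m Qs).
by split; move: h1 h2 eP eQ e p0 q0 x0'; lra.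
Qed.

End HypPerturb.

Lemma near_open (T : topologicalType) (P : set T) (x : T) : nbhs x P ->
  exists2 U : set T, open U /\ U x & U `<=` P.
Proof. by rewrite nbhsE => -[U [oU Ux] h]; exists U. Qed.

Section PowerSmall.
Variable R : realType.

Lemma affine_cont d (x : 'rV[R]_d) (A : 'M[R]_d) : continuous (fun y : 'rV[R]_d => x + y *m A).
Proof.
move=> y; apply/(@cvgrPdist_le _ _ _ (nbhs y)) => e e0.
have mc := @mulmx_cont R d d A y; move: mc => /(@cvgrPdist_le _ _ _ (nbhs y))/(_ e e0); apply: filterS => z.
by rewrite opprD addrACA subrr add0r.
Qed.

Lemma small_pow (alpha k eta : R) : 0 < alpha -> 0 <= k -> 0 < eta ->
  exists2 e : R, 0 < e & forall t, 0 <= t <= e -> k * t `^ alpha <= eta.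
Proof.
move=> al0 k0 eta0; exists ((eta / (k + 1)) `^ alpha^-1).
  by rewrite powR_gt0// divr_gt0// ltr_wpDl.
move=> t /andP[t0 te]; have k1 : 0 < k + 1 by rewrite ltr_wpDl.
have h : t `^ alpha <= eta / (k + 1).
  apply: (@le_trans _ _ (((eta / (k + 1)) `^ alpha^-1) `^ alpha)).
    by apply: ge0_ler_powR => //; rewrite ?nnegrE ?powR_ge0// ltW.
  rewrite -powRrM mulVf ?gt_eqF// powRr1// divr_ge0// ltW//.
apply: le_trans (ler_wpM2l k0 h) _; rewrite mulrCA ler_piMr ?(ltW eta0)// ler_pdivrMr// mul1r lerDl.
exact: ler01.
Qed.

End PowerSmall.

Section UniformCoordinates.
Variables (R : realType) (d s : nat) (M : ptopologicalType) (X : manifold R d M).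
Notation V := 'rV[R]_d.
Notation Ps := (@Ps R d s).
Notation Qs := (@Qs R d s).
Variable leb : {measure set (borel V) -> \bar R}.
Hypothesis hleb : is_lebesgue leb.
Hypotheses (hM : hausdorff_space M) (cM : compact [set: M]) (kM : connected [set: M]).
Variables (I : finType) (ch : I -> chart R d M) (yc : I -> V) (Rc : I -> R) (Rm : R).
Hypothesis hp : pieces X ch yc Rc Rm.
Notation big := (piece yc Rc Rm).
Notation hit := (hit ch yc Rc Rm).
Variables (G : M -> M) (ix : M -> I) (L L' : M -> 'M[R]_d) (ell alpha K KH rz r0 r rho rhoM r2 : R).
Notation xc p := (cmap (ch (ix p)) p).
Hypothesis C1G : C1m X G.
Hypothesis ixP : forall p, cdom (ch (ix p)) p /\ `|xc p - yc (ix p)| <= Rc (ix p).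
Hypothesis LL' : forall p, L p *m L' p = 1%:M.
Hypothesis ell1 : 1 <= ell.
Hypothesis L_opb : forall p, opb (L p) ell.
Hypothesis L'_opb : forall p, opb (L' p) ell.
Hypotheses (al0 : 0 < alpha) (K0 : 0 <= K) (KH0 : 0 <= KH).
Hypothesis unifG : forall i j z z', hit G i j z -> `|z' - z| <= rz -> ov G (ch i) (ch j) z' /\ opb (Jh G (ch i) (ch j) z') K.
Hypothesis unif1 : forall i j z z', hit id i j z -> `|z' - z| <= rz -> ov id (ch i) (ch j) z' /\ opb (Jh id (ch i) (ch j) z') K.
Hypothesis holG : forall i j z z' z'', hit G i j z -> `|z' - z| <= rz -> `|z'' - z| <= rz ->
  opb (Jh G (ch i) (ch j) z' - Jh G (ch i) (ch j) z'') (KH * `|z' - z''| `^ alpha).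
Hypothesis marg : forall p q w, big (ix q) w -> G p = cinv (ch (ix q)) w -> `|w - xc q| <= rhoM -> forall v : V,
  let M0 := L p *m Jh G (ch (ix p)) (ch (ix q)) (xc p) *m L' q in
  `|v *m M0 *m Ps| <= 8^-1 * (`|v *m Ps| + `|v *m Qs|) /\ `|v *m Qs| <= 8^-1 * (`|v *m M0 *m Qs| + `|v *m Ps|).
Hypotheses (r_gt0 : 0 < r) (r0_Rm : ell * r0 <= Rm) (r_rz : ell * r <= rz) (rho5 : 5 * rho <= r) (rho0 : 0 < rho).
Hypotheses (rho_M : ell * rho <= rhoM) (r_r0 : r * (1 + ell * K * ell) <= r0) (r20 : 0 < r2) (r2_r0 : r2 <= r0).
Hypotheses (r2_rz : ell * (2 * r2) <= rz) (r_small : ell * (KH * (ell * (2 * r)) `^ alpha) * ell <= 16^-1).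

Definition psi (p : M) (v : V) : M := cinv (ch (ix p)) (xc p + v *m L p).
Definition Fm (p q : M) (y : V) : V := (hc G (ch (ix p)) (ch (ix q)) (xc p + y *m L p) - xc q) *m L' q.
Definition Mm (p q : M) (y : V) : 'M[R]_d := L p *m Jh G (ch (ix p)) (ch (ix q)) (xc p + y *m L p) *m L' q.
Notation nr := (nr G psi rho).

Let ell0 : 0 < ell. Proof. exact: lt_le_trans ltr01 ell1. Qed.
Let L'L p : L' p *m L p = 1%:M. Proof. exact: mulmx1C. Qed.
Let Rm0 : 0 < Rm. Proof. by have [] := hp. Qed.
Let r_le_r0 : r <= r0.
Proof. by apply: le_trans r_r0; rewrite ler_peMr// ?(ltW r_gt0)// lerDl !mulr_ge0// ltW. Qed.
Let rho_r : rho <= r. Proof. by move: rho5 rho0; lra. Qed.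
Let at_i p := ch_atlas hp (ix p).

Lemma Lle p (v : V) (a : R) : `|v| <= a -> `|v *m L p| <= ell * a.
Proof. by move=> h; apply: le_trans (L_opb p v) _; rewrite ler_pM2l. Qed.

Lemma xc_big p (u : V) : `|u| <= Rm -> big (ix p) (xc p + u).
Proof.
move=> hu; rewrite /piece addrAC; apply: le_trans (ler_normD _ _) _.
by apply: lerD => //; have [] := ixP p.
Qed.

Lemma xc_big0 p : big (ix p) (xc p).
Proof. by rewrite -[xc p]addr0; apply: xc_big; rewrite normr0 ltW. Qed.

Lemma psi_big p (v : V) : `|v| <= r0 -> big (ix p) (xc p + v *m L p).
Proof. by move=> hv; apply: xc_big; apply: le_trans (Lle p hv) r0_Rm. Qed.

Lemma cinv_inj i y y' : big i y -> big i y' -> cinv (ch i) y = cinv (ch i) y' -> y = y'.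
Proof. by move=> /(big_img hp)/imgP[_ e] /(big_img hp)/imgP[_ e'] h; rewrite -e -e' h. Qed.

Lemma psi0 p : psi p 0 = p.
Proof. by rewrite /psi mul0mx addr0 cmapK//; have [] := ixP p. Qed.

Lemma psi_inj p (v v' : V) : `|v| <= r0 -> `|v'| <= r0 -> psi p v = psi p v' -> v = v'.
Proof.
move=> hv hv' /(cinv_inj (psi_big p hv) (psi_big p hv'))/addrI h.
by rewrite -[v]mulmx1 -[v']mulmx1 -(LL' p) !mulmxA h.
Qed.

Lemma nr_hit p q : nr p q -> exists v : V, [/\ `|v| <= rho, big (ix q) (xc q + v *m L q), G p = cinv (ch (ix q)) (xc q + v *m L q) &
  hit G (ix p) (ix q) (xc p)].
Proof.
move=> [v hv e]; have hb : big (ix q) (xc q + v *m L q) by apply: psi_big; exact: le_trans hv (le_trans rho_r r_le_r0).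
exists v; split => //; split; first exact: xc_big0.
by exists (xc q + v *m L q); split => //; rewrite cmapK//; have [] := ixP p.
Qed.

Lemma ball_rz p (y : V) : `|y| <= r -> `|xc p + y *m L p - xc p| <= rz.
Proof. by move=> hy; rewrite addrAC subrr add0r; apply: le_trans (Lle p hy) r_rz. Qed.

Lemma Fm_at0 p q : nr p q -> `|Fm p q 0| <= rho.
Proof.
move=> npq; have [v [hv hb e hh]] := nr_hit npq.
suff -> : Fm p q 0 = v by [].
rewrite /Fm mul0mx addr0 hcE cmapK; last by have [] := ixP p.
have [_ e'] := imgP (big_img hp hb); rewrite e e' addrAC subrr add0r -mulmxA LL' mulmx1 //.
Qed.

Lemma Fm_lipschitz p q (y y' : V) : nr p q -> `|y| <= r -> `|y'| <= r -> `|Fm p q y - Fm p q y'| <= ell * K * ell * `|y - y'|.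
Proof.
move=> npq hy hy'; have [v [hv hb e hh]] := nr_hit npq.
have -> : Fm p q y - Fm p q y' = (hc G (ch (ix p)) (ch (ix q)) (xc p + y *m L p) - hc G (ch (ix p)) (ch (ix q)) (xc p + y' *m L p)) *m L' q.
  by rewrite /Fm -mulmxBl opprB addrA subrK.
apply: le_trans (L'_opb q _) _; rewrite -!mulrA ler_pM2l//.
apply: (@le_trans _ _ (K * `|(xc p + y *m L p) - (xc p + y' *m L p)|)).
  apply: (@hc_lip R d M X G (ch (ix p)) (ch (ix q)) (xc p) rz K C1G) => //; try exact: ball_rz.
  by move=> z hz; exact: (unifG hh hz).
apply: ler_wpM2l => //.
have -> : xc p + y *m L p - (xc p + y' *m L p) = (y - y') *m L p by rewrite opprD addrACA subrr add0r mulmxBl.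
exact: L_opb.
Qed.

Lemma Fm_psi p q (y : V) : nr p q -> `|y| <= r -> psi q (Fm p q y) = G (psi p y) /\ `|Fm p q y| <= r0.
Proof.
move=> npq hy; have [v [hv hb e hh]] := nr_hit npq.
have [ov1 _] := unifG hh (ball_rz p hy); split.
  by rewrite /psi /Fm -mulmxA L'L mulmx1 subrKC (hcK ov1).
have z0 : `|0 : V| <= r by rewrite normr0 ltW.
have h1 := Fm_lipschitz npq hy z0; have h2 := Fm_at0 npq.
rewrite -(subrK (Fm p q 0) (Fm p q y)); apply: le_trans (ler_normD _ _) _.
apply: le_trans r_r0; rewrite mulrDr mulr1 addrC; apply: lerD; first exact: le_trans h2 rho_r.
by apply: le_trans h1 _; rewrite subr0 mulrC ler_wpM2r// !mulr_ge0// ltW.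
Qed.

(** The mean value inequality along the segment, where the derivative differs from its value at z by
    the Hoelder bound at distance dl. *)
Lemma lin_est p q (y y' z : V) (dl : R) : nr p q -> `|y| <= r -> `|y'| <= r -> `|z| <= r -> 0 <= dl ->
  (forall t : R, 0 <= t <= 1 -> `|y' + t *: (y - y') - z| <= dl) ->
  `|Fm p q y - Fm p q y' - (y - y') *m Mm p q z| <= ell * (KH * (ell * dl) `^ alpha) * ell * `|y - y'|.
Proof.
move=> npq hy hy' hz dl0 seg; have [v [hv hb e hh]] := nr_hit npq.
set H := hc G (ch (ix p)) (ch (ix q)); set J := Jh G (ch (ix p)) (ch (ix q)).
set w := xc p + y *m L p; set w' := xc p + y' *m L p; set wz := xc p + z *m L p.
have ww : w - w' = (y - y') *m L p by rewrite /w /w' opprD addrACA subrr add0r mulmxBl.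
have -> : Fm p q y - Fm p q y' - (y - y') *m Mm p q z = (H w - H w' - (w - w') *m J wz) *m L' q.
  rewrite /Fm /Mm -/H -/J -/w -/w' -/wz ww -mulmxBl opprB addrA subrK !mulmxA.
  by rewrite -mulmxBl.
apply: le_trans (L'_opb q _) _; rewrite -!mulrA ler_pM2l//.
apply: (@le_trans _ _ (KH * (ell * dl) `^ alpha * `|w - w'|)); last first.
  by rewrite ww -mulrA; apply: ler_wpM2l => //; apply: ler_wpM2l; [exact: powR_ge0|exact: L_opb].
have [_ D1] := C1G.
apply: (@mean_value R d d H [set u | `|u - xc p| <= rz /\ `|u - wz| <= ell * dl]).
  move=> t t01; rewrite ww.
  have -> : w' + t *: ((y - y') *m L p) = xc p + (y' + t *: (y - y')) *m L p.
    by rewrite /w' (mulmxDl y') -(scalemxAl t) addrA.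
  split.
    have := ball_rz p (_ : `|y' + t *: (y - y')| <= r); apply.
    by have := @seg_ball R d 0 y y' r t; rewrite !subr0; apply.
  by rewrite /wz opprD addrACA subrr add0r -mulmxBl; exact: Lle (seg t t01).
move=> u [hu1 hu2]; have [ou _] := unifG hh hu1; split; first by have [] := D1 _ _ (at_i p) (at_i q) u ou.
move=> x; rewrite JhE -mulmxBr.
apply: le_trans (holG hh hu1 (ball_rz p hz) x) _; rewrite ler_wpM2r// ler_wpM2l//.
by apply: ge0_ler_powR => //; rewrite ?nnegrE ?mulr_ge0// ltW.
Qed.

Let seg_r (y y' z : V) (t : R) : `|y| <= r -> `|y'| <= r -> `|z| <= r -> 0 <= t <= 1 -> `|y' + t *: (y - y') - z| <= 2 * r.
Proof.
move=> hy hy' hz t01; apply: le_trans (ler_normB _ _) _.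
have := @seg_ball R d 0 y y' r t; rewrite !subr0 => h.
by have := h hy hy' t01; move: hz; lra.
Qed.

Lemma Fm_lin16 p q (y y' z : V) : nr p q -> `|y| <= r -> `|y'| <= r -> `|z| <= r ->
  `|Fm p q y - Fm p q y' - (y - y') *m Mm p q z| <= 16^-1 * `|y - y'|.
Proof.
move=> npq hy hy' hz; have r2' : 0 <= 2 * r by rewrite mulr_ge0// ltW.
apply: le_trans (lin_est npq hy hy' hz r2' _) _; first by move=> t; exact: seg_r.
by rewrite ler_wpM2r.
Qed.

Lemma Fm_lin p q (y y' z : V) : nr p q -> `|y| <= r -> `|y'| <= r -> `|z| <= r ->
  `|Fm p q y - Fm p q y' - (y - y') *m Mm p q z| <= `|y - y'|.
Proof.
move=> npq hy hy' hz; apply: le_trans (Fm_lin16 npq hy hy' hz) _.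
by rewrite ler_piMl// invf_le1// ler1n.
Qed.

Lemma Fm_diff (eta : R) : 0 < eta -> exists2 e : R, 0 < e &
  forall p q (y y' : V), nr p q -> `|y| <= r -> `|y'| <= r -> `|y - y'| <= e ->
  `|Fm p q y - Fm p q y' - (y - y') *m Mm p q y'| <= eta * `|y - y'|.
Proof.
move=> eta0; have k0 : 0 <= ell * KH * ell by rewrite !mulr_ge0// ltW.
have [e e0 he] := small_pow al0 k0 eta0; exists (e / ell); first by rewrite divr_gt0.
move=> p q y y' npq hy hy' hyy; apply: le_trans (lin_est npq hy hy' hy' (normr_ge0 (y - y')) _) _.
  move=> t /andP[t0 t1]; rewrite addrAC subrr add0r normrZ ger0_norm// ler_piMl//.
rewrite ler_wpM2r//.
have -> : ell * (KH * (ell * `|y - y'|) `^ alpha) * ell = ell * KH * ell * (ell * `|y - y'|) `^ alpha by ring.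
by apply: he; rewrite mulr_ge0 ?(ltW ell0)//= mulrC -ler_pdivlMr.
Qed.

Lemma Mm_diff p q (y y' : V) : nr p q -> `|y| <= r -> `|y'| <= r ->
  opb (Mm p q y - Mm p q y') (ell * (KH * (ell * `|y - y'|) `^ alpha) * ell).
Proof.
move=> npq hy hy'; have [v [hv hb e hh]] := nr_hit npq.
have -> : Mm p q y - Mm p q y' = L p *m (Jh G (ch (ix p)) (ch (ix q)) (xc p + y *m L p) - Jh G (ch (ix p)) (ch (ix q)) (xc p + y' *m L p)) *m L' q.
  by rewrite /Mm mulmxBr mulmxBl.
have pw u : 0 <= KH * u `^ alpha by rewrite mulr_ge0// powR_ge0.
apply: opbM => //; first exact: ltW.
apply: opbM => //.
apply: opb_le (holG hh (ball_rz p hy) (ball_rz p hy')); rewrite ler_wpM2l//.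
apply: ge0_ler_powR; rewrite ?nnegrE ?mulr_ge0// ?(ltW al0)// ?(ltW ell0)//.
have -> : xc p + y *m L p - (xc p + y' *m L p) = (y - y') *m L p by rewrite opprD addrACA subrr add0r mulmxBl.
exact: L_opb.
Qed.

Lemma marg0 p q : nr p q -> forall v : V,
  `|v *m Mm p q 0 *m Ps| <= 8^-1 * (`|v *m Ps| + `|v *m Qs|) /\ `|v *m Qs| <= 8^-1 * (`|v *m Mm p q 0 *m Qs| + `|v *m Ps|).
Proof.
move=> npq u; have [v [hv hb e hh]] := nr_hit npq.
rewrite /Mm mul0mx addr0; apply: marg hb e _ u.
by rewrite addrAC subrr add0r; apply: le_trans (Lle q hv) rho_M.
Qed.

Lemma Mm_hyp p q (y : V) : nr p q -> `|y| <= r -> hyp s (Mm p q y).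
Proof.
move=> npq hy v; have [h1 h2] := marg0 npq v; have z0 : `|0 : V| <= r by rewrite normr0 ltW.
apply: (hyp_perturb (lexx 16^-1) _ h1 h2); rewrite -mulmxBr.
apply: le_trans (Mm_diff npq hy z0 v) _; rewrite ler_wpM2r//; apply: le_trans r_small.
rewrite ler_wpM2r ?(ltW ell0)// ler_wpM2l ?(ltW ell0)// ler_wpM2l//.
apply: ge0_ler_powR; rewrite ?nnegrE ?mulr_ge0// ?(ltW al0)// ?(ltW ell0)// ?(ltW r_gt0)//.
by rewrite ler_pM2l// subr0; move: hy r_gt0; lra.
Qed.

Lemma Fm_hyp p q : nr p q -> nhyp s r (Fm p q).
Proof.
move=> npq y y' hy hy'; have [h1 h2] := marg0 npq (y - y'); have z0 : `|0 : V| <= r by rewrite normr0 ltW.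
by apply: (hyp_perturb (lexx 16^-1) _ h1 h2); exact: Fm_lin16.
Qed.

Lemma Mm_le p q (y : V) : nr p q -> `|y| <= r -> opb (Mm p q y) (ell * K * ell).
Proof.
move=> npq hy; have [v [hv hb e hh]] := nr_hit npq; have [_ ov2] := unifG hh (ball_rz p hy).
by apply: opbM; [exact: ltW|apply: opbM|].
Qed.

(** Halving a distance multiplies a Hoelder bound of exponent alpha by this factor. *)
Definition nu : R := 2^-1 `^ alpha.
(** The first summand is twice the bound on the matrices, wanted at the jump of a concatenated
    pseudo-orbit; the second is the Hoelder bound at scale r. *)
Definition Cm : R := 2 * (ell * K * ell) + ell * (KH * (ell * r) `^ alpha) * ell.

Lemma nu_ge0 : 0 <= nu. Proof. exact: powR_ge0. Qed.
Lemma nu_lt1 : nu < 1.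
Proof.
have := @gt0_ltr_powR R alpha al0 2^-1 1; rewrite !nnegrE powR1; apply => //.
by rewrite invf_lt1// ltr1n.
Qed.

Lemma Mm_holder p q (y y' : V) k : nr p q -> `|y| <= r -> `|y'| <= r -> `|y - y'| <= 2 ^- k * r ->
  opb (Mm p q y - Mm p q y') (Cm * nu ^+ k).
Proof.
move=> npq hy hy' hk; apply: opb_le (Mm_diff npq hy hy').
have e : (2 ^- k * (ell * r)) `^ alpha = nu ^+ k * (ell * r) `^ alpha.
  have pk : 0 <= 2 ^- k :> R by rewrite invr_ge0 exprn_ge0.
  have pl : 0 <= ell * r by rewrite mulr_ge0// ltW.
  rewrite (@powRM R _ _ alpha pk pl).
  congr (_ * _); rewrite -exprVn /nu; elim: k {hk pk} => [|k IH]; first by rewrite !expr0 powR1.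
  by rewrite !exprS powRM ?IH// ?invr_ge0// exprn_ge0// invr_ge0.
apply: (@le_trans _ _ (ell * (KH * (2 ^- k * (ell * r)) `^ alpha) * ell)).
  rewrite ler_wpM2r ?(ltW ell0)// ler_wpM2l ?(ltW ell0)// ler_wpM2l//.
  apply: ge0_ler_powR; rewrite ?nnegrE ?mulr_ge0// ?(ltW al0)// ?(ltW ell0)// ?(ltW r_gt0)// ?invr_ge0 ?exprn_ge0//.
  by rewrite mulrCA ler_pM2l.
rewrite e /Cm mulrDl.
have -> : ell * (KH * (nu ^+ k * (ell * r) `^ alpha)) * ell = ell * (KH * (ell * r) `^ alpha) * ell * nu ^+ k by ring.
by rewrite lerDr !mulr_ge0// ?(ltW ell0)// exprn_ge0// nu_ge0.
Qed.

Lemma psi_change p q (y y' v : V) : `|y| <= r2 -> `|y'| <= r2 -> `|v| <= r2 -> psi p y = psi q y' ->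
  exists v', psi q v = psi p v' /\ `|v' - y| <= (1 + ell * K * ell) * `|v - y'|.
Proof.
move=> hy hy' hv e; set z := xc q + y' *m L q; set z1 := xc q + v *m L q.
have by_ := psi_big p (le_trans hy r2_r0).
have bz : big (ix q) z := psi_big q (le_trans hy' r2_r0).
have hh : hit id (ix q) (ix p) z by split => //; exists (xc p + y *m L p).
have zz : z1 - z = (v - y') *m L q by rewrite /z /z1 opprD addrACA subrr add0r mulmxBl.
have hz1 : `|z1 - z| <= rz.
  rewrite zz; apply: le_trans r2_rz; apply: Lle; apply: le_trans (ler_normB _ _) _; move: hv hy'; lra.
have [ou _] := unif1 hh hz1.
pose H := hc id (ch (ix q)) (ch (ix p)).
exists ((H z1 - xc p) *m L' p); split.
  by rewrite {2}/psi -mulmxA L'L mulmx1 subrKC /H (hcK ou).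
have Hz : H z = xc p + y *m L p.
  by rewrite /H hcE /= -[cinv (ch (ix q)) z]/(psi q y') -e; have [_] := imgP (big_img hp by_).
have -> : (H z1 - xc p) *m L' p - y = (H z1 - H z) *m L' p.
  by rewrite Hz opprD addrA [RHS]mulmxBl -(mulmxA y) LL' mulmx1.
apply: le_trans (L'_opb p _) _.
have lip : `|H z1 - H z| <= K * `|z1 - z|.
  have rz0 : 0 <= rz by apply: le_trans hz1.
  apply: (@hc_lip R d M X id (ch (ix q)) (ch (ix p)) z rz K (C1m_id X)) => //; try by rewrite subrr normr0.
  by move=> u hu; exact: (unif1 hh hu).
apply: (@le_trans _ _ (ell * (K * (ell * `|v - y'|)))).
  rewrite ler_pM2l//; apply: le_trans lip _; rewrite ler_wpM2l// zz; exact: L_opb.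
by rewrite mulrDl mul1r !mulrA lerDr.
Qed.

Lemma psi_cont p : {within [set y : V | `|y| <= r], continuous (psi p)}.
Proof.
apply/subspace_continuousP => y hy; apply: cvg_within_filter.
have by_ := psi_big p (le_trans hy r_le_r0).
apply: (@continuous_comp _ _ _ (fun y : V => xc p + y *m L p) (cinv (ch (ix p)))); last exact: (cinv_cont (big_img hp by_)).
exact: affine_cont.
Qed.

Let core_closed i : closed (cinv (ch i) @` [set z | `|z - yc i| <= Rc i]).
Proof.
apply: compact_closed => //; apply: continuous_compact; last exact: cball_compact.
apply/subspace_continuousP => z hz; apply: cvg_within_filter.
apply: (cinv_cont (big_img hp _)); rewrite /piece; apply: le_trans hz _; rewrite lerDl ltW//.
Qed.

(** The index [ix] may jump. But a core that does not contain p0 is closed, so it is avoided near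
    p0; for p near p0 the chosen core thus contains p0, and only finitely many indices are to be
    treated. *)
Lemma near_chart p0 (e : R) : 0 < e -> \forall p \near p0,
  [/\ cdom (ch (ix p)) p0, big (ix p) (cmap (ch (ix p)) p0) & `|xc p - cmap (ch (ix p)) p0| <= e].
Proof.
move=> e0.
have : \forall p \near p0, forall i, ix p = i -> [/\ cdom (ch i) p0, big i (cmap (ch i) p0) & `|cmap (ch i) p - cmap (ch i) p0| <= e].
  apply: fin_near => i.
  case: (pselect ((cinv (ch i) @` [set z | `|z - yc i| <= Rc i]) p0)) => h.
    have [z hz ez] := h.
    have bz : big i z by rewrite /piece; apply: le_trans hz _; rewrite lerDl ltW.
    have [dz cz] := imgP (big_img hp bz); rewrite ez in dz cz.
    have := cmap_continuous dz; move=> /cvgrPdist_le/(_ _ e0); apply: filterS => p hpp _.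
    by split => //; [rewrite cz|rewrite distrC].
  apply: filterS (open_near (closed_openC (@core_closed i)) h) => p np ip; exfalso; apply: np.
  have [d1 d2] := ixP p; rewrite ip in d1 d2; exists (cmap (ch i) p) => //; exact: cmapK.
by apply: filterS => p hpp; exact: hpp.
Qed.

Lemma psi_near (p0 : M) (e : R) : 0 < e ->
  exists2 U : set M, open U /\ U p0 & forall x x', U x -> U x' -> exists2 v : V, `|v| <= e & x' = psi x v.
Proof.
move=> e0; pose e1 := Num.min (e / ell / 2) (Rm / 2).
have e10 : 0 < e1 by rewrite lt_min !divr_gt0.
have N1 := near_chart p0 e10.
have N2 : \forall p \near p0, forall i, cdom (ch i) p0 -> cdom (ch i) p /\ `|cmap (ch i) p - cmap (ch i) p0| <= e1.
  apply: fin_near => i; case: (pselect (cdom (ch i) p0)) => di; last by apply: filterE.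
  have := cmap_continuous di; move=> /cvgrPdist_le/(_ _ e10); apply: filterS2 (open_near (cdom_open (ch i)) di) => p h1 h2 _.
  by rewrite distrC.
have [U [oU Up] hU] := near_open (filterI N1 N2); exists U => //.
move=> x x' Ux Ux'; have [[d0 b0 c0] _] := hU x Ux; have [_ h'] := hU x' Ux'.
have [dx' cx'] := h' _ d0.
have dist : `|cmap (ch (ix x)) x' - xc x| <= e / ell.
  rewrite -(subrKA (cmap (ch (ix x)) p0)); apply: le_trans (ler_normD _ _) _.
  rewrite [`|_ - xc x|]distrC [leRHS](_ : _ = e / ell / 2 + e / ell / 2); last by field; rewrite gt_eqF.
  by apply: lerD; [apply: le_trans cx' _|apply: le_trans c0 _]; rewrite ge_min lexx.
exists ((cmap (ch (ix x)) x' - xc x) *m L' x).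
  apply: le_trans (L'_opb x _) _; rewrite mulrC -ler_pdivlMr//.
by rewrite /psi -mulmxA L'L mulmx1 subrKC cmapK.
Qed.

Lemma psi_small (O' : set M) (p0 : M) : open O' -> O' p0 ->
  exists2 e : R, 0 < e & \forall p \near p0, forall v : V, `|v| <= e -> O' (psi p v).
Proof.
move=> oO Op0.
have [|n0 hn] := @fin_unif I (fun n i => cdom (ch i) p0 -> forall z, `|z - cmap (ch i) p0| <= n.+1%:R^-1 -> O' (cinv (ch i) z)).
  move=> i; case: (pselect (cdom (ch i) p0)) => di; last by exists 0%N.
  have ii : img (ch i) (cmap (ch i) p0) by exact: img_cmap.
  have N : \forall z \near cmap (ch i) p0, O' (cinv (ch i) z).
    by apply: (cinv_cont ii); rewrite cmapK//; exact: open_near.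
  have [e e0 he] := near_ball N; have [n0 hn] := nat_bound 0 e0; exists n0 => n /hn[h _] _ z hz.
  by apply: he; exact: le_trans hz h.
pose e := n0.+1%:R^-1 : R; have e0 : 0 < e by rewrite invr_gt0.
exists (e / 2 / ell); first by rewrite !divr_gt0.
have e2 : 0 < e / 2 by rewrite divr_gt0.
apply: filterS (near_chart p0 e2) => p [dp _ hpp] v hv.
apply: (hn n0 _ (leqnn n0) dp); rewrite addrAC; apply: le_trans (ler_normD _ _) _.
have -> : n0.+1%:R^-1 = e / 2 + e / 2 by rewrite -splitr.
apply: lerD => //; apply: le_trans (Lle p hv) _.
by rewrite mulrC mulfVK// gt_eqF.
Qed.

Section WithMeasure.
Variables (m : probability (borel M) R) (w0 w1 : R).
Hypotheses (w00 : 0 < w0) (w10 : 0 < w1) (G_pres : preserves m (G : borel M -> borel M)).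
Hypothesis m_chart : forall i (E : set (borel V)), compact (E : set V) -> (forall y, E y -> big i y) ->
  (w0%:E * leb E <= m (cinv (ch i) @` E : set (borel M)))%E /\ (m (cinv (ch i) @` E : set (borel M)) <= w1%:E * leb E)%E.

Lemma L_unit p : L p \in unitmx. Proof. by have [] := mulmx1_unit (LL' p). Qed.

(** The frame and its inverse are both bounded by ell, so the frame scales volume by a factor
    between ell^-d and ell^d. *)
Lemma psi_vol p (E : set (borel V)) : compact (E : set V) -> (forall y, E y -> `|y : V| <= r) ->
  ((w0 * (ell ^+ d)^-1)%:E * leb E <= m (psi p @` E : set (borel M)))%E /\
  (m (psi p @` E : set (borel M)) <= (w1 * ell ^+ d)%:E * leb E)%E.
Proof.
move=> cE Er.
pose A (y : V) : V := xc p + y *m L p.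
have cA : continuous A by exact: affine_cont.
have cAE : compact (A @` E : set V).
  by apply: continuous_compact => //; apply: continuous_subspaceT.
have bAE y : (A @` E) y -> big (ix p) y.
  by move=> [z Ez <-]; apply: psi_big; apply: le_trans (Er z Ez) r_le_r0.
have -> : psi p @` E = cinv (ch (ix p)) @` (A @` E) by rewrite image_comp.
have mE : measurable E by apply: borel_closed; apply: compact_closed => //; exact: norm_hausdorff.
have u := L_unit p.
have iL : invmx (L p) = L' p by rewrite -[L' p]mul1mx -(mulVmx u) -mulmxA LL' mulmx1.
have lebA : leb (A @` E) = ((kap leb (L p))%:E * leb E)%E.
  rewrite -(leb_mulmx hleb u mE).
  have -> : (A @` E : set (borel V)) = (fun x : V => x + (- xc p)) @^-1` ((fun x : V => x *m invmx (L p)) @^-1` E).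
    apply/seteqP; split=> [_ [y Ey <-]|x /= Ex].
      by rewrite /= /A addrAC subrr add0r mulmxK.
    by exists ((x - xc p) *m invmx (L p)) => //; rewrite /A mulmxKV// subrKC.
  by rewrite (leb_trans_inv hleb)//; exact: measurable_mulmx.
have [h1 h2] := m_chart cAE bAE; rewrite lebA in h1 h2.
have kp : 0 < kap leb (L p) by exact: kap_gt0.
have k1 : kap leb (L p) <= ell ^+ d by apply: kap_le => //; exact: ltW.
have k2 : (ell ^+ d)^-1 <= kap leb (L p).
  have uV : invmx (L p) \in unitmx by rewrite unitmx_inv.
  have : kap leb (invmx (L p)) <= ell ^+ d by apply: kap_le => //; [exact: ltW|rewrite iL].
  by rewrite kapV// => h; rewrite -[leRHS]invrK lef_pV2 ?posrE ?invr_gt0// exprn_gt0.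
split.
  apply: le_trans h1; rewrite muleA -EFinM; apply: lee_wpmul2r => //.
  by rewrite lee_fin ler_pM2l.
apply: le_trans h2 _; rewrite muleA -EFinM; apply: lee_wpmul2r => //.
by rewrite lee_fin ler_pM2l.
Qed.

Lemma coordinates_ergodic : ergodic m (G : borel M -> borel M).
Proof.
have Lc1 : 1 <= 1 + ell * K * ell by rewrite lerDl !mulr_ge0// ltW.
have KL : 0 <= ell * K * ell by rewrite !mulr_ge0// ltW.
have C2 : 2 * (ell * K * ell) <= Cm by rewrite lerDl !mulr_ge0 ?powR_ge0// ltW.
have w0' : 0 < w0 * (ell ^+ d)^-1 by rewrite mulr_gt0// invr_gt0 exprn_gt0.
have w1' : 0 < w1 * ell ^+ d by rewrite mulr_gt0// exprn_gt0.
have Gc : continuous G by have [] := C1G.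
exact: (@hyperbolic_ergodic R d s M leb hleb G psi Fm Mm r r0 rho (ell * K * ell) Cm nu (1 + ell * K * ell) r2
  psi0 psi_inj Fm_psi Fm_hyp Mm_hyp Fm_lin Fm_diff KL Mm_le rho0 rho5 r_le_r0 nu_ge0 nu_lt1 C2 Mm_holder Lc1 psi_change
  m hM _ _ w0' w1' psi_cont psi_vol cM kM Gc G_pres r20 psi_near psi_small).
Qed.

End WithMeasure.
End UniformCoordinates.

(** * The volume measure in charts *)

Lemma half_bounds (R : realType) (a b : R) : `|a - b| <= `|a| / 2 -> `|a| / 2 <= `|b| <= 2 * `|a|.
Proof.
move=> h; have := le_trans (ler_dist_dist a b) h; rewrite ler_norml => /andP[t2 t3].
by have := normr_ge0 a; move: t2 t3; move: (`|a|) (`|b|) => x y *; apply/andP; split; lra.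
Qed.

Section VolumeBounds.
Variables (R : realType) (d : nat) (M : ptopologicalType) (X : manifold R d M) (omega : volume_form X).
Notation V := 'rV[R]_d.
Hypothesis hM : hausdorff_space M.

Definition density (c : chart R d M) (y : V) : R := vform omega (cinv c y) (chart_frame X c y).

Lemma chart_frameE c y : chart_frame X c y = Jh id c (chart_at X (cinv c y)) y.
Proof.
apply/row_matrixP => i; rewrite rowK rowE.
exact: (dE id c (chart_at X (cinv c y)) y (delta_mx 0 i)).
Qed.

Lemma density_neq0 c y : atlas X c -> img c y -> density c y != 0.
Proof.
move=> ac iy; apply: form_unit_neq0.
- exact: vform_multilinear.
- exact: vform_alternating.
- exact: vform_nonvanishing.
have o : ov id c (chart_at X (cinv c y)) y by apply/ovP; split => //; exact: mem_chart_at.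
have e := Jh_inv ac (chart_at_atlas X _) o.
by rewrite chart_frameE; have [] := mulmx1_unit e.
Qed.

Lemma density_cont c y : atlas X c -> img c y -> {for y, continuous (density c)}.
Proof. by move=> ac iy; exact: (vform_smooth omega ac 0%N _ iy). Qed.

Lemma density_measurable c (E : set (borel V)) : atlas X c -> measurable E -> (forall y, E y -> img c y) ->
  measurable_fun E ((fun y => `|density c y|) : borel V -> R).
Proof.
move=> ac mE Ei _; apply: (measurability _ (measurable_realfun.RGenOInfty.measurableE R)) => // _ [_ [x ->] <-].
have -> : E `&` (fun y => `|density c y|) @^-1` `]x, +oo[%classic = E `&` [set y | img c y /\ x < `|density c y|].
  apply/seteqP; split=> y [Ey /=]; rewrite in_itv/= andbT.
    by move=> h; split => //; split => //; exact: Ei.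
  by move=> [_ h]; split => //=; rewrite in_itv/= andbT.
apply: measurableI => //; apply: borel_open.
rewrite openE => y [iy xy].
have h0 : 0 < `|density c y| - x by rewrite subr_gt0.
have := density_cont ac iy; move=> /cvgrPdist_lt/(_ _ h0).
apply: filterS2 (open_near (img_open (c := c)) iy) => z iz hz; split; first exact: iz.
have := le_lt_trans (ler_dist_dist _ _) hz; rewrite ltr_norml => /andP[_].
by rewrite ltrD2l ltrN2.
Qed.

Variables (I : finType) (ch : I -> chart R d M) (yc : I -> V) (Rc : I -> R) (Rm : R).
Hypothesis hp : pieces X ch yc Rc Rm.
Notation big := (piece yc Rc Rm).

Lemma density_bounds : exists2 w0 : R, 0 < w0 & exists2 w1 : R, 0 < w1 &
  forall i y, big i y -> w0 <= `|density (ch i) y| <= w1.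
Proof.
have [|n0 hn] := @fin_unif I (fun n i => forall y, big i y -> n.+1%:R^-1 <= `|density (ch i) y| <= n%:R).
  move=> i; have [|n0 hn] := @compact_unif V [set z | big i z] (fun n y => n.+1%:R^-1 <= `|density (ch i) y| <= n%:R) (@big_compact R d I yc Rc Rm i).
    move=> y0 by0; have iy := big_img hp by0; have ai := ch_atlas hp i.
    have p0 : 0 < `|density (ch i) y0| by rewrite normr_gt0 density_neq0.
    have p2 : 0 < `|density (ch i) y0| / 2 by rewrite divr_gt0.
    have [n0 hn] := nat_bound (2 * `|density (ch i) y0|) p2; exists n0.
    have := density_cont ai iy; move=> /cvgrPdist_le/(_ _ p2); apply: filterS => y hy n /hn[h1 h2].
    have /andP[h3 h4] := half_bounds hy.
    by rewrite (le_trans h1)//= (le_trans h4).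
  by exists n0 => n ln y by0; exact: hn.
exists n0.+1%:R^-1; first by rewrite invr_gt0.
exists (n0%:R + 1); first by rewrite ltr_wpDl.
move=> i y by0; have /andP[h1 h2] := hn n0 i (leqnn _) y by0; rewrite h1 /=.
by apply: le_trans h2 _; rewrite lerDl.
Qed.

Lemma volume_bounds (m : probability (borel M) R) : is_normalized_volume_measure omega m ->
  exists leb : {measure set (borel V) -> \bar R}, is_lebesgue leb /\
  exists2 w0 : R, 0 < w0 & exists2 w1 : R, 0 < w1 &
  forall i (E : set (borel V)), compact (E : set V) -> (forall y, E y -> big i y) ->
  (w0%:E * leb E <= m (cinv (ch i) @` E : set (borel M)))%E /\ (m (cinv (ch i) @` E : set (borel M)) <= w1%:E * leb E)%E.
Proof.
move=> [mu [[leb [hl hmu]] hm]]; exists leb; split => //.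
have [w0 w00 [w1 w10 hw]] := density_bounds.
pose k : R := (fine (mu setT))^-1.
(* If the total volume were 0 or infinite, this inverse would be 0 and m would have total mass 0. *)
have k0 : 0 < k.
  have k0 : 0 <= k by rewrite invr_ge0 fine_ge0.
  rewrite lt_def k0 andbT; apply/eqP => h.
  have := hm setT measurableT; rewrite probability_setT -/k h mule0 => /eqP.
  by rewrite onee_eq0.
exists (w0 * k); first exact: mulr_gt0.
exists (w1 * k); first exact: mulr_gt0.
move=> i E cE Eb; pose B : set (borel M) := cinv (ch i) @` E.
have Ei y : E y -> img (ch i) y by move=> /Eb/(big_img hp).
have cB : compact (B : set M).
  apply: continuous_compact => //; apply/subspace_continuousP => z hz; apply: cvg_within_filter.
  exact: (cinv_cont (Ei z hz)).
have mB : measurable B by apply: borel_closed; exact: compact_closed.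
have mE : measurable E by apply: borel_closed; apply: compact_closed => //; exact: norm_hausdorff.
have Bd : B `<=` cdom (ch i) by move=> _ [y Ey <-]; have [] := imgP (Ei y Ey).
have cBE : cmap (ch i) @` B = E.
  apply/seteqP; split=> [_ [_ [y Ey <-] <-]|y Ey]; first by have [_ ->] := imgP (Ei y Ey).
  by exists (cinv (ch i) y); [exists y|have [_ ->] := imgP (Ei y Ey)].
have := hmu (ch i) B (ch_atlas hp i) mB Bd; rewrite cBE => muB.
have dm := density_measurable (ch_atlas hp i) mE Ei.
have dens := (measurable_realfun.measurable_EFinP _ _).2 dm.
have lo : (w0%:E * leb E <= mu B)%E.
  rewrite muB -integral_cst//; apply: ge0_le_integral => //.
  - by move=> x _; rewrite lee_fin ltW.
  - by move=> x Ex; rewrite lee_fin; have /andP[] := hw i x (Eb x Ex).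
have up : (mu B <= w1%:E * leb E)%E.
  rewrite muB -integral_cst//; apply: ge0_le_integral => //.
  - by move=> x Ex; rewrite lee_fin; have /andP[] := hw i x (Eb x Ex).
have kE : (0 <= k%:E)%E by rewrite lee_fin ltW.
rewrite (hm B mB) -/k; split.
  by rewrite EFinM -muleA [(k%:E * _)%E]muleC muleA; apply: lee_wpmul2r.
by rewrite EFinM -[leRHS]muleA [(k%:E * _)%E]muleC muleA; apply: lee_wpmul2r.
Qed.

End VolumeBounds.

(** * Ergodicity *)

Section Splitting.
Variables (R : realType) (d : nat) (M : ptopologicalType) (X : manifold R d M) (g : riemannian_metric X).
Notation V := 'rV[R]_d.
Hypothesis kM : connected [set: M].

Lemma connected_const (u : M -> nat) : (forall p0, \forall p \near p0, u p = u p0) -> forall p q, u p = u q.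
Proof.
move=> hu p q; pose B := [set x | u x = u q].
have oB : open B by rewrite openE => x xq; apply: filterS (hu x) => y; rewrite /B/= xq.
have oC : open (~` B).
  rewrite openE => x xq; apply: filterS (hu x) => y; rewrite /B/= => e h; apply: xq; rewrite /B/= -e; exact: h.
suff BT : B = setT by have : B p by rewrite BT.
apply: kM; first by exists q.
  by exists B; rewrite ?setTI.
exists B; last by rewrite setTI.
by have := open_closedC oC; rewrite setCK.
Qed.

Variables (I : finType) (ch : I -> chart R d M) (yc : I -> V) (Rc : I -> R) (Rm : R).
Hypothesis hp : pieces X ch yc Rc Rm.
Notation big := (piece yc Rc Rm).

Variables (f : M -> M) (Es Eu : M -> {vspace V}) (A La : R).
Hypotheses (Cf : C1m X f) (A1 : 1 <= A) (La1 : 1 < La).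
Hypothesis Esu : forall p, [/\ (Es p + Eu p)%VS = fullv, (Es p :&: Eu p)%VS = 0%VS,
  forall (N n : nat) (v : V), v \in Es p -> tn g f p (N + n) v <= A / La ^+ n * tn g f p N v &
  forall (N n : nat) (v : V), v \in Eu p -> A^-1 * La ^+ n * tn g f p N v <= tn g f p (N + n) v].

Let qn n i y w := q g (iter n f) (ch i) y w.
Let S i y := pull X (ch i) y (Es (cinv (ch i) y)).
Let U i y := pull X (ch i) y (Eu (cinv (ch i) y)).
Let Rm0 : 0 < Rm. Proof. by have [] := hp. Qed.

Let qn_tn n i y w : big i y -> qn n i y w = tn g f (cinv (ch i) y) n (to_T X (ch i) y w).
Proof. by move=> hb; exact: (q_tnorm g w (C1m_iter n Cf) (ch_atlas hp i) (big_img hp hb)). Qed.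

Let SU i y : big i y -> (S i y + U i y = fullv)%VS /\ (S i y :&: U i y = 0)%VS.
Proof.
by move=> hb; have [h1 h2 _ _] := Esu (cinv (ch i) y); exact: (pull_split (ch_atlas hp i) (big_img hp hb)).
Qed.

Let S_dec N n i y w : big i y -> w \in S i y -> qn (N + n) i y w <= A * La ^- n * qn N i y w.
Proof.
move=> hb /(pullP (ch_atlas hp i) (big_img hp hb)) hw; rewrite !qn_tn//.
by have [_ _ h _] := Esu (cinv (ch i) y); exact: h.
Qed.

Let U_inc N n i y w : big i y -> w \in U i y -> A^-1 * La ^+ n * qn N i y w <= qn (N + n) i y w.
Proof.
move=> hb /(pullP (ch_atlas hp i) (big_img hp hb)) hw; rewrite !qn_tn//.
by have [_ _ _ h] := Esu (cinv (ch i) y); exact: h.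
Qed.

Let qn_ge0 n i y w : 0 <= qn n i y w. Proof. exact: q_ge0. Qed.
Let qnN n i y w : qn n i y (- w) = qn n i y w. Proof. exact: qN. Qed.
Let qnD n i y u w : qn n i y (u + w) <= 2 * qn n i y u + 2 * qn n i y w. Proof. exact: qD. Qed.
Let qn_unif n (zeta : R) : 0 < zeta -> exists2 rho : R, 0 < rho &
  forall i (y y' w : V), big i y -> `|y' - y| <= rho -> `|qn n i y' w - qn n i y w| <= zeta * `|w| ^+ 2.
Proof. by move=> z0; exact: (q_unif g hp (C1m_iter n Cf) z0). Qed.
Let qn_upper n : exists2 B : R, 0 < B & forall i (y w : V), big i y -> qn n i y w <= B * `|w| ^+ 2.
Proof. exact: (q_upper g hp (C1m_iter n Cf)). Qed.
Let qn_lower : exists2 c : R, 0 < c & forall i (y w : V), big i y -> c * `|w| ^+ 2 <= qn 0 i y w.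
Proof. exact: (q_lower g hp). Qed.

(** [dim_le] is symmetric in the two points, so it gives equality nearby; connectedness then makes
    the dimension constant, and one block size serves everywhere. *)
Lemma stable_dim_near p0 : \forall p \near p0, \dim (Es p) = \dim (Es p0).
Proof.
have [rho rho0 hr] := dim_le qn_ge0 qnN qnD qn_unif qn_upper qn_lower A1 La1 SU S_dec U_inc.
have [_ _ _ hc0] := hp; have [i [di ci]] := hc0 p0.
have e0 : 0 < Num.min rho Rm by rewrite lt_min rho0.
have := cmap_continuous di; move=> /cvgrPdist_le/(_ _ e0).
apply: filterS2 (open_near (cdom_open (ch i)) di) => p dp hd.
have [h1 h2] : `|cmap (ch i) p0 - cmap (ch i) p| <= rho /\ `|cmap (ch i) p0 - cmap (ch i) p| <= Rm.
  by move: hd; rewrite le_min => /andP.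
have b0 : big i (cmap (ch i) p0) by rewrite /piece; apply: le_trans ci _; rewrite lerDl ltW.
have b1 : big i (cmap (ch i) p).
  rewrite /piece -(subrKA (cmap (ch i) p0)) addrC; apply: le_trans (ler_normD _ _) _; apply: lerD => //.
  by rewrite distrC.
have hS x : cdom (ch i) x -> big i (cmap (ch i) x) -> \dim (S i (cmap (ch i) x)) = \dim (Es x).
  by move=> dx bx; rewrite /S (pull_dim (ch_atlas hp i) (big_img hp bx)) cmapK.
rewrite -(hS p dp b1) -(hS p0 di b0); apply/eqP; rewrite eqn_leq; apply/andP; split; apply: hr => //.
by rewrite distrC.
Qed.

Lemma stable_dim_const p q : \dim (Es p) = \dim (Es q).
Proof. apply: (connected_const (u := fun p => \dim (Es p))); exact: stable_dim_near. Qed.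

Lemma adapted_frames : exists Q : I -> V -> 'M[R]_d, forall i y, big i y ->
  Q i y *m (Q i y)^T = 1%:M /\ forall v : V, v \in S i y <-> v *m (Q i y)^T *m Qs R d (\dim (Es point)) = 0.
Proof.
have [Q hQ] := choice (fun iy : I * V => adapted_frame (S iy.1 iy.2)).
exists (fun i y => Q (i, y)) => i y hb; have /= := hQ (i, y).
suff -> : \dim (S i y) = \dim (Es point) by [].
by rewrite /S (pull_dim (ch_atlas hp i) (big_img hp hb)); exact: stable_dim_const.
Qed.

Lemma iterSD N n : iter (N.+1 + n) f = iter n f \o iter N.+1 f.
Proof. by apply/funext => x; rewrite addnC iterD. Qed.

Lemma hyperbolic_frames : exists N (ell rhoM : R) (L L' : I -> V -> 'M[R]_d), [/\ 1 <= ell, 0 < rhoM,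
  forall i y, big i y -> [/\ L i y *m L' i y = 1%:M, opb (L i y) ell & opb (L' i y) ell] &
  forall i y j z z', big i y -> big j z -> big j z' -> iter N.+1 f (cinv (ch i) y) = cinv (ch j) z -> `|z - z'| <= rhoM -> forall v : V,
  let M0 := L i y *m Jh (iter N.+1 f) (ch i) (ch j) y *m L' j z' in
  let s := \dim (Es point) in
  `|v *m M0 *m Ps R d s| <= 8^-1 * (`|v *m Ps R d s| + `|v *m Qs R d s|) /\
  `|v *m Qs R d s| <= 8^-1 * (`|v *m M0 *m Qs R d s| + `|v *m Ps R d s|)].
Proof.
have [Q hQ] := adapted_frames.
have [N [kappa k01 [rho rho0 hm]]] := margin qn_ge0 qnN qnD qn_unif qn_upper qn_lower A1 La1 SU S_dec U_inc hQ.
have /andP[k0 k1] := k01.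
have ki : 0 <= kappa^-1 by rewrite invr_ge0 ltW.
have a0 : 0 <= (kappa^-1 + 1) * d%:R by rewrite mulr_ge0// addr_ge0.
have b0 : 0 <= d%:R * 2 :> R by rewrite mulr_ge0.
pose ell : R := (kappa^-1 + 1) * d%:R + d%:R * 2 + 1.
exists N, ell, rho, (frame (\dim (Es point)) Q kappa), (coframe (\dim (Es point)) Q kappa); split => //.
- by rewrite /ell lerDr addr_ge0.
- move=> i y hb; have [opb1 opb2] := frame_opb hQ k01 hb; split.
  + by apply: (frameK hQ) => //; rewrite gt_eqF.
  + by move=> v; apply: le_trans (opb1 v) _; apply: ler_wpM2r => //; rewrite /ell -addrA lerDl addr_ge0.
  + by move=> v; apply: le_trans (opb2 v) _; apply: ler_wpM2r => //; rewrite /ell addrAC lerDr addr_ge0.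
move=> i y j z z' hb hbz hbz' e hz; apply: (hm i y j z z') => //; first by rewrite distrC.
move=> n w.
have [dz cz] := imgP (big_img hp hbz).
have o : ov (iter N.+1 f) (ch i) (ch j) y by apply/ovP; split; [exact: (big_img hp hb)|rewrite e].
rewrite /qn iterSD; apply: etrans (q_comp g w (C1m_iter N.+1 Cf) (C1m_iter n Cf) (ch_atlas hp i) (ch_atlas hp j) o) _.
by rewrite hcE e cz.
Qed.

End Splitting.

Lemma iter_preserves (R : realType) (M : ptopologicalType) (m : probability (borel M) R) (f : M -> M) n :
  continuous f -> preserves m (f : borel M -> borel M) -> preserves m (iter n f : borel M -> borel M).
Proof.
move=> cf pf; elim: n => [|n IH] B mB //.
have -> : iter n.+1 f @^-1` B = iter n f @^-1` (f @^-1` B) by [].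
rewrite IH; last exact: borel_preimage.
exact: pf.
Qed.

Lemma iter_invariant (T : Type) (f : T -> T) (B : set T) n : f @^-1` B = B -> iter n f @^-1` B = B.
Proof.
move=> hB; elim: n => [//|n IH].
have -> : iter n.+1 f @^-1` B = iter n f @^-1` (f @^-1` B) by [].
by rewrite hB.
Qed.

(** r0 exhausts the collar Rm; r is cut down until one step stays within r0 and the Hoelder error is
    at most 1/16; rho and r2 follow. *)
Lemma small_scales (R : realType) (alpha ell K KH Rm rz rhoM : R) : 0 < alpha -> 1 <= ell -> 0 <= K -> 0 <= KH ->
  0 < Rm -> 0 < rz -> 0 < rhoM -> exists r0 r rho r2 : R,
  [/\ 0 < r, ell * r0 <= Rm, ell * r <= rz & 5 * rho <= r] /\
  [/\ 0 < rho, ell * rho <= rhoM, r * (1 + ell * K * ell) <= r0 & 0 < r2] /\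
  [/\ r2 <= r0, ell * (2 * r2) <= rz & ell * (KH * (ell * (2 * r)) `^ alpha) * ell <= 16^-1].
Proof.
move=> al0 ell1 K0 KH0 Rm0 rz0 rhoM0.
have ell0 : 0 < ell := lt_le_trans ltr01 ell1.
have [e e0 he] := small_pow al0 (mulr_ge0 (mulr_ge0 (ltW ell0) KH0) (ltW ell0)) (ltac:(rewrite invr_gt0//) : 0 < 16^-1 :> R).
have k0 : 0 < 1 + ell * K * ell by apply: ltr_wpDr => //; rewrite !mulr_ge0// ltW.
have l2 : 0 < 2 * ell by rewrite mulr_gt0.
pose r := Num.min (Rm / ell / (1 + ell * K * ell)) (Num.min (rz / ell) (e / (2 * ell))).
have r_gt0 : 0 < r by rewrite !lt_min !divr_gt0.
have [ra [rb rc]] : r <= Rm / ell / (1 + ell * K * ell) /\ r <= rz / ell /\ r <= e / (2 * ell).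
  by split; [|split]; rewrite /r !ge_min lexx ?orbT.
exists (Rm / ell), r, (Num.min (r / 5) (rhoM / ell)), (Num.min (Rm / ell) (rz / (2 * ell))).
split; [split|split; split] => //.
- by rewrite mulrC divfK ?gt_eqF.
- by rewrite mulrC -ler_pdivlMr.
- by rewrite mulrC -ler_pdivlMr// ge_min lexx.
- by rewrite lt_min !divr_gt0.
- by rewrite mulrC -ler_pdivlMr// ge_min lexx orbT.
- by rewrite -ler_pdivlMr.
- by rewrite lt_min !divr_gt0.
- by rewrite ge_min lexx.
- have h : Num.min (Rm / ell) (rz / (2 * ell)) <= rz / (2 * ell) by rewrite ge_min lexx orbT.
  by rewrite mulrA mulrC [ell * 2]mulrC; move: h; rewrite ler_pdivlMr.
have -> : ell * (KH * (ell * (2 * r)) `^ alpha) * ell = ell * KH * ell * (ell * (2 * r)) `^ alpha by ring.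
have E : ell * (2 * r) = r * (2 * ell) by ring.
by apply: he; rewrite E -ler_pdivlMr// rc andbT ltW// mulr_gt0.
Qed.

Theorem theorem5p2 (R : realType) (d : nat) (M : ptopologicalType)
    (X : manifold R d M) (g : riemannian_metric X) (omega : volume_form X)
    (m : probability (borel M) R) (alpha : R) (f : M -> M) :
  hausdorff_space M -> compact [set: M] -> connected [set: M] ->
  is_normalized_volume_measure omega m ->
  0 < alpha -> C1alpha X alpha f -> anosov_endomorphism g f ->
  preserves m f ->
  ergodic m f.
Proof.
move=> hM cM kM hm al0 [C1f hf] af pf.
have Cf := C1mP C1f.
have [k [ch [yc [Rc [Rm hp]]]]] := pieces_exist X cM.
have [A [La [A1 La1 hs]]] := anosov_split hM cM kM Cf af.
have [Es hEs] := choice hs.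
have [Eu Esu] := choice hEs.
have [N [ell [rhoM [L [L' [ell1 rhoM0 hL hmarg]]]]]] := hyperbolic_frames kM hp Cf A1 La1 Esu.
(* A high iterate absorbs the constant A and the angles, so one step of G is hyperbolic in the
   chosen frames. As f-invariant sets are G-invariant, ergodicity of G suffices. *)
pose G := iter N.+1 f.
have CG : C1m X G := C1m_iter N.+1 Cf.
have [rz1 rz10 [K1 K10 hK1]] := C1_unif hM hp CG.
have [rz2 rz20 [K2 K20 hK2]] := C1_unif hM hp (C1m_id X).
have [rz3 rz30 [KH KH0 hKH]] := hol_unif hM hp CG (hol_iter (n := N) al0 Cf (holP hf)).
pose rz := Num.min rz1 (Num.min rz2 rz3).
have rz0 : 0 < rz by rewrite !lt_min rz10 rz20.
have rzE t : t <= rz -> [/\ t <= rz1, t <= rz2 & t <= rz3] by rewrite !le_min => /andP[-> /andP[-> ->]].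
have K0 : 0 <= K1 + K2 by rewrite addr_ge0.
have [Rm0 _ _ hcore] := hp.
have [ix ixP] := choice hcore.
have [r0 [r [rho [r2 [[s1 s2 s3 s4] [[s5 s6 s7 s8] [s9 s10 s11]]]]]]] := small_scales al0 ell1 K0 KH0 Rm0 rz0 rhoM0.
have [leb [hleb [w0 w00 [w1 w10 hw]]]] := volume_bounds hM hp hm.
have xb p : piece yc Rc Rm (ix p) (cmap (ch (ix p)) p).
  by have [_ h] := ixP p; apply: le_trans h _; rewrite lerDl ltW.
have Gp : preserves m (G : borel M -> borel M) by apply: iter_preserves => //; have [] := Cf.
have eG : ergodic m (G : borel M -> borel M).
  apply: (@coordinates_ergodic R d (\dim (Es point)) M X leb hleb hM cM kM _ ch yc Rc Rm hp G ix
    (fun p => L (ix p) (cmap (ch (ix p)) p)) (fun p => L' (ix p) (cmap (ch (ix p)) p))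
    ell alpha (K1 + K2) KH rz r0 r rho rhoM r2 CG ixP) hw => //.
  - by move=> p; have [] := hL _ _ (xb p).
  - by move=> p; have [] := hL _ _ (xb p).
  - by move=> p; have [] := hL _ _ (xb p).
  - move=> i j z z' hz /rzE[h _ _]; have [ho hb] := hK1 i j z z' hz h; split => // v.
    by apply: le_trans (hb v) _; apply: ler_wpM2r => //; rewrite lerDl.
  - move=> i j z z' hz /rzE[_ h _]; have [ho hb] := hK2 i j z z' hz h; split => // v.
    by apply: le_trans (hb v) _; apply: ler_wpM2r => //; rewrite lerDr.
  - by move=> i j z z' z'' hz /rzE[_ _ h] /rzE[_ _ h']; exact: hKH hz h h'.
  - move=> p q w bw ew hwq; apply: (hmarg _ _ _ w) => //.
    by rewrite cmapK; [exact: ew|have [] := ixP p].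
move=> B mB hB; apply: eG => //; exact: iter_invariant.
Qed.
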